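(* Assume (C1)–(C4) and let $a_n=\sqrt{L_n\log n/n}+L_n^{-d}$. Then the least-squares B-spline estimator satisfies $$\|\hat\theta-\tilde\theta\|_{L_2}=O_{\mathbb P}\Big(\sqrt{\tfrac{pL_n\log n}{n}}+a_n\,pL_n\sqrt{\tfrac{\log n}{n}}+\sqrt p\,L_n^{-d}\Big).$$
   Context: Model: $U\in[0,1]$ is an exposure variable, $Y\in\{0,1\}$ a label independent of $U$ with $\mathbb P(Y=1)=\mathbb P(Y=0)=1/2$, and $X\in\mathbb R^p$ satisfies, conditionally on $U=u$, $X\sim\mathcal N(\mu_1(u),\Sigma(u))$ if $Y=1$ and $X\sim\mathcal N(\mu_2(u),\Sigma(u))$ if $Y=0$. Write $\delta(u)=\mu_1(u)-\mu_2(u)$, $\mu(u)=(\mu_1(u)+\mu_2(u))/2$, $\beta^*(u)=\Sigma(u)^{-1}\delta(u)$. Let $Z=\mathbb 1(Y=1)-1/2$ and let $\theta^*(u)$ be the minimizer over $\theta\in\mathbb R^p$ of $\mathbb E[(Z-\theta^\top(X-\mu(U)))^2\mid U=u]$. B-splines: $B^*(u)=(B^*_1(u),\dots,B^*_{L_n}(u))^\top$ is a normalized B-spline basis of fixed order on $[0,1]$ with quasi-uniform knots ($B_k^*\ge0$, $\sum_kB_k^*=1$) and $B(u)=\sqrt{L_n}B^*(u)$. For $v\in\mathbb R^{pL_n}$, $v_{(j)}\in\mathbb R^{L_n}$ denotes its $j$-th consecutive block. Population quantities: $\tilde B(U)=(X-\mu(U))\otimes B(U)$, $D=\mathbb E[\tilde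 B\tilde B^\top]$, $b=\mathbb E[\tilde BZ]$, $\tilde\gamma=D^{-1}b$, $\tilde\theta(u)=(\tilde\gamma_{(1)}^\top B(u),\dots,\tilde\gamma_{(p)}^\top B(u))^\top$. Sample: $(X_i,U_i,Y_i)$, $i=1,\dots,2n$, independent, with $I_1=\{i:Y_i=1\}$, $I_2=\{i:Y_i=0\}$, $|I_1|=|I_2|=n$, and given $Y_i$ the pair $(X_i,U_i)$ is distributed as $(X,U)$ given $Y=Y_i$. Put $B_i=B(U_i)$, $Z_i=\mathbb 1(Y_i=1)-1/2$. For $l=1,2$ and $j=1,\dots,p$: $\hat\alpha_{lj}=(\sum_{i\in I_l}B_iB_i^\top)^{-1}\sum_{i\in I_l}B_iX_{ij}$, $\hat\mu_l(u)=(\hat\alpha_{l1}^\top B(u),\dots,\hat\alpha_{lp}^\top B(u))^\top$, $\hat\mu=(\hat\mu_1+\hat\mu_2)/2$. Let $\tilde B_i=(X_i-\hat\mu(U_i))\otimes B_i$, $D_n=\frac1{2n}\sum_{i=1}^{2n}\tilde B_i\tilde B_i^\top$, $b_n=\frac1{2n}\sum_{i=1}^{2n}\tilde B_iZ_i$, $\hat\gamma=D_n^{-1}b_n$ and $\hat\theta(u)=(\hat\gamma_{(1)}^\top B(u),\dots,\hat\gamma_{(p)}^\top B(u))^\top$. For $\nu,\xi:[0,1]\to\mathbb R^m$, $\|\nu-\xi\|_{L_2}=(\int_0^1\|\nu(u)-\xi(u)\|_2^2du)^{1/2}$. Asymptotics: $n\to\infty$, $p=p_n$, $L_n\to\infty$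 with $L_n\sqrt{p\log n/n}\to0$. Conditions: (C1) there are constants $0<\lambda_0\le\lambda_1<\infty$ with $\lambda_0\le\lambda_{\min}(\Sigma(u))\le\lambda_{\max}(\Sigma(u))\le\lambda_1$ for all $u$. (C2) $U$ has a density $h$ with $0<D_1\le h(u)\le D_2<\infty$ on $[0,1]$. (C3) every coordinate of $\mu_1,\mu_2,\beta^*$ lies in $\mathcal W^d([0,1])=\{f:\sup_x|f^{(\ell)}(x)|\le D,\ \ell=0,\dots,t;\ |f^{(t)}(x)-f^{(t)}(x')|\le L|x-x'|^r\}$ with $d=r+t\ge1$ and fixed constants $D,L$. (C4) $\sup_u\max\{\|\delta(u)\|_2,\|\theta^*(u)\|_2\}=\delta_p\le M$ for a constant $M$, and $p=o(n^{(2d-1)/(2d+1)})$.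
   Formalization: The fixed B-spline order is assumed to be at least t+1 (equivalently at least d = r+t, with 0 < r ≤ 1); for too low an order, such as piecewise constants with d = 4 and non-constant means, the stated rate with L_n^{-d} fails. *)

(* Defs.v *)
From HB Require Import structures.
From mathcomp Require Import all_boot all_order all_algebra.
From mathcomp Require Import all_classical all_reals all_analysis.
Set Implicit Arguments. Unset Strict Implicit. Unset Printing Implicit Defensive.
Import Order.TTheory GRing.Theory Num.Theory.
Local Open Scope ring_scope.
Local Open Scope classical_set_scope.

Section Defs.
Context {R : realType}.

Definition vnorm2 {k : nat} (v : 'cV[R]_k) : R :=
  Num.sqrt (\sum_(i < k) v i 0 ^+ 2).

Definition L2dist {k : nat} (nu xi : R -> 'cV[R]_k) : R :=
  Num.sqrt (fine (\int[@lebesgue_measure R]_(u in [set u : R | (0 <= u <= 1)%R])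
                   ((vnorm2 (nu u - xi u)) ^+ 2)%:E)%E).

Definition holder_class (t : nat) (r Dc Lc : R) (f : R -> R) : Prop :=
  (forall (l : nat) (x : R), (l < t)%N -> 0 <= x <= 1 ->
      derivable (derive1n l f) x 1) /\
  (forall (l : nat) (x : R), (l <= t)%N -> 0 <= x <= 1 ->
      `|derive1n l f x| <= Dc) /\
  (forall x x' : R, 0 <= x <= 1 -> 0 <= x' <= 1 ->
      `|derive1n t f x - derive1n t f x'| <= Lc * (`|x - x'| `^ r)).

(* B-splines (Cox--de Boor recursion).                                 *)
(* bspline tau j k u = normalized B-spline of ORDER j+1 on the knot    *)
(* sequence tau, supported on [tau k, tau (k+j+1)].  Order one: the    *)
(* indicator of [tau k, tau (k+1)), the last non-degenerate interval   *)
(* ending at 1 being closed at 1.  Division by 0 is 0 in MathComp,     *)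
(* which is the usual 0/0 := 0 convention.                             *)
Fixpoint bspline (tau : nat -> R) (j k : nat) (u : R) : R :=
  match j with
  | 0 => if (tau k <= u < tau k.+1)
            || [&& u == tau k.+1, tau k < tau k.+1 & tau k.+1 == 1]
         then 1 else 0
  | j'.+1 =>
      (u - tau k) / (tau (k + j'.+1)%N - tau k) * bspline tau j' k u
    + (tau (k + j'.+2)%N - u) / (tau (k + j'.+2)%N - tau k.+1)
        * bspline tau j' k.+1 u
  end.

Definition interior_knots (K : nat) (xi : nat -> R) : Prop :=
  xi 0%N = 0 /\ xi K = 1 /\ forall j : nat, (j < K)%N -> xi j < xi j.+1.

Definition quasi_uniform (Cq : R) (K : nat) (xi : nat -> R) : Prop :=
  forall j1 j2 : nat, (j1 < K)%N -> (j2 < K)%N ->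
    xi j1.+1 - xi j1 <= Cq * (xi j2.+1 - xi j2).

(* Extended knot sequence for order m: the end knots 0 and 1 have      *)
(* multiplicity m.                                                     *)
Definition ext_knots (m K : nat) (xi : nat -> R) (i : nat) : R :=
  if (i < m)%N then 0
  else if (i - m.-1 <= K)%N then xi (i - m.-1)%N else 1.

Definition nbasis (m K : nat) : nat := (K + m.-1)%N.

Definition Bstar (m K : nat) (xi : nat -> R) (u : R) : 'cV[R]_(nbasis m K) :=
  \col_(k < nbasis m K) bspline (ext_knots m K xi) m.-1 k u.

Definition Bvec (m K : nat) (xi : nat -> R) (u : R) : 'cV[R]_(nbasis m K) :=
  Num.sqrt (nbasis m K)%:R *: Bstar m K xi u.

(* Kronecker product x (x) b in R^{pL}: the j-th consecutive block of  *)
(* length L is x_j b (mxvec flattens row-major).                       *)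
Definition kron {p L : nat} (x : 'cV[R]_p) (b : 'cV[R]_L) : 'cV[R]_(p * L) :=
  (mxvec (x *m b^T))^T.

(* theta(u) = (gamma_(1)^T B(u), ..., gamma_(p)^T B(u))^T ; row j of   *)
(* vec_mx gamma^T is the j-th block gamma_(j). *)
Definition thetaOf {p L : nat} (gamma : 'cV[R]_(p * L)) (Bf : R -> 'cV[R]_L)
  (u : R) : 'cV[R]_p := vec_mx (gamma^T) *m Bf u.

Section Estimator.
Variables (p L N : nat) (Bf : R -> 'cV[R]_L) (y : 'I_N -> bool)
  (Us : 'I_N -> R) (Xs : 'I_N -> 'cV[R]_p).

(* columns of alpha_hat cls are the hat alpha_{lj}, j = 1..p *)
Definition alpha_hat (cls : bool) : 'M[R]_(L, p) :=
  invmx (\sum_(i < N | y i == cls) Bf (Us i) *m (Bf (Us i))^T)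
  *m (\sum_(i < N | y i == cls) Bf (Us i) *m (Xs i)^T).

Definition mu_hat_cls (cls : bool) (u : R) : 'cV[R]_p :=
  (alpha_hat cls)^T *m Bf u.

Definition mu_hat (u : R) : 'cV[R]_p :=
  2^-1 *: (mu_hat_cls true u + mu_hat_cls false u).

Definition Btilde_hat (i : 'I_N) : 'cV[R]_(p * L) :=
  kron (Xs i - mu_hat (Us i)) (Bf (Us i)).

Definition Zlab (b : bool) : R := (b%:R) - 2^-1.

Definition D_n : 'M[R]_(p * L) :=
  (N%:R)^-1 *: \sum_(i < N) Btilde_hat i *m (Btilde_hat i)^T.

Definition b_n : 'cV[R]_(p * L) :=
  (N%:R)^-1 *: \sum_(i < N) Zlab (y i) *: Btilde_hat i.

Definition gamma_hat : 'cV[R]_(p * L) := invmx D_n *m b_n.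

Definition theta_hat : R -> 'cV[R]_p := thetaOf gamma_hat Bf.
End Estimator.

Definition prob {d} {T : measurableType d} (P : probability T R) (A : set T) : R :=
  fine (P A).

Definition Eexp {d} {T : measurableType d} (P : probability T R) (f : T -> R) : R :=
  fine ('E_P[f])%E.

Definition mxExp {d} {T : measurableType d} (P : probability T R) {a b : nat}
  (F : T -> 'M[R]_(a, b)) : 'M[R]_(a, b) :=
  \matrix_(i < a, j < b) Eexp P (fun w => F w i j).

Definition mutually_independent {d} {T : measurableType d} (P : probability T R)
  (I : finType) (F : I -> T -> R) : Prop :=
  (forall i, measurable_fun setT (F i)) /\
  forall (S : {set I}) (B : I -> set R), (forall i, measurable (B i)) ->
    prob P [set w | forall i, i \in S -> B i (F i w)]
    = \prod_(i in S) prob P (F i @^-1` B i).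

Definition has_density_01 {d} {T : measurableType d} (P : probability T R)
  (U : T -> R) (h : R -> R) : Prop :=
  forall B : set R, measurable B ->
    P (U @^-1` B) = (\int[@lebesgue_measure R]_(u in B `&` [set u : R | (0 <= u <= 1)%R])
                       (h u)%:E)%E.

Definition std_normal {d} {T : measurableType d} (P : probability T R)
  (W : T -> R) : Prop :=
  forall B : set R, measurable B -> P (W @^-1` B) = normal_prob 0 1 B.

Definition fair_label {d} {T : measurableType d} (P : probability T R)
  (Y : T -> R) : Prop :=
  P (Y @^-1` [set 1]) = (2^-1)%:E /\ P (Y @^-1` [set 0]) = (2^-1)%:E.

(* The family (sample U_i, W_{ik}; population U, W_k, Y) indexed by    *)
(* option ((sample index + population) * option coordinate):           *)
(*   None            -> Y (population label)                            *)
(*   Some (s, None)  -> U of unit s                                     *)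
(*   Some (s, Some k)-> k-th standard normal coordinate of unit s       *)
Definition sample_family {T : Type} {N p : nat}
  (U : 'I_N -> T -> R) (W : 'I_N -> 'I_p -> T -> R)
  (U0 : T -> R) (W0 : 'I_p -> T -> R) (Y0 : T -> R)
  : option (('I_N + unit) * option 'I_p) -> T -> R :=
  fun j => match j with
  | None => Y0
  | Some (inl i, None) => U i
  | Some (inl i, Some k) => W i k
  | Some (inr _, None) => U0
  | Some (inr _, Some k) => W0 k
  end.

Definition colv {T : Type} {p : nat} (W : 'I_p -> T -> R) (w : T) : 'cV[R]_p :=
  \col_(k < p) W k w.

(* Gaussian observation: X = mu_Y(U) + A(U) W with A A^T = Sigma, W ~ N(0, I);  *)
(* conditionally on U = u (and Y), X ~ N(mu_Y(u), Sigma(u)).                   *)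
Definition gauss_obs {p : nat} (mu1 mu2 : R -> 'cV[R]_p) (A : R -> 'M[R]_p)
  (cls : bool) (u : R) (w : 'cV[R]_p) : 'cV[R]_p :=
  (if cls then mu1 u else mu2 u) + A u *m w.

Section Population.
Context {d} {T : measurableType d} (P : probability T R).
Variables (p L : nat) (Bf : R -> 'cV[R]_L) (mu1 mu2 : R -> 'cV[R]_p)
  (A : R -> 'M[R]_p) (U0 : T -> R) (W0 : 'I_p -> T -> R) (Y0 : T -> R).

Definition mu_mid (u : R) : 'cV[R]_p := 2^-1 *: (mu1 u + mu2 u).
Definition X0 (w : T) : 'cV[R]_p :=
  gauss_obs mu1 mu2 A (Y0 w == 1) (U0 w) (colv W0 w).
Definition Z0 (w : T) : R := Zlab (Y0 w == 1).
Definition Btilde_pop (w : T) : 'cV[R]_(p * L) :=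
  kron (X0 w - mu_mid (U0 w)) (Bf (U0 w)).
Definition D_pop : 'M[R]_(p * L) :=
  mxExp P (fun w => Btilde_pop w *m (Btilde_pop w)^T).
Definition b_pop : 'cV[R]_(p * L) := mxExp P (fun w => Z0 w *: Btilde_pop w).
Definition gamma_tilde : 'cV[R]_(p * L) := invmx D_pop *m b_pop.
Definition theta_tilde : R -> 'cV[R]_p := thetaOf gamma_tilde Bf.

(* E[(Z - theta^T (X - mu(U)))^2 | U = u] : here (X,Y) given U = u has  *)
(* the law of (gauss_obs .. Y0 u W0, Y0), W0, Y0 being independent of U0. *)
Definition cond_risk (u : R) (th : 'cV[R]_p) : R :=
  Eexp P (fun w => (Z0 w - (th^T *m
     (gauss_obs mu1 mu2 A (Y0 w == 1) u (colv W0 w) - mu_mid u)) 0 0) ^+ 2).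
End Population.

End Defs.

Section Rate.
Context {R : realType}.
Definition a_rate (d : R) (L n : nat) : R :=
  Num.sqrt ((L%:R * ln (n%:R)) / n%:R) + (L%:R `^ (- d)).
Definition rate (d : R) (p L n : nat) : R :=
  Num.sqrt ((p%:R * L%:R * ln (n%:R)) / n%:R)
  + a_rate d L n * (p%:R * L%:R) * Num.sqrt (ln (n%:R) / n%:R)
  + Num.sqrt p%:R * (L%:R `^ (- d)).
End Rate.

(* Main.v *)
Require Import Defs.
From HB Require Import structures.
From mathcomp Require Import all_boot all_order all_algebra.
From mathcomp Require Import all_classical all_reals all_analysis.
From mathcomp Require Import measurable_realfun ring lra zify.
Set Implicit Arguments. Unset Strict Implicit. Unset Printing Implicit Defensive.
Import Order.TTheory GRing.Theory Num.Theory.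
Local Open Scope ring_scope.
Local Open Scope classical_set_scope.

(** Put [q_i = (X_i - mu_hat(U_i)) (x) B_i].  With [rho_i = Z_i - theta~(U_i).(X_i - mu(U_i))] and
    [eta_i = theta~(U_i).(mu - mu_hat)(U_i)], the residual of [gamma~] is [rho_i - eta_i], so the
    normal equations bound [|gamma_hat - gamma~|^2] by the score [avg rho_i q_i] and by
    [avg eta_i^2], provided the smallest eigenvalue of [D_n] is bounded below.
    - Population equations give [E rho (X - mu) (x) B = 0]; since the labels are balanced,
      [avg rho_i B_i B_i^T] is centred as well, and both are controlled by second moments.
    - [mu_hat - mu] is a spline approximation error plus [M B], with [M] the least-squares image
      of that error and of the noise.
    - [theta~] is bounded uniformly, by testing its normal equations with weights decaying
      geometrically away from a given basis index (only neighbouring B-splines interact).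
    - [D_n >= kappa] holds simultaneously for all [M] by a union bound over a polynomially fine grid
      in [(v, M)], a space of dimension [2 p L]: at one grid point, integrating out the Gaussian
      coordinates gives [E exp (- s (a.W + c)^2) <= (1 + 2 s |a|^2)^(-1/2)], hence a lower tail
      [exp (- c n / L)], and [L^2 p log n = o(n)].
    - Spline approximation and the stability of the B-spline basis come from the de Boor-Fix dual
      functionals and Marsden's identity. *)

(** * Splines *)

Section PolyFacts.
Context {R : realType}.
Local Notation "p ^` ()" := (deriv p) : classical_set_scope.
Local Notation "p ^` ( n )" := (derivn n p) : classical_set_scope.
Implicit Types (p q : {poly R}) (c y : R).

Lemma poly_eq_horner p q : (forall u, p.[u] = q.[u]) -> p = q.
Proof.
move=> h; apply/eqP; rewrite -subr_eq0; apply/negPn/negP => pq0.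
have /(max_poly_roots pq0) : all (root (p - q)) [seq (i%:R : R) | i <- iota 0 (size (p - q))].
  by apply/allP => x _; rewrite rootE hornerD hornerN h subrr.
rewrite map_inj_uniq ?iota_uniq; last by move=> a b /eqP; rewrite eqr_nat => /eqP.
by move=> /(_ isT); rewrite size_map size_iota ltnn.
Qed.

Lemma poly_sum_coef p n : (size p <= n)%N -> p = \sum_(l < n) p`_l *: 'X^l.
Proof.
move=> sp; rewrite -(poly_def n (fun l => p`_l)); apply/polyP => l.
by rewrite coef_poly; case: ltnP => // nl; rewrite nth_default // (leq_trans sp).
Qed.

Lemma deriv_eq0_const p x y : p^`() = 0 -> p.[x] = p.[y].
Proof.
move=> dp; suff -> : p = (p`_0)%:P by rewrite !hornerC.
apply/polyP => -[|i]; rewrite coefC //=.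
have := congr1 (fun q : {poly R} => q`_i) dp.
rewrite coef_deriv coef0 => /eqP; rewrite mulrn_eq0 /= => /eqP //.
Qed.

Lemma derivn_mul_linear p c r :
  (p * (c%:P - 'X))^`(r) = p^`(r) * (c%:P - 'X) - r%:R *: p^`(r.-1).
Proof.
elim: r => [|r IH]; first by rewrite !derivn0 scale0r subr0.
rewrite derivnS IH derivB derivM derivB derivC derivX sub0r mulrN1 derivZ.
case: r {IH} => [|r]; first by rewrite scale0r subr0 /= scale1r.
rewrite [r.+1.-1]/= [r.+2.-1]/= -!derivnS.
rewrite -addrA -opprD; congr (_ - _).
by rewrite -{1}(scale1r (p^`(r.+1))) -scalerDl nat1r.
Qed.

Lemma derivn_big_scale (I : Type) (s : seq I) (a : I -> R) (f : I -> {poly R}) r :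
  (\sum_(i <- s) a i *: f i)^`(r) = \sum_(i <- s) a i *: (f i)^`(r).
Proof.
elim: s => [|x s IH]; first by rewrite !big_nil derivn_poly0 ?size_poly0.
by rewrite !big_cons derivnD derivnZ IH.
Qed.

Lemma derivn_exp_linear c j r :
  ((c%:P - 'X) ^+ j)^`(r) = (-1) ^+ r *: ((c%:P - 'X) ^+ (j - r) *+ (j ^_ r)).
Proof.
elim: r => [|r IH]; first by rewrite derivn0 subn0 ffactn0 mulr1n expr0 scale1r.
rewrite derivnS IH derivZ derivMn deriv_exp derivB derivC derivX sub0r.
rewrite mulN1r -mulrnA ffactnSr -subnS mulNrn scalerN exprS mulN1r scaleNr.
by rewrite [X in _ *+ X]mulnC.
Qed.

Lemma derivn_exp_linear_at c j r : (r <= j)%N ->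
  (((c%:P - 'X) ^+ j)^`(r)).[c] = if r == j then (-1) ^+ j * (j`!)%:R else 0.
Proof.
move=> rj; rewrite derivn_exp_linear hornerZ hornerMn horner_exp hornerD hornerN hornerC hornerX subrr.
case: eqP => [->|/eqP nrj]; first by rewrite subnn expr0 ffactnn.
have : (0 < j - r)%N by rewrite subn_gt0 ltn_neqAle nrj.
by case: (j - r)%N => // k _; rewrite exprS mul0r mul0rn mulr0.
Qed.
End PolyFacts.

Section DeBoorFix.
Context {R : realType}.
Local Notation "p ^` ()" := (deriv p) : classical_set_scope.
Local Notation "p ^` ( n )" := (derivn n p) : classical_set_scope.
Variable tau : nat -> R.

Definition psi (k j : nat) : {poly R} := \prod_(l < j) ((tau (k + l.+1)%N)%:P - 'X).

Lemma psiSr k j : psi k j.+1 = psi k j * ((tau (k + j.+1)%N)%:P - 'X).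
Proof. by rewrite /psi big_ord_recr. Qed.

Lemma psiSl k j : psi k j.+1 = ((tau k.+1)%:P - 'X) * psi k.+1 j.
Proof.
rewrite /psi big_ord_recl addn1; congr (_ * _).
by apply: eq_bigr => l _; rewrite lift0 addSnnS.
Qed.

Lemma size_psi k j : (size (psi k j) <= j.+1)%N.
Proof.
elim: j => [|j IH]; first by rewrite /psi big_ord0 size_poly1.
rewrite psiSr; apply: (leq_trans (size_polyMleq _ _)).
have : (size ((tau (k + j.+1)%N)%:P - 'X)%R <= 2)%N.
  by rewrite -opprB size_polyN size_XsubC.
by move: IH; lia.
Qed.

Lemma psi_derivn_bound k j r y H : 0 <= H ->
  (forall l, (k < l <= k + j)%N -> `|tau l - y| <= H) ->
  `|((psi k j)^`(r)).[y]| <= (j.+1)`!%:R * H ^+ (j - r).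
Proof.
move=> H0; elim: j r => [|j IH] r tauH.
  rewrite /psi big_ord0 sub0n expr0 mulr1.
  case: r => [|r]; first by rewrite derivn0 hornerC normr1.
  by rewrite derivn_poly0 ?horner0 ?normr0 // size_poly1.
have IH' s := IH s (fun l hl => tauH l ltac:(lia)).
rewrite psiSr derivn_mul_linear !(hornerD, hornerN, hornerM, hornerZ, hornerC, hornerX).
have tH : `|tau (k + j.+1)%N - y| <= H by apply: tauH; lia.
case: (ltngtP r j.+1) => [rj|rj|->].
- apply: (le_trans (ler_normB _ _)); rewrite !normrM.
  apply: (@le_trans _ _ ((j.+1)`!%:R * H ^+ (j - r) * H + r%:R * ((j.+1)`!%:R * H ^+ (j - r.-1)))).
    apply: lerD; first by apply: ler_pM => //; exact: IH'.
    by rewrite ger0_norm // ler_wpM2l // IH'.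
  have -> : (j.+1 - r)%N = (j - r).+1 by lia.
  have fS : (j.+2)`!%:R = (j.+2)%:R * (j.+1)`!%:R :> R by rewrite -natrM factS.
  case: r rj => [|r] rj.
    rewrite mul0r addr0 subn0 -mulrA -exprSr fS -mulrA ler_peMl //; first by rewrite mulr_ge0 // exprn_ge0.
    by rewrite ler1n.
  have -> : (j - r.+1.-1)%N = (j - r.+1).+1 by move: rj => /=; lia.
  rewrite -mulrA -exprSr fS -[X in X + _]mul1r -mulrDl -mulrA ler_wpM2r //.
    by rewrite mulr_ge0 // exprn_ge0.
  by rewrite nat1r ler_nat; lia.
- rewrite !derivn_poly0 ?horner0 ?mul0r ?mulr0 ?subr0 ?normr0 //; first by rewrite mulr_ge0 // exprn_ge0.
  + by apply: (leq_trans (size_psi _ _)); lia.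
  + by apply: (leq_trans (size_psi _ _)); lia.
- rewrite derivn_poly0 ?horner0 ?mul0r ?sub0r ?normrN ?size_psi //= subnn expr0 mulr1.
  rewrite normrM ger0_norm //.
  have := IH' j; rewrite subnn expr0 mulr1 => IHj.
  rewrite (@le_trans _ _ (j.+1%:R * (j.+1)`!%:R)) //; first by rewrite ler_wpM2l.
  by rewrite -natrM ler_nat (factS j.+1) leq_mul.
Qed.

Definition dbfP (k j : nat) (q : {poly R}) : {poly R} :=
  \sum_(l < j.+1) ((-1) ^+ l *: (q^`(l) * (psi k j)^`(j - l))).

Lemma dbfP_const k j (q : {poly R}) x y : (size q <= j.+1)%N -> (dbfP k j q).[x] = (dbfP k j q).[y].
Proof.
move=> sq; apply: deriv_eq0_const.
pose a (l : nat) : {poly R} := (-1) ^+ l *: (q^`(l) * (psi k j)^`(j.+1 - l)).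
rewrite /dbfP raddf_sum /=.
transitivity (\sum_(0 <= l < j.+1) - (a l.+1 - a l)).
  rewrite big_mkord; apply: eq_bigr => l _.
  rewrite derivZ derivM /a subSS opprB -derivnS -derivnS.
  have -> : (j.+1 - l)%N = (j - l).+1 by rewrite subSn // -ltnS.
  by rewrite exprS mulN1r scaleNr opprK scalerDr addrC.
rewrite sumrN telescope_sumr // /a subnn expr0 scale1r derivn_poly0 // mul0r scaler0.
by rewrite derivn0 subn0 (@derivn_poly0 _ (psi k j)) ?size_psi // mulr0 subr0 oppr0.
Qed.

(* The de Boor-Fix functional; by dbfP_const the evaluation point is immaterial
   on polynomials of size at most j.+1. *)
Definition dbf (k j : nat) (q : {poly R}) : R := (-1) ^+ j / (j`!)%:R * (dbfP k j q).[0].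

Lemma dbfE k j (q : {poly R}) y : (size q <= j.+1)%N ->
  dbf k j q = (-1) ^+ j / (j`!)%:R * \sum_(l < j.+1) (-1) ^+ l * ((q^`(l)).[y] * ((psi k j)^`(j - l)).[y]).
Proof.
move=> sq; rewrite /dbf (dbfP_const _ 0 y sq) /dbfP horner_sum.
by congr (_ * _); apply: eq_bigr => l _; rewrite hornerZ hornerM.
Qed.

Lemma dbf_bound k j (q : {poly R}) y H : (size q <= j.+1)%N -> 0 <= H ->
  (forall l, (k < l <= k + j)%N -> `|tau l - y| <= H) ->
  `|dbf k j q| <= j.+1%:R * \sum_(l < j.+1) `|(q^`(l)).[y]| * H ^+ l.
Proof.
move=> sq H0 tauH; rewrite (dbfE _ y sq) !normrM normrX normrN1 expr1n mul1r normfV (ger0_norm (ler0n _ _)).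
apply: (@le_trans _ _ ((j`!)%:R^-1 * \sum_(l < j.+1) `|(q^`(l)).[y]| * ((j.+1)`!%:R * H ^+ l))).
  rewrite ler_wpM2l ?invr_ge0 //; apply: (le_trans (ler_norm_sum _ _ _)); apply: ler_sum => l _.
  rewrite !normrM normrX normrN1 expr1n mul1r ler_wpM2l //.
  have := psi_derivn_bound (j - l) H0 tauH.
  by have -> : (j - (j - l))%N = l by have := ltn_ord l; lia.
rewrite factS natrM mulr_sumr mulr_sumr; apply: ler_sum => l _.
have f0 : (j`!)%:R != 0 :> R by rewrite pnatr_eq0 -lt0n fact_gt0.
by rewrite le_eqVlt; apply/orP; left; apply/eqP; field.
Qed.

Lemma dbf_linear k j a q q' : (dbf k j (a *: (q : {poly R}) + q')) = a * dbf k j q + dbf k j q'.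
Proof.
rewrite /dbf /dbfP !horner_sum mulrCA -mulrDr; congr (_ * _).
rewrite mulr_sumr -big_split; apply: eq_bigr => l _ /=.
by rewrite derivnD derivnZ !(hornerD, hornerN, hornerM, hornerZ, hornerC, hornerX); ring.
Qed.

Lemma dbf0 k j : dbf k j 0 = 0.
Proof. by have := dbf_linear k j 0 0 0; rewrite scale0r add0r mul0r add0r => ->; have := dbf_linear k j (-1) 0 0; rewrite scaler0 addr0 mulN1r addrC subrr. Qed.

Lemma dbf_sum k j (I : Type) (s : seq I) (a : I -> R) (f : I -> {poly R}) :
  dbf k j (\sum_(i <- s) a i *: f i) = \sum_(i <- s) a i * dbf k j (f i).
Proof.
elim: s => [|x s IH]; first by rewrite !big_nil dbf0.
by rewrite !big_cons dbf_linear IH.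
Qed.

End DeBoorFix.

Section Pieces.
Context {R : realType}.
Local Notation "p ^` ()" := (deriv p) : classical_set_scope.
Local Notation "p ^` ( n )" := (derivn n p) : classical_set_scope.
Variable tau : nat -> R.

(* The polynomial with which bspline tau j k agrees on [tau i, tau i.+1). *)
Fixpoint bspP (i j k : nat) : {poly R} :=
  match j with
  | 0 => ((k == i)%:R)%:P
  | j'.+1 => (tau (k + j'.+1)%N - tau k)^-1 *: (('X - (tau k)%:P) * bspP i j' k)
     + (tau (k + j'.+2)%N - tau k.+1)^-1 *: (((tau (k + j'.+2)%N)%:P - 'X) * bspP i j' k.+1)
  end.

Lemma bspline_bspP i u j k : (forall k, bspline tau 0 k u = (k == i)%:R) ->
  bspline tau j k u = (bspP i j k).[u].
Proof.
move=> h; elim: j k => [|j IH] k; first by rewrite h /= hornerC.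
rewrite [LHS]/= [bspP _ _ _]/= !IH !(hornerD, hornerN, hornerM, hornerZ, hornerC, hornerX); ring.
Qed.

Lemma bspP_out i j k : (i < k)%N || (k + j < i)%N -> bspP i j k = 0.
Proof.
elim: j k => [|j IH] k /= h.
  by rewrite (_ : k == i = false) //; lia.
by rewrite !IH ?mulr0 ?scaler0 ?addr0 //; lia.
Qed.

Lemma size_bspP i j k : (size (bspP i j k) <= j.+1)%N.
Proof.
elim: j k => [|j IH] k /=; first by rewrite size_polyC; case: (_ != 0).
apply: (leq_trans (size_polyD _ _)); rewrite geq_max; apply/andP; split.
  apply: (leq_trans (size_scale_leq _ _)); apply: (leq_trans (size_polyMleq _ _)).
  by rewrite size_XsubC; have := IH k; lia.
apply: (leq_trans (size_scale_leq _ _)); apply: (leq_trans (size_polyMleq _ _)).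
rewrite -opprB size_polyN size_XsubC; have := IH k.+1; lia.
Qed.

Hypothesis tau_homo : {homo tau : a b / (a <= b)%N >-> a <= b}.
Variable i : nat.
Hypothesis tau_i : tau i < tau i.+1.

Lemma tau_gap j k : (k <= i)%N -> (i <= k + j)%N -> tau k < tau (k + j.+1)%N.
Proof.
move=> h1 h2; apply: (le_lt_trans (tau_homo h1)); apply: (lt_le_trans tau_i); apply: tau_homo; lia.
Qed.

Lemma bspP_ge0 j k u : tau i <= u <= tau i.+1 -> 0 <= (bspP i j k).[u].
Proof.
move=> /andP[u1 u2]; elim: j k => [|j IH] k; first by rewrite /= hornerC ler0n.
rewrite /= !(hornerD, hornerN, hornerM, hornerZ, hornerC, hornerX); apply: addr_ge0.
  case: (boolP ((i < k) || (k + j < i))%N) => h; first by rewrite bspP_out // horner0 !mulr0.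
  have g : tau k < tau (k + j.+1)%N by apply: tau_gap; lia.
  rewrite mulr_ge0 ?invr_ge0 ?subr_ge0 ?(ltW g) // mulr_ge0 // subr_ge0.
  by apply: (le_trans _ u1); apply: tau_homo; lia.
case: (boolP ((i < k.+1) || (k.+1 + j < i))%N) => h; first by rewrite bspP_out // horner0 !mulr0.
have g : tau k.+1 < tau (k.+1 + j.+1)%N by apply: tau_gap; lia.
rewrite addSnnS in g.
rewrite mulr_ge0 ?invr_ge0 ?subr_ge0 ?(ltW g) // mulr_ge0 // subr_ge0.
by apply: (le_trans u2); apply: tau_homo; lia.
Qed.

(* One step of de Boor's algorithm. *)
Lemma bspP_sum_step (V : lmodType R) (c : nat -> V) j u : (j < i)%N ->
  \sum_(0 <= k < i.+1) (bspP i j.+1 k).[u] *: c k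
  = \sum_(1 <= k < i.+1) (bspP i j k).[u] *:
     ((tau (k + j.+1)%N - tau k)^-1 *:
        ((u - tau k) *: c k + (tau (k + j.+1)%N - u) *: c k.-1)).
Proof.
move=> ji.
transitivity (\sum_(0 <= k < i.+1) (bspP i j k).[u] *: ((tau (k + j.+1)%N - tau k)^-1 *: ((u - tau k) *: c k))
  + \sum_(1 <= k < i.+2) (bspP i j k).[u] *: ((tau (k + j.+1)%N - tau k)^-1 *: ((tau (k + j.+1)%N - u) *: c k.-1))).
  rewrite big_add1 -big_split /=; apply: eq_bigr => k _.
  rewrite !(hornerD, hornerN, hornerM, hornerZ, hornerC, hornerX) !scalerA -scalerDl addSnnS.
  by congr (_ *: _); ring.
rewrite [in X in X + _]big_ltn // (bspP_out (j := j) (k := 0)) ?horner0 ?scale0r ?add0r; last by lia.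
rewrite [in X in _ + X]big_nat_recr //= (bspP_out (k := i.+1)) ?horner0 ?scale0r ?addr0; last by lia.
rewrite -big_split /=; apply: eq_bigr => k _.
by rewrite -scalerDr -scalerDr.
Qed.

Lemma bspP_sum1 j u : (j <= i)%N -> \sum_(0 <= k < i.+1) (bspP i j k).[u] = 1.
Proof.
elim: j => [|j IH] ji.
  rewrite big_nat_recr //= eqxx hornerC big_nat big1 ?add0r // => k /andP[_ ki].
  by rewrite hornerC (_ : k == i = false) //; lia.
have := @bspP_sum_step R^o (fun=> 1) j u ji.
rewrite (eq_bigr (fun k => (bspP i j.+1 k).[u])); last by move=> k _; rewrite /GRing.scale /= mulr1.
move=> ->; rewrite -[RHS](IH (ltnW ji)).
rewrite [in RHS]big_ltn // (bspP_out (k := 0)) ?horner0 ?add0r; last by lia.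
apply: eq_bigr => k _; case: (boolP ((i < k) || (k + j < i))%N) => h; first by rewrite bspP_out // horner0 scale0r.
have g : tau k < tau (k + j.+1)%N by apply: tau_gap; lia.
rewrite /GRing.scale /=; have : tau (k + j.+1)%N - tau k != 0 by rewrite subr_eq0 gt_eqF.
by move=> nz; field.
Qed.

Lemma marsden j u : (j <= i)%N ->
  \sum_(0 <= k < i.+1) (bspP i j k).[u] *: psi tau k j = (u%:P - 'X) ^+ j.
Proof.
elim: j => [|j IH] ji.
  rewrite (eq_bigr (fun k => (bspP i 0 k).[u] *: 1)); last by move=> k _; rewrite /psi big_ord0.
  by rewrite -scaler_suml bspP_sum1 // scale1r expr0.
rewrite bspP_sum_step // exprS -(IH (ltnW ji)).
rewrite [in RHS]big_ltn // (bspP_out (k := 0)) ?horner0 ?scale0r ?add0r; last by lia.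
rewrite mulr_sumr; apply: eq_big_nat => k /andP[k1 ki].
case: (boolP ((i < k) || (k + j < i))%N) => h; first by rewrite bspP_out // horner0 !scale0r mulr0.
have g : tau k < tau (k + j.+1)%N by apply: tau_gap; lia.
have nz : tau (k + j.+1)%N - tau k != 0 by rewrite subr_eq0 gt_eqF.
rewrite -scalerAr; congr (_ *: _).
rewrite psiSr; case: k k1 ki h g nz => // k _ ki h g nz; rewrite [k.+1.-1]/= psiSl.
apply: (scalerI nz); rewrite scalerA divff // scale1r -!mul_polyC !rmorphB /=; ring.
Qed.

Lemma dbf_reproduce j (q : {poly R}) u : (j <= i)%N -> (size q <= j.+1)%N ->
  \sum_(0 <= k < i.+1) dbf tau k j q * (bspP i j k).[u] = q.[u].
Proof.
move=> ji sq.
under eq_bigr => k _ do rewrite (dbfE _ _ u sq) -[_ * (bspP _ _ _).[_]]mulrA mulr_suml.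
rewrite -mulr_sumr exchange_big /=.
under eq_bigr => l _.
  under eq_bigr => k _ do rewrite -mulrA -mulrA (mulrC _ (bspP i j k).[u]).
  rewrite -mulr_sumr -mulr_sumr.
  under eq_bigr => k _ do rewrite -hornerZ.
  rewrite -horner_sum -derivn_big_scale marsden // derivn_exp_linear_at; last by rewrite leq_subr.
  over.
rewrite big_ord_recl /= subn0 eqxx big1 ?addr0; last first.
  move=> l _; rewrite (_ : _ == j = false) ?mulr0 //.
  by rewrite /bump /=; have := ltn_ord l; lia.
rewrite expr0 mul1r.
have f0 : (j`!)%:R != 0 :> R by rewrite pnatr_eq0 -lt0n fact_gt0.
transitivity ((-1) ^+ (j + j) * q.[u]); first by rewrite exprD; field.
by rewrite addnn -mul2n exprM sqrrN expr1n expr1n mul1r.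
Qed.

Lemma dbf_dual j (c : nat -> R) k : (j <= i)%N -> (k <= i)%N -> (i <= k + j)%N ->
  dbf tau k j (\sum_(0 <= k < i.+1) c k *: bspP i j k) = c k.
Proof.
move=> ji ki kj.
pose MN : 'M[R]_(j.+1) := \matrix_(a, l) (bspP i j (i - j + a))`_l.
pose ML : 'M[R]_(j.+1) := \matrix_(l, a) dbf tau (i - j + a) j 'X^l.
have shift (V : nmodType) (f : nat -> V) : (forall k, (k + j < i)%N -> f k = 0) ->
    \sum_(0 <= k < i.+1) f k = \sum_(a < j.+1) f (i - j + a)%N.
  move=> f0; rewrite (big_cat_nat (n := (i - j)%N)) //=; last by lia.
  rewrite big_nat big1 ?add0r; last by move=> b hb; apply: f0; lia.
  rewrite -{1}[(i - j)%N]add0n big_addn (_ : (i.+1 - (i - j))%N = j.+1); last by lia.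
  by rewrite big_mkord; apply: eq_bigr => a _; rewrite addnC.
have h1 : ML *m MN = 1%:M.
  apply/matrixP => l l'; rewrite !mxE.
  under eq_bigr => a _ do rewrite !mxE.
  have /(congr1 (fun q : {poly R} => q`_l')) : \sum_(a < j.+1) dbf tau (i - j + a) j 'X^l *: bspP i j (i - j + a) = 'X^l.
    apply: poly_eq_horner => u; rewrite -(@dbf_reproduce j 'X^l u) //; last by rewrite size_polyXn.
    rewrite shift ?horner_sum; first by apply: eq_bigr => a _; rewrite hornerZ.
    by move=> b hb; rewrite bspP_out ?horner0 ?mulr0 //; lia.
  rewrite coef_sum coefXn eq_sym => h.
  have -> : (l == l') = (l == l' :> nat) by [].
  by rewrite -h; apply: eq_bigr => a _; rewrite coefZ.
have h2 := mulmx1C h1.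
have h3 (a b : 'I_j.+1) : dbf tau (i - j + b) j (bspP i j (i - j + a)) = (a == b)%:R.
  rewrite (poly_sum_coef (size_bspP i j (i - j + a))) dbf_sum.
  have := congr1 (fun A : 'M[R]_(j.+1) => A a b) h2; rewrite !mxE => <-.
  by apply: eq_bigr => l _; rewrite !mxE.
have ka : (k - (i - j) < j.+1)%N by lia.
rewrite shift; last by move=> b hb; rewrite bspP_out ?scaler0 //; lia.
have kE : (i - j + Ordinal ka)%N = k by rewrite /=; lia.
have h4 (a : 'I_j.+1) : dbf tau k j (bspP i j (i - j + a)) = (a == Ordinal ka)%:R by rewrite -h3 kE.
rewrite dbf_sum (bigD1 (Ordinal ka)) // h4 eqxx mulr1 kE big1; first exact: addr0.
by move=> a na; rewrite h4 (negbTE na) mulr0.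
Qed.

End Pieces.

Section ExtKnots.
Context {R : realType}.
Variables (m K : nat) (xi : nat -> R).
Hypothesis m_gt0 : (0 < m)%N.
Hypothesis hxi : interior_knots K xi.
Local Notation tau := (ext_knots m K xi).

Lemma interior_knots_K_gt0 : (0 < K)%N.
Proof.
case: hxi => x0 [xK _]; rewrite lt0n; apply/eqP => K0.
by move: xK; rewrite K0 x0 => /eqP; rewrite eq_sym oner_eq0.
Qed.

Lemma xi_lt a b : (a < b)%N -> (b <= K)%N -> xi a < xi b.
Proof.
case: hxi => _ [_ h]; elim: b => // b IH; rewrite ltnS leq_eqVlt => /orP[/eqP -> bK|ab bK]; first exact: h.
by apply: lt_trans (IH ab (ltnW bK)) (h _ bK).
Qed.

Lemma xi_le a b : (a <= b)%N -> (b <= K)%N -> xi a <= xi b.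
Proof. by rewrite leq_eqVlt => /orP[/eqP -> //|ab] bK; apply/ltW/xi_lt. Qed.

Lemma xi_bound a : (a <= K)%N -> 0 <= xi a <= 1.
Proof.
move=> aK; case: hxi => x0 [xK _].
by rewrite -{1}x0 -{1}xK !xi_le.
Qed.

Lemma ext_knots_mid j : (j <= K)%N -> tau (m.-1 + j)%N = xi j.
Proof.
move=> jK; rewrite /ext_knots; case: ltnP => h.
  by have -> : j = 0%N by [lia]; case: hxi => ->.
by rewrite addKn jK.
Qed.

Lemma ext_knots_hi i : (m.-1 + K <= i)%N -> tau i = 1.
Proof.
move=> h; have K0 := interior_knots_K_gt0.
rewrite /ext_knots ifN; last by lia.
case: ifP => // h2; have -> : (i - m.-1)%N = K by lia.
by case: hxi => _ [].
Qed.

Lemma ext_knots_lo i : (i <= m.-1)%N -> tau i = 0.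
Proof. by move=> h; rewrite /ext_knots ifT //; lia. Qed.

Lemma ext_knots_homo : {homo tau : a b / (a <= b)%N >-> a <= b}.
Proof.
move=> a b ab; case: (leqP a m.-1) => am; last first.
  case: (leqP (m.-1 + K) b) => bm.
    rewrite (ext_knots_hi bm); case: (leqP (m.-1 + K) a) => am'; first by rewrite ext_knots_hi.
    have -> : a = (m.-1 + (a - m.-1))%N by lia.
    rewrite ext_knots_mid; last by lia.
    by have /andP[] : 0 <= xi (a - m.-1) <= 1 by apply: xi_bound; lia.
  have -> : a = (m.-1 + (a - m.-1))%N by lia.
  have -> : b = (m.-1 + (b - m.-1))%N by lia.
  by rewrite !ext_knots_mid ?xi_le //; lia.
rewrite (ext_knots_lo am) /ext_knots; case: ifP => // _; case: ifP => // h.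
by have /andP[] := xi_bound h.
Qed.

Lemma ext_knots_01 i : 0 <= tau i <= 1.
Proof.
rewrite /ext_knots; case: ifP => _; first by rewrite lexx ler01.
by case: ifP => h; [exact: xi_bound | rewrite ler01 lexx].
Qed.

Lemma ext_knots_strict k : tau k < tau k.+1 -> (m.-1 <= k < m.-1 + K)%N.
Proof.
case: (ltnP k m.-1) => h1; first by rewrite !ext_knots_lo ?ltxx //; lia.
case: (leqP (m.-1 + K) k) => h2; first by rewrite !ext_knots_hi ?ltxx //; lia.
by move=> _; lia.
Qed.

Lemma ext_knots_lt_mid j : (j < K)%N -> tau (m.-1 + j)%N < tau (m.-1 + j).+1.
Proof. by move=> jK; rewrite -addnS !ext_knots_mid ?xi_lt //; exact: ltnW. Qed.

Definition in_piece (j : nat) (u : R) : bool :=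
  (xi j <= u < xi j.+1) || ((u == 1) && (j.+1 == K)).

Lemma in_piece_exists u : 0 <= u <= 1 -> exists2 j, (j < K)%N & in_piece j u.
Proof.
move=> /andP[u0 u1]; have K0 := interior_knots_K_gt0; case: hxi => x0 [xK _].
case: (ltrP u 1) => u1'; last first.
  exists K.-1; first by lia.
  by rewrite /in_piece (_ : u == 1) ?prednK // ?eqxx ?orbT // eq_le u1 u1'.
have : exists j, (j < K)%N && (u < xi j.+1).
  by exists K.-1; rewrite prednK // xK u1' leqnn.
case/ex_minnP => j /andP[jK uj] jmin; exists j => //.
rewrite /in_piece uj andbT; apply/orP; left.
case: j jK uj jmin => [|j] jK uj jmin; first by rewrite x0.
rewrite leNgt; apply/negP => h; have := jmin j; rewrite h (ltnW jK) /= => /(_ isT).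
by rewrite ltnn.
Qed.

Lemma in_piece_bounds j u : (j < K)%N -> in_piece j u -> xi j <= u <= xi j.+1.
Proof.
move=> jK /orP[/andP[-> /ltW ->] //|/andP[/eqP -> /eqP jE]].
case: hxi => _ [xK _]; rewrite jE xK lexx andbT.
by have /andP[] := xi_bound (ltnW jK).
Qed.

Lemma bspline0_piece j u : (j < K)%N -> in_piece j u ->
  forall k, bspline tau 0 k u = (k == (m.-1 + j)%N)%:R.
Proof.
move=> jK ju k /=.
have g := ext_knots_lt_mid jK.
have xjE := ext_knots_mid (ltnW jK); have xjE' := ext_knots_mid jK; rewrite addnS in xjE'.
case: (eqVneq k (m.-1 + j)%N) => [->|nk].
  rewrite (_ : _ || _ = true) //; rewrite xjE xjE' in g *.
  case/orP: ju => [-> //|/andP[/eqP -> /eqP jE]].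
  by apply/orP; right; rewrite g jE; case: hxi => _ [-> _]; rewrite eqxx.
rewrite (_ : _ || _ = false) //; apply/negP => /orP[/andP[h1 h2]|/and3P[/eqP uE h1 /eqP h2]].
- have /andP[a1 a2] := ext_knots_strict (le_lt_trans h1 h2).
  case/orP: ju => [/andP[j1 j2]|/andP[/eqP u1 _]]; last first.
    by move: h2; rewrite u1; have /andP[_ ?] := ext_knots_01 k.+1; rewrite ltNge => /negP.
  move: nk; rewrite neq_ltn => /orP[lt|lt].
    have : tau k.+1 <= tau (m.-1 + j)%N by apply: ext_knots_homo.
    by rewrite xjE => h; move: (lt_le_trans h2 h); rewrite ltNge j1.
  have : tau (m.-1 + j).+1 <= tau k by apply: ext_knots_homo.
  by rewrite xjE' => h; move: (le_lt_trans (le_trans h h1) j2); rewrite ltxx.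
- have /andP[a1 a2] := ext_knots_strict h1.
  case/orP: ju => [/andP[j1 j2]|/andP[/eqP u1 /eqP jE]].
    have := j2; rewrite uE h2; have /andP[_ ?] := xi_bound jK.
    by rewrite ltNge => /negP.
  have : tau k.+1 < 1.
    have -> : k.+1 = (m.-1 + (k.+1 - m.-1))%N by lia.
    rewrite ext_knots_mid; last by lia.
    by case: hxi => _ [<- _]; apply: xi_lt => //; move/eqP: nk; lia.
  by rewrite h2 ltxx.
Qed.

Lemma bspline_piece j u : (j < K)%N -> in_piece j u ->
  forall o k, bspline tau o k u = (bspP tau (m.-1 + j) o k).[u].
Proof. by move=> jK ju o k; apply: bspline_bspP => k'; apply: bspline0_piece. Qed.

Lemma bspline_out o k u : ~~ (0 <= u <= 1) -> bspline tau o k u = 0.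
Proof.
move=> u01; elim: o k => [|o IH] k /=; last by rewrite !IH !mulr0 addr0.
rewrite ifF //; apply/negP => /orP[/andP[h1 h2]|/and3P[/eqP uE h1 /eqP h2]].
  have /andP[t1 _] := ext_knots_01 k; have /andP[_ t2] := ext_knots_01 k.+1.
  by move: u01; rewrite (le_trans t1 h1) (le_trans (ltW h2) t2).
by move: u01; rewrite uE h2 ler01 lexx.
Qed.

Local Notation L := (nbasis m K).
Local Notation Bs u k := (Bstar m K xi u k 0).

Lemma BstarE u (k : 'I_L) : Bs u k = bspline tau m.-1 k u.
Proof. by rewrite mxE. Qed.

Lemma Bstar_out u k : ~~ (0 <= u <= 1) -> Bs u k = 0.
Proof. by move=> h; rewrite BstarE bspline_out. Qed.

Lemma Bstar_piece j u k : (j < K)%N -> in_piece j u ->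
  Bs u k = (bspP tau (m.-1 + j) m.-1 k).[u].
Proof. by move=> jK ju; rewrite BstarE (bspline_piece jK ju). Qed.

Lemma sum_basis_piece (V : nmodType) (f : nat -> V) j : (j < K)%N ->
  (forall k, (m.-1 + j < k)%N -> f k = 0) ->
  \sum_(k < L) f k = \sum_(0 <= k < (m.-1 + j).+1) f k.
Proof.
move=> jK f0; rewrite -(big_mkord xpredT f) (big_cat_nat (n := (m.-1 + j).+1)) //=; last by rewrite /nbasis; lia.
by rewrite [X in _ + X]big_nat [X in _ + X]big1 ?addr0 // => k /andP[h _]; exact: f0.
Qed.

Lemma Bstar_ge0 u k : 0 <= Bs u k.
Proof.
case: (boolP (0 <= u <= 1)) => [/in_piece_exists[j jK ju]|h]; last by rewrite Bstar_out.
rewrite (Bstar_piece _ jK ju); apply: bspP_ge0.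
- exact: ext_knots_homo.
- exact: ext_knots_lt_mid.
by rewrite -addnS !ext_knots_mid ?(ltnW jK) //; exact: in_piece_bounds.
Qed.

Lemma Bstar_sum1 u : 0 <= u <= 1 -> \sum_k Bs u k = 1.
Proof.
case/in_piece_exists => j jK ju.
under eq_bigr => k _ do rewrite (Bstar_piece _ jK ju).
rewrite (@sum_basis_piece _ (fun k => (bspP tau (m.-1 + j) m.-1 k).[u]) j) //.
  apply: bspP_sum1; [exact: ext_knots_homo | exact: ext_knots_lt_mid | exact: leq_addr].
by move=> k h; rewrite bspP_out ?horner0 // h.
Qed.

Lemma Bstar_sum_le1 u : \sum_k Bs u k <= 1.
Proof.
case: (boolP (0 <= u <= 1)) => [h|h]; first by rewrite Bstar_sum1.
by rewrite big1 ?ler01 // => k _; rewrite Bstar_out.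
Qed.

Lemma Bstar_le1 u k : Bs u k <= 1.
Proof.
apply: le_trans (Bstar_sum_le1 u); rewrite (bigD1 k) //= lerDl.
by apply: sumr_ge0 => l _; exact: Bstar_ge0.
Qed.

Lemma Bstar_support u k : Bs u k != 0 -> tau k <= u <= tau (k + m)%N.
Proof.
case: (boolP (0 <= u <= 1)) => [/in_piece_exists[j jK ju]|h]; last by rewrite Bstar_out ?eqxx.
rewrite (Bstar_piece _ jK ju) => nz.
have h : ~~ ((m.-1 + j < k) || (k + m.-1 < m.-1 + j))%N.
  by apply: contra nz => h; rewrite bspP_out // horner0.
have /andP[b1 b2] := in_piece_bounds jK ju.
rewrite -(ext_knots_mid (ltnW jK)) in b1; rewrite -(ext_knots_mid jK) in b2.
apply/andP; split; [apply: le_trans b1 | apply: (le_trans b2)]; apply: ext_knots_homo; lia.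
Qed.

Lemma Bstar_overlap u (a b : 'I_L) : (a + m <= b)%N -> Bs u a * Bs u b = 0.
Proof.
move=> ab.
case: (boolP (0 <= u <= 1)) => [/in_piece_exists[j jK ju]|h]; last by rewrite Bstar_out ?mul0r.
rewrite !(Bstar_piece _ jK ju); case: (leqP b (m.-1 + j)) => h.
  by rewrite bspP_out ?horner0 ?mul0r //; apply/orP; right; lia.
by rewrite [X in _ * X.[u]]bspP_out ?horner0 ?mulr0 // h.
Qed.

Lemma measurable_bspline (t : nat -> R) o k : measurable_fun setT (bspline t o k).
Proof.
elim: o k => [|o IH] k /=; last first.
  apply: measurable_funD; apply: measurable_funM => //; apply: measurable_funM => //.
    exact: measurable_funB.
  exact: measurable_funB.
apply: measurable_fun_ifT => //; apply: measurable_or; first apply: measurable_and.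
- exact: measurable_fun_ler.
- exact: measurable_fun_ltr.
- apply: measurable_and => //; exact: measurable_fun_eqr.
Qed.

Variable Cq : R.
Hypothesis hq : quasi_uniform Cq K xi.

Lemma quasi_uniform_ge1 : 1 <= Cq.
Proof.
have K0 := interior_knots_K_gt0; have := hq K0 K0.
have l0 : 0 < xi 1%N - xi 0%N by rewrite subr_gt0 xi_lt.
by rewrite -{1}[xi 1%N - xi 0%N]mul1r ler_pM2r.
Qed.

Lemma sum_knot_gaps : \sum_(j < K) (xi j.+1 - xi j) = 1.
Proof.
rewrite -(big_mkord xpredT (fun j => xi j.+1 - xi j)) telescope_sumr //.
by case: hxi => -> [-> _]; rewrite subr0.
Qed.

Lemma knot_gap_le j : (j < K)%N -> xi j.+1 - xi j <= Cq / K%:R.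
Proof.
move=> jK; have K0 : 0 < K%:R :> R by rewrite ltr0n interior_knots_K_gt0.
rewrite ler_pdivlMr // -[leRHS]mulr1 -[in leRHS]sum_knot_gaps mulr_sumr mulr_natr.
rewrite -[X in _ *+ X](card_ord K) -sumr_const; apply: ler_sum => i _; exact: hq.
Qed.

Lemma knot_gap_ge j : (j < K)%N -> (Cq * K%:R)^-1 <= xi j.+1 - xi j.
Proof.
move=> jK; have K0 : 0 < K%:R :> R by rewrite ltr0n interior_knots_K_gt0.
have C0 : 0 < Cq by apply: lt_le_trans quasi_uniform_ge1.
rewrite -div1r ler_pdivrMr ?mulr_gt0 // -{1}sum_knot_gaps mulrC mulrAC mulr_natr.
rewrite -[X in _ *+ X](card_ord K) -sumr_const; apply: ler_sum => i _; exact: hq.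
Qed.

Lemma ext_knots_step i : tau i.+1 - tau i <= Cq / K%:R.
Proof.
have K0 : 0 < K%:R :> R by rewrite ltr0n interior_knots_K_gt0.
have c0 : 0 <= Cq / K%:R by rewrite divr_ge0 ?(ltW K0) // (le_trans _ quasi_uniform_ge1).
case: (lerP (tau i.+1) (tau i)) => [h|/ext_knots_strict h]; first by rewrite (le_trans _ c0) // subr_le0.
have -> : i.+1 = (m.-1 + (i - m.-1).+1)%N by lia.
have -> : tau i = tau (m.-1 + (i - m.-1))%N by congr (tau _); lia.
by rewrite !ext_knots_mid ?knot_gap_le //; lia.
Qed.

Lemma ext_knots_dist a s : tau (a + s)%N - tau a <= s%:R * (Cq / K%:R).
Proof.
elim: s => [|s IH]; first by rewrite addn0 subrr mul0r.
rewrite addnS; have := ext_knots_step (a + s).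
by rewrite -natr1 mulrDl mul1r; move: IH; lra.
Qed.

Lemma ext_knots_dist_sym a b s u : (a <= b <= a + s)%N -> tau a <= u <= tau (a + s)%N ->
  `|tau b - u| <= s%:R * (Cq / K%:R).
Proof.
move=> /andP[ab bs] /andP[u1 u2]; have := ext_knots_dist a s.
have h1 := ext_knots_homo ab; have h2 := ext_knots_homo bs.
by rewrite ler_norml; lra.
Qed.

End ExtKnots.

(** * Moments and independence *)

Section Moments.
Context d (T : measurableType d) (R : realType) (P : probability T R).
Implicit Types (f g : T -> R) (A B : set T).

(* Functions with all moments: closed under products, so that integrability never has to be
   discussed for polynomial expressions in Gaussian and bounded variables. *)
Definition mom f := measurable_fun setT f /\
  forall k, (\int[P]_w ((f w) ^+ (2 * k))%:E < +oo)%E.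

Lemma mom_meas f : mom f -> measurable_fun setT f. Proof. by case. Qed.

Lemma even_pow_ge0 (x : R) k : 0 <= x ^+ (2 * k).
Proof. by rewrite exprM exprn_ge0 // sqr_ge0. Qed.

Lemma mom_dom f g C : measurable_fun setT f -> mom g -> 0 <= C ->
  (forall w, `|f w| <= C * `|g w|) -> mom f.
Proof.
move=> mf [mg ig] C0 fg; split=> // k.
have [e0 e1] : (forall w, (0 <= ((f w) ^+ (2 * k))%:E)%E) /\ (forall w, (0 <= ((g w) ^+ (2 * k))%:E)%E).
  by split=> w; rewrite lee_fin even_pow_ge0.
apply: (@le_lt_trans _ _ (\int[P]_w ((C ^+ (2 * k))%:E * ((g w) ^+ (2 * k))%:E))%E); last first.
  rewrite ge0_integralZl //; last by rewrite lee_fin even_pow_ge0.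
    by rewrite lte_mul_pinfty // ?lee_fin ?even_pow_ge0.
  by apply/measurable_EFinP; exact: measurable_funX.
apply: ge0_le_integral => //.
- by apply/measurable_EFinP; exact: measurable_funX.
- apply/measurable_EFinP; apply: measurable_funM => //; exact: measurable_funX.
- move=> w _; rewrite -EFinM lee_fin -exprMn.
  rewrite -[leLHS]ger0_norm ?even_pow_ge0 // -[leRHS]ger0_norm ?even_pow_ge0 // !normrX.
  by rewrite lerXn2r ?nnegrE // normrM (ger0_norm C0).
Qed.

Lemma mom_bounded f C : measurable_fun setT f -> (forall w, `|f w| <= C) -> mom f.
Proof.
move=> mf fC; have C0 : 0 <= C by apply: le_trans (fC point); exact: normr_ge0.
have : mom (cst 1).
  split=> // k; under eq_integral do rewrite expr1n.
  by have := expectation_cst P 1; rewrite unlock => ->; rewrite ltry.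
by move=> h; apply: (mom_dom mf h C0) => w /=; rewrite normr1 mulr1.
Qed.

Lemma mom_cst c : mom (fun=> c).
Proof. by apply: (@mom_bounded _ `|c|) => //. Qed.

Lemma momD f g : mom f -> mom g -> mom (fun w => f w + g w).
Proof.
move=> [mf hf] [mg hg]; split=> [|k]; first exact: measurable_funD.
have [e0 e1] : (forall w, (0 <= ((f w) ^+ (2 * k))%:E)%E) /\ (forall w, (0 <= ((g w) ^+ (2 * k))%:E)%E).
  by split=> w; rewrite lee_fin even_pow_ge0.
have mf' : measurable_fun setT (fun w => ((f w) ^+ (2 * k))%:E) by apply/measurable_EFinP; exact: measurable_funX.
have mg' : measurable_fun setT (fun w => ((g w) ^+ (2 * k))%:E) by apply/measurable_EFinP; exact: measurable_funX.
apply: (@le_lt_trans _ _ (\int[P]_w ((2 ^+ (2 * k))%:E * (((f w) ^+ (2 * k))%:E + ((g w) ^+ (2 * k))%:E)))%E); last first.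
  rewrite ge0_integralZl //.
  - rewrite lte_mul_pinfty // ?lee_fin ?even_pow_ge0 // ge0_integralD //.
    by rewrite lte_add_pinfty.
  - exact: emeasurable_funD.
  - by move=> w _; rewrite adde_ge0.
apply: ge0_le_integral => //.
- by move=> w _; rewrite lee_fin even_pow_ge0.
- by apply/measurable_EFinP; apply: measurable_funX; exact: measurable_funD.
- apply: emeasurable_funM => //; exact: emeasurable_funD.
- move=> w _; rewrite -EFinD -EFinM lee_fin.
  have aux (a b : R) : `|a| <= `|b| -> (a + b) ^+ (2 * k) <= 2 ^+ (2 * k) * (a ^+ (2 * k) + b ^+ (2 * k)).
    move=> ab; apply: (@le_trans _ _ ((2 * b) ^+ (2 * k))).
      rewrite -[leLHS]ger0_norm ?even_pow_ge0 // -[leRHS]ger0_norm ?even_pow_ge0 // !normrX.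
      rewrite lerXn2r ?nnegrE // normrM (ger0_norm (ler0n _ _)).
      by apply: (le_trans (ler_normD _ _)); move: ab; lra.
    by rewrite exprMn ler_wpM2l ?even_pow_ge0 // lerDr even_pow_ge0.
  case: (leP `|f w| `|g w|) => h; first exact: aux.
  by rewrite addrC [X in _ * X]addrC; apply: aux; exact: ltW.
Qed.

Lemma momM f g : mom f -> mom g -> mom (fun w => f w * g w).
Proof.
move=> [mf hf] [mg hg]; split=> [|k]; first exact: measurable_funM.
have [e0 e1] : (forall w, (0 <= ((f w) ^+ (2 * (2 * k)))%:E)%E) /\ (forall w, (0 <= ((g w) ^+ (2 * (2 * k)))%:E)%E).
  by split=> w; rewrite lee_fin even_pow_ge0.
have mf' : measurable_fun setT (fun w => ((f w) ^+ (2 * (2 * k)))%:E) by apply/measurable_EFinP; exact: measurable_funX.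
have mg' : measurable_fun setT (fun w => ((g w) ^+ (2 * (2 * k)))%:E) by apply/measurable_EFinP; exact: measurable_funX.
apply: (@le_lt_trans _ _ (\int[P]_w (((f w) ^+ (2 * (2 * k)))%:E + ((g w) ^+ (2 * (2 * k)))%:E))%E); last first.
  by rewrite ge0_integralD // lte_add_pinfty.
apply: ge0_le_integral => //.
- by move=> w _; rewrite lee_fin even_pow_ge0.
- by apply/measurable_EFinP; apply: measurable_funX; exact: measurable_funM.
- exact: emeasurable_funD.
- move=> w _; rewrite -EFinD lee_fin exprMn ![_ ^+ (2 * (2 * k))]exprM -![(_ ^+ 2) ^+ (2 * k)]exprM.
  rewrite ![(2 * (2 * k))%N]mulnC !exprM.
  set a := (f w ^+ 2) ^+ k; set b := (g w ^+ 2) ^+ k.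
  have : 0 <= (a - b) ^+ 2 by rewrite sqr_ge0.
  have : 0 <= (a + b) ^+ 2 by rewrite sqr_ge0.
  by nra.
Qed.

Lemma momN f : mom f -> mom (fun w => - f w).
Proof.
move=> h; have := momM (mom_cst (-1)) h.
by rewrite (_ : (fun w => -1 * f w) = (fun w => - f w)) //; apply/funext => w; rewrite mulN1r.
Qed.

Lemma momB f g : mom f -> mom g -> mom (fun w => f w - g w).
Proof. by move=> hf hg; apply: momD => //; exact: momN. Qed.

Lemma mom_sum (I : Type) (s : seq I) (Q : pred I) (F : I -> T -> R) :
  (forall i, mom (F i)) -> mom (fun w => \sum_(i <- s | Q i) F i w).
Proof.
move=> h; elim: s => [|i s IH].
  by under eq_fun do rewrite big_nil; exact: mom_cst.
under eq_fun do rewrite big_cons; case: (Q i) => //.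
exact: momD.
Qed.

Lemma momX f n : mom f -> mom (fun w => f w ^+ n).
Proof.
move=> h; elim: n => [|n IH]; first by under eq_fun do rewrite expr0; exact: mom_cst.
by under eq_fun do rewrite exprS; exact: momM.
Qed.

Lemma mom_integrable f : mom f -> P.-integrable setT (EFin \o f).
Proof.
move=> mf; have [mf0 _] := mf; apply/integrableP; split; first exact/measurable_EFinP.
have [m1 /(_ 1%N)] := momD (mom_cst 1) (momX 2 mf).
have mab : measurable_fun setT (fun w => `|f w|%:E).
  by apply/measurable_EFinP; exact: measurableT_comp.
apply: le_lt_trans.
apply: ge0_le_integral => //.
- by apply/measurable_EFinP; exact: measurable_funX.
- move=> w _ /=; rewrite lee_fin muln1.
  set a := `|f w|; have -> : f w ^+ 2 = a ^+ 2 by rewrite /a real_normK ?num_real.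
  have a0 : 0 <= a by exact: normr_ge0.
  have : 0 <= (a - 1/2) ^+ 2 by rewrite sqr_ge0.
  by move: (a : R) a0 => b b0; nra.
Qed.

Local Notation Ex := (Eexp P).

Lemma ExE f : mom f -> ((Ex f)%:E = \int[P]_w (f w)%:E)%E.
Proof.
move=> mf; rewrite /Eexp unlock fineK //.
by apply: integrable_fin_num => //; exact: mom_integrable.
Qed.

Lemma ExD f g : mom f -> mom g -> Ex (fun w => f w + g w) = Ex f + Ex g.
Proof.
move=> mf mg; apply: EFin_inj; rewrite EFinD !ExE //; last exact: momD.
under eq_integral do rewrite EFinD.
by rewrite integralD //; exact: mom_integrable.
Qed.

Lemma ExZ c f : mom f -> Ex (fun w => c * f w) = c * Ex f.
Proof.
move=> mf; apply: EFin_inj; rewrite EFinM !ExE //; last by apply: momM => //; exact: mom_cst.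
under eq_integral do rewrite EFinM.
by rewrite integralZl //; exact: mom_integrable.
Qed.

Lemma ExZr c f : mom f -> Ex (fun w => f w * c) = Ex f * c.
Proof. by move=> mf; rewrite mulrC -ExZ //; congr (Eexp P _); apply/funext => w; rewrite mulrC. Qed.

Lemma ExN f : mom f -> Ex (fun w => - f w) = - Ex f.
Proof. by move=> mf; rewrite -mulN1r -ExZ //; congr (Eexp P _); apply/funext => w; rewrite mulN1r. Qed.

Lemma ExB f g : mom f -> mom g -> Ex (fun w => f w - g w) = Ex f - Ex g.
Proof. by move=> mf mg; rewrite ExD ?ExN //; exact: momN. Qed.

Lemma Ex_cst c : Ex (fun=> c) = c.
Proof.
by rewrite /Eexp -[RHS]/(fine c%:E); congr fine; exact: (expectation_cst P c).
Qed.

Lemma Ex_sum (I : Type) (s : seq I) (Q : pred I) (F : I -> T -> R) :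
  (forall i, mom (F i)) ->
  Ex (fun w => \sum_(i <- s | Q i) F i w) = \sum_(i <- s | Q i) Ex (F i).
Proof.
move=> h; elim: s => [|i s IH].
  by rewrite big_nil; under eq_fun do rewrite big_nil; exact: Ex_cst.
rewrite big_cons; under eq_fun do rewrite big_cons.
by case: (Q i) => //; rewrite ExD ?IH //; exact: mom_sum.
Qed.

Lemma Ex_ge0 f : (forall w, 0 <= f w) -> 0 <= Ex f.
Proof.
move=> h; rewrite /Eexp unlock; apply: fine_ge0.
by apply: integral_ge0 => w _; rewrite lee_fin.
Qed.

Lemma Ex_le f g : mom f -> mom g -> (forall w, f w <= g w) -> Ex f <= Ex g.
Proof.
move=> mf mg h; rewrite -subr_ge0 -ExB //; apply: Ex_ge0 => w; by rewrite subr_ge0.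
Qed.

Lemma measurable_ge f c : measurable_fun setT f -> measurable [set w | c <= f w].
Proof.
move=> mf; rewrite [X in measurable X](_ : _ = setT `&` f @^-1` `[c, +oo[%classic); first exact: mf.
by rewrite setTI; apply/seteqP; split=> w /=; rewrite in_itv /= andbT.
Qed.

Lemma measurable_gt f c : measurable_fun setT f -> measurable [set w | c < f w].
Proof.
move=> mf; rewrite [X in measurable X](_ : _ = setT `&` f @^-1` `]c, +oo[%classic); first exact: mf.
by rewrite setTI; apply/seteqP; split=> w /=; rewrite in_itv /= andbT.
Qed.

Lemma prob_le A B : measurable A -> measurable B -> A `<=` B -> prob P A <= prob P B.
Proof.
move=> mA mB AB; rewrite /prob fine_le //.
- exact: fin_num_measure.
- exact: fin_num_measure.
- by apply: le_measure => //; rewrite inE.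
Qed.

Lemma prob_indic A : measurable A -> prob P A = Ex (\1_A : T -> R).
Proof. by move=> mA; rewrite /prob /Eexp unlock /= integral_indic // setIT. Qed.

Lemma mom_indic A : measurable A -> mom (\1_A : T -> R).
Proof.
move=> mA; apply: (@mom_bounded _ 1); first exact: measurable_indic.
by move=> w; rewrite indicE; case: (_ \in _); rewrite ?normr1 ?normr0.
Qed.

Lemma markov_ineq f t : mom f -> (forall w, 0 <= f w) -> 0 < t ->
  prob P [set w | t <= f w] <= Ex f / t.
Proof.
move=> mf f0 t0; have mA := measurable_ge t (mom_meas mf).
rewrite prob_indic // ler_pdivlMr // mulrC -ExZ; last exact: mom_indic.
apply: Ex_le => //; first by apply: momM; [exact: mom_cst | exact: mom_indic].
move=> w; rewrite indicE; case: (boolP (w \in _)) => h; last by rewrite mulr0.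
by rewrite mulr1; move: h; rewrite inE.
Qed.

Lemma prob_bigU_le (I : finType) (A : I -> set T) : (forall i, measurable (A i)) ->
  prob P [set w | exists i, A i w] <= \sum_i prob P (A i).
Proof.
move=> mA; have mU : measurable [set w | exists i, A i w].
  rewrite [X in measurable X](_ : _ = \bigcup_(i in [set` predT]) A i).
    by apply: fin_bigcup_measurable => //; exact: finite_finset.
  by apply/seteqP; split=> w /= [i]; [exists i|move=> ?; exists i].
rewrite prob_indic //; under eq_bigr => i _ do rewrite prob_indic //.
rewrite -Ex_sum; last by move=> i; exact: mom_indic.
apply: Ex_le; [exact: mom_indic | by apply: mom_sum => i; exact: mom_indic|].
move=> w; rewrite indicE; case: (boolP (w \in _)) => [|_]; last by apply: sumr_ge0.
rewrite inE => -[i Ai]; rewrite (bigD1 i) //= indicE mem_set // lerDl.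
by apply: sumr_ge0.
Qed.

End Moments.

Lemma ge0_integral_law d1 d2 (T1 : measurableType d1) (T2 : measurableType d2) (R : realType)
    (P1 : probability T1 R) (P2 : probability T2 R) (X1 : T1 -> R) (X2 : T2 -> R) (g : R -> \bar R) :
  measurable_fun setT X1 -> measurable_fun setT X2 ->
  (forall B, measurable B -> P1 (X1 @^-1` B) = P2 (X2 @^-1` B)) ->
  measurable_fun setT g -> (forall x, (0 <= g x)%E) ->
  (\int[P1]_w g (X1 w) = \int[P2]_w g (X2 w))%E.
Proof.
move=> m1 m2 h mg g0.
have e1 : (\int[pushforward P1 X1]_x g x = \int[P1]_w g (X1 w))%E.
  by rewrite ge0_integral_pushforward // preimage_setT.
have e2 : (\int[pushforward P2 X2]_x g x = \int[P2]_w g (X2 w))%E.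
  by rewrite ge0_integral_pushforward // preimage_setT.
rewrite -e1 -e2; apply: eq_measure_integral => B mB _.
exact: h.
Qed.

Lemma Ex_law d1 d2 (T1 : measurableType d1) (T2 : measurableType d2) (R : realType)
    (P1 : probability T1 R) (P2 : probability T2 R) (X1 : T1 -> R) (X2 : T2 -> R) (f : R -> R) :
  measurable_fun setT X1 -> measurable_fun setT X2 ->
  (forall B, measurable B -> P1 (X1 @^-1` B) = P2 (X2 @^-1` B)) ->
  measurable_fun setT f -> mom P1 (f \o X1) ->
  mom P2 (f \o X2) /\ Eexp P1 (f \o X1) = Eexp P2 (f \o X2).
Proof.
move=> m1 m2 h mf mom1.
have key g := @ge0_integral_law _ _ _ _ _ P1 P2 X1 X2 g m1 m2 h.
have mom2 : mom P2 (f \o X2).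
  split=> [|k]; first exact: measurableT_comp.
  have [_ /(_ k)] := mom1; rewrite (key (fun x => (f x ^+ (2 * k))%:E)) //.
    by apply/measurable_EFinP; exact: measurable_funX.
  by move=> x; rewrite lee_fin even_pow_ge0.
split=> //; apply: EFin_inj; rewrite !ExE //.
have mf' : measurable_fun setT (EFin \o f) by exact/measurable_EFinP.
have e1 : (\int[pushforward P1 X1]_x (f x)%:E = \int[P1]_w (f (X1 w))%:E)%E.
  by rewrite (@integral_pushforward _ _ _ _ _ _ m1 _ _ (EFin \o f)) ?preimage_setT //; exact: (mom_integrable mom1).
have e2 : (\int[pushforward P2 X2]_x (f x)%:E = \int[P2]_w (f (X2 w))%:E)%E.
  by rewrite (@integral_pushforward _ _ _ _ _ _ m2 _ _ (EFin \o f)) ?preimage_setT //; exact: (mom_integrable mom2).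
rewrite -e1 -e2; apply: eq_measure_integral => B mB _.
exact: h.
Qed.

Section Cylinders.
Context d (T : measurableType d) (R : realType) (I : finType) (F : I -> T -> R).

Definition cyl (S : {set I}) : set (set T) :=
  [set E | exists2 B : I -> set R, (forall i, measurable (B i)) &
           E = [set w | forall i, i \in S -> B i (F i w)]].

Definition TS (S : {set I}) := g_sigma_algebraType (cyl S).

Definition msig (S : {set I}) (f : T -> R) := measurable_fun [set: TS S] (f : TS S -> R).

Lemma cyl_setI S : setI_closed (cyl S).
Proof.
move=> _ _ [A mA ->] [B mB ->]; exists (fun i => A i `&` B i) => [i|]; first exact: measurableI.
by apply/seteqP; split=> w /= => [[h1 h2] i iS|h]; [split; [exact: h1|exact: h2]|split=> i iS; have [] := h i iS].
Qed.

Lemma cyl_setT S : cyl S setT.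
Proof. by exists (fun=> setT) => //; apply/seteqP; split. Qed.

Lemma cyl_coord (S : {set I}) i B : i \in S -> measurable B -> cyl S (F i @^-1` B).
Proof.
move=> iS mB; exists (fun j => if j == i then B else setT) => [j|]; first by case: ifP.
apply/seteqP; split=> w /=; first by move=> h j _; case: eqP => [->|].
by move=> /(_ i iS); rewrite eqxx.
Qed.

Lemma cyl_sub (S S' : {set I}) : S \subset S' -> cyl S `<=` cyl S'.
Proof.
move=> SS' _ [B mB ->]; exists (fun j => if j \in S then B j else setT) => [j|]; first by case: ifP.
apply/seteqP; split=> w /= h i iS; first by case: ifP => // iS'; exact: h.
by have := h i (fintype.subsetP SS' _ iS); rewrite iS.
Qed.

Lemma msig_coord (S : {set I}) i : i \in S -> msig S (F i).
Proof.
move=> iS _ B mB; rewrite setTI; apply: sub_sigma_algebra; exact: cyl_coord.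
Qed.

Lemma msig_sub (S S' : {set I}) f : S \subset S' -> msig S f -> msig S' f.
Proof.
move=> SS' mf _ B mB; have := mf measurableT B mB.
by apply: sub_sigma_algebra2; exact: cyl_sub.
Qed.

Hypothesis mF : forall i, measurable_fun setT (F i).

Lemma cyl_measurable S E : cyl S E -> measurable E.
Proof.
move=> [B mB ->]; rewrite [X in measurable X](_ : _ = \bigcap_(i in [set` S]) (F i @^-1` B i)).
  apply: fin_bigcap_measurable => [|i _]; first exact: finite_finset.
  by rewrite -[X in measurable X]setTI; exact: mF.
by apply/seteqP; split.
Qed.

Definition idS (S : {set I}) : T -> TS S := id.

Lemma TS_measurable S (E : set T) : @measurable _ (TS S) E -> @measurable _ T E.
Proof.
apply: smallest_sub; first exact: sigma_algebra_measurable.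
by move=> A; exact: cyl_measurable.
Qed.

Lemma measurable_idS S : measurable_fun setT (idS S).
Proof. by move=> _ B mB; rewrite setTI; exact: (TS_measurable mB). Qed.

Lemma msig_meas S f : msig S f -> measurable_fun setT f.
Proof. by move=> mf _ B mB; have := mf measurableT B mB; rewrite !setTI => /TS_measurable. Qed.

End Cylinders.

Section Decouple.
Context d (T : measurableType d) (R : realType) (P : probability T R)
  (I : finType) (F : I -> T -> R).
Hypothesis hF : mutually_independent P F.
Let mF := hF.1.
Local Notation cyl := (cyl F).
Local Notation TS := (TS F).
Local Notation msig := (msig F).
Variables S S' : {set I}.
Hypothesis SS' : forall i, i \in S -> i \notin S'.

Lemma cyl_indep E E' : cyl S E -> cyl S' E' -> P (E `&` E') = (P E * P E')%E.
Proof.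
move=> cE cE'; have [mE mE'] := (cyl_measurable mF cE, cyl_measurable mF cE').
case: cE cE' mE mE' => [B mB ->] [B' mB' ->] mE mE'.
pose C i := if i \in S then B i else B' i.
have mC i : measurable (C i) by rewrite /C; case: ifP.
have e1 := hF.2 S C mC; have e2 := hF.2 S' C mC; have e3 := hF.2 (S :|: S') C mC.
have CS : [set w | forall i, i \in S -> C i (F i w)] = [set w | forall i, i \in S -> B i (F i w)].
  by apply/seteqP; split=> w /= h i iS; have := h i iS; rewrite /C iS.
have CS' : [set w | forall i, i \in S' -> C i (F i w)] = [set w | forall i, i \in S' -> B' i (F i w)].
  have nS i : i \in S' -> i \in S = false by move=> iS'; apply/negbTE/negP => /SS'; rewrite iS'.
  by apply/seteqP; split=> w /= h i iS; have := h i iS; rewrite /C (nS i iS).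
have CU : [set w | forall i, i \in S :|: S' -> C i (F i w)] =
  [set w | forall i, i \in S -> B i (F i w)] `&` [set w | forall i, i \in S' -> B' i (F i w)].
  rewrite -CS -CS'; apply/seteqP; split=> w /= h.
    by split=> i iS; apply: h; rewrite finset.in_setU iS ?orbT.
  by move=> i; rewrite finset.in_setU => /orP[] iS; [apply: h.1|apply: h.2].
rewrite CS in e1; rewrite CS' in e2; rewrite CU in e3.
have pE (A : set T) : measurable A -> P A = (prob P A)%:E by move=> mA; rewrite /prob fineK // fin_num_measure.
rewrite (pE _ mE) (pE _ mE') (pE _ (measurableI _ _ mE mE')) e1 e2 e3 -EFinM; congr _%:E.
rewrite big_mkcond [X in _ = X * _]big_mkcond [X in _ = _ * X]big_mkcond -big_split /=.
apply: eq_bigr => i _; rewrite finset.in_setU; case: (boolP (i \in S)) => [/SS' /negbTE -> |_] /=; first by rewrite mulr1.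
by rewrite mul1r.
Qed.

Lemma half_indep E E' : @measurable _ (TS S) E -> cyl S' E' -> P (E `&` E') = (P E * P E')%E.
Proof.
move=> mE cE'; have mE' := cyl_measurable mF cE'.
have p0 : 0 <= fine (P E') by exact: fine_ge0.
have := @measure_unique _ _ (TS S) (cyl S) (fun=> setT) erefl (@cyl_setI _ _ _ _ F S)
  (fun=> cyl_setT F S) _ (pushforward (mrestr P mE') (idS F S)) (mscale (NngNum p0) (pushforward P (idS F S))).
have mid := @measurable_idS _ _ _ _ F mF S.
move=> h; have key : P (E `&` E') = ((fine (P E'))%:E * P E)%E.
  apply: (h _ mid mid _ _ E mE); first by rewrite bigcup_const.
  - move=> A cA; transitivity (P (A `&` E')); first by [].
    by rewrite (cyl_indep cA cE') muleC -{1}[P E']fineK ?fin_num_measure.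
  - by move=> _; apply: (le_lt_trans (probability_le1 P (measurableI _ _ measurableT mE'))); exact: ltry.
by rewrite key fineK ?fin_num_measure // muleC.
Qed.

Lemma TS_indep E E' : @measurable _ (TS S) E -> @measurable _ (TS S') E' ->
  P (E `&` E') = (P E * P E')%E.
Proof.
move=> mE mE'; have mE0 : @measurable _ T E := TS_measurable mF mE.
have p0 : 0 <= fine (P E) by exact: fine_ge0.
have mid := @measurable_idS _ _ _ _ F mF S'.
have := @measure_unique _ _ (TS S') (cyl S') (fun=> setT) erefl (@cyl_setI _ _ _ _ F S')
  (fun=> cyl_setT F S') _ (pushforward (mrestr P mE0) (idS F S')) (mscale (NngNum p0) (pushforward P (idS F S'))).
move=> h; have key : P (E' `&` E) = ((fine (P E))%:E * P E')%E.
  apply: (h _ mid mid _ _ E' mE'); first by rewrite bigcup_const.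
  - move=> A cA; transitivity (P (A `&` E)); first by [].
    by rewrite setIC (half_indep mE cA) -{1}[P E]fineK ?fin_num_measure.
  - by move=> _; apply: (le_lt_trans (probability_le1 P (measurableI _ _ measurableT mE0))); exact: ltry.
by rewrite setIC key fineK ?fin_num_measure.
Qed.

Lemma decouple (H : T -> T -> \bar R) :
  measurable_fun setT (fun z : TS S * TS S' => H z.1 z.2) ->
  (forall x y, (0 <= H x y)%E) ->
  (\int[P]_w H w w = \int[P]_x \int[P]_y H x y)%E.
Proof.
move=> mH H0.
have mid := @measurable_idS _ _ _ _ F mF S.
have mid' := @measurable_idS _ _ _ _ F mF S'.
pose X := HB.pack_for {mfun T >-> TS S} (idS F S) (isMeasurableFun.Build _ _ _ _ (idS F S) mid).
pose X' := HB.pack_for {mfun T >-> TS S'} (idS F S') (isMeasurableFun.Build _ _ _ _ (idS F S') mid').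
pose m1 : probability (TS S) R := distribution P X.
pose m2 : probability (TS S') R := distribution P X'.
pose f (z : TS S * TS S') := H z.1 z.2.
have mdiag : measurable_fun setT (fun w : T => (idS F S w, idS F S' w)).
  exact: measurable_fun_pair.
have f0 z : (0 <= f z)%E by exact: H0.
transitivity (\int[pushforward P (fun w : T => (idS F S w, idS F S' w))]_z f z)%E.
  by rewrite ge0_integral_pushforward // preimage_setT.
transitivity (\int[(m1 \x m2)%E]_z f z)%E.
  apply: eq_measure_integral => A mA _; apply/esym; apply: product_measure_unique => // B C mB mC.
  by have := TS_indep mB mC.
have push1 (g : TS S -> \bar R) : measurable_fun setT g -> (forall x, (0 <= g x)%E) ->
    (\int[m1]_x g x = \int[P]_x g x)%E.
  move=> mg g0; transitivity (\int[pushforward P (idS F S)]_x g x)%E; first by [].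
  by rewrite ge0_integral_pushforward // preimage_setT.
have push2 (g : TS S' -> \bar R) : measurable_fun setT g -> (forall x, (0 <= g x)%E) ->
    (\int[m2]_x g x = \int[P]_x g x)%E.
  move=> mg g0; transitivity (\int[pushforward P (idS F S')]_x g x)%E; first by [].
  by rewrite ge0_integral_pushforward // preimage_setT.
have e x : (\int[m2]_y f (x, y) = \int[P]_y H x y)%E.
  by rewrite push2 //; apply: measurableT_comp => //; exact: measurable_pair1.
have mf2 : measurable_fun setT (fubini_F m2 f).
  by apply: measurable_fun_fubini_tonelli_F.
rewrite fubini_tonelli1 // push1 //; first by apply: eq_integral => x _; exact: e.
by move=> x; exact: integral_ge0.
Qed.

Lemma Ex_mul_indep_ge0 f g : msig S f -> msig S' g -> mom P f -> mom P g ->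
  (forall w, 0 <= f w) -> (forall w, 0 <= g w) ->
  Eexp P (fun w => f w * g w) = Eexp P f * Eexp P g.
Proof.
move=> sf sg mf mg f0 g0; apply: EFin_inj; rewrite EFinM !ExE //; last exact: momM.
rewrite (@decouple (fun x y => (f x * g y)%:E)); last first.
  by move=> x y; rewrite lee_fin mulr_ge0.
  apply/measurable_EFinP; apply: measurable_funM.
    exact: (measurableT_comp sf measurable_fst).
  exact: (measurableT_comp sg measurable_snd).
have e x : (\int[P]_y (f x * g y)%:E = (f x)%:E * \int[P]_y (g y)%:E)%E.
  rewrite -ge0_integralZl ?lee_fin //; first by apply/measurable_EFinP; exact: mom_meas mg.
  by move=> y _; rewrite lee_fin.
under eq_integral do rewrite e.
rewrite ge0_integralZr //; first by apply/measurable_EFinP; exact: mom_meas mf.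
  by move=> x _; rewrite lee_fin.
by apply: integral_ge0 => y _; rewrite lee_fin.
Qed.

Lemma Ex_mul_indep f g : msig S f -> msig S' g -> mom P f -> mom P g ->
  Eexp P (fun w => f w * g w) = Eexp P f * Eexp P g.
Proof.
move=> sf sg mf mg.
pose pos (u : T -> R) w := Num.max (u w) 0; pose neg (u : T -> R) w := Num.max (- u w) 0.
have upn (u : T -> R) w : u w = pos u w - neg u w.
  rewrite /pos /neg; case: (lerP (u w) 0) => h.
    by rewrite max_l ?oppr_ge0 // sub0r opprK.
  by rewrite max_r ?oppr_le0 ?(ltW h) // subr0.
have p0 (u : T -> R) w : 0 <= pos u w by rewrite /pos le_max lexx orbT.
have n0 (u : T -> R) w : 0 <= neg u w by rewrite /neg le_max lexx orbT.
have mp u S0 : msig S0 u -> msig S0 (pos u) /\ msig S0 (neg u).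
  move=> mu; split; first exact: measurable_maxr.
  by apply: measurable_maxr => //; exact: measurableT_comp.
have mm u : mom P u -> mom P (pos u) /\ mom P (neg u).
  move=> mu; have mu' := mom_meas mu.
  split; apply: (mom_dom (g := u) (C := 1)) => //; try exact: measurable_maxr.
  - move=> w; rewrite mul1r ger0_norm // /pos ge_max normr_ge0 andbT; exact: ler_norm.
  - by apply: measurable_maxr => //; exact: measurableT_comp.
  - move=> w; rewrite mul1r ger0_norm // /neg ge_max normr_ge0 andbT -normrN; exact: ler_norm.
have [sfp sfn] := mp _ _ sf; have [sgp sgn] := mp _ _ sg.
have [mfp mfn] := mm _ mf; have [mgp mgn] := mm _ mg.
have -> : (fun w => f w * g w) = (fun w => (pos f w * pos g w - pos f w * neg g w) - (neg f w * pos g w - neg f w * neg g w)).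
  by apply/funext => w; rewrite {1}(upn f w) {1}(upn g w); ring.
have ef : Eexp P f = Eexp P (pos f) - Eexp P (neg f) by rewrite -ExB //; congr Eexp; apply/funext => w; exact: upn.
have eg : Eexp P g = Eexp P (pos g) - Eexp P (neg g) by rewrite -ExB //; congr Eexp; apply/funext => w; exact: upn.
rewrite ExB; try (by apply: momB; exact: momM).
rewrite !ExB; try exact: momM.
by rewrite !Ex_mul_indep_ge0 // ef eg; ring.
Qed.

End Decouple.

Lemma msig_mul d (T : measurableType d) (R : realType) (I : finType) (F : I -> T -> R) S f g :
  msig F S f -> msig F S g -> msig F S (fun w => f w * g w).
Proof. exact: measurable_funM. Qed.

Lemma Ex_prod_indep d (T : measurableType d) (R : realType) (P : probability T R)
  (I : finType) (F : I -> T -> R) (J : eqType) (s : seq J) (S : J -> {set I}) (f : J -> T -> R) :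
  mutually_independent P F -> uniq s ->
  (forall a b i, a != b -> i \in S a -> i \notin S b) ->
  (forall j, msig F (S j) (f j)) -> (forall j w, `|f j w| <= 1) ->
  Eexp P (fun w => \prod_(j <- s) f j w) = \prod_(j <- s) Eexp P (f j).
Proof.
move=> hF us dS mf f1.
have mom1 j : mom P (f j) by apply: (@mom_bounded _ _ _ P _ 1) => //; exact: (msig_meas hF.1 (mf j)).
elim: s us => [|j s IH] /=.
  by move=> _; rewrite big_nil; under eq_fun do rewrite big_nil; exact: Ex_cst.
move=> /andP[js us]; rewrite big_cons -IH //.
under eq_fun do rewrite big_cons.
have mS : msig F (\bigcup_(j <- s) S j) (fun w => \prod_(j <- s) f j w).
  elim: s {us js IH} => [|k s IH].
    have -> : (fun w => \prod_(j <- [::]) f j w) = cst 1 by apply/funext => w; rewrite big_nil.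
    exact: measurable_cst.
  have -> : (fun w => \prod_(j <- k :: s) f j w) = (fun w => f k w * \prod_(j <- s) f j w).
    by apply/funext => w; rewrite big_cons.
  rewrite big_cons; apply: msig_mul.
    by apply: msig_sub (mf k); exact: finset.subsetUl.
  by apply: msig_sub IH; exact: finset.subsetUr.
apply: (Ex_mul_indep hF _ (mf j) mS) => //.
  move=> i ij; elim: s js {us IH mS} => [|k s IH]; first by rewrite big_nil finset.in_set0.
  rewrite inE negb_or => /andP[jk js]; rewrite big_cons finset.in_setU negb_or IH // andbT.
  exact: dS jk ij.
apply: (@mom_bounded _ _ _ P _ 1); first exact: (msig_meas hF.1 mS).
move=> w; elim: s {us js IH mS} => [|k s IH]; first by rewrite big_nil normr1.
by rewrite big_cons normrM mulr_ile1.
Qed.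

Import numFieldNormedType.Exports.

(** * Linear algebra *)

Section Sums.
Context {R : realType}.

Lemma cauchy_schwarz_sum (I : finType) (Q : pred I) (a b : I -> R) :
  (\sum_(i | Q i) a i * b i) ^+ 2 <= (\sum_(i | Q i) a i ^+ 2) * (\sum_(i | Q i) b i ^+ 2).
Proof.
set A := \sum_(i | Q i) a i ^+ 2; set B := \sum_(i | Q i) b i ^+ 2; set C := \sum_(i | Q i) a i * b i.
have B0 : 0 <= B by apply: sumr_ge0 => i _; exact: sqr_ge0.
have h (t : R) : 0 <= A - 2 * t * C + t ^+ 2 * B.
  have -> : A - 2 * t * C + t ^+ 2 * B = \sum_(i | Q i) (a i - t * b i) ^+ 2.
    rewrite /A /B /C !mulr_sumr -sumrB -big_split /=; apply: eq_bigr => i _; ring.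
  by apply: sumr_ge0 => i _; exact: sqr_ge0.
have A0 : 0 <= A by apply: sumr_ge0 => i _; exact: sqr_ge0.
case: (eqVneq B 0) => [B00|Bn].
  have C0 : C = 0.
    apply/eqP/negPn/negP => Cn; have := h ((A + 1) / (2 * C)).
    rewrite B00 mulr0 addr0.
    have -> : 2 * ((A + 1) / (2 * C)) * C = A + 1 by field.
    by lra.
  by rewrite C0 B00 mulr0 expr0n.
have := h (C / B); have Bp : 0 < B by rewrite lt_neqAle eq_sym Bn.
have -> : A - 2 * (C / B) * C + (C / B) ^+ 2 * B = (A * B - C ^+ 2) / B by field.
by rewrite pmulr_lge0 ?invr_gt0 // subr_ge0.
Qed.

Lemma sqr_sum_le (I : finType) (a : I -> R) :
  (\sum_i a i) ^+ 2 <= #|I|%:R * \sum_i a i ^+ 2.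
Proof.
have := cauchy_schwarz_sum xpredT a (fun=> 1).
under eq_bigr do rewrite mulr1; under [X in _ * X]eq_bigr do rewrite expr1n.
by rewrite sumr_const mulrC -mulr_natl mulr1.
Qed.

Definition dot {k} (u v : 'cV[R]_k) : R := \sum_i u i 0 * v i 0.
Definition nsq {k} (v : 'cV[R]_k) : R := \sum_i v i 0 ^+ 2.
Definition fsq {a b} (A : 'M[R]_(a, b)) : R := \sum_i \sum_j A i j ^+ 2.

Lemma nsq_ge0 k (v : 'cV[R]_k) : 0 <= nsq v.
Proof. by apply: sumr_ge0 => i _; exact: sqr_ge0. Qed.

Lemma fsq_ge0 a b (A : 'M[R]_(a, b)) : 0 <= fsq A.
Proof. by apply: sumr_ge0 => i _; apply: sumr_ge0 => j _; exact: sqr_ge0. Qed.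

Lemma dotvv k (v : 'cV[R]_k) : dot v v = nsq v.
Proof. by apply: eq_bigr => i _; rewrite expr2. Qed.

Lemma dotC k (u v : 'cV[R]_k) : dot u v = dot v u.
Proof. by apply: eq_bigr => i _; rewrite mulrC. Qed.

Lemma dotDr k (u v w : 'cV[R]_k) : dot u (v + w) = dot u v + dot u w.
Proof. by rewrite -big_split; apply: eq_bigr => i _; rewrite mxE mulrDr. Qed.

Lemma dotZr k c (u v : 'cV[R]_k) : dot u (c *: v) = c * dot u v.
Proof. by rewrite mulr_sumr; apply: eq_bigr => i _; rewrite mxE mulrCA. Qed.

Lemma dotDl k (u v w : 'cV[R]_k) : dot (u + v) w = dot u w + dot v w.
Proof. by rewrite dotC dotDr !(dotC w). Qed.

Lemma dotZl k c (u v : 'cV[R]_k) : dot (c *: u) v = c * dot u v.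
Proof. by rewrite dotC dotZr dotC. Qed.

Lemma dotNr k (u v : 'cV[R]_k) : dot u (- v) = - dot u v.
Proof. by rewrite -scaleN1r dotZr mulN1r. Qed.

Lemma dotBr k (u v w : 'cV[R]_k) : dot u (v - w) = dot u v - dot u w.
Proof. by rewrite dotDr dotNr. Qed.

Lemma dotBl k (u v w : 'cV[R]_k) : dot (u - v) w = dot u w - dot v w.
Proof. by rewrite dotC dotBr !(dotC w). Qed.

Lemma dot_sumr k (I : Type) (s : seq I) (Q : pred I) (u : 'cV[R]_k) (f : I -> 'cV[R]_k) :
  dot u (\sum_(i <- s | Q i) f i) = \sum_(i <- s | Q i) dot u (f i).
Proof.
rewrite exchange_big /=; apply: eq_bigr => i _.
by rewrite summxE mulr_sumr.
Qed.

Lemma dotE k (u v : 'cV[R]_k) : dot u v = (u^T *m v) 0 0.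
Proof. by rewrite mxE; apply: eq_bigr => i _; rewrite mxE. Qed.

Lemma dot_mulmxr a b (u : 'cV[R]_a) (M : 'M[R]_(a, b)) (v : 'cV[R]_b) :
  dot u (M *m v) = dot (M^T *m u) v.
Proof. by rewrite !dotE trmx_mul trmxK mulmxA. Qed.

Lemma cauchy_schwarz k (u v : 'cV[R]_k) : dot u v ^+ 2 <= nsq u * nsq v.
Proof. exact: cauchy_schwarz_sum. Qed.

Lemma nsq_mulmx a b (M : 'M[R]_(a, b)) (v : 'cV[R]_b) : nsq (M *m v) <= fsq M * nsq v.
Proof.
rewrite /nsq /fsq mulr_suml; apply: ler_sum => i _.
by rewrite mxE; exact: cauchy_schwarz_sum.
Qed.

Lemma nsqZ k c (v : 'cV[R]_k) : nsq (c *: v) = c ^+ 2 * nsq v.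
Proof. by rewrite mulr_sumr; apply: eq_bigr => i _; rewrite mxE exprMn. Qed.

Lemma nsqD_le k (u v : 'cV[R]_k) : nsq (u + v) <= 2 * nsq u + 2 * nsq v.
Proof.
rewrite !mulr_sumr -big_split; apply: ler_sum => i _; rewrite mxE /=.
by have := sqr_ge0 (u i 0 - v i 0); rewrite !expr2; nra.
Qed.

Lemma nsqB_le k (u v : 'cV[R]_k) : nsq (u - v) <= 2 * nsq u + 2 * nsq v.
Proof. by rewrite (le_trans (nsqD_le _ _)) // -scaleN1r nsqZ sqrrN expr1n mul1r. Qed.

Lemma fsqD_le a b (M N : 'M[R]_(a, b)) : fsq (M + N) <= 2 * fsq M + 2 * fsq N.
Proof.
rewrite !mulr_sumr -big_split; apply: ler_sum => i _; rewrite !mulr_sumr -big_split; apply: ler_sum => j _ /=.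
rewrite mxE /=; by have := sqr_ge0 (M i j - N i j); rewrite !expr2; nra.
Qed.

Lemma fsqZ a b c (M : 'M[R]_(a, b)) : fsq (c *: M) = c ^+ 2 * fsq M.
Proof.
rewrite mulr_sumr; apply: eq_bigr => i _; rewrite mulr_sumr; apply: eq_bigr => j _.
by rewrite mxE exprMn.
Qed.

Lemma fsq_tr a b (M : 'M[R]_(a, b)) : fsq M^T = fsq M.
Proof. by rewrite /fsq exchange_big; apply: eq_bigr => i _; apply: eq_bigr => j _; rewrite mxE. Qed.

Lemma fsq_col a b (M : 'M[R]_(a, b)) : fsq M = \sum_j nsq (col j M).
Proof. by rewrite /fsq exchange_big; apply: eq_bigr => i _; apply: eq_bigr => j _; rewrite mxE. Qed.

Lemma fsq_mulmx a b c (M : 'M[R]_(a, b)) (N : 'M[R]_(b, c)) : fsq (M *m N) <= fsq M * fsq N.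
Proof.
rewrite fsq_col [fsq N]fsq_col mulr_sumr; apply: ler_sum => j _.
by rewrite !colE -mulmxA; exact: nsq_mulmx.
Qed.

Lemma vnorm2_sq k (v : 'cV[R]_k) : vnorm2 v ^+ 2 = nsq v.
Proof. by rewrite /vnorm2 sqr_sqrtr // nsq_ge0. Qed.

End Sums.

Section Rayleigh.
Context {R : realType}.

Lemma quad_min_lin (b c : R) : (forall t, 0 <= t * b + t ^+ 2 * c) -> b = 0.
Proof.
move=> h; have e0 : 0 < `|c| + 1 by rewrite ltr_wpDl.
have := h (- b / (`|c| + 1)).
have -> : - b / (`|c| + 1) * b + (- b / (`|c| + 1)) ^+ 2 * c
  = b ^+ 2 * (c - (`|c| + 1)) / (`|c| + 1) ^+ 2 by field; rewrite gt_eqF.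
rewrite pmulr_lge0 ?invr_gt0 ?exprn_gt0 // => h'.
have : c - (`|c| + 1) < 0 by have := ler_norm c; lra.
move=> hc; apply/eqP; rewrite -sqrf_eq0 eq_le sqr_ge0 andbT.
by rewrite leNgt; apply/negP => hb; move: h'; rewrite pmulr_rge0 // leNgt hc.
Qed.

Lemma rayleigh_min n (S : 'M[R]_n.+1) : S^T = S ->
  exists2 a, eigenvalue S a & forall v : 'cV[R]_n.+1, a * nsq v <= dot v (S *m v).
Proof.
move=> sS.
pose f (v : 'rV[R]_n.+1) : R := \sum_i \sum_j v 0 i * S i j * v 0 j.
pose A : set 'rV[R]_n.+1 := [set v | \sum_i v 0 i ^+ 2 = 1].
have cco i : continuous (fun v : 'rV[R]_n.+1 => v 0 i) by exact: coord_continuous.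
have csum (I : finType) (g : I -> 'rV[R]_n.+1 -> R) : (forall i, continuous (g i)) ->
    continuous (fun v => \sum_i g i v).
  move=> h; elim: (index_enum I) => [|i s IH].
    rewrite (_ : (fun v => _) = (fun=> 0)); last by apply/funext => v; rewrite big_nil.
    exact: (@cst_continuous 'rV[R]_n.+1 R 0).
  rewrite (_ : (fun v => _) = (fun v => g i v + \sum_(j <- s) g j v)); last by apply/funext => v; rewrite big_cons.
  by move=> v; exact: (continuousD (h i v) (IH v)).
have cf : continuous f.
  apply: (csum 'I_n.+1) => i; apply: (csum 'I_n.+1) => j v.
  exact: (continuousM (continuousM (cco i v) (@cst_continuous 'rV[R]_n.+1 R (S i j) v)) (cco j v)).
have cq : continuous (fun v : 'rV[R]_n.+1 => \sum_i v 0 i ^+ 2).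
  by apply: (csum 'I_n.+1) => i v; exact: (continuousM (cco i v) (cco i v)).
have A0 : A !=set0.
  exists (\row_j (j == 0)%:R); rewrite /A /= (bigD1 0) //= !mxE eqxx expr1n big1 ?addr0 //.
  by move=> i /negbTE i0; rewrite mxE i0 expr0n.
have cA : compact A.
  apply: bounded_closed_compact.
    exists 1; split; first exact: num_real.
    move=> M M1 v Av; apply: (le_trans _ (ltW M1)).
    rewrite /Num.norm /= mx_normrE; apply: bigmax_le => // -[i j] _ /=.
    rewrite (ord1 i) -(@ler_pXn2r _ 2) ?nnegrE // expr1n -Av real_normK ?num_real //.
    rewrite (bigD1 j) //= lerDl; apply: sumr_ge0 => k _; exact: sqr_ge0.
  have -> : A = (fun v : 'rV[R]_n.+1 => \sum_i v 0 i ^+ 2) @^-1` [set 1] by [].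
  by apply: preimage_closed => //; exact: closed_eq.
have [v0 Av0 fmin] := EVT_min_rV A0 cA (@continuous_subspaceT _ _ A f cf).
pose a := f v0.
have fge (v : 'rV[R]_n.+1) : a * (\sum_i v 0 i ^+ 2) <= f v.
  set s := \sum_i v 0 i ^+ 2; have s0 : 0 <= s by apply: sumr_ge0 => i _; exact: sqr_ge0.
  case: (eqVneq s 0) => [s00|sn].
    rewrite s00 mulr0 /f big1 // => i _; rewrite big1 // => j _.
    have : v 0 i ^+ 2 == 0.
      move/eqP: s00; rewrite psumr_eq0; last by move=> *; exact: sqr_ge0.
      by move=> /allP /(_ i); rewrite mem_index_enum => /(_ isT).
    by rewrite sqrf_eq0 => /eqP ->; rewrite !mul0r.
  have sp : 0 < s by rewrite lt_neqAle eq_sym sn.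
  have sqp : 0 < Num.sqrt s by rewrite sqrtr_gt0.
  have : A ((Num.sqrt s)^-1 *: v).
    rewrite /A /=; under eq_bigr do rewrite mxE exprMn.
    by rewrite -mulr_sumr exprVn sqr_sqrtr // mulVf.
  move=> /mem_set /fmin; rewrite -/a.
  have -> : f ((Num.sqrt s)^-1 *: v) = f v / s.
    rewrite /f mulr_suml; apply: eq_bigr => i _; rewrite mulr_suml; apply: eq_bigr => j _.
    rewrite !mxE -[in RHS](sqr_sqrtr s0); field; by rewrite gt_eqF.
  by rewrite ler_pdivlMr.
have v0E : \sum_i v0 0 i ^+ 2 = 1 by move: Av0; rewrite inE.
exists a; last first.
  move=> v; have := fge v^T; rewrite /nsq /dot /f.
  under eq_bigr do rewrite mxE.
  move=> h; apply: (le_trans h); rewrite le_eqVlt; apply/orP; left; apply/eqP.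
  apply: eq_bigr => i _; rewrite !mxE mulr_sumr; apply: eq_bigr => j _; rewrite !mxE; ring.
apply/eigenvalueP; exists v0; last first.
  apply/eqP => v00; move: v0E; rewrite v00 big1 => [/eqP|i _]; first by rewrite eq_sym oner_eq0.
  by rewrite mxE expr0n.
apply/rowP => k; rewrite !mxE.
pose w : 'rV[R]_n.+1 := \row_j (j == k)%:R.
have fD t : f (v0 + t *: w) = f v0 + t * (2 * \sum_j v0 0 j * S j k) + t ^+ 2 * S k k.
  have wE i : w 0 i = (i == k)%:R by rewrite mxE.
  pose g (x y : 'rV[R]_n.+1) := \sum_i \sum_j x 0 i * S i j * y 0 j.
  have gD x y : f (x + t *: y) = f x + t * (g x y + g y x) + t ^+ 2 * f y.
    rewrite /f /g mulrDr !mulr_sumr -!big_split; apply: eq_bigr => i _ /=.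
    rewrite !mulr_sumr -!big_split; apply: eq_bigr => j _ /=.
    rewrite !mxE; ring.
  rewrite gD; congr (_ + _ * _ + _ * _).
  - have g1 : g v0 w = \sum_j v0 0 j * S j k.
      apply: eq_bigr => i _; rewrite (bigD1 k) //= wE eqxx mulr1 big1 ?addr0 //.
      by move=> j /negbTE jk; rewrite wE jk mulr0.
    have g2 : g w v0 = \sum_j v0 0 j * S j k.
      rewrite /g exchange_big; apply: eq_bigr => j _; rewrite (bigD1 k) //= wE eqxx mul1r big1 ?addr0.
        by rewrite -[in LHS]sS mxE mulrC.
      by move=> i /negbTE ik; rewrite wE ik !mul0r.
    by rewrite g1 g2 mulr2n mulrDl mul1r.
  - rewrite /f (bigD1 k) //= (bigD1 k) //= wE eqxx mul1r mulr1 big1 ?addr0.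
      rewrite big1 ?addr0 // => i /negbTE ik; rewrite big1 // => j _; by rewrite wE ik !mul0r.
    by move=> j /negbTE jk; rewrite wE jk mulr0.
have qD t : \sum_i (v0 + t *: w) 0 i ^+ 2 = 1 + t * (2 * v0 0 k) + t ^+ 2.
  have := v0E; rewrite (bigD1 k) //= [in X in _ -> X](bigD1 k) //= !mxE eqxx.
  rewrite [in X in _ -> X](eq_bigr (fun i => v0 0 i ^+ 2)); last by move=> i /negbTE ik; rewrite !mxE ik mulr0 addr0.
  move=> e; rewrite mulr1; nra.
have := @quad_min_lin (2 * (\sum_j v0 0 j * S j k) - a * (2 * v0 0 k)) (S k k - a).
move=> /(_ _) h; have : 2 * (\sum_j v0 0 j * S j k) - a * (2 * v0 0 k) = 0.
  apply: h => t; have := fge (v0 + t *: w); rewrite fD qD -/a; lra.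
by move=> e; lra.
Qed.

Lemma sym_form_bounds n (S : 'M[R]_n) lo hi : S^T = S ->
  (forall a, eigenvalue S a -> lo <= a <= hi) ->
  forall v : 'cV[R]_n, lo * nsq v <= dot v (S *m v) <= hi * nsq v.
Proof.
case: n S => [S _ _ v|n S sS hS v]; first by rewrite /nsq /dot !big_ord0 !mulr0 lexx.
have [a /hS /andP[la _] ha] := rayleigh_min sS.
have sN : (- S)^T = - S by rewrite linearN /= sS.
have [b /eigenvalueP[x xS x0] hb] := rayleigh_min sN.
have /hS /andP[_ bh] : eigenvalue S (- b).
  by apply/eigenvalueP; exists x => //; rewrite scaleNr -xS mulmxN opprK.
apply/andP; split; first by apply: le_trans (ha v); rewrite ler_wpM2r ?nsq_ge0.
have := hb v; rewrite mulNmx dotNr => h.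
have : - b * nsq v <= hi * nsq v by rewrite ler_wpM2r ?nsq_ge0.
by lra.
Qed.

End Rayleigh.

Section Unif01.
Context {R : realType}.
Local Notation mu := (@lebesgue_measure R).

Definition unif01 : probability (measurableTypeR R) R := uniform_prob (@ltr01 R).

Lemma unif01_integral (f : R -> \bar R) : measurable_fun setT f -> (forall x, (0 <= f x)%E) ->
  (\int[unif01]_x f x = \int[mu]_(x in `[0%R, 1%R]) f x)%E.
Proof. by move=> mf f0; rewrite integral_uniform // subr0 invr1 mul1e. Qed.

Lemma mom_unif01 (f : R -> R) C : measurable_fun setT f ->
  (forall x, 0 <= x <= 1 -> `|f x| <= C) -> mom unif01 f.
Proof.
move=> mf fC; split=> // k.
rewrite unif01_integral; last 2 first.
- by apply/measurable_EFinP; exact: measurable_funX.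
- by move=> x; rewrite lee_fin even_pow_ge0.
apply: (@le_lt_trans _ _ (\int[mu]_(x in `[0%R, 1%R]) (C ^+ (2 * k))%:E)%E).
  apply: ge0_le_integral => //.
  - by move=> x _; rewrite lee_fin even_pow_ge0.
  - by apply/measurable_EFinP/measurable_funTS; exact: measurable_funX.
  - move=> x; rewrite /= in_itv /= => /fC h; rewrite lee_fin.
    rewrite -[leLHS]ger0_norm ?even_pow_ge0 // normrX lerXn2r ?nnegrE //.
    exact: le_trans (normr_ge0 _) h.
rewrite integral_cst //= lebesgue_measure_itv /= lte_fin ltr01 -EFinD -EFinM; exact: ltry.
Qed.

Lemma measurable_horner (q : {poly R}) : measurable_fun setT (horner q).
Proof. by apply: continuous_measurable_fun; exact: continuous_horner. Qed.

Lemma mom_horner (q : {poly R}) : mom unif01 (horner q).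
Proof.
apply: (@mom_unif01 _ (\sum_(i < size q) `|q`_i|)); first exact: measurable_horner.
move=> x /andP[x0 x1]; rewrite horner_coef; apply: (le_trans (ler_norm_sum _ _ _)); apply: ler_sum => i _.
by rewrite normrM normrX (ger0_norm x0) ler_piMr // exprn_ile1.
Qed.

Lemma poly_roots_seq n (q : {poly R}) : (size q <= n)%N -> q != 0 ->
  exists s : seq R, forall x, q.[x] = 0 -> x \in s.
Proof.
elim: n q => [|n IH] q sq q0; first by move: q0; rewrite -size_poly_eq0 -leqn0 sq.
case: (pselect (exists a, q.[a] = 0)) => [[a qa]|nr]; last first.
  by exists [::] => x qx; exfalso; apply: nr; exists x.
have /factor_theorem[p pE] : root q a by rewrite rootE qa.
have p0 : p != 0 by apply: contraNneq q0 => p0; rewrite pE p0 mul0r.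
have sp : (size p <= n)%N.
  by move: sq; rewrite pE size_Mmonic ?monicXsubC // size_XsubC addn2.
have [s hs] := IH p sp p0.
exists (a :: s) => x; rewrite pE hornerM hornerXsubC => /eqP; rewrite mulf_eq0 inE => /orP[/eqP/hs ->|].
  by rewrite orbT.
by rewrite subr_eq0 => ->.
Qed.

Lemma Ex_horner_sq_gt0 (q : {poly R}) : q != 0 -> 0 < Eexp unif01 (fun x => q.[x] ^+ 2).
Proof.
move=> q0; have mq := momX 2 (mom_horner q).
rewrite lt_neqAle Ex_ge0 ?andbT; last by move=> x; exact: sqr_ge0.
apply/negP => /eqP e0.
have [s hs] := poly_roots_seq (leqnn _) q0.
have : (\int[unif01]_x `|(q.[x] ^+ 2)%:E| = 0)%E.
  transitivity (\int[unif01]_x (q.[x] ^+ 2)%:E)%E; last by rewrite -ExE // -e0.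
  by apply: eq_integral => x _; rewrite gee0_abs // lee_fin sqr_ge0.
have mq' : measurable_fun setT (fun x => (q.[x] ^+ 2)%:E) by apply/measurable_EFinP; exact: mom_meas mq.
move=> /(ae_eq_integral_abs unif01 measurableT mq')[N [mN N0 sub]].
have fs : finite_set [set` s] by exact: finite_seq.
have ms : measurable ([set` s] : set R) by apply: countable_measurable => [x|]; [exact: measurable_set1|exact: (finite_set_countable fs)].
have s0 : unif01 [set` s] = 0%E.
  have /null_content_dominatesP := dominates_uniform_prob (@ltr01 R).
  by apply => //; apply: countable_lebesgue_measure0; exact: finite_set_countable.
have : (unif01 setT <= unif01 N + unif01 [set` s])%E.
  apply: (le_trans _ (measureU2 unif01 mN ms)).
  apply: le_measure; rewrite ?inE //; first exact: measurableU.
  move=> x _; case: (boolP (x \in s)) => xs; [by right|left].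
  apply: sub => /= h; move/(_ I): h => -[] /eqP; rewrite sqrf_eq0 => /eqP /hs.
  by rewrite (negbTE xs).
by rewrite probability_setT N0 s0 adde0 leNgt lte01.
Qed.

Lemma poly_L2_lower n : exists2 c : R, 0 < c & forall q : {poly R}, (size q <= n.+1)%N ->
  c * (\sum_(l < n.+1) q`_l ^+ 2) <= Eexp unif01 (fun x => q.[x] ^+ 2).
Proof.
pose G : 'M[R]_n.+1 := \matrix_(i, j) Eexp unif01 (horner 'X^(i + j)).
have sG : G^T = G by apply/matrixP => i j; rewrite !mxE addnC.
have formE (v : 'cV[R]_n.+1) : dot v (G *m v) = Eexp unif01 (fun x => (\sum_(l < n.+1) v l 0 *: 'X^l).[x] ^+ 2).
  transitivity (Eexp unif01 (fun x => \sum_i \sum_j (v i 0 * v j 0) * ('X^(i + j)).[x])).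
    rewrite Ex_sum; last by move=> i; apply: mom_sum => j; apply: momM; [exact: mom_cst | exact: mom_horner].
    apply: eq_bigr => i _; rewrite Ex_sum; last by move=> j; apply: momM; [exact: mom_cst | exact: mom_horner].
    rewrite mxE mulr_sumr; apply: eq_bigr => j _; rewrite ExZ; last exact: mom_horner.
    by rewrite mxE; ring.
  congr (Eexp _ _); apply/funext => x; rewrite horner_sum expr2 mulr_suml; apply: eq_bigr => i _.
  rewrite mulr_sumr; apply: eq_bigr => j _; rewrite !hornerZ !hornerXn exprD; ring.
have [a /eigenvalueP[x xG x0] ha] := rayleigh_min sG.
have coefv (v : 'cV[R]_n.+1) : (\sum_(l < n.+1) v l 0 *: 'X^l) = \poly_(l < n.+1) (v (inord l) 0).
  by rewrite poly_def; apply: eq_bigr => l _; rewrite inord_val.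
exists a; last first.
  move=> q sq; have := ha (\col_l q`_l); rewrite formE /nsq.
  under eq_bigr do rewrite mxE; move=> h; apply: (le_trans h).
  rewrite le_eqVlt; apply/orP; left; apply/eqP; congr (Eexp _ _); apply/funext => y.
  by rewrite [in RHS](poly_sum_coef sq); congr (_.[_] ^+ _); apply: eq_bigr => l _; rewrite mxE.
have nx : 0 < nsq x^T.
  rewrite lt_neqAle nsq_ge0 andbT; apply: contra x0; rewrite eq_sym psumr_eq0 => [/allP h|i _]; last exact: sqr_ge0.
  apply/eqP/rowP => i; have := h i; rewrite mem_index_enum => /(_ isT); rewrite mxE sqrf_eq0 => /eqP ->.
  by rewrite mxE.
have e : dot x^T (G *m x^T) = a * nsq x^T.
  by rewrite -[G]sG -trmx_mul xG linearZ /= dotZr dotvv.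
have : 0 < dot x^T (G *m x^T).
  rewrite formE; apply: Ex_horner_sq_gt0; apply: contra x0 => /eqP p0.
  apply/eqP/rowP => i; rewrite mxE.
  have := congr1 (fun p : {poly R} => p`_i) p0.
  by rewrite coefv coef_poly ltn_ord coef0 inord_val mxE.
by rewrite e pmulr_lgt0.
Qed.

Lemma poly_piece_integral (q : {poly R}) a l : 0 <= a -> 0 < l -> a + l <= 1 ->
  Eexp unif01 (fun x => q.[x] ^+ 2 * \1_(`[a, a + l[%classic) x)
  = l * Eexp unif01 (fun s => q.[a + l * s] ^+ 2).
Proof.
move=> a0 l0 al1.
have mI : measurable (`[a, a + l[%classic : set R) by exact: measurable_itv.
have mq2 : measurable_fun setT (fun x => q.[x] ^+ 2) by apply: measurable_funX; exact: measurable_horner.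
have mlin : measurable_fun setT (fun s : R => a + l * s).
  by apply: measurable_funD => //; apply: measurable_funM.
have mqs : measurable_fun setT (fun s => q.[a + l * s] ^+ 2).
  by apply: measurable_funX; exact: (measurableT_comp (measurable_horner q) mlin).
pose Q := q \Po (l *: 'X + a%:P).
have QE s : q.[a + l * s] = Q.[s] by rewrite /Q horner_comp hornerD hornerZ hornerX hornerC addrC.
have momQ : mom unif01 (fun s => q.[a + l * s] ^+ 2).
  by under eq_fun do rewrite QE; apply: momX; exact: mom_horner.
apply: EFin_inj; rewrite EFinM !ExE //; last by apply: momM; [apply: momX; exact: mom_horner | exact: mom_indic].
rewrite !unif01_integral; last 4 first.
- by apply/measurable_EFinP.
- by move=> x; rewrite lee_fin sqr_ge0.
- by apply/measurable_EFinP; apply: measurable_funM => //; exact: measurable_indic.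
- by move=> x; rewrite lee_fin mulr_ge0 ?sqr_ge0.
transitivity (\int[mu]_(x in `[a, (a + l)%R[) (q.[x] ^+ 2)%:E)%E.
  rewrite integral_mkcond [RHS]integral_mkcond; apply: eq_integral => x _.
  rewrite !patchE; case: ifPn => h1; case: ifPn => h2; rewrite ?indicE ?h2 ?mulr1 //.
  - by rewrite (negbTE h2) mulr0.
  - exfalso; move: h1; rewrite notin_setE; apply; move: h2; rewrite inE /= !in_itv /= => /andP[x1 x2].
    by rewrite (le_trans a0 x1) (le_trans (ltW x2) al1).
rewrite integral_itv_bndo_bndc; last by apply/measurable_EFinP/measurable_funTS.
pose pF : {poly R} := l *: 'X + a%:P.
have pFE s : pF.[s] = a + l * s by rewrite /pF hornerD hornerZ hornerX hornerC addrC.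
pose F := horner pF.
have F0 : F 0 = a by rewrite /F pFE mulr0 addr0.
have F1 : F 1 = a + l by rewrite /F pFE mulr1.
have F'E : (F^`())%classic = cst l.
  by rewrite /F -derivE; apply/funext => x; rewrite derivD derivZ derivX derivC addr0 alg_polyC hornerC.
have cFc : continuous F by exact: continuous_horner.
have := @integration_by_substitution_increasing R F (fun x => q.[x] ^+ 2) 0 1 ler01.
rewrite F0 F1 => -> //.
- rewrite F'E -ge0_integralZl //.
  + by apply: eq_integral => x _ /=; rewrite -EFinM -pFE; congr _%:E; exact: mulrC.
  + by apply/measurable_EFinP/measurable_funTS.
  + by move=> x _; rewrite lee_fin sqr_ge0.
  + by rewrite lee_fin ltW.
- by move=> x y _ _ xy; rewrite /F !pFE ltrD2l ltr_pM2l.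
- by rewrite F'E => x _; exact: cst_continuous.
- by rewrite F'E; exact: is_cvg_cst.
- by rewrite F'E; exact: is_cvg_cst.
- split; first by move=> x _; exact: derivable_horner.
  + exact: cvg_at_right_filter (cFc 0).
  + exact: cvg_at_left_filter (cFc 1).
- apply: continuous_subspaceT => x.
  have -> : (fun x : R => q.[x] ^+ 2) = horner (q ^+ 2) by apply/funext => y; rewrite horner_exp.
  exact: continuous_horner.
Qed.

End Unif01.

Section Stability.
Context {R : realType}.

Lemma sum_pieces_ge (m K : nat) (f : nat -> R) : (0 < m)%N -> (0 < K)%N -> (forall k, 0 <= f k) ->
  \sum_(k < nbasis m K) f k <= \sum_(j < K) \sum_(a < m) f (j + a)%N.
Proof.
move=> m0 K0 f0; rewrite exchange_big /= /nbasis big_split_ord /=.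
case: m m0 => // m _ /=; rewrite big_ord_recl /=; apply: lerD.
  by apply: ler_sum => j _; rewrite addn0.
apply: ler_sum => a _; have KK : (K.-1 < K)%N by lia.
rewrite (bigD1 (Ordinal KK)) //=.
have -> : (K + a)%N = (K.-1 + bump 0 a)%N by rewrite /bump /=; lia.
by rewrite lerDl; apply: sumr_ge0.
Qed.

Lemma size_sum_scale (I : Type) (s : seq I) (a : I -> R) (p : I -> {poly R}) n :
  (forall i, (size (p i) <= n)%N) -> (size (\sum_(i <- s) a i *: p i)%R <= n)%N.
Proof.
move=> h; apply: (big_ind (fun q : {poly R} => (size q <= n)%N)); first by rewrite size_poly0.
  by move=> x y hx hy; apply: (leq_trans (size_polyD _ _)); rewrite geq_max hx.
by move=> i _; apply: (leq_trans (size_scale_leq _ _)).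
Qed.

Lemma mom_Bstar (P : probability (measurableTypeR R) R) m K xi k : (0 < m)%N -> interior_knots K xi ->
  mom P (fun u => Bstar m K xi u k 0).
Proof.
move=> m0 hxi; apply: (@mom_bounded _ _ _ _ _ 1).
  by under eq_fun do rewrite mxE; exact: measurable_bspline.
by move=> u; rewrite ger0_norm ?(Bstar_ge0 m0 hxi) // (Bstar_le1 m0 hxi).
Qed.

Lemma spline_stability_nat m (Cq : R) : (0 < m)%N -> 1 <= Cq ->
  exists2 c0 : R, 0 < c0 & forall K xi, interior_knots K xi -> quasi_uniform Cq K xi ->
  forall c : nat -> R, c0 * \sum_(k < nbasis m K) c k ^+ 2
    <= K%:R * Eexp unif01 (fun u => (\sum_(k < nbasis m K) c k * Bstar m K xi u k 0) ^+ 2).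
Proof.
move=> m0 C1.
have [c1 c10 hc1] := @poly_L2_lower R m.-1.
have C0 : 0 < Cq by apply: lt_le_trans C1.
pose rho := m%:R * Cq ^+ 2; have rho1 : 1 <= rho.
  by rewrite -[1]mulr1 ler_pM // ?ler1n // exprn_ege1.
have rho0 : 0 <= rho by apply: le_trans rho1.
pose Amp := m%:R * (m`!%:R * rho ^+ m).
have mR : 0 < m%:R :> R by rewrite ltr0n.
have Amp0 : 0 < Amp by rewrite !mulr_gt0 // ?ltr0n ?fact_gt0 // exprn_gt0 // (lt_le_trans _ rho1).
pose A := Amp ^+ 2 * m%:R / c1.
have A0 : 0 < A by apply: divr_gt0 => //; apply: mulr_gt0 => //; exact: exprn_gt0.
exists (m%:R * A * Cq)^-1; first by rewrite invr_gt0; apply: mulr_gt0 => //; exact: mulr_gt0.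
move=> K xi hxi hq c.
have K0 := interior_knots_K_gt0 hxi; have KR : 0 < K%:R :> R by rewrite ltr0n.
set L := nbasis m K; set tau := ext_knots m K xi.
pose g u := \sum_(k < L) c k * Bstar m K xi u k 0.
have mg : mom unif01 g by apply: mom_sum => k; apply: momM; [exact: mom_cst | exact: mom_Bstar].
pose len j := xi j.+1 - xi j.
pose I1 (j : nat) (x : R) : R := \1_(`[xi j, xi j + len j[%classic) x.
have momI j : mom unif01 (I1 j) by apply: mom_indic; exact: measurable_itv.
have piece (j : 'I_K) a : (a < m)%N ->
    c (j + a)%N ^+ 2 <= A * Cq * K%:R * Eexp unif01 (fun x => g x ^+ 2 * I1 j x).
  move=> am; have jK := ltn_ord j; set i := (m.-1 + j)%N.
  have len0 : 0 < len j by rewrite subr_gt0 (xi_lt hxi).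
  have th := ext_knots_homo m0 hxi; have ti := ext_knots_lt_mid m0 hxi jK.
  pose q : {poly R} := \sum_(0 <= k < i.+1) c k *: bspP tau i m.-1 k.
  have sq : (size q <= m.-1.+1)%N by apply: size_sum_scale => k; exact: size_bspP.
  have gq x : in_piece K xi j x -> g x = q.[x].
    move=> jx; rewrite /g; under eq_bigr => k _ do rewrite (Bstar_piece m0 hxi _ jK jx).
    rewrite (@sum_basis_piece m K m0 _ (fun k => c k * (bspP tau i m.-1 k).[x]) j) //.
      by rewrite /q horner_sum; apply: eq_bigr => k _; rewrite hornerZ.
    by move=> k h; rewrite bspP_out ?horner0 ?mulr0 // h.
  have e1 : Eexp unif01 (fun x => g x ^+ 2 * I1 j x) = len j * Eexp unif01 (fun s => q.[xi j + len j * s] ^+ 2).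
    have /andP[xi0 _] := xi_bound hxi (ltnW jK).
    rewrite -poly_piece_integral //; last by rewrite addrC subrK; have /andP[] := xi_bound hxi jK.
    congr (Eexp _ _); apply/funext => x; rewrite /I1 indicE; case: (boolP (x \in _)) => h; last by rewrite !mulr0.
    rewrite gq //; move: h; rewrite inE /= in_itv /= addrC subrK => h.
    by rewrite /in_piece h.
  set k := (j + a)%N; have [ki kj] : (k <= i)%N /\ (i <= k + m.-1)%N by rewrite /k /i; clear -am; lia.
  have dual : dbf tau k m.-1 q = c k by apply: dbf_dual => //; rewrite leq_addr.
  pose H := m%:R * (Cq / K%:R).
  have H0 : 0 <= H by rewrite mulr_ge0 // divr_ge0 // ltW.
  have Hlen : H <= rho * len j.
    have := knot_gap_ge hxi hq jK; rewrite -/(len j) => hl.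
    rewrite /H /rho -mulrA ler_wpM2l // expr2 -mulrA ler_wpM2l ?(ltW C0) //.
    move: hl; rewrite invfM mulrC ler_pdivrMr //; by rewrite mulrC.
  have bnd : `|c k| <= m.-1.+1%:R * \sum_(l < m.-1.+1) `|(derivn l q).[xi j]| * H ^+ l.
    rewrite -dual; apply: dbf_bound => // l hl.
    apply: (@ext_knots_dist_sym _ m K xi m0 hxi Cq hq k l m (xi j)); first by clear -hl; lia.
    rewrite -(ext_knots_mid m0 hxi (ltnW jK)); apply/andP; split; apply: th; clear -ki kj m0; rewrite -/i; lia.
  pose Q : {poly R} := \poly_(l < m.-1.+1) ((nderivn l q).[xi j] * len j ^+ l).
  have QE s : Q.[s] = q.[xi j + len j * s].
    rewrite (nderiv_taylor_wide _ sq) ?horner_poly; last exact: mulrC.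
    by apply: eq_bigr => l _; rewrite exprMn mulrA.
  have sQ : (size Q <= m.-1.+1)%N by exact: size_poly.
  have bnd2 : `|c k| <= Amp * \sum_(l < m.-1.+1) `|Q`_l|.
    apply: (le_trans bnd); rewrite /Amp prednK // -mulrA ler_wpM2l ?ler0n // mulr_sumr; apply: ler_sum => l _.
    rewrite coef_poly prednK // ltn_ord nderivn_def hornerMn normrMn normrM (ger0_norm (exprn_ge0 _ (ltW len0))).
    have lm : (l <= m)%N by rewrite ltnW.
    set nq := `|_|; apply: (@le_trans _ _ (nq * (m`!%:R * (rho ^+ m * len j ^+ l)))); last first.
      by rewrite le_eqVlt; apply/orP; left; apply/eqP; ring.
    have -> : nq *+ l`! * H ^+ l = nq * (l`!%:R * H ^+ l) by rewrite -[nq *+ _]mulr_natr mulrA.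
    rewrite ler_wpM2l ?normr_ge0 //; apply: ler_pM => //; first by rewrite exprn_ge0.
      by rewrite ler_nat leq_fact.
    apply: (@le_trans _ _ ((rho * len j) ^+ l)); first by rewrite lerXn2r ?nnegrE // mulr_ge0 // ltW.
    by rewrite exprMn ler_wpM2r ?exprn_ge0 ?(ltW len0) // ler_weXn2l.
  have : c k ^+ 2 <= A * Eexp unif01 (fun s => q.[xi j + len j * s] ^+ 2).
    have := hc1 _ sQ; rewrite (_ : (fun x : measurableTypeR R => Q.[x] ^+ 2) = (fun s => q.[xi j + len j * s] ^+ 2)); last by apply/funext => s; rewrite QE.
    set X := Eexp _ _ => hX.
    have : (\sum_(l < m.-1.+1) `|Q`_l|) ^+ 2 <= m%:R * \sum_(l < m.-1.+1) Q`_l ^+ 2.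
      have := sqr_sum_le (fun l : 'I_m.-1.+1 => `|Q`_l|); rewrite card_ord prednK //.
      by under [X in _ <= _ * X -> _]eq_bigr do rewrite real_normK ?num_real //.
    set S1 := \sum_(l < _) `|_|; set S2 := \sum_(l < _) _ ^+ 2 => h2.
    have : c k ^+ 2 <= Amp ^+ 2 * S1 ^+ 2.
      rewrite -exprMn -[leLHS]real_normK ?num_real // lerXn2r ?nnegrE // mulr_ge0 ?(ltW Amp0) //.
      by apply: sumr_ge0.
    move=> h3; apply: (le_trans h3).
    have -> : A * X = Amp ^+ 2 * (m%:R * (X / c1)) by rewrite /A; move: (Amp ^+ 2) => Z; ring.
    rewrite ler_wpM2l ?sqr_ge0 //; apply: (le_trans h2); rewrite ler_wpM2l // ler_pdivlMr // mulrC; exact: hX.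
  move=> h; rewrite e1; apply: (le_trans h); set X := Eexp _ _.
  have X0 : 0 <= X by apply: Ex_ge0 => s; exact: sqr_ge0.
  have -> : A * Cq * K%:R * (len j * X) = A * ((Cq * K%:R * len j) * X) by ring.
  rewrite ler_wpM2l ?(ltW A0) // ler_peMl //.
  have := knot_gap_ge hxi hq jK; rewrite -/(len j) => hl.
  by rewrite [leRHS]mulrC -ler_pdivrMr ?mulr_gt0 // div1r.
have gt_c : 0 < m%:R * A * Cq by apply: mulr_gt0 => //; exact: mulr_gt0.
rewrite mulrC ler_pdivrMr //.
apply: (le_trans (@sum_pieces_ge m K (fun k => c k ^+ 2) m0 K0 (fun k => sqr_ge0 _))).
apply: (@le_trans _ _ (\sum_(j < K) m%:R * (A * Cq * K%:R * Eexp unif01 (fun x => g x ^+ 2 * I1 j x)))).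
  apply: ler_sum => j _; rewrite mulr_natl -[X in _ *+ X](card_ord m) -sumr_const; apply: ler_sum => a _.
  exact: piece.
rewrite -mulr_sumr -mulr_sumr -Ex_sum; last by move=> j; apply: momM => //; exact: momX.
have : Eexp unif01 (fun w => \sum_(j < K) g w ^+ 2 * I1 j w) <= Eexp unif01 (fun u => g u ^+ 2).
  apply: Ex_le; first by apply: mom_sum => j; apply: momM => //; exact: momX.
    exact: momX.
  move=> x; rewrite -mulr_sumr ler_piMr ?sqr_ge0 //.
  case: (boolP [exists j : 'I_K, x \in `[xi j, xi j.+1[%classic]) => [/existsP[j xj]|/existsPn h]; last first.
    rewrite big1 ?ler01 // => j _; rewrite /I1 indicE /len addrC subrK.
    by have := h j => /negbTE ->.
  rewrite (bigD1 j) //= big1 ?addr0; first by rewrite /I1 indicE; case: (_ \in _).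
  move=> k kj; rewrite /I1 indicE /len addrC subrK.
  case: (boolP (x \in _)) => // xk; exfalso; move: xj xk; rewrite !inE /= !in_itv /= => /andP[j1 j2] /andP[k1 k2].
  move: kj; rewrite neq_ltn => /orP[lt|lt].
    by have := xi_le hxi lt (ltnW (ltn_ord j)); lra.
  by have := xi_le hxi lt (ltnW (ltn_ord k)); lra.
set E1 := Eexp _ _; set E2 := Eexp _ _ => hE.
apply: (@le_trans _ _ (m%:R * (A * Cq * K%:R * E2))).
  apply: ler_wpM2l => //; apply: ler_wpM2l => //; apply: mulr_ge0; last exact: ltW.
  by apply: mulr_ge0; exact: ltW.
by rewrite le_eqVlt; apply/orP; left; apply/eqP; ring.
Qed.

Lemma dot_BvecE m K xi (c : 'cV[R]_(nbasis m K)) u :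
  dot c (Bvec m K xi u) = Num.sqrt (nbasis m K)%:R * \sum_k c k 0 * Bstar m K xi u k 0.
Proof. by rewrite /Bvec dotZr. Qed.

Lemma spline_stability m (Cq : R) : (0 < m)%N ->
  exists2 c0 : R, 0 < c0 & forall K xi, interior_knots K xi -> quasi_uniform Cq K xi ->
  forall c : 'cV[R]_(nbasis m K), c0 * nsq c <= Eexp unif01 (fun u => dot c (Bvec m K xi u) ^+ 2).
Proof.
move=> m0; case: (lerP 1 Cq) => C1; last first.
  by exists 1 => // K xi hxi hq; have := quasi_uniform_ge1 hxi hq; rewrite leNgt C1.
have [c0 c00 hc] := spline_stability_nat m0 C1; exists c0 => // K xi hxi hq c.
pose cn k := if insub k is Some o then c o 0 else 0.
have cnE (k : 'I_(nbasis m K)) : cn k = c k 0 by rewrite /cn valK.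
have := hc K xi hxi hq cn; rewrite /nsq.
under eq_bigr do rewrite cnE; move=> h; apply: (le_trans h).
have mB : mom unif01 (fun u => (\sum_(k < nbasis m K) c k 0 * Bstar m K xi u k 0) ^+ 2).
  by apply: momX; apply: mom_sum => k; apply: momM; [exact: mom_cst | exact: mom_Bstar].
have -> : (fun u => dot c (Bvec m K xi u) ^+ 2) = (fun u => (nbasis m K)%:R * (\sum_(k < nbasis m K) c k 0 * Bstar m K xi u k 0) ^+ 2).
  by apply/funext => u; rewrite dot_BvecE exprMn sqr_sqrtr.
rewrite ExZ //.
have -> : (fun u => (\sum_(k < nbasis m K) cn k * Bstar m K xi u k 0) ^+ 2) = (fun u => (\sum_(k < nbasis m K) c k 0 * Bstar m K xi u k 0) ^+ 2).
  by apply/funext => u; congr (_ ^+ 2); apply: eq_bigr => k _; rewrite cnE.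
apply: ler_wpM2r; first by apply: Ex_ge0 => u; exact: sqr_ge0.
by rewrite ler_nat /nbasis leq_addr.
Qed.

End Stability.

Section Approx.
Context {R : realType}.

Definition tayP (a : R) (t : nat) (g : nat -> R) : {poly R} :=
  \sum_(i < t.+1) (g i / (i`!)%:R) *: ('X - a%:P) ^+ i.

Lemma size_tayP a t g : (size (tayP a t g) <= t.+1)%N.
Proof.
apply: (big_ind (fun q : {poly R} => (size q <= t.+1)%N)); first by rewrite size_poly0.
  by move=> x y hx hy; apply: (leq_trans (size_polyD _ _)); rewrite geq_max hx.
by move=> i _; apply: (leq_trans (size_scale_leq _ _)); rewrite size_exp_XsubC.
Qed.

Lemma tayP_at a t g : (tayP a t g).[a] = g 0%N.
Proof.
rewrite /tayP horner_sum big_ord_recl /= big1 ?addr0.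
  by rewrite hornerZ expr0 hornerC fact0 divr1 mulr1.
by move=> i _; rewrite hornerZ horner_exp hornerXsubC subrr expr0n /= mulr0.
Qed.

Lemma deriv_tayP a t g : deriv (tayP a t.+1 g) = tayP a t (fun i => g i.+1).
Proof.
rewrite /tayP big_ord_recl /= expr0 derivD alg_polyC derivC add0r raddf_sum /=.
apply: eq_bigr => i _; rewrite /bump /= add1n derivZ deriv_exp derivXsubC mul1r -(scaler_nat i.+1) scalerA; congr (_ *: _).
rewrite factS natrM; have : (i`!)%:R != 0 :> R by rewrite pnatr_eq0 -lt0n fact_gt0.
by have h1 : (i.+1)%:R != 0 :> R by [rewrite pnatr_eq0]; move=> h2; move: (i`!%:R : R) h2 (i.+1%:R : R) h1 => F0 hF S0 hS; field; rewrite hF hS.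
Qed.

Lemma derivn_tayP a t g l : (l <= t)%N -> derivn l (tayP a t g) = tayP a (t - l) (fun i => g (l + i)%N).
Proof.
elim: l => [|l IH] lt; first by rewrite derivn0 subn0.
rewrite derivnS IH ?(ltnW lt) //.
have -> : (t - l)%N = (t - l.+1).+1 by lia.
by rewrite deriv_tayP; congr (tayP _ _ _); apply/funext => i; rewrite addSnnS.
Qed.

Lemma taylor_holder t r Dc Lc f : 0 < r -> holder_class t r Dc Lc f ->
  forall s, (s <= t)%N -> forall x a, 0 <= x <= 1 -> 0 <= a <= 1 ->
  `|derive1n (t - s) f x - (tayP a s (fun i => derive1n (t - s + i) f a)).[x]|
    <= `|Lc| * (`|x - a| `^ (s%:R + r)).
Proof.
move=> r0 [hder [hbd hhol]]; elim=> [|s IH] st x a hx ha.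
  rewrite subn0 add0r /tayP big_ord_recl big_ord0 addr0 expr0 fact0 divr1 alg_polyC hornerC addn0.
  apply: (le_trans (hhol x a hx ha)); rewrite ler_wpM2r ?powR_ge0 //; exact: ler_norm.
set l := (t - s.+1)%N; have lt : (l < t)%N by rewrite /l; lia.
have lS : (t - s)%N = l.+1 by rewrite /l; lia.
pose T1 := tayP a s.+1 (fun i => derive1n (l + i) f a).
pose T0 := tayP a s (fun i => derive1n (l.+1 + i) f a).
pose phi y := derive1n l f y - T1.[y].
pose dphi y := derive1n l.+1 f y - T0.[y].
have phia : phi a = 0 by rewrite /phi /T1 tayP_at addn0 subrr.
have dphiE (y : R) : 0 <= y <= 1 -> is_derive y 1 phi (dphi y).
  move=> hy; apply: is_deriveB.
    by apply: DeriveDef; [exact: hder | rewrite derive1nS derive1E].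
  apply: DeriveDef; first exact: derivable_horner.
  rewrite -derive1E -derivE /T1 deriv_tayP /T0; congr (_.[_]); congr (tayP _ _ _).
  by apply/funext => i; rewrite addSnnS.
have dbound (y : R) : 0 <= y <= 1 -> `|y - a| <= `|x - a| -> `|dphi y| <= `|Lc| * (`|x - a| `^ (s%:R + r)).
  move=> hy yx; have := IH (ltnW st) y a hy ha; rewrite lS => h; apply: (le_trans h).
  rewrite ler_wpM2l // ge0_ler_powR ?nnegrE // addr_ge0 // ltW //.
have fin (D : R) : `|D| <= `|Lc| * (`|x - a| `^ (s%:R + r)) -> phi x = D * (x - a) ->
    `|phi x| <= `|Lc| * (`|x - a| `^ (s.+1%:R + r)).
  move=> hD ->; rewrite normrM.
  have -> : (s.+1%:R + r) = 1 + (s%:R + r) by rewrite -nat1r addrA.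
  case: (eqVneq `|x - a| 0) => [e|e]; first by rewrite e mulr0 mulr_ge0 // powR_ge0.
  rewrite powRD; last by rewrite e implybT.
  by rewrite powRr1 // mulrCA mulrC ler_wpM2l.
move: hx ha => /andP[x0 x1] /andP[a0 a1].
have cont (u v : R) : 0 <= u -> v <= 1 -> {within `[u, v], continuous phi}.
  move=> u0 v1; apply: derivable_within_continuous => y; rewrite in_itv /= => /andP[y0 y1].
  by have [] := dphiE y ltac:(apply/andP; split; lra).
case: (ltgtP x a) => [xa|ax|->].
- have [c] := MVT_segment (ltW xa) (fun y hy => dphiE y ltac:(move: hy; rewrite in_itv /= => /andP[? ?]; apply/andP; split; lra)) (cont x a x0 a1).
  rewrite in_itv /= => /andP[c1 c2]; rewrite phia => e.
  apply: (fin (dphi c)); last by lra.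
  by apply: dbound; [apply/andP; split; lra | rewrite !ler0_norm; lra].
- have [c] := MVT_segment (ltW ax) (fun y hy => dphiE y ltac:(move: hy; rewrite in_itv /= => /andP[? ?]; apply/andP; split; lra)) (cont a x a0 x1).
  rewrite in_itv /= => /andP[c1 c2]; rewrite phia subr0 => e.
  apply: (fin (dphi c)) => //.
  by apply: dbound; [apply/andP; split; lra | rewrite !ger0_norm; lra].
- by rewrite -/(phi a) phia normr0 mulr_ge0 // powR_ge0.
Qed.

Lemma spline_approx m t r (Dc Lc Cq : R) : (t < m)%N -> 0 < r ->
  exists2 C : R, 0 <= C & forall K xi, interior_knots K xi -> quasi_uniform Cq K xi ->
  forall f, holder_class t r Dc Lc f -> exists c : 'cV[R]_(nbasis m K), forall u, 0 <= u <= 1 ->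
  `|f u - dot c (Bvec m K xi u)| <= C * ((nbasis m K)%:R `^ (- (r + t%:R))).
Proof.
move=> tm r0; have m0 : (0 < m)%N by apply: leq_ltn_trans tm.
case: (lerP 1 Cq) => C1; last first.
  by exists 1 => // K xi hxi hq; have := quasi_uniform_ge1 hxi hq; rewrite leNgt C1.
have C0 : 0 < Cq by apply: lt_le_trans C1.
have d0 : 0 <= r + t%:R by rewrite addr_ge0 // ltW.
have mR : 0 < m%:R :> R by rewrite ltr0n.
exists (m%:R * (m%:R * `|Lc|) * ((m%:R * (Cq * m%:R)) `^ (r + t%:R))); first by rewrite !mulr_ge0 ?powR_ge0.
move=> K xi hxi hq f hf.
have K0 := interior_knots_K_gt0 hxi; have KR : 0 < K%:R :> R by rewrite ltr0n.
set L := nbasis m K; have L0 : 0 < L%:R :> R by rewrite ltr0n /L /nbasis; lia.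
set tau := ext_knots m K xi.
pose P a := tayP a t (fun i => derive1n i f a).
exists (\col_(k < L) ((Num.sqrt L%:R)^-1 * dbf tau k m.-1 (P (tau k)))) => u hu.
have sP a : (size (P a) <= m.-1.+1)%N by apply: (leq_trans (size_tayP _ _ _)); lia.
pose H := m%:R * (Cq / K%:R); have H0 : 0 < H by rewrite mulr_gt0 // divr_gt0.
have [j jK ju] := in_piece_exists m0 hxi hu.
have rep : f u = \sum_(k < L) dbf tau k m.-1 (P u) * Bstar m K xi u k 0.
  under eq_bigr => k _ do rewrite (Bstar_piece m0 hxi _ jK ju).
  rewrite (@sum_basis_piece m K m0 _ (fun k => dbf tau k m.-1 (P u) * (bspP tau (m.-1 + j) m.-1 k).[u]) j) //.
    rewrite dbf_reproduce //; last 3 first.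
    - exact: ext_knots_homo.
    - exact: ext_knots_lt_mid.
    - exact: leq_addr.
    by rewrite /P tayP_at.
  by move=> k h; rewrite bspP_out ?horner0 ?mulr0 // h.
have -> : dot (\col_k ((Num.sqrt L%:R)^-1 * dbf tau k m.-1 (P (tau k)))) (Bvec m K xi u)
   = \sum_(k < L) dbf tau k m.-1 (P (tau k)) * Bstar m K xi u k 0.
  rewrite dot_BvecE mulr_sumr; apply: eq_bigr => k _; rewrite mxE mulrA mulrA mulfV ?mul1r //.
  by rewrite gt_eqF // sqrtr_gt0.
rewrite {1}rep -sumrB.
have key (k : 'I_L) : Bstar m K xi u k 0 != 0 ->
    `|dbf tau k m.-1 (P u) - dbf tau k m.-1 (P (tau k))| <= m%:R * (m%:R * `|Lc|) * (H `^ (r + t%:R)).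
  move=> nz; have /andP[ku1 ku2] := Bstar_support m0 hxi nz.
  have -> : dbf tau k m.-1 (P u) - dbf tau k m.-1 (P (tau k)) = dbf tau k m.-1 (P u - P (tau k)).
    have := dbf_linear tau k m.-1 (-1) (P (tau k)) (P u).
    by rewrite scaleN1r mulN1r addrC => ->; rewrite addrC.
  have sD : (size (P u - P (tau k))%R <= m.-1.+1)%N.
    by apply: (leq_trans (size_polyD _ _)); rewrite size_polyN geq_max !sP.
  have := @dbf_bound _ tau k m.-1 _ u H sD (ltW H0).
  move=> /(_ _) h; apply: (le_trans (h _)).
    move=> l hl; apply: (@ext_knots_dist_sym _ m K xi m0 hxi Cq hq k l m u); first by clear -hl; lia.
    by rewrite ku1 ku2.
  rewrite prednK // -!mulrA ler_wpM2l //.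
  have -> : m%:R * (`|Lc| * (H `^ (r + t%:R))) = \sum_(l < m) `|Lc| * (H `^ (r + t%:R)).
    by rewrite sumr_const card_ord mulr_natl.
  apply: ler_sum => l _.
  have hk : 0 <= tau k <= 1 by exact: ext_knots_01.
  rewrite derivnB hornerD hornerN; case: (leqP l t) => lt; last first.
    rewrite !derivn_poly0 ?horner0 ?subr0 ?normr0 ?mul0r ?mulr_ge0 ?powR_ge0 //; exact: (leq_trans (size_tayP _ _ _)).
  rewrite /P !derivn_tayP // tayP_at addn0.
  have := taylor_holder r0 hf (leq_subr l t) hu hk.
  rewrite subKn //.
  move=> hh; apply: (@le_trans _ _ (`|Lc| * (`|u - tau k| `^ ((t - l)%:R + r)) * H ^+ l)).
    by rewrite ler_wpM2r // exprn_ge0 // ltW.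
  rewrite -mulrA ler_wpM2l //.
  have uH : `|u - tau k| <= H.
    rewrite distrC; apply: (@ext_knots_dist_sym _ m K xi m0 hxi Cq hq k k m u); first by clear; lia.
    by rewrite ku1 ku2.
  apply: (@le_trans _ _ (H `^ ((t - l)%:R + r) * H ^+ l)).
    rewrite ler_wpM2r ?exprn_ge0 ?(ltW H0) // ge0_ler_powR ?nnegrE // ?(ltW H0) //.
    by rewrite addr_ge0 // ltW.
  rewrite -powR_mulrn ?(ltW H0) // -powRD; last by apply/implyP => _; rewrite gt_eqF.
  by rewrite natrB // le_eqVlt; apply/orP; left; apply/eqP; congr (_ `^ _); ring.
apply: (le_trans (ler_norm_sum _ _ _)).
apply: (@le_trans _ _ (\sum_(k < L) m%:R * (m%:R * `|Lc|) * (H `^ (r + t%:R)) * Bstar m K xi u k 0)).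
  apply: ler_sum => k _; rewrite -mulrBl normrM (ger0_norm (Bstar_ge0 m0 hxi _ _)).
  case: (eqVneq (Bstar m K xi u k 0) 0) => [->|nz]; first by rewrite !mulr0.
  by rewrite ler_wpM2r ?(Bstar_ge0 m0 hxi) // key.
rewrite -mulr_sumr (Bstar_sum1 m0 hxi hu) mulr1 -[leRHS]mulrA ler_wpM2l ?mulr_ge0 //.
rewrite -[leRHS]mulrC mulrC -[L%:R `^ _]mulr1 powRN.
have -> : (L%:R `^ (r + t%:R))^-1 * 1 = (L%:R^-1) `^ (r + t%:R).
  have -> : (L%:R)^-1 = L%:R `^ (-1) :> R by rewrite powRN powRr1 ?ler0n.
  by rewrite mulr1 -powRrM mulN1r powRN.
rewrite mulrC -powRM ?mulr_ge0 ?(ltW C0) ?invr_ge0 ?ler0n //.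
rewrite ge0_ler_powR ?nnegrE ?mulr_ge0 ?(ltW C0) ?(ltW H0) ?invr_ge0 ?ler0n //.
rewrite mulrC ler_pdivlMr //.
have -> : H * L%:R = (L%:R / K%:R) * (m%:R * Cq) by rewrite /H; field; rewrite gt_eqF.
have -> : m%:R * (Cq * m%:R) = m%:R * (m%:R * Cq) by ring.
rewrite ler_wpM2r ?mulr_ge0 ?(ltW C0) // ler_pdivrMr // -natrM ler_nat /L /nbasis.
clear -m0 K0; nia.
Qed.

End Approx.

Section Density.
Context d (T : measurableType d) (R : realType) (mu nu : {measure set T -> \bar R}) (g : T -> R).
Hypothesis mg : measurable_fun setT g.
Hypothesis g0 : forall x, 0 <= g x.
Hypothesis nuE : forall A, measurable A -> nu A = (\int[mu]_(x in A) (g x)%:E)%E.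
Import HBNNSimple.

Lemma integral_density_nnsfun (h : {nnsfun T >-> R}) :
  (\int[nu]_x (h x)%:E = \int[mu]_x ((h x)%:E * (g x)%:E))%E.
Proof.
under [LHS]eq_integral do rewrite fimfunE -fsumEFin//.
rewrite [LHS]ge0_integral_fsum//; last 2 first.
  - by move=> r; exact/measurable_EFinP/measurableT_comp.
  - by move=> n x _; rewrite EFinM nnfun_muleindic_ge0.
under [RHS]eq_integral.
  move=> x xD; rewrite fimfunE -fsumEFin// ge0_mule_fsuml; last first.
    by move=> r; rewrite EFinM nnfun_muleindic_ge0.
  over.
rewrite [RHS]ge0_integral_fsum//; last 2 first.
  - move=> r; apply: emeasurable_funM; first by exact/measurable_EFinP/measurableT_comp.
    exact/measurable_EFinP.
  - by move=> n x _; apply: mule_ge0; [by rewrite EFinM nnfun_muleindic_ge0 | by rewrite lee_fin].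
apply: eq_fsbigr => r /set_mem [x0 _ hr].
have r0 : 0 <= r by rewrite -hr.
have mA : measurable (h @^-1` [set r]) by rewrite -[X in measurable X]setTI; apply: measurable_funP.
rewrite integralZl_indic_nnsfun //= integral_indic // setIT nuE //.
under [RHS]eq_integral do rewrite EFinM -muleA.
rewrite ge0_integralZl //; last 2 first.
  - by apply: emeasurable_funM; apply/measurable_EFinP.
  - by move=> x _; rewrite mule_ge0 // lee_fin.
congr (_ * _)%E; rewrite [LHS]integral_mkcond; apply: eq_integral => x _.
by rewrite patchE indicE; case: ifPn => _; rewrite ?mul1e ?mul0e.
Qed.

Lemma ge0_integral_density (f : T -> \bar R) : measurable_fun setT f -> (forall x, (0 <= f x)%E) ->
  (\int[nu]_x f x = \int[mu]_x (f x * (g x)%:E))%E.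
Proof.
move=> mf f0; pose f_ := nnsfun_approx measurableT mf.
transitivity (lim (\int[nu]_x (f_ n x)%:E @[n --> \oo])%E).
  rewrite -monotone_convergence//=.
  - apply: eq_integral => ? /[!inE] xD; apply/esym/cvg_lim => //=.
    exact: cvg_nnsfun_approx.
  - by move=> n; exact/measurable_EFinP/measurable_funTS.
  - by move=> n ? _; rewrite lee_fin.
  - by move=> ? _ ? ? mn; rewrite lee_fin; exact/lefP/nd_nnsfun_approx.
under eq_fun do rewrite integral_density_nnsfun.
rewrite -monotone_convergence//=.
- apply: eq_integral => x /[!inE] xD; apply/cvg_lim => //=.
  under eq_fun do rewrite muleC; rewrite muleC; apply: cvgeZl => //.
  exact: cvg_nnsfun_approx.
- by move=> n; apply: emeasurable_funM; exact/measurable_EFinP.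
- by move=> n x _; rewrite mule_ge0 // lee_fin.
- move=> x _ a b ab; rewrite lee_wpmul2r ?lee_fin //.
  exact/lefP/nd_nnsfun_approx.
Qed.

End Density.

Section GaussMoments.
Context {R : realType}.
Local Notation mu := (@lebesgue_measure R).

Definition N01 : probability (measurableTypeR R) R := normal_prob 0 1.

Lemma N01_integral (f : R -> \bar R) : measurable_fun setT f -> (forall x, (0 <= f x)%E) ->
  (\int[N01]_x f x = \int[mu]_x (f x * (normal_pdf 0 1 x)%:E))%E.
Proof.
move=> mf f0; apply: ge0_integral_density => //.
- exact: measurable_normal_pdf.
- by move=> x; exact: normal_pdf_ge0.
Qed.

Lemma measurable_quad (al be ga : R) : measurable_fun setT (fun w : R => - (al * w ^+ 2 + be * w + ga)).
Proof.
apply: measurableT_comp => //; apply: measurable_funD => //; apply: measurable_funD.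
  by apply: measurable_funM => //; exact: measurable_funX.
exact: measurable_funM.
Qed.

Lemma gauss_quad (al be ga : R) : - 2^-1 < al ->
  (\int[N01]_w (expR (- (al * w ^+ 2 + be * w + ga)))%:E =
   ((Num.sqrt (1 + 2 * al))^-1 * expR (be ^+ 2 / (2 * (1 + 2 * al)) - ga))%:E)%E.
Proof.
move=> al2; set D := 1 + 2 * al; have D0 : 0 < D by rewrite /D; lra.
have sD0 : 0 < Num.sqrt D by rewrite sqrtr_gt0.
rewrite N01_integral; last 2 first.
- by apply/measurable_EFinP; apply: measurableT_comp => //; exact: measurable_quad.
- by move=> x; rewrite lee_fin expR_ge0.
set c := _ * expR _.
transitivity (\int[mu]_w (c%:E * (normal_pdf (- be / D) (Num.sqrt D)^-1 w)%:E))%E.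
  apply: eq_integral => w _; rewrite -!EFinM; congr _%:E.
  rewrite !normal_pdfE ?oner_neq0 ?invr_neq0 ?gt_eqF // /normal_fun /normal_peak /c.
  have -> : Num.sqrt ((Num.sqrt D)^-1 ^+ 2 * pi *+ 2) = (Num.sqrt D)^-1 * Num.sqrt (1 ^+ 2 * pi *+ 2) :> R.
    rewrite exprVn sqr_sqrtr ?(ltW D0) // expr1n mul1r -mulrnAr sqrtrM ?invr_ge0 ?(ltW D0) //.
    by rewrite sqrtrV ?(ltW D0).
  rewrite [((Num.sqrt D)^-1 * _)^-1]invfM invrK.
  have -> : expR (- (al * w ^+ 2 + be * w + ga)) * ((Num.sqrt (1 ^+ 2 * pi *+ 2))^-1 * expR (- (w - 0) ^+ 2 / (1 ^+ 2 *+ 2)))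
     = (Num.sqrt (1 ^+ 2 * pi *+ 2))^-1 * (expR (- (al * w ^+ 2 + be * w + ga)) * expR (- (w - 0) ^+ 2 / (1 ^+ 2 *+ 2))) by ring.
  set p1 := (Num.sqrt (1 ^+ 2 * pi *+ 2))^-1.
  rewrite -expRD.
  have -> : (Num.sqrt D)^-1 * expR (be ^+ 2 / (2 * D) - ga) * (Num.sqrt D * p1 * expR (- (w - - be / D) ^+ 2 / ((Num.sqrt D)^-1 ^+ 2 *+ 2)))
     = p1 * (expR (be ^+ 2 / (2 * D) - ga) * expR (- (w - - be / D) ^+ 2 / ((Num.sqrt D)^-1 ^+ 2 *+ 2))).
    by field; rewrite gt_eqF.
  rewrite -expRD; congr (_ * expR _).
  rewrite exprVn sqr_sqrtr ?(ltW D0) //.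
  have Dn : D != 0 by rewrite gt_eqF.
  have -> : D^-1 *+ 2 = 2 / D by rewrite mulr2n; field.
  have -> : al = (D - 1) / 2 by rewrite /D; field.
  by field.
rewrite ge0_integralZl //.
- by rewrite integral_normal_pdf mule1.
- by apply/measurable_EFinP; exact: measurable_normal_pdf.
- by move=> x _; rewrite lee_fin normal_pdf_ge0.
- by rewrite lee_fin mulr_ge0 ?invr_ge0 ?expR_ge0 // ltW.
Qed.

Lemma pow_le_expR (x : R) k : 0 <= x -> x ^+ k <= k%:R ^+ k * expR x.
Proof.
move=> x0; case: k => [|k]; first by rewrite !expr0 mul1r -expR0 ler_expR.
have k0 : 0 < k.+1%:R :> R by rewrite ltr0n.
have -> : expR x = expR (x / k.+1%:R) ^+ k.+1 by rewrite -expRM_natl; congr expR; field; rewrite gt_eqF.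
rewrite -exprMn lerXn2r ?nnegrE ?mulr_ge0 ?expR_ge0 ?(ltW k0) //.
rewrite mulrC -ler_pdivrMr //.
by apply: (le_trans _ (expR_ge1Dx _)); rewrite lerDr ler01.
Qed.

Lemma mom_N01_id : mom N01 (fun w => w).
Proof.
split=> // k.
have h := @gauss_quad (- 4^-1) 0 0 ltac:(lra).
apply: (@le_lt_trans _ _ (\int[N01]_w ((4 ^+ k * k%:R ^+ k)%:E * (expR (- (- 4^-1 * w ^+ 2 + 0 * w + 0)))%:E))%E).
  apply: ge0_le_integral => //.
  - by move=> w _; rewrite lee_fin even_pow_ge0.
  - by apply/measurable_EFinP; exact: measurable_funX.
  - apply/measurable_EFinP; apply: measurable_funM => //; apply: measurableT_comp => //; exact: measurable_quad.
  - move=> w _; rewrite -EFinM lee_fin exprM.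
    have -> : w ^+ 2 = 4 * (w ^+ 2 / 4) by field.
    rewrite exprMn -mulrA ler_wpM2l ?exprn_ge0 //.
    have -> : - (- 4^-1 * (4 * (w ^+ 2 / 4)) + 0 * w + 0) = w ^+ 2 / 4 by field.
    by apply: pow_le_expR; rewrite divr_ge0 // sqr_ge0.
rewrite ge0_integralZl //.
- by rewrite h -EFinM ltry.
- by apply/measurable_EFinP; apply: measurableT_comp => //; exact: measurable_quad.
Qed.

Lemma N01_quad (al be ga : R) : - 2^-1 < al -> mom N01 (fun w => expR (- (al * w ^+ 2 + be * w + ga))) ->
  Eexp N01 (fun w => expR (- (al * w ^+ 2 + be * w + ga)))
  = (Num.sqrt (1 + 2 * al))^-1 * expR (be ^+ 2 / (2 * (1 + 2 * al)) - ga).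
Proof. by move=> h m; apply: EFin_inj; rewrite ExE // gauss_quad. Qed.

Lemma mom_N01_exp be : mom N01 (fun w => expR (- (0 * w ^+ 2 + be * w + 0))).
Proof.
split=> [|k]; first by apply: measurableT_comp => //; exact: measurable_quad.
have -> : (\int[N01]_w (expR (- (0 * w ^+ 2 + be * w + 0)) ^+ (2 * k))%:E
    = \int[N01]_w (expR (- (0 * w ^+ 2 + ((2 * k)%:R * be) * w + 0)))%:E)%E.
  by apply: eq_integral => w _; rewrite -expRM_natl; congr (expR _)%:E; ring.
by rewrite gauss_quad ?ltry //; lra.
Qed.

Lemma N01_mean0 : Eexp N01 (fun w => w) = 0.
Proof.
have key (s : R) : s ^+ 2 = 1 -> s * Eexp N01 (fun w => w) <= 0.
  move=> s2; rewrite -ExZ; last exact: mom_N01_id.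
  apply/ler_addgt0Pl => e e0; rewrite addr0.
  pose t := Num.min e 1; have t0 : 0 < t by rewrite lt_min e0 ltr01.
  have [te t1] : t <= e /\ t <= 1 by rewrite /t !ge_min !lexx orbT.
  apply: (le_trans _ te).
  have m1 := mom_N01_exp (- (s * t)).
  have h : Eexp N01 (fun w => s * w) <= Eexp N01 (fun w => t^-1 * (expR (- (0 * w ^+ 2 + - (s * t) * w + 0)) - 1)).
    apply: Ex_le.
    - by apply: momM; [exact: mom_cst | exact: mom_N01_id].
    - by apply: momM; [exact: mom_cst | apply: momB => //; exact: mom_cst].
    - move=> w; rewrite [leRHS]mulrC ler_pdivlMr //.
      have := expR_ge1Dx (- (0 * w ^+ 2 + - (s * t) * w + 0)); nra.
  apply: (le_trans h); rewrite ExZ; last by apply: momB => //; exact: mom_cst.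
  rewrite ExB //; last exact: mom_cst.
  rewrite Ex_cst N01_quad //; try by lra.
  rewrite mulr0 addr0 sqrtr1 invr1 mul1r mulr1 subr0 sqrrN exprMn s2 mul1r.
  rewrite mulrC ler_pdivrMr //.
  have : 1 - t ^+ 2 / 2 <= expR (- (t ^+ 2 / 2)) by apply: (le_trans _ (expR_ge1Dx _)); lra.
  rewrite expRN => hE; have E0 := expR_gt0 (t ^+ 2 / 2).
  have : (1 - t ^+ 2 / 2) * expR (t ^+ 2 / 2) <= 1 by rewrite -ler_pdivlMr // div1r.
  set E := expR _; move=> h2; have : t ^+ 2 <= 1 by rewrite expr2; nra.
  by move=> h3; nra.
apply/eqP; rewrite eq_le; have := key 1 (expr1n _ _); rewrite mul1r => -> /=.
by have := key (-1) ltac:(by rewrite sqrrN expr1n); rewrite mulN1r oppr_le0.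
Qed.

Definition gv2 : R := Eexp N01 (fun w => w ^+ 2).
Definition gv4 : R := Eexp N01 (fun w => w ^+ 4).

Lemma gv2_gt0 : 0 < gv2.
Proof.
have mq : mom N01 (fun w => expR (- (1 * w ^+ 2 + 0 * w + 0))).
  apply: (@mom_bounded _ _ _ _ _ 1); first by apply: measurableT_comp => //; exact: measurable_quad.
  by move=> w; rewrite ger0_norm ?expR_ge0 // -[leRHS]expR0 ler_expR; have := sqr_ge0 w; lra.
have : Eexp N01 (fun w => 1 - w ^+ 2) <= Eexp N01 (fun w => expR (- (1 * w ^+ 2 + 0 * w + 0))).
  apply: Ex_le => //.
    by apply: momB; [exact: mom_cst | apply: momX; exact: mom_N01_id].
  by move=> w; apply: (le_trans _ (expR_ge1Dx _)); lra.
rewrite ExB; [|exact: mom_cst|by apply: momX; exact: mom_N01_id].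
rewrite Ex_cst -/gv2 N01_quad //; try by lra.
rewrite expr0n mul0r subr0 expR0 mulr1.
have h3 : 1 < Num.sqrt (1 + 2) :> R by rewrite -{1}sqrtr1 ltr_sqrt; lra.
have : (Num.sqrt (1 + 2))^-1 < 1 :> R by rewrite invf_lt1 // (lt_trans ltr01 h3).
by rewrite !mulr1; lra.
Qed.

Lemma gv4_ge0 : 0 <= gv4.
Proof. by apply: Ex_ge0 => w; rewrite -[4%N]/(2 * 2)%N even_pow_ge0. Qed.

Lemma std_normal_moments d (T : measurableType d) (P : probability T R) (W : T -> R) :
  measurable_fun setT W -> std_normal P W ->
  [/\ mom P W, Eexp P W = 0, Eexp P (fun w => W w ^+ 2) = gv2 & Eexp P (fun w => W w ^+ 4) = gv4].
Proof.
move=> mW hW.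
have law (f : R -> R) : measurable_fun setT f -> mom N01 f -> mom P (f \o W) /\ Eexp N01 f = Eexp P (f \o W).
  move=> mf mmf.
  by apply: (@Ex_law _ _ _ _ _ N01 P (fun x => x) W f) => // B mB; rewrite hW.
have [m1 e1] := law (fun x => x) (@measurable_id _ _ _) mom_N01_id.
have [_ e2] := law (fun x => x ^+ 2) (measurable_funX 2 (@measurable_id _ _ _)) (momX 2 mom_N01_id).
have [_ e4] := law (fun x => x ^+ 4) (measurable_funX 4 (@measurable_id _ _ _)) (momX 4 mom_N01_id).
by split=> //; rewrite -e1 N01_mean0.
Qed.

End GaussMoments.

Section MeasurableInv.
Context {R : realType}.

Lemma measurable_inv : measurable_fun [set: R] (@GRing.inv R).
Proof.
rewrite (_ : @GRing.inv R = (fun x => x * ((x ^+ 2) `^ (-1)))); last first.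
  apply/funext => x; rewrite powR_inv1 ?sqr_ge0 //; case: (eqVneq x 0) => [->|x0]; first by rewrite mul0r invr0.
  by field.
apply: measurable_funM => //; apply: (@measurableT_comp _ _ _ _ _ _ (fun y : R => y `^ (-1))).
  exact: measurable_powR.
exact: measurable_funX.
Qed.

Lemma measurable_sqrt : measurable_fun [set: R] (@Num.sqrt R).
Proof. by apply: continuous_measurable_fun; exact: sqrt_continuous. Qed.

End MeasurableInv.

Section GaussStep.
Context d (T : measurableType d) (R : realType) (P : probability T R)
  (I : finType) (F : I -> T -> R).
Hypothesis hF : mutually_independent P F.
Let mF := hF.1.
Local Notation msig := (msig F).

Lemma msig_inv_sqrt (S : {set I}) (D : T -> R) : msig S D -> msig S (fun w => (Num.sqrt (D w))^-1).
Proof.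
move=> mD; apply: (@measurableT_comp _ _ _ _ _ _ (@GRing.inv R)); first exact: measurable_inv.
by apply: (@measurableT_comp _ _ _ _ _ _ (@Num.sqrt R)) => //; exact: measurable_sqrt.
Qed.

Lemma msig_inv (S : {set I}) (D : T -> R) : msig S D -> msig S (fun w => (D w)^-1).
Proof. by move=> mD; apply: (@measurableT_comp _ _ _ _ _ _ (@GRing.inv R)); first exact: measurable_inv. Qed.

Lemma gauss_step (S : {set I}) j (psi sg a c : T -> R) : j \notin S -> std_normal P (F j) ->
  msig S psi -> msig S sg -> msig S a -> msig S c ->
  (forall w, 0 <= psi w) -> (forall w, 0 <= sg w) ->
  (\int[P]_w (psi w * expR (- (sg w * (a w * F j w + c w) ^+ 2)))%:E =
   \int[P]_w (psi w * (Num.sqrt (1 + 2 * (sg w * a w ^+ 2)))^-1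
              * expR (- (sg w / (1 + 2 * (sg w * a w ^+ 2)) * c w ^+ 2)))%:E)%E.
Proof.
move=> jS hj mpsi msg ma mc psi0 sg0.
have dis : forall i, i \in S -> i \notin [set j]%SET.
  by move=> i iS; rewrite finset.in_set1; apply: contraNneq jS => <-.
rewrite (@decouple _ _ _ P I F hF S [set j]%SET dis
  (fun x y => (psi x * expR (- (sg x * (a x * F j y + c x) ^+ 2)))%:E)); last first.
- by move=> x y; rewrite lee_fin mulr_ge0 ?expR_ge0.
- have mj : msig [set j]%SET (F j) by apply: msig_coord; rewrite finset.in_set1.
  have L1 (f : T -> R) : msig S f -> measurable_fun setT (fun z : TS F S * TS F [set j]%SET => f z.1).
    by move=> mf; exact: (measurableT_comp mf measurable_fst).
  apply/measurable_EFinP; apply: measurable_funM; first exact: L1.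
  apply: measurableT_comp => //; apply: measurableT_comp => //; apply: measurable_funM; first exact: L1.
  apply: measurable_funX; apply: measurable_funD; last exact: L1.
  apply: measurable_funM; first exact: L1.
  exact: (measurableT_comp mj measurable_snd).
apply: eq_integral => x _.
have s0 := sg0 x; set A := a x; set s := sg x; set C := c x.
pose g (t : R) : \bar R := (expR (- ((s * A ^+ 2) * t ^+ 2 + (2 * s * A * C) * t + s * C ^+ 2)))%:E.
have mg : measurable_fun setT g by apply/measurable_EFinP; apply: measurableT_comp => //; exact: measurable_quad.
have g0 t : (0 <= g t)%E by rewrite lee_fin expR_ge0.
have e1 : (\int[P]_y g (F j y) = \int[N01]_t g t)%E.
  by apply: (@ge0_integral_law _ _ _ _ _ P N01 (F j) (fun t => t) g) => //; exact: mF.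
transitivity ((psi x)%:E * \int[P]_y g (F j y))%E.
  rewrite -ge0_integralZl //; last 2 first.
  - by apply: measurableT_comp.
  - by rewrite lee_fin.
  apply: eq_integral => y _; rewrite /g -EFinM; congr (_ * expR _)%:E; rewrite /s /A /C; ring.
rewrite e1 gauss_quad; last by apply: (@lt_le_trans _ _ 0); [lra | rewrite mulr_ge0 // sqr_ge0].
rewrite -EFinM; congr (_%:E); rewrite [LHS]mulrA; congr (_ * _); congr expR.
have : 0 <= s * A ^+ 2 by rewrite mulr_ge0 // sqr_ge0.
move=> h; have Dn : 1 + 2 * (s * A ^+ 2) != 0 by rewrite gt_eqF //; lra.
by field.
Qed.

Lemma gauss_unit (S0 : {set I}) (ks : seq I) (a : I -> T -> R) (c psi sg : T -> R) :
  uniq ks -> (forall k, k \in ks -> k \notin S0) -> (forall k, k \in ks -> std_normal P (F k)) ->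
  (forall k, msig S0 (a k)) -> msig S0 c -> msig S0 psi -> msig S0 sg ->
  (forall w, 0 <= psi w) -> (forall w, 0 <= sg w) ->
  (\int[P]_w (psi w * expR (- (sg w * (\sum_(k <- ks) a k w * F k w + c w) ^+ 2)))%:E <=
   \int[P]_w (psi w * (Num.sqrt (1 + 2 * (sg w * \sum_(k <- ks) a k w ^+ 2)))^-1)%:E)%E.
Proof.
move=> + + + ma mc; elim: ks psi sg => [|k ks IH] psi sg.
  move=> _ _ _ mpsi msg psi0 sg0.
  have Tm f : msig S0 f -> measurable_fun setT f by exact: msig_meas.
  apply: ge0_le_integral => //.
  - by move=> w _; rewrite lee_fin mulr_ge0 ?expR_ge0.
  - apply/measurable_EFinP; apply: measurable_funM; first exact: Tm.
    apply: measurableT_comp => //; apply: measurableT_comp => //; apply: measurable_funM; first exact: Tm.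
    apply: measurable_funX; apply: measurable_funD; last exact: Tm.
    by rewrite (_ : (fun w => _) = cst 0) //; apply/funext => w; rewrite big_nil.
  - apply/measurable_EFinP; apply: measurable_funM; first exact: Tm.
    by rewrite (_ : (fun w => _) = cst ((Num.sqrt (1 : R))^-1)) //; apply/funext => w; rewrite big_nil !mulr0 addr0.
  - move=> w _; rewrite lee_fin ler_wpM2l // !big_nil !mulr0 addr0 sqrtr1 invr1 -[leRHS]expR0 ler_expR oppr_le0.
    by rewrite mulr_ge0 // sqr_ge0.
rewrite /= => /andP[kks uks] dis nor mpsi msg psi0 sg0.
pose S1 : {set I} := S0 :|: [set i in ks]%SET.
have s01 : S0 \subset S1 by exact: finset.subsetUl.
have kS1 : k \notin S1.
  by rewrite finset.in_setU finset.inE negb_or kks andbT; apply: dis; rewrite mem_head.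
have up f : msig S0 f -> msig S1 f by exact: msig_sub.
have mc1 : msig S1 (fun w => \sum_(i <- ks) a i w * F i w + c w).
  apply: measurable_funD; last exact: up.
  have : {subset ks <= ks} by [].
  elim: {-2}ks => [|i l IHl] sub.
    by rewrite (_ : (fun w => _) = cst 0) //; apply/funext => w; rewrite big_nil.
  under eq_fun do rewrite big_cons; apply: measurable_funD; last by apply: IHl => z zl; apply: sub; rewrite inE zl orbT.
  apply: measurable_funM; first exact: up.
  by apply: msig_coord; rewrite finset.in_setU finset.inE sub ?orbT // mem_head.
under eq_integral => w _ do rewrite big_cons -addrA.
rewrite (gauss_step kS1) //; try exact: up; last by apply: nor; rewrite mem_head.
have D1 w : 1 <= 1 + 2 * (sg w * a k w ^+ 2).
  by rewrite lerDl mulr_ge0 // mulr_ge0 // sqr_ge0.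
pose D w := 1 + 2 * (sg w * a k w ^+ 2).
have mD : msig S0 D.
  apply: measurable_funD => //; apply: measurable_funM => //; apply: measurable_funM => //.
  by apply: measurable_funX; exact: ma.
apply: le_trans (IH (fun w => psi w * (Num.sqrt (D w))^-1) (fun w => sg w / D w) uks _ _ _ _ _ _) _.
- by move=> i il; apply: dis; rewrite inE il orbT.
- by move=> i il; apply: nor; rewrite inE il orbT.
- by apply: measurable_funM => //; exact: msig_inv_sqrt.
- by apply: measurable_funM => //; exact: msig_inv.
- by move=> w; rewrite mulr_ge0 ?invr_ge0.
- by move=> w; rewrite divr_ge0 // (le_trans _ (D1 w)).
rewrite le_eqVlt; apply/orP; left; apply/eqP; apply: eq_integral => w _; congr _%:E.
rewrite -mulrA -invfM -sqrtrM ?(le_trans _ (D1 w)) //; congr (_ * (Num.sqrt _)^-1).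
rewrite big_cons; have Dn : D w != 0 by rewrite gt_eqF // (lt_le_trans _ (D1 w)).
by rewrite mulrDr mulr1 {1}/D; field.
Qed.

End GaussStep.

Section Kron.
Context {R : realType}.

Lemma sum_mxvec p L (V : nmodType) (f : 'I_(p * L) -> V) :
  \sum_k f k = \sum_(j < p) \sum_(a < L) f (mxvec_index j a).
Proof.
rewrite pair_bigA /= (reindex (uncurry (@mxvec_index p L))); last exact: curry_mxvec_bij.
by apply: eq_bigr => -[j a] _.
Qed.

Lemma nsq_vec p L (v : 'cV[R]_(p * L)) : nsq v = fsq (vec_mx v^T).
Proof.
rewrite /nsq sum_mxvec; apply: eq_bigr => j _; apply: eq_bigr => a _.
by rewrite !mxE.
Qed.

Lemma dot_kron p L (x : 'cV[R]_p) (b : 'cV[R]_L) (v : 'cV[R]_(p * L)) :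
  dot (kron x b) v = dot x (vec_mx v^T *m b).
Proof.
rewrite !dotE /kron trmxK.
have := mxvec_dotmul (vec_mx v^T) x^T b^T.
by rewrite !trmxK vec_mxK trmxK mulmxA => ->.
Qed.

Lemma vec_mx_kron p L (x : 'cV[R]_p) (b : 'cV[R]_L) : vec_mx (kron x b)^T = x *m b^T.
Proof. by rewrite /kron trmxK mxvecK. Qed.

Lemma kronE p L (x : 'cV[R]_p) (b : 'cV[R]_L) j a :
  kron x b (mxvec_index j a) 0 = x j 0 * b a 0.
Proof. by rewrite /kron mxE mxvecE mxE big_ord1 mxE. Qed.

Lemma thetaOfB p L (v v' : 'cV[R]_(p * L)) (Bf : R -> 'cV[R]_L) u :
  thetaOf v Bf u - thetaOf v' Bf u = thetaOf (v - v') Bf u.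
Proof. by rewrite /thetaOf -mulmxBl !linearB. Qed.

End Kron.

Section PosDef.
Context {R : realType}.

Lemma nsq_eq0 k (v : 'cV[R]_k) : nsq v = 0 -> v = 0.
Proof.
move/eqP; rewrite psumr_eq0 => [/allP h|i _]; last exact: sqr_ge0.
apply/colP => i; have := h i; rewrite mem_index_enum => /(_ isT); rewrite sqrf_eq0 => /eqP ->.
by rewrite mxE.
Qed.

Lemma posdef_unit k (G : 'M[R]_k) kap : 0 < kap -> (forall v, kap * nsq v <= dot v (G *m v)) -> G \in unitmx.
Proof.
move=> k0 h; rewrite -row_free_unit -kermx_eq0; apply/negPn/negP => kn0.
have [i /eqP ri] : exists i, row i (kermx G) != 0.
  apply/existsP; move: kn0; apply: contraR; rewrite negb_exists => /forallP h0.
  by apply/eqP/row_matrixP => i; rewrite row0; apply/eqP; move: (h0 i); rewrite negbK.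
set v := row i (kermx G) in ri.
have vG : v *m G = 0 by apply/sub_kermxP; exact: row_sub.
have := h v^T; rewrite dotE trmxK mulmxA vG mul0mx mxE => hv.
have : nsq v^T = 0.
  by apply/eqP; rewrite eq_le nsq_ge0 andbT -(pmulr_rle0 _ k0).
by move/nsq_eq0 => /(congr1 trmx); rewrite trmxK trmx0.
Qed.

Lemma posdef_expand k (G : 'M[R]_k) kap v : 0 < kap -> (forall v, kap * nsq v <= dot v (G *m v)) ->
  kap ^+ 2 * nsq v <= nsq (G *m v).
Proof.
move=> k0 h; have h1 := h v; have h2 := cauchy_schwarz v (G *m v).
have a0 := nsq_ge0 v; have b0 := nsq_ge0 (G *m v).
have h3 : (kap * nsq v) ^+ 2 <= nsq v * nsq (G *m v).
  apply: (le_trans _ h2); rewrite lerXn2r ?nnegrE ?mulr_ge0 ?(ltW k0) //.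
  by apply: le_trans h1; rewrite mulr_ge0 // ltW.
case: (eqVneq (nsq v) 0) => [->|nv]; first by rewrite mulr0.
have np : 0 < nsq v by rewrite lt_neqAle eq_sym nv.
by rewrite -(ler_pM2l np); apply: le_trans h3; rewrite exprMn expr2 [X in _ <= _ * X]expr2; nra.
Qed.

Lemma fsq_inv_mul k q (G : 'M[R]_k) (F : 'M[R]_(k, q)) kap : 0 < kap ->
  (forall v, kap * nsq v <= dot v (G *m v)) -> fsq (invmx G *m F) <= fsq F / kap ^+ 2.
Proof.
move=> k0 h; have uG := posdef_unit k0 h.
rewrite ler_pdivlMr ?exprn_gt0 // mulrC [fsq (invmx _ *m _)]fsq_col [fsq F]fsq_col mulr_sumr.
apply: ler_sum => j _; rewrite !colE -mulmxA -[X in _ <= nsq X](mulKVmx uG (F *m delta_mx j 0)).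
exact: posdef_expand.
Qed.

(* Normal equations with the residual split as [rho - eta]: the [eta] part enters only
   through its empirical norm, the rest through the score [T]. *)
Lemma ls_bound N k (q : 'I_N -> 'cV[R]_k) (z rho eta : 'I_N -> R) (gt : 'cV[R]_k) kap :
  0 < kap -> (0 < N)%N ->
  (forall v, kap * nsq v <= N%:R^-1 * \sum_i dot (q i) v ^+ 2) ->
  (forall i, z i - dot (q i) gt = rho i - eta i) ->
  nsq (invmx (N%:R^-1 *: \sum_i q i *m (q i)^T) *m (N%:R^-1 *: \sum_i z i *: q i) - gt)
  <= 6 / kap ^+ 2 * nsq (N%:R^-1 *: \sum_i rho i *: q i) + 2 / kap * (N%:R^-1 * \sum_i eta i ^+ 2).
Proof.
move=> k0 N0 hk hz; set D := N%:R^-1 *: \sum_i q i *m (q i)^T; set b := N%:R^-1 *: \sum_i z i *: q i.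
have Nn : 0 < N%:R^-1 :> R by rewrite invr_gt0 ltr0n.
have Dv v : D *m v = N%:R^-1 *: \sum_i dot (q i) v *: q i.
  rewrite /D -scalemxAl mulmx_suml; congr (_ *: _); apply: eq_bigr => i _.
  rewrite -mulmxA [(q i)^T *m v]mx11_scalar -dotE mul_mx_scalar //.
have formD v : dot v (D *m v) = N%:R^-1 * \sum_i dot (q i) v ^+ 2.
  rewrite Dv dotZr dot_sumr; congr (_ * _); apply: eq_bigr => i _.
  by rewrite dotZr dotC expr2.
have uD : D \in unitmx by apply: (posdef_unit k0) => v; rewrite formD.
set gh := invmx D *m b; set Dl := gh - gt.
have DDl : D *m Dl = N%:R^-1 *: \sum_i (rho i - eta i) *: q i.
  rewrite mulmxBr mulKVmx // Dv -scalerBr -sumrB; congr (_ *: _); apply: eq_bigr => i _.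
  by rewrite -scalerBl hz.
set Tv := N%:R^-1 *: \sum_i rho i *: q i; set E := N%:R^-1 * \sum_i dot (q i) Dl ^+ 2.
set H := N%:R^-1 * \sum_i eta i ^+ 2.
have EE : E = dot Dl Tv - N%:R^-1 * \sum_i eta i * dot (q i) Dl.
  rewrite /E -formD DDl dotZr dot_sumr /Tv dotZr dot_sumr -mulrBr -sumrB; congr (_ * _).
  by apply: eq_bigr => i _; rewrite !dotZr mulrBl (dotC Dl).
have cs2 : - (N%:R^-1 * \sum_i eta i * dot (q i) Dl) <= 2^-1 * E + 2^-1 * H.
  rewrite /E /H -mulrN -sumrN mulrCA [_^-1 * (_ * \sum_i eta i ^+ 2)]mulrCA -mulrDr.
  rewrite ler_wpM2l ?(ltW Nn) // !mulr_sumr -big_split; apply: ler_sum => i _ /=.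
  by have := sqr_ge0 (dot (q i) Dl + eta i); rewrite !expr2; nra.
have hE : kap * nsq Dl <= E by exact: hk.
have cs1 : dot Dl Tv <= kap / 8 * nsq Dl + 2 / kap * nsq Tv.
  have : 0 <= kap / 8 * nsq (Dl - (4 / kap) *: Tv) by rewrite mulr_ge0 ?nsq_ge0 // divr_ge0 // ltW.
  have -> : kap / 8 * nsq (Dl - (4 / kap) *: Tv) = kap / 8 * nsq Dl - dot Dl Tv + 2 / kap * nsq Tv.
    move: Dl Tv {EE cs2 hE DDl E H} => Dl Tv.
    rewrite -dotvv dotBr !dotBl !dotvv dotZr (dotC _ Dl) dotZr nsqZ.
    by field; rewrite gt_eqF.
  by lra.
have n0 := nsq_ge0 Dl.
have fin : kap * nsq Dl <= 16 / kap / 3 * nsq Tv + 4 / 3 * H.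
  have : 2^-1 * E <= kap / 8 * nsq Dl + 2 / kap * nsq Tv + 2^-1 * H by move: EE cs2 cs1; lra.
  have -> : 16 / kap / 3 * nsq Tv = 8 / 3 * (2 / kap * nsq Tv) by field; rewrite gt_eqF.
  have -> : kap / 8 * nsq Dl = 8^-1 * (kap * nsq Dl) by field.
  move: hE; clear EE cs2 cs1; move: (2 / kap * nsq Tv : R) (kap * nsq Dl : R) E H => X Y E1 H1.
  by clear; move=> *; lra.
have H0 : 0 <= H by rewrite mulr_ge0 ?(ltW Nn) // sumr_ge0 // => i _; exact: sqr_ge0.
have T0 := nsq_ge0 Tv.
rewrite -(ler_pM2l k0); apply: (le_trans fin).
have -> : kap * (6 / kap ^+ 2 * nsq Tv + 2 / kap * H) = 6 / kap * nsq Tv + 2 * H by field; rewrite gt_eqF.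
have : 0 <= kap^-1 * nsq Tv by rewrite mulr_ge0 // invr_ge0 ltW.
have -> : 16 / kap / 3 * nsq Tv = 16 / 3 * (kap^-1 * nsq Tv) by field; rewrite gt_eqF.
have -> : 6 / kap * nsq Tv = 6 * (kap^-1 * nsq Tv) by field; rewrite gt_eqF.
by move: (kap^-1 * nsq Tv) => Z; lra.
Qed.

End PosDef.

Section Estimator.
Context {R : realType}.
Variables (p L N n : nat) (Bf : R -> 'cV[R]_L) (y : 'I_N -> bool) (Us : 'I_N -> R).
Hypothesis n0 : (0 < n)%N.
Hypothesis NE : N = (2 * n)%N.

Lemma theta_hat_ext (Xs Xs' : 'I_N -> 'cV[R]_p) :
  (forall i, Bf (Us i) = 0 \/ Xs i = Xs' i) -> theta_hat Bf y Us Xs = theta_hat Bf y Us Xs'.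
Proof.
move=> h.
have ea cls : alpha_hat Bf y Us Xs cls = alpha_hat Bf y Us Xs' cls.
  rewrite /alpha_hat; congr (_ *m _); apply: eq_bigr => i _.
  by case: (h i) => ->; rewrite ?mul0mx.
have em u : mu_hat Bf y Us Xs u = mu_hat Bf y Us Xs' u by rewrite /mu_hat /mu_hat_cls !ea.
have eb : Btilde_hat Bf y Us Xs = Btilde_hat Bf y Us Xs'.
  apply/funext => i; rewrite /Btilde_hat em; case: (h i) => -> //.
  by rewrite /kron trmx0 !mulmx0.
have eD : D_n Bf y Us Xs = D_n Bf y Us Xs' by rewrite /D_n eb.
have eb' : b_n Bf y Us Xs = b_n Bf y Us Xs' by rewrite /b_n eb.
by rewrite /theta_hat /gamma_hat eD eb'.
Qed.

Variables (Xs : 'I_N -> 'cV[R]_p) (S : bool -> 'M[R]_(p, L)) (ph : bool -> 'I_N -> 'cV[R]_p) (e : 'I_N -> 'cV[R]_p).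
Local Notation Bi i := (Bf (Us i)).
Hypothesis XsE : forall i, Xs i = S (y i) *m Bi i + ph (y i) i + e i.

Definition Gcls (cls : bool) : 'M[R]_L := n%:R^-1 *: \sum_(i < N | y i == cls) Bi i *m (Bi i)^T.
Definition Fcls (cls : bool) : 'M[R]_(L, p) :=
  n%:R^-1 *: \sum_(i < N | y i == cls) Bi i *m (ph cls i + e i)^T.

Variables (kG LamG : R).
Hypothesis kG0 : 0 < kG.
Hypothesis hG : forall cls v, kG * nsq v <= dot v (Gcls cls *m v) <= LamG * nsq v.

Let nR : n%:R != 0 :> R. Proof. by rewrite pnatr_eq0 -lt0n. Qed.

Lemma alpha_hatE cls : alpha_hat Bf y Us Xs cls = (S cls)^T + invmx (Gcls cls) *m Fcls cls.
Proof.
have uG : Gcls cls \in unitmx by apply: (posdef_unit kG0) => v; have /andP[] := hG cls v.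
set Q := \sum_(i < N | y i == cls) Bi i *m (Bi i)^T.
have GQ : Q = n%:R *: Gcls cls by rewrite /Gcls scalerA divff // scale1r.
have uQ : Q \in unitmx by rewrite GQ unitmxZ // unitfE.
have iQ : invmx Q = n%:R^-1 *: invmx (Gcls cls) by rewrite GQ invmxZ // -GQ.
rewrite /alpha_hat -/Q.
have -> : \sum_(i < N | y i == cls) Bi i *m (Xs i)^T = Q *m (S cls)^T + n%:R *: Fcls cls.
  rewrite /Fcls scalerA divff // scale1r /Q mulmx_suml -big_split /=; apply: eq_bigr => i /eqP yi.
  by rewrite XsE yi -addrA linearD /= mulmxDr trmx_mul mulmxA.
rewrite mulmxDr mulKmx // iQ -scalemxAl -scalemxAr scalerA mulVf // scale1r //.
Qed.

Definition Mcls (cls : bool) : 'M[R]_(p, L) := (invmx (Gcls cls) *m Fcls cls)^T.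
Definition Mbar : 'M[R]_(p, L) := 2^-1 *: (Mcls true + Mcls false).
Definition phbar i : 'cV[R]_p := 2^-1 *: (ph true i + ph false i).

Lemma Xs_sub_mu_hat i : Xs i - mu_hat Bf y Us Xs (Us i)
  = Zlab (y i) *: ((S true *m Bi i + ph true i) - (S false *m Bi i + ph false i)) + e i
    + phbar i - Mbar *m Bi i.
Proof.
have mh cls : mu_hat_cls Bf y Us Xs cls (Us i) = S cls *m Bi i + Mcls cls *m Bi i.
  by rewrite /mu_hat_cls alpha_hatE linearD /= trmxK mulmxDl.
rewrite /mu_hat !mh XsE /phbar /Mbar /Zlab -scalemxAl mulmxDl.
apply/colP => k; rewrite !mxE; case: (y i) => /=; by field.
Qed.

Lemma fsq_outer_mean (I : finType) (Q : pred I) (b : I -> 'cV[R]_L) (f : I -> 'cV[R]_p) (c Lam beta : R) :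
  0 <= c -> 0 <= Lam ->
  (forall v, c * \sum_(i | Q i) dot v (b i) ^+ 2 <= Lam * nsq v) ->
  c * (\sum_(i | Q i) nsq (f i)) <= beta ->
  fsq (c *: \sum_(i | Q i) b i *m (f i)^T) <= Lam * beta.
Proof.
move=> c0 L0 hl hb; set F := c *: _.
have F0 := fsq_ge0 F.
have e1 : fsq F = c * \sum_(i | Q i) dot (f i) (F^T *m b i).
  rewrite /fsq; transitivity (\sum_a \sum_j F a j * (c * \sum_(i | Q i) b i a 0 * f i j 0)).
    apply: eq_bigr => a _; apply: eq_bigr => j _; rewrite expr2; congr (_ * _).
    rewrite /F mxE summxE; congr (_ * _); apply: eq_bigr => i _; by rewrite mxE big_ord1 mxE.
  rewrite mulr_sumr.
  transitivity (\sum_a \sum_j \sum_(i | Q i) c * (f i j 0 * (F a j * b i a 0))).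
    apply: eq_bigr => a _; apply: eq_bigr => j _; rewrite !mulr_sumr; apply: eq_bigr => i _; ring.
  rewrite (eq_bigr (fun a => \sum_(i | Q i) \sum_j c * (f i j 0 * (F a j * b i a 0)))); last first.
    by move=> a _; rewrite exchange_big.
  rewrite exchange_big; apply: eq_bigr => i _ /=; rewrite exchange_big /= /dot mulr_sumr.
  apply: eq_bigr => j _; rewrite [(F^T *m b i) j 0]mxE !mulr_sumr; apply: eq_bigr => a _.
  by rewrite [F^T j a]mxE.
have e2 : c * \sum_(i | Q i) nsq (F^T *m b i) <= Lam * fsq F.
  have -> : c * \sum_(i | Q i) nsq (F^T *m b i) = \sum_j c * \sum_(i | Q i) dot (col j F) (b i) ^+ 2.
    rewrite -mulr_sumr exchange_big /=; congr (_ * _); apply: eq_bigr => i _.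
    rewrite /nsq; apply: eq_bigr => j _; rewrite mxE; congr (_ ^+ 2); apply: eq_bigr => a _; by rewrite !mxE.
  by rewrite fsq_col mulr_sumr; apply: ler_sum => j _; exact: hl.
have cs : (\sum_(i | Q i) dot (f i) (F^T *m b i)) ^+ 2 <= (\sum_(i | Q i) nsq (f i)) * (\sum_(i | Q i) nsq (F^T *m b i)).
  have h1 : `|\sum_(i | Q i) dot (f i) (F^T *m b i)| <= \sum_(i | Q i) Num.sqrt (nsq (f i)) * Num.sqrt (nsq (F^T *m b i)).
    apply: (le_trans (ler_norm_sum _ _ _)); apply: ler_sum => i _.
    rewrite -sqrtrM ?nsq_ge0 // -(@ler_pXn2r _ 2) ?nnegrE // real_normK ?num_real // sqr_sqrtr ?mulr_ge0 ?nsq_ge0 //.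
    exact: cauchy_schwarz.
  have := cauchy_schwarz_sum Q (fun i => Num.sqrt (nsq (f i))) (fun i => Num.sqrt (nsq (F^T *m b i))).
  under [X in _ <= X * _ -> _]eq_bigr do rewrite sqr_sqrtr ?nsq_ge0 //.
  under [X in _ <= _ * X -> _]eq_bigr do rewrite sqr_sqrtr ?nsq_ge0 //.
  apply: le_trans; rewrite -[leLHS]real_normK ?num_real // lerXn2r ?nnegrE //.
  by apply: sumr_ge0 => i _; rewrite mulr_ge0.
have b0 : 0 <= beta by apply: le_trans hb; rewrite mulr_ge0 // sumr_ge0 // => i _; exact: nsq_ge0.
have : fsq F ^+ 2 <= beta * (Lam * fsq F).
  rewrite e1 exprMn; apply: (@le_trans _ _ ((c * \sum_(i | Q i) nsq (f i)) * (c * \sum_(i | Q i) nsq (F^T *m b i)))).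
    rewrite [leRHS]mulrACA -expr2 ler_wpM2l ?sqr_ge0 //.
  rewrite -e1; apply: ler_pM => //; rewrite mulr_ge0 // sumr_ge0 // => i _; exact: nsq_ge0.
case: (eqVneq (fsq F) 0) => [->|Fn]; first by rewrite mulr_ge0.
have Fp : 0 < fsq F by rewrite lt_neqAle eq_sym Fn.
by rewrite expr2 mulrA ler_pM2r // mulrC.
Qed.

End Estimator.

Ltac momt :=
  lazymatch goal with
  | |- mom ?P (fun w => @?f w + @?g w) => apply: (@momD _ _ _ P f g); momt
  | |- mom ?P (fun w => @?f w * @?g w) => apply: (@momM _ _ _ P f g); momt
  | |- mom ?P (fun w => - @?f w) => apply: (@momN _ _ _ P f); momt
  | |- mom ?P (fun w => (@?f w) ^+ ?n) => apply: (@momX _ _ _ P f n); momt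
  | |- mom ?P (fun w => \sum_(i <- _ | _) _) => apply: mom_sum => ?; momt
  | |- _ => first [by [] | exact: mom_cst | idtac]
  end.

Section UnitMoments.
Context d (T : measurableType d) (R : realType) (P : probability T R).
Variables (I : finType) (F : I -> T -> R).
Hypothesis hF : mutually_independent P F.
Variables (p : nat) (ws : 'I_p -> I) (S0 : {set I}).
Hypothesis ws_inj : injective ws.
Hypothesis wsS : forall k, ws k \notin S0.
Hypothesis hW : forall k, std_normal P (F (ws k)).
Local Notation W k := (F (ws k)).
Local Notation Ex := (Eexp P).
Local Notation msig := (msig F).

Definition gw4 : R := gv4 + gv2 ^+ 2.

Lemma mom_W k : mom P (W k). Proof. by case: (std_normal_moments (hF.1 _) (@hW k)). Qed.
Lemma Ex_W k : Ex (W k) = 0. Proof. by case: (std_normal_moments (hF.1 _) (@hW k)). Qed.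
Lemma Ex_Wsq k : Ex (fun w => W k w ^+ 2) = gv2.
Proof. by case: (std_normal_moments (hF.1 _) (@hW k)). Qed.
Lemma Ex_Wquart k : Ex (fun w => W k w ^+ 4) = gv4.
Proof. by case: (std_normal_moments (hF.1 _) (@hW k)). Qed.

Let up (S S' : {set I}) f : S \subset S' -> msig S f -> msig S' f. Proof. exact: msig_sub. Qed.
Let mW (S : {set I}) k : ws k \in S -> msig S (W k). Proof. exact: msig_coord. Qed.

Lemma Ex_isolate (S : {set I}) H k : ws k \notin S -> msig S H -> mom P H ->
  Ex (fun w => H w * W k w) = 0.
Proof.
move=> kS sH mH; rewrite (Ex_mul_indep hF (S := S) (S' := [set ws k]%SET)) //.
- by rewrite Ex_W mulr0.
- by move=> i iS; rewrite finset.in_set1; apply: contraNneq kS => <-.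
- by apply: mW; rewrite finset.in_set1.
- exact: mom_W.
Qed.

Lemma Ex_W1 G k : msig S0 G -> mom P G -> Ex (fun w => G w * W k w) = 0.
Proof. by move=> sG mG; apply: (@Ex_isolate S0). Qed.

Let msigM (S : {set I}) f g : msig S f -> msig S g -> msig S (fun w => f w * g w).
Proof. exact: measurable_funM. Qed.
Let msigX (S : {set I}) f n : msig S f -> msig S (fun w => f w ^+ n).
Proof. exact: measurable_funX. Qed.

Lemma Ex_sq_isolate (S : {set I}) H k : ws k \notin S -> msig S H -> mom P H ->
  Ex (fun w => H w * W k w ^+ 2) = gv2 * Ex H.
Proof.
move=> kS sH mH; rewrite (Ex_mul_indep hF (S := S) (S' := [set ws k]%SET)) //.
- by rewrite Ex_Wsq mulrC.
- by move=> i iS; rewrite finset.in_set1; apply: contraNneq kS => <-.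
- by apply: msigX; apply: mW; rewrite finset.in_set1.
- by apply: momX; exact: mom_W.
Qed.

Lemma Ex_W2 G k l : msig S0 G -> mom P G ->
  Ex (fun w => G w * (W k w * W l w)) = (k == l)%:R * (gv2 * Ex G).
Proof.
move=> sG mG; have mWk := mom_W.
case: eqP => [<-|/eqP kl].
  by rewrite mul1r -(Ex_sq_isolate (wsS k)) //; congr Eexp; apply/funext => w; rewrite expr2.
rewrite mul0r -(@Ex_isolate (ws k |: S0) (fun w => G w * W k w) l); first by congr Eexp; apply/funext => w; rewrite mulrA.
- by rewrite finset.in_setU1 negb_or wsS andbT (inj_eq ws_inj) eq_sym.
- apply: msigM; first by apply: (up _ sG); exact: finset.subsetUr.
  by apply: mW; rewrite finset.setU11.
- exact: momM.
Qed.

Lemma Ex_W4_off G k k' l : msig S0 G -> mom P G -> k != k' ->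
  Ex (fun w => G w * (W k w * W k' w * W l w ^+ 2)) = 0.
Proof.
move=> sG mG; have mWk := mom_W.
wlog kl : k k' / l != k'.
  move=> wl kk'; case: (eqVneq l k') => [lk|]; last by move=> h; exact: wl.
  rewrite -(wl k' k) ?lk 1?eq_sym //.
  by congr Eexp; apply/funext => w; rewrite [W k w * _]mulrC.
move=> kk'.
rewrite -(@Ex_isolate (ws l |: (ws k |: S0)) (fun w => G w * (W k w * W l w ^+ 2)) k').
- by congr Eexp; apply/funext => w; ring.
- by rewrite !finset.in_setU1 !negb_or wsS andbT !(inj_eq ws_inj) ![k' == _]eq_sym kl kk'.
- apply: msigM; first by apply: (up _ sG); apply: (fintype.subset_trans (finset.subsetUr [set ws k]%SET _)); exact: finset.subsetUr.
  apply: msigM; first by apply: mW; rewrite finset.in_setU1 finset.setU11 orbT.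
  by apply: msigX; apply: mW; rewrite finset.setU11.
- by momt.
Qed.

Lemma Ex_W4_diag G k l : msig S0 G -> mom P G -> (forall w, 0 <= G w) ->
  Ex (fun w => G w * (W k w ^+ 2 * W l w ^+ 2)) <= gw4 * Ex G.
Proof.
move=> sG mG G0; have mWk := mom_W; have EG := Ex_ge0 P G0.
have g2 := ltW (@gv2_gt0 R); have g4 := @gv4_ge0 R.
case: (eqVneq k l) => [<-|kl].
  have -> : Ex (fun w => G w * (W k w ^+ 2 * W k w ^+ 2)) = gv4 * Ex G.
    transitivity (Ex (fun w => G w * W k w ^+ 4)); first by congr Eexp; apply/funext => w; rewrite -exprD.
    rewrite (Ex_mul_indep hF (S := S0) (S' := [set ws k]%SET)) //.
    - by rewrite Ex_Wquart mulrC.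
    - by move=> i iS; rewrite finset.in_set1; apply: contraNneq (wsS k) => <-.
    - by apply: msigX; apply: mW; rewrite finset.in_set1.
    - by momt.
  by rewrite ler_wpM2r // /gw4 lerDl sqr_ge0.
have -> : Ex (fun w => G w * (W k w ^+ 2 * W l w ^+ 2)) = gv2 * (gv2 * Ex G).
  rewrite -(Ex_sq_isolate (wsS k)) // -(@Ex_sq_isolate (ws k |: S0) _ l).
  - by congr Eexp; apply/funext => w; ring.
  - by rewrite finset.in_setU1 negb_or wsS andbT (inj_eq ws_inj) eq_sym.
  - apply: msigM; first by apply: (up _ sG); exact: finset.subsetUr.
    by apply: msigX; apply: mW; rewrite finset.setU11.
  - by momt.
by rewrite mulrA -expr2 ler_wpM2r // /gw4 lerDr.
Qed.

Definition Wv (w : T) : 'cV[R]_p := \col_k W k w.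
Definition msigv (a : T -> 'cV[R]_p) := forall k, msig S0 (fun w => a w k 0) /\ mom P (fun w => a w k 0).

Lemma mom_dot (a b : T -> 'cV[R]_p) : (forall k, mom P (fun w => a w k 0)) -> (forall k, mom P (fun w => b w k 0)) ->
  mom P (fun w => dot (a w) (b w)).
Proof. by move=> ha hb; apply: mom_sum => k; exact: momM. Qed.

Lemma mom_nsq (a : T -> 'cV[R]_p) : (forall k, mom P (fun w => a w k 0)) -> mom P (fun w => nsq (a w)).
Proof. by move=> ha; apply: mom_sum => k; exact: momX. Qed.

Lemma mom_Wv k : mom P (fun w => Wv w k 0).
Proof. by under eq_fun do rewrite mxE; exact: mom_W. Qed.

Lemma mom_dotW a : msigv a -> mom P (fun w => dot (a w) (Wv w)).
Proof. by move=> ha; apply: mom_dot => k; [case: (ha k)|exact: mom_Wv]. Qed.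

Lemma Ex_dotW a : msigv a -> Ex (fun w => dot (a w) (Wv w)) = 0.
Proof.
move=> ha; rewrite /dot; have mW1 := mom_W.
under eq_fun => w do under eq_bigr => k _ do rewrite mxE.
rewrite Ex_sum; last by move=> k; have [_ ?] := ha k; exact: momM.
by rewrite big1 // => k _; have [? ?] := ha k; apply: Ex_W1.
Qed.

Lemma Ex_dotW2 a b : msigv a -> msigv b ->
  Ex (fun w => dot (a w) (Wv w) * dot (b w) (Wv w)) = gv2 * Ex (fun w => dot (a w) (b w)).
Proof.
move=> ha hb; have mW1 := mom_W.
have mak k : mom P (fun w => a w k 0) by case: (ha k).
have mbk k : mom P (fun w => b w k 0) by case: (hb k).
have -> : (fun w => dot (a w) (Wv w) * dot (b w) (Wv w))
    = (fun w => \sum_k \sum_l (a w k 0 * b w l 0) * (W k w * W l w)).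
  apply/funext => w; rewrite /dot mulr_suml; apply: eq_bigr => k _; rewrite mulr_sumr.
  by apply: eq_bigr => l _; rewrite !mxE; ring.
rewrite Ex_sum; last by move=> k; momt.
rewrite /dot Ex_sum; last by move=> k; momt.
rewrite mulr_sumr; apply: eq_bigr => k _.
rewrite Ex_sum; last by move=> l; momt.
rewrite (bigD1 k) //= big1 ?addr0 => [|l lk]; rewrite Ex_W2 ?eqxx ?mul1r //.
- by apply: msigM; [case: (ha k)|case: (hb k)].
- by momt.
- by rewrite eq_sym (negPf lk) mul0r.
- by apply: msigM; [case: (ha k)|case: (hb l)].
- by momt.
Qed.

Lemma Ex_dotW4 a : msigv a ->
  Ex (fun w => dot (a w) (Wv w) ^+ 2 * nsq (Wv w)) <= gw4 * p%:R * Ex (fun w => nsq (a w)).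
Proof.
move=> ha; have mW1 := mom_W.
have mak k : mom P (fun w => a w k 0) by case: (ha k).
have sak k : msig S0 (fun w => a w k 0) by case: (ha k).
have -> : (fun w => dot (a w) (Wv w) ^+ 2 * nsq (Wv w))
    = (fun w => \sum_l \sum_k \sum_k' (a w k 0 * a w k' 0) * (W k w * W k' w * W l w ^+ 2)).
  apply/funext => w; rewrite /nsq mulr_sumr; apply: eq_bigr => l _.
  rewrite expr2 /dot -mulrA mulr_suml; apply: eq_bigr => k _; rewrite mulr_suml mulr_sumr.
  by apply: eq_bigr => k' _; rewrite !mxE; ring.
rewrite Ex_sum; last by move=> l; momt.
rewrite mulrAC mulr_natr -[X in _ *+ X](card_ord p) -sumr_const; apply: ler_sum => l _.
rewrite Ex_sum; last by move=> k; momt.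
rewrite /nsq Ex_sum; last by move=> k; momt.
rewrite mulr_sumr; apply: ler_sum => k _.
rewrite Ex_sum; last by move=> k'; momt.
rewrite (bigD1 k) //= big1 ?addr0 => [|k' kk'].
  under eq_fun do rewrite -!expr2.
  apply: Ex_W4_diag => //; [by apply: msigX|by momt|by move=> w; exact: sqr_ge0].
by apply: Ex_W4_off; [apply: msigM|momt|rewrite eq_sym].
Qed.

Lemma Ex_nsqW : Ex (fun w => nsq (Wv w)) = gv2 * p%:R.
Proof.
have mW1 := mom_W; rewrite /nsq; under eq_fun => w do under eq_bigr => k _ do rewrite mxE.
rewrite Ex_sum; last by move=> k; momt.
by under eq_bigr do rewrite Ex_Wsq; rewrite sumr_const card_ord mulr_natr.
Qed.

End UnitMoments.

Section BoundedMeasurable.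
Context {R : realType}.

Definition bm (f : R -> R) := measurable_fun setT f /\ exists C, forall u, `|f u| <= C.

Lemma bm_cst c : bm (fun=> c).
Proof. by split=> //; exists `|c|. Qed.

Lemma bmD f g : bm f -> bm g -> bm (fun u => f u + g u).
Proof.
move=> [mf [C hC]] [mg [D hD]]; split; first exact: measurable_funD.
by exists (C + D) => u; apply: le_trans (ler_normD _ _) _; exact: lerD.
Qed.

Lemma bmM f g : bm f -> bm g -> bm (fun u => f u * g u).
Proof.
move=> [mf [C hC]] [mg [D hD]]; split; first exact: measurable_funM.
by exists (C * D) => u; rewrite normrM ler_pM.
Qed.

Lemma bmN f : bm f -> bm (fun u => - f u).
Proof.
move=> [mf [C hC]]; split; first exact: measurableT_comp.
by exists C => u; rewrite normrN.
Qed.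

Lemma bmX f n : bm f -> bm (fun u => f u ^+ n).
Proof.
move=> [mf [C hC]]; split; first exact: measurable_funX.
by exists (C ^+ n) => u; rewrite normrX lerXn2r ?nnegrE // (le_trans _ (hC u)).
Qed.

Lemma bm_sum (I : Type) (s : seq I) (Q : pred I) (f : I -> R -> R) : (forall i, bm (f i)) ->
  bm (fun u => \sum_(i <- s | Q i) f i u).
Proof.
move=> h; elim: s => [|i s IH]; first by under eq_fun do rewrite big_nil; exact: bm_cst.
under eq_fun do rewrite big_cons; case: (Q i) => //; exact: bmD.
Qed.

Lemma bm_mulmxv a b (A : R -> 'M[R]_(a, b)) (v : R -> 'cV[R]_b) :
  (forall i j, bm (fun u => A u i j)) -> (forall j, bm (fun u => v u j 0)) ->
  forall i, bm (fun u => (A u *m v u) i 0).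
Proof. by move=> hA hv i; under eq_fun do rewrite mxE; apply: bm_sum => k; exact: bmM. Qed.

Lemma bm_dot k (a b : R -> 'cV[R]_k) : (forall i, bm (fun u => a u i 0)) -> (forall i, bm (fun u => b u i 0)) ->
  bm (fun u => dot (a u) (b u)).
Proof. by move=> ha hb; apply: bm_sum => i; exact: bmM. Qed.

Lemma bm_nsq k (a : R -> 'cV[R]_k) : (forall i, bm (fun u => a u i 0)) -> bm (fun u => nsq (a u)).
Proof. by move=> ha; apply: bm_sum => i; exact: bmX. Qed.

Lemma mom_bm d (T : measurableType d) (P : probability T R) (X : T -> R) f :
  measurable_fun setT X -> bm f -> mom P (fun w => f (X w)).
Proof.
move=> mX [mf [C hC]]; apply: (@mom_bounded _ _ _ _ _ C); first exact: measurableT_comp.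
by move=> w; exact: hC.
Qed.

Lemma msig_bm d (T : measurableType d) (I : finType) (F : I -> T -> R) S (X : T -> R) f :
  msig F S X -> bm f -> msig F S (fun w => f (X w)).
Proof. by move=> mX [mf _]; exact: (measurableT_comp mf mX). Qed.

End BoundedMeasurable.

Ltac bmt :=
  lazymatch goal with
  | |- bm (fun w => @?f w + @?g w) => apply: (@bmD _ f g); bmt
  | |- bm (fun w => @?f w * @?g w) => apply: (@bmM _ f g); bmt
  | |- bm (fun w => - @?f w) => apply: (@bmN _ f); bmt
  | |- bm (fun w => (@?f w) ^+ ?n) => apply: (@bmX _ f n); bmt
  | |- bm (fun w => \sum_(i <- _ | _) _) => apply: bm_sum => ?; bmt
  | |- bm (fun w => dot _ _) => apply: bm_dot => ?; bmt
  | |- bm (fun w => nsq _) => apply: bm_nsq => ?; bmt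
  | |- bm (fun w => fun_of_matrix (mulmx _ _) _ _) => apply: bm_mulmxv => ? *; bmt
  | |- _ => first [by [] | exact: bm_cst | idtac]
  end.

Section DensityBounds.
Context {R : realType} d (T : measurableType d) (P : probability T R).
Variables (U : T -> R) (h : R -> R) (D1 D2 : R).
Hypothesis mU : measurable_fun setT U.
Hypothesis hU : has_density_01 P U h.
Hypothesis mh : measurable_fun setT h.
Hypothesis D10 : 0 < D1.
Hypothesis hh : forall u, 0 <= u <= 1 -> D1 <= h u <= D2.
Local Notation mu := (@lebesgue_measure R).

Let I01 : set R := [set u : R | 0 <= u <= 1].

Let I01E : I01 = `[0%R, 1%R]%classic.
Proof. by apply/seteqP; split=> x /=; rewrite in_itv. Qed.

Lemma ge0_integral_density01 (g : R -> \bar R) : measurable_fun setT g -> (forall x, (0 <= g x)%E) ->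
  (\int[P]_w g (U w) = \int[mu]_(x in `[0%R, 1%R]) (g x * (h x)%:E))%E.
Proof.
move=> mg g0; have mI : measurable I01 by rewrite I01E; exact: measurable_itv.
pose hc x := h x * (\1_I01 x).
have mhc : measurable_fun setT hc by apply: measurable_funM => //; exact: measurable_indic.
have hc0 x : 0 <= hc x.
  rewrite /hc indicE; case: (boolP (x \in I01)); last by rewrite mulr0.
  by rewrite inE => /hh /andP[h1 _]; rewrite mulr1 (le_trans _ h1) // ltW.
pose X := HB.pack_for {mfun T >-> measurableTypeR R} U (isMeasurableFun.Build _ _ _ _ (U : T -> measurableTypeR R) mU).
pose nu : probability (measurableTypeR R) R := distribution P X.
have e1 : (\int[nu]_x g x = \int[P]_w g (U w))%E.
  by rewrite [LHS](@ge0_integral_pushforward _ _ _ (measurableTypeR R) _ U) // preimage_setT.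
rewrite -e1 (@ge0_integral_density _ _ _ mu nu hc) //; last first.
  move=> B mB; transitivity (P (U @^-1` B)); first by [].
  rewrite hU // -/I01 integral_mkcondr.
  apply: eq_integral => x _; rewrite patchE /hc indicE.
  by case: ifP => _; rewrite ?mulr1 // mulr0.
rewrite -I01E [RHS]integral_mkcond; apply: eq_integral => x _; rewrite /hc patchE indicE.
by case: ifP => _; rewrite ?mulr1 // mulr0 mule0.
Qed.

Lemma Ex_density_bounds (f : R -> R) : bm f -> (forall u, 0 <= f u) ->
  D1 * Eexp unif01 f <= Eexp P (fun w => f (U w)) <= D2 * Eexp unif01 f.
Proof.
move=> bf f0; have [mf _] := bf.
have m1 : mom unif01 f by exact: (@mom_bm _ _ _ unif01 id).
have m2 : mom P (fun w => f (U w)) by exact: mom_bm.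
have mEf : measurable_fun setT (EFin \o f) by exact/measurable_EFinP.
have mI : measurable (`[0%R, 1%R]%classic : set R) by exact: measurable_itv.
have s1 D : 0 <= D -> ((D * Eexp unif01 f)%:E = \int[mu]_(x in `[0%R, 1%R]) ((f x)%:E * D%:E))%E.
  move=> D0; rewrite EFinM ExE // unif01_integral //.
  rewrite muleC -ge0_integralZr ?lee_fin //; first exact: measurable_funTS.
  by move=> x _; rewrite lee_fin.
have e2 : ((Eexp P (fun w => f (U w)))%:E = \int[mu]_(x in `[0%R, 1%R]) ((f x)%:E * (h x)%:E))%E.
  by rewrite ExE // (@ge0_integral_density01 (EFin \o f)) // => x; rewrite lee_fin.
have D20 : 0 <= D2.
  have /andP[a b] := hh (u := 0) ltac:(by rewrite lexx ler01).
  by rewrite (le_trans _ b) // (le_trans _ a) // ltW.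
have mm (g : R -> R) : measurable_fun setT g -> measurable_fun (`[0%R, 1%R]%classic : set R) (fun x => ((f x)%:E * (g x)%:E)%E).
  move=> mg; apply: measurable_funTS; apply: (emeasurable_funM mEf); exact/measurable_EFinP.
apply/andP; split; rewrite -lee_fin e2 s1 // ?(ltW D10) //; apply: ge0_le_integral => //; try exact: mm.
- by move=> x _; rewrite mule_ge0 ?lee_fin // ltW.
- move=> x /=; rewrite in_itv /= => /hh /andP[h1 _]; rewrite -EFinM lee_fin ler_wpM2l //.
- move=> x /=; rewrite in_itv /= => /hh /andP[h1 _]; by rewrite mule_ge0 ?lee_fin // (le_trans _ h1) // ltW.
- move=> x /=; rewrite in_itv /= => /hh /andP[_ h1]; rewrite -EFinM lee_fin ler_wpM2l //.
Qed.

End DensityBounds.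

Section BvecFacts.
Context {R : realType}.
Variables (m K : nat) (xi : nat -> R) (Cq : R).
Hypothesis m0 : (0 < m)%N.
Hypothesis hxi : interior_knots K xi.
Hypothesis hq : quasi_uniform Cq K xi.
Local Notation L := (nbasis m K).
Local Notation B := (Bvec m K xi).
Local Notation Bs u k := (Bstar m K xi u k 0).

Lemma nbasis_gt0 : (0 < L)%N.
Proof. by rewrite /nbasis addn_gt0 (interior_knots_K_gt0 hxi). Qed.

Lemma nbasis_le : (L <= m * K)%N.
Proof. rewrite /nbasis; have := interior_knots_K_gt0 hxi; move: m0; clear; nia. Qed.

Lemma BvecE u k : B u k 0 = Num.sqrt L%:R * Bs u k.
Proof. by rewrite mxE. Qed.

Lemma Bvec_ge0 u k : 0 <= B u k 0.
Proof. by rewrite BvecE mulr_ge0 // (Bstar_ge0 m0 hxi). Qed.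

Lemma Bvec_sum_le u : \sum_k B u k 0 <= Num.sqrt L%:R.
Proof.
under eq_bigr do rewrite BvecE; rewrite -mulr_sumr ler_piMr //; exact: (Bstar_sum_le1 m0 hxi).
Qed.

Lemma Bvec_out u : ~~ (0 <= u <= 1) -> B u = 0.
Proof. by move=> h; apply/colP => k; rewrite BvecE (Bstar_out hxi) // mulr0 mxE. Qed.

Lemma Bvec_overlap u (a b : 'I_L) : (a + m <= b)%N -> B u a 0 * B u b 0 = 0.
Proof. by move=> ab; rewrite !BvecE mulrACA (Bstar_overlap m0 hxi) // mulr0. Qed.

Lemma bm_Bstar k : bm (fun u => Bs u k).
Proof.
split; first by under eq_fun do rewrite mxE; exact: measurable_bspline.
by exists 1 => u; rewrite ger0_norm ?(Bstar_ge0 m0 hxi) // (Bstar_le1 m0 hxi).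
Qed.

Lemma bm_Bvec k : bm (fun u => B u k 0).
Proof. under eq_fun do rewrite BvecE; apply: bmM; [exact: bm_cst|exact: bm_Bstar]. Qed.

Lemma dot_Bvec_le c u : dot c (B u) ^+ 2 <= L%:R * \sum_k c k 0 ^+ 2 * Bs u k.
Proof.
have -> : dot c (B u) = Num.sqrt L%:R * \sum_k c k 0 * Bs u k.
  by rewrite /dot mulr_sumr; apply: eq_bigr => k _; rewrite BvecE mulrCA.
rewrite exprMn sqr_sqrtr ?ler0n // ler_wpM2l ?ler0n //.
have B0 := Bstar_ge0 m0 hxi u.
have := cauchy_schwarz_sum xpredT (fun k => c k 0 * Num.sqrt (Bs u k)) (fun k => Num.sqrt (Bs u k)).
under eq_bigr do rewrite -mulrA -expr2 sqr_sqrtr //.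
move/le_trans; apply.
under eq_bigr do rewrite exprMn sqr_sqrtr //.
under [X in _ * X <= _]eq_bigr do rewrite sqr_sqrtr //.
rewrite ler_piMr ?(Bstar_sum_le1 m0 hxi) //.
by apply: sumr_ge0 => k _; rewrite mulr_ge0 // sqr_ge0.
Qed.

Lemma nsq_Bvec_le u : nsq (B u) <= L%:R.
Proof.
rewrite /nsq; under eq_bigr do rewrite BvecE exprMn sqr_sqrtr ?ler0n //.
rewrite -mulr_sumr ler_piMr ?ler0n //; apply: le_trans (Bstar_sum_le1 m0 hxi u).
apply: ler_sum => k _; rewrite expr2 ler_piMr ?(Bstar_le1 m0 hxi) // (Bstar_ge0 m0 hxi) //.
Qed.

Lemma unif01_itv (a b : R) : 0 <= a -> a <= b -> b <= 1 -> Eexp unif01 (\1_(`[a, b]%classic) : R -> R) = b - a.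
Proof.
move=> a0 ab b1; have mI : measurable (`[a, b]%classic : set R) by exact: measurable_itv.
apply: EFin_inj; rewrite ExE; last exact: mom_indic.
rewrite unif01_integral; last 2 first.
- by apply/measurable_EFinP; exact: measurable_indic.
- by move=> x; rewrite lee_fin.
rewrite integral_indic //.
rewrite setIidl; last first.
  move=> x /=; rewrite !in_itv /= => /andP[xa xb]; rewrite (le_trans a0 xa) (le_trans xb b1) //.
have := @lebesgue_measure_itv R `[a, b]%R; rewrite /= lte_fin => ->.
by move: ab; rewrite le_eqVlt => /orP[/eqP ->|->]; rewrite ?ltxx ?subrr // -EFinB.
Qed.

Lemma unif01_Bstar_le k : Eexp unif01 (fun u => Bs u k) <= m%:R * (Cq / K%:R).
Proof.
have /andP[t0 _] := ext_knots_01 m hxi k; have /andP[_ t1] := ext_knots_01 m hxi (k + m).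
have tt := ext_knots_homo m0 hxi (leq_addr m k).
apply: le_trans (ext_knots_dist m0 hxi hq k m).
rewrite -(unif01_itv t0 tt t1); apply: Ex_le.
- exact: mom_Bstar.
- by apply: mom_indic; exact: measurable_itv.
move=> u; rewrite indicE; case: (boolP (u \in _)) => h; first exact: (Bstar_le1 m0 hxi).
case: (eqVneq (Bs u k) 0) => [-> //|/(Bstar_support m0 hxi) hs].
by move: h; rewrite notin_setE /= in_itv /= hs.
Qed.

Let KL : L%:R <= m%:R * K%:R :> R. Proof. by rewrite -natrM ler_nat nbasis_le. Qed.
Let K0 : 0 < K%:R :> R. Proof. by rewrite ltr0n (interior_knots_K_gt0 hxi). Qed.
Let C0 : 0 <= Cq. Proof. by apply: le_trans (quasi_uniform_ge1 hxi hq). Qed.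

Lemma unif01_Bstar_leL k : L%:R * Eexp unif01 (fun u => Bs u k) <= m%:R ^+ 2 * Cq.
Proof.
apply: (@le_trans _ _ (m%:R * K%:R * (m%:R * (Cq / K%:R)))); last first.
  by rewrite le_eqVlt; apply/orP; left; apply/eqP; field; rewrite gt_eqF.
apply: ler_pM => //; [by apply: Ex_ge0 => u; exact: (Bstar_ge0 m0 hxi)|exact: unif01_Bstar_le].
Qed.

Context d (T : measurableType d) (P : probability T R).
Variables (U : T -> R) (h : R -> R) (D1 D2 : R).
Hypothesis mU : measurable_fun setT U.
Hypothesis hU : has_density_01 P U h.
Hypothesis mh : measurable_fun setT h.
Hypothesis D10 : 0 < D1.
Hypothesis hh : forall u, 0 <= u <= 1 -> D1 <= h u <= D2.

Let D20 : 0 <= D2.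
Proof.
have /andP[a b] := hh (u := 0) ltac:(by rewrite lexx ler01).
by rewrite (le_trans _ b) // (le_trans _ a) // ltW.
Qed.

Lemma Ex_Bstar_le k : L%:R * Eexp P (fun w => Bs (U w) k) <= D2 * (m%:R ^+ 2 * Cq).
Proof.
have /andP[_ h2] := Ex_density_bounds mU hU mh D10 hh (bm_Bstar k) (fun u => Bstar_ge0 m0 hxi u k).
apply: (@le_trans _ _ (L%:R * (D2 * Eexp unif01 (fun u => Bs u k)))); first by rewrite ler_wpM2l ?ler0n.
by rewrite mulrCA ler_wpM2l // unif01_Bstar_leL.
Qed.

Lemma Ex_Bvec_le k : Eexp P (fun w => B (U w) k 0) <= D2 * (m%:R ^+ 2 * Cq) / Num.sqrt L%:R.
Proof.
have L0 : 0 < Num.sqrt L%:R :> R by rewrite sqrtr_gt0 ltr0n nbasis_gt0.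
rewrite ler_pdivlMr //; under eq_fun do rewrite BvecE.
rewrite ExZ; last by apply: (@mom_bm _ _ _ P U (fun u => Bs u k)) => //; exact: bm_Bstar.
by rewrite mulrAC -expr2 sqr_sqrtr ?ler0n // Ex_Bstar_le.
Qed.

Lemma Ex_dot_Bvec_le c : Eexp P (fun w => dot c (B (U w)) ^+ 2) <= D2 * (m%:R ^+ 2 * Cq) * nsq c.
Proof.
have mb k : mom P (fun w => Bs (U w) k) by apply: (@mom_bm _ _ _ P U (fun u => Bs u k)) => //; exact: bm_Bstar.
apply: (@le_trans _ _ (Eexp P (fun w => L%:R * \sum_k c k 0 ^+ 2 * Bs (U w) k))).
  apply: Ex_le; [|by momt|by move=> w; exact: dot_Bvec_le].
  apply: (@mom_bm _ _ _ P U (fun u => dot c (B u) ^+ 2)) => //; bmt.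
  exact: bm_Bvec.
rewrite ExZ; last by momt.
rewrite Ex_sum; last by move=> k; momt.
rewrite mulr_sumr /nsq mulr_sumr; apply: ler_sum => k _.
by rewrite ExZ // mulrCA mulrC ler_wpM2r ?sqr_ge0 // Ex_Bstar_le.
Qed.

End BvecFacts.

(** * The model for fixed sample size *)

Section GeometricWeights.
Context {R : realType}.

Definition ndist (a b : nat) := ((a - b) + (b - a))%N.

Lemma sum_ndist_le (x : R) L k : 0 <= x -> x < 1 -> \sum_(a < L) x ^+ ndist a k <= 2 / (1 - x).
Proof.
move=> x0 x1; have d0 : 0 < 1 - x by rewrite subr_gt0.
rewrite ler_pdivlMr // mulrC.
have h1 : (1 - x) * \sum_(a < L | (k <= a)%N) x ^+ (a - k) = 1 - x ^+ (L - k).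
  elim: L => [|L IH]; first by rewrite big_ord0 mulr0 sub0n expr0 subrr.
  rewrite big_mkcond big_ord_recr /= -big_mkcond mulrDr IH; case: leqP => kL.
    by rewrite (subSn kL) exprS; ring.
  by rewrite mulr0 addr0; congr (_ - _ ^+ _); move: kL; clear; lia.
have h2 : (1 - x) * \sum_(a < L | ~~ (k <= a)%N) x ^+ (k - a) + x ^+ k.+1 = x ^+ (k - L).+1.
  elim: L {h1} => [|L IH]; first by rewrite big_ord0 mulr0 add0r subn0.
  rewrite big_mkcond big_ord_recr /= -big_mkcond mulrDr addrAC IH; case: leqP => kL /=.
    by rewrite mulr0 addr0; congr (_ ^+ _); move: kL; clear; lia.
  have -> : (k - L)%N = (k - L.+1).+1 by move: kL; clear; lia.
  by rewrite !exprS; ring.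
rewrite (bigID (fun a : 'I_L => k <= a)%N) /= mulrDr.
under eq_bigr => a ka do rewrite /ndist (eqP ka) addn0.
rewrite [X in _ + _ * X](eq_bigr (fun a : 'I_L => x ^+ (k - a))); last first.
  by move=> a; rewrite -ltnNge => /ltnW /eqP ak; rewrite /ndist ak add0n.
have : 0 <= x ^+ (L - k) by exact: exprn_ge0.
have : 0 <= x ^+ k.+1 by exact: exprn_ge0.
have : x ^+ (k - L).+1 <= 1 by apply: exprn_ile1 => //; exact: ltW.
by move: h1 h2; lra.
Qed.

Definition agmon_ratio (m : nat) (e : R) : R := 1 - Num.min 2^-1 e / m%:R.

Lemma agmon_ratioP m e : (0 < m)%N -> 0 < e ->
  0 < agmon_ratio m e < 1 /\
  forall s, (s <= m)%N -> (1 - agmon_ratio m e ^+ s) ^+ 2 <= e * agmon_ratio m e ^+ s.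
Proof.
move=> m0 e0; set r := agmon_ratio m e; set t := Num.min 2^-1 e.
have mR : 1 <= m%:R :> R by rewrite ler1n.
have t0 : 0 < t by rewrite lt_min e0 invr_gt0 ltr0n.
have t1 : t <= 2^-1 by rewrite /t ge_min lexx.
have te : t <= e by rewrite /t ge_min lexx orbT.
have q0 : 0 < t / m%:R by rewrite divr_gt0 // (lt_le_trans _ mR).
have q1 : t / m%:R <= t by rewrite ler_piMr ?invf_le1 ?(ltW t0) // (lt_le_trans _ mR).
have r01 : 0 < r < 1 by rewrite /r /agmon_ratio -/t; lra.
split=> // s sm; case/andP: r01 => r0 r1.
have bern k : 1 - k%:R * (t / m%:R) <= r ^+ k.
  elim: k => [|k IH]; first by rewrite mul0r subr0 expr0.
  rewrite exprS; apply: (@le_trans _ _ (r * (1 - k%:R * (t / m%:R)))); last by rewrite ler_wpM2l // ltW.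
  rewrite /r /agmon_ratio -/t -natr1; have : 0 <= k%:R :> R by rewrite ler0n.
  by move: (k%:R) (t / m%:R) q0 => k' q' q'0 k'0; nra.
have hs : 1 - t <= r ^+ s.
  apply: le_trans (bern s); rewrite lerD2l lerN2 mulrCA ler_piMr ?(ltW t0) //.
  by rewrite ler_pdivrMr ?mul1r ?ler_nat // (lt_le_trans _ mR).
have rs1 : r ^+ s <= 1 by apply: exprn_ile1; exact: ltW.
move: (r ^+ s) hs rs1 => y hy y1; nra.
Qed.

Lemma nsq_mean_le k (a b : 'cV[R]_k) c : nsq a <= c -> nsq b <= c -> nsq (2^-1 *: (a + b)) <= c.
Proof. by move=> ha hb; rewrite nsqZ; have := nsqD_le a b; rewrite expr2; lra. Qed.

End GeometricWeights.

Section Model.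
Context d (T : measurableType d) (R : realType) (P : probability T R).
Variables (N p L m : nat).
Variables (U : 'I_N -> T -> R) (W : 'I_N -> 'I_p -> T -> R) (U0 : T -> R) (W0 : 'I_p -> T -> R) (Y0 : T -> R).
Local Notation F := (sample_family U W U0 W0 Y0).
Local Notation I := (option (('I_N + unit) * option 'I_p)).
Local Notation Ex := (Eexp P).
Local Notation EU f := (Eexp P (fun w => f (U0 w))).
Hypothesis hF : mutually_independent P F.
Hypothesis hUlaw : forall i B, measurable B -> P (U0 @^-1` B) = P (U i @^-1` B).
Hypothesis hW : forall i k, std_normal P (W i k).
Hypothesis hW0 : forall k, std_normal P (W0 k).
Variables (Bf : R -> 'cV[R]_L) (dl : R -> 'cV[R]_p) (Ac : R -> 'M[R]_p) (g0 g1 M2 lam0 lam1 : R).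
Hypothesis m0 : (0 < m)%N.
Hypothesis L0 : (0 < L)%N.
Hypothesis bB : forall k, bm (fun u => Bf u k 0).
Hypothesis B_ge0 : forall u k, 0 <= Bf u k 0.
Hypothesis B_sum : forall u, \sum_k Bf u k 0 <= Num.sqrt L%:R.
Hypothesis B_nsq : forall u, nsq (Bf u) <= L%:R.
Hypothesis B_ov : forall u (a b : 'I_L), (a + m <= b)%N -> Bf u a 0 * Bf u b 0 = 0.
Hypothesis g00 : 0 < g0.
Hypothesis g10 : 0 < g1.
Hypothesis hgl : forall c, g0 * nsq c <= EU (fun u => dot c (Bf u) ^+ 2).
Hypothesis hgu : forall c, EU (fun u => dot c (Bf u) ^+ 2) <= g1 * nsq c.
Hypothesis hgb : forall k, EU (fun u => Bf u k 0) <= g1 / Num.sqrt L%:R.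
Hypothesis bdl : forall k, bm (fun u => dl u k 0).
Hypothesis M20 : 0 <= M2.
Hypothesis hdl : forall u, nsq (dl u) <= M2.
Hypothesis bA : forall i j, bm (fun u => Ac u i j).
Hypothesis l00 : 0 < lam0.
Hypothesis l10 : 0 < lam1.
Hypothesis hA1 : forall u v, nsq (Ac u *m v) <= lam1 * nsq v.
Hypothesis hA2 : forall u v, nsq ((Ac u)^T *m v) <= lam1 * nsq v.
Hypothesis hA0 : forall u (G : 'M[R]_(p, L)), lam0 * nsq (G *m Bf u) <= nsq ((Ac u)^T *m (G *m Bf u)).

Definition Uu (s : 'I_N + unit) : T -> R := F (Some (s, None)).
Definition wsu (s : 'I_N + unit) (k : 'I_p) : I := Some (s, Some k).
(* Contains [None] because the population unit also carries its random label. *)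
Definition S0u (s : 'I_N + unit) : {set I} := (None |: [set Some (s, None)])%SET.
Local Notation Wu s := (Wv F (wsu s)).

Let mF i : measurable_fun setT (F i) := hF.1 i.
Let mUu s : measurable_fun setT (Uu s). Proof. exact: mF. Qed.
Let mU0 : measurable_fun setT U0. Proof. exact: (mF (Some (inr tt, None))). Qed.

Let wsu_inj s : injective (wsu s). Proof. by move=> k l []. Qed.
Let wsu_S s k : wsu s k \notin S0u s.
Proof. by rewrite finset.in_setU1 finset.in_set1; apply/norP; split; apply/eqP => -[]. Qed.
Let hWu s k : std_normal P (F (wsu s k)).
Proof. by case: s => [i|[]]; [exact: hW|exact: hW0]. Qed.

Lemma EUs s f : bm f -> Ex (fun w => f (Uu s w)) = EU f.
Proof.
move=> bf; case: s => [i|[]] //.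
have [_ e] := Ex_law mU0 (mUu (inl i)) (@hUlaw i) bf.1 (mom_bm P mU0 bf).
exact: esym.
Qed.

Let sU s f : bm f -> msig F (S0u s) (fun w => f (Uu s w)).
Proof.
move=> bf; apply: (@msig_bm _ _ _ _ F _ (Uu s)) => //.
by apply: msig_coord; rewrite finset.in_setU1 finset.in_set1 eqxx.
Qed.
Let momU s f : bm f -> mom P (fun w => f (Uu s w)). Proof. exact: mom_bm. Qed.

Lemma bm_trA i j : bm (fun u => (Ac u)^T i j).
Proof. by under eq_fun do rewrite mxE; exact: bA. Qed.

Section OneUnit.
Variables (s : 'I_N + unit) (zt : T -> R).
Hypothesis szt : msig F [set None]%SET zt.
Hypothesis zt2 : forall w, zt w ^+ 2 = 4^-1.

Definition xu (w : T) : 'cV[R]_p := zt w *: dl (Uu s w) + Ac (Uu s w) *m Wu s w.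

Let szt' : msig F (S0u s) zt.
Proof. by apply: msig_sub szt; exact: finset.subsetUl. Qed.

Let mzt : mom P zt.
Proof.
apply: (@mom_bounded _ _ _ P _ 1); first exact: (msig_meas hF.1 szt).
move=> w; rewrite -(@ler_pXn2r _ 2) ?nnegrE // real_normK ?num_real // zt2 expr1n invf_le1 ?ltr0n //.
by rewrite ler1n.
Qed.

Let svec (g : R -> 'cV[R]_p) : (forall k, bm (fun u => g u k 0)) -> msigv P F (S0u s) (fun w => g (Uu s w)).
Proof. by move=> bg k; split; [exact: (sU (bg k))|exact: (momU s (bg k))]. Qed.

Let svecz (g : R -> 'cV[R]_p) : (forall k, bm (fun u => g u k 0)) -> msigv P F (S0u s) (fun w => zt w *: g (Uu s w)).
Proof.
move=> bg k; under eq_fun do rewrite mxE.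
by split; [apply: measurable_funM => //; exact: (sU (bg k))|apply: momM => //; exact: (momU s (bg k))].
Qed.

Let bAt (g : R -> 'cV[R]_p) : (forall k, bm (fun u => g u k 0)) -> forall k, bm (fun u => ((Ac u)^T *m g u) k 0).
Proof. by move=> bg k; apply: bm_mulmxv => // i j; exact: bm_trA. Qed.

Lemma dot_xu w v : dot (xu w) v = zt w * dot (dl (Uu s w)) v + dot ((Ac (Uu s w))^T *m v) (Wu s w).
Proof.
rewrite /xu dotDl dotZl; congr (_ + _).
by rewrite dotC dot_mulmxr.
Qed.

Section WithDirection.
Variable g : R -> 'cV[R]_p.
Hypothesis bg : forall k, bm (fun u => g u k 0).

Definition rhou (w : T) : R := zt w - dot (xu w) (g (Uu s w)).

Let a_ u := (Ac u)^T *m g u.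
Let c_ u := 1 - dot (dl u) (g u).
Let ba k : bm (fun u => a_ u k 0). Proof. exact: bAt. Qed.
Let bc : bm c_. Proof. by rewrite /c_; bmt. Qed.

Lemma rhouE w : rhou w = zt w * c_ (Uu s w) - dot (a_ (Uu s w)) (Wu s w).
Proof. by rewrite /rhou dot_xu /c_ /a_; ring. Qed.

Lemma mom_xu j : mom P (fun w => xu w j 0).
Proof.
have -> : (fun w => xu w j 0) = (fun w => zt w * dl (Uu s w) j 0 + \sum_k Ac (Uu s w) j k * F (wsu s k) w).
  by apply/funext => w; rewrite !mxE; congr (_ + _); apply: eq_bigr => k _; rewrite mxE.
have m1 := momU s (bdl j); have m2 k := momU s (bA j k); have m3 := mom_W hF (@hWu s).
by momt.
Qed.

Lemma mom_rhou : mom P rhou.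
Proof.
rewrite /rhou; have m1 := mom_xu; have m2 k := momU s (bg k).
by apply: momB => //; apply: mom_dot => k; [exact: m1|exact: m2].
Qed.

Lemma score_mean f j : bm f ->
  Ex (fun w => rhou w * xu w j 0 * f (Uu s w))
  = EU (fun u => (4^-1 * c_ u * dl u j 0 - gv2 * (Ac u *m a_ u) j 0) * f u).
Proof.
move=> bf.
pose r_ u := (Ac u)^T *m (delta_mx j 0 : 'cV[R]_p).
have br k : bm (fun u => r_ u k 0) by apply: bAt => k'; exact: bm_cst.
have rE u : forall v : 'cV[R]_p, (Ac u *m v) j 0 = dot (r_ u) v.
  by move=> v; rewrite /r_ -dot_mulmxr /dot (bigD1 j) //= [delta_mx _ _ _ _]mxE !eqxx mul1r big1 ?addr0 // => i /negPf h; rewrite [delta_mx _ _ _ _]mxE h mul0r.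
have -> : (fun w => rhou w * xu w j 0 * f (Uu s w)) = (fun w =>
   ((4^-1 * c_ (Uu s w) * dl (Uu s w) j 0 * f (Uu s w)
    + dot (zt w *: ((c_ (Uu s w) * f (Uu s w)) *: r_ (Uu s w))) (Wu s w))
    - dot (zt w *: ((dl (Uu s w) j 0 * f (Uu s w)) *: a_ (Uu s w))) (Wu s w))
    - dot (a_ (Uu s w)) (Wu s w) * dot (f (Uu s w) *: r_ (Uu s w)) (Wu s w)).
  have xE w : xu w j 0 = zt w * dl (Uu s w) j 0 + dot (r_ (Uu s w)) (Wu s w) by rewrite -rE !mxE.
  by apply/funext => w; rewrite rhouE xE !dotZl -(zt2 w); ring.
have bf1 : bm (fun u => 4^-1 * c_ u * dl u j 0 * f u) by bmt.
have v1 : msigv P F (S0u s) (fun w => zt w *: ((c_ (Uu s w) * f (Uu s w)) *: r_ (Uu s w))).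
  apply: (@svecz (fun u => (c_ u * f u) *: r_ u)) => k; under eq_fun do rewrite mxE; by bmt.
have v2 : msigv P F (S0u s) (fun w => zt w *: ((dl (Uu s w) j 0 * f (Uu s w)) *: a_ (Uu s w))).
  apply: (@svecz (fun u => (dl u j 0 * f u) *: a_ u)) => k; under eq_fun do rewrite mxE; by bmt.
have v3 := svec ba.
have v4 : msigv P F (S0u s) (fun w => f (Uu s w) *: r_ (Uu s w)).
  apply: (@svec (fun u => f u *: r_ u)) => k; under eq_fun do rewrite mxE; by bmt.
have mm1 := momU s bf1.
have mm2 := mom_dotW hF (@hWu s) v1; have mm3 := mom_dotW hF (@hWu s) v2.
have mm4 := momM (mom_dotW hF (@hWu s) v3) (mom_dotW hF (@hWu s) v4).
rewrite ExB //; last by apply: momB => //; exact: momD.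
rewrite ExB //; last exact: momD.
rewrite ExD // (Ex_dotW hF (@wsu_S s) (@hWu s) v1) (Ex_dotW hF (@wsu_S s) (@hWu s) v2).
rewrite (Ex_dotW2 hF (@wsu_inj s) (@wsu_S s) (@hWu s) v3 v4) addr0 subr0.
have bd : bm (fun u => dot (a_ u) (f u *: r_ u)).
  by apply: bm_dot => k; [exact: ba|under eq_fun do rewrite mxE; bmt; exact: br].
rewrite (EUs s bf1) (EUs s bd) -ExZ -?ExB; last 3 first.
- exact: (mom_bm P mU0 bf1).
- by apply: momM; [exact: mom_cst|exact: (mom_bm P mU0 bd)].
- exact: (mom_bm P mU0 bd).
congr Eexp; apply/funext => w; rewrite rE dotZr (dotC (r_ _)); ring.
Qed.

Lemma Ex_dot_xu_sq :
  Ex (fun w => dot (xu w) (g (Uu s w)) ^+ 2)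
  = EU (fun u => 4^-1 * dot (dl u) (g u) ^+ 2 + gv2 * nsq (a_ u)).
Proof.
pose e_ u := dot (dl u) (g u); have be : bm e_ by rewrite /e_; bmt.
have -> : (fun w => dot (xu w) (g (Uu s w)) ^+ 2) = (fun w =>
   (4^-1 * e_ (Uu s w) ^+ 2 + dot (zt w *: ((2 * e_ (Uu s w)) *: a_ (Uu s w))) (Wu s w))
   + dot (a_ (Uu s w)) (Wu s w) * dot (a_ (Uu s w)) (Wu s w)).
  by apply/funext => w; rewrite dot_xu !dotZl -(zt2 w) -/(a_ _) -/(e_ _); ring.
have bf1 : bm (fun u => 4^-1 * e_ u ^+ 2) by bmt.
have v1 : msigv P F (S0u s) (fun w => zt w *: ((2 * e_ (Uu s w)) *: a_ (Uu s w))).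
  apply: (@svecz (fun u => (2 * e_ u) *: a_ u)) => k; under eq_fun do rewrite mxE; by bmt.
have v3 := svec ba.
have mm1 := momU s bf1; have mm2 := mom_dotW hF (@hWu s) v1.
have mm4 := momM (mom_dotW hF (@hWu s) v3) (mom_dotW hF (@hWu s) v3).
rewrite ExD //; last exact: momD.
rewrite ExD // (Ex_dotW hF (@wsu_S s) (@hWu s) v1).
rewrite (Ex_dotW2 hF (@wsu_inj s) (@wsu_S s) (@hWu s) v3 v3) addr0.
have bd : bm (fun u => dot (a_ u) (a_ u)) by apply: bm_dot => k; exact: ba.
rewrite (EUs s bf1) (EUs s bd) -ExZ -?ExD; last 3 first.
- exact: (mom_bm P mU0 bf1).
- by apply: momM; [exact: mom_cst|exact: (mom_bm P mU0 bd)].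
- exact: (mom_bm P mU0 bd).
by congr Eexp; apply/funext => w; rewrite dotvv.
Qed.

Variable Cg : R.
Hypothesis hg : forall u, nsq (g u) <= Cg.

Let Cg0 : 0 <= Cg. Proof. by apply: le_trans (hg 0); exact: nsq_ge0. Qed.

Let hc u : c_ u ^+ 2 <= 2 + 2 * (M2 * Cg).
Proof.
rewrite /c_; have := cauchy_schwarz (dl u) (g u).
have : nsq (dl u) * nsq (g u) <= M2 * Cg by apply: ler_pM; rewrite ?nsq_ge0.
move: (dot _ _) => x; have := sqr_ge0 (1 + x); rewrite !expr2; nra.
Qed.

Let ha u : nsq (a_ u) <= lam1 * Cg.
Proof. by apply: le_trans (hA2 _ _) _; rewrite ler_wpM2l // ltW. Qed.

Let hrho w : rhou w ^+ 2 <= (1 + M2 * Cg) + 2 * dot (a_ (Uu s w)) (Wu s w) ^+ 2.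
Proof.
rewrite rhouE; move: (dot _ _) => x; have h1 := hc (Uu s w); have h2 := zt2 w.
have h3 : (zt w * c_ (Uu s w)) ^+ 2 <= 4^-1 * (2 + 2 * (M2 * Cg)) by rewrite exprMn h2 ler_wpM2l // invr_ge0.
move: (zt w * _) h3 => z; have := sqr_ge0 (z + x); rewrite !expr2; nra.
Qed.

Let Ea2 : Ex (fun w => dot (a_ (Uu s w)) (Wu s w) ^+ 2) <= gv2 * (lam1 * Cg).
Proof.
have v3 := svec ba; under eq_fun do rewrite expr2.
rewrite (Ex_dotW2 hF (@wsu_inj s) (@wsu_S s) (@hWu s) v3 v3) ler_wpM2l ?(ltW gv2_gt0) //.
rewrite -(Ex_cst P (lam1 * Cg)); apply: Ex_le; [|exact: mom_cst|by move=> w; rewrite dotvv].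
by apply: (@momU s (fun u => dot (a_ u) (a_ u))); apply: bm_dot => k; exact: ba.
Qed.

Definition cst_rho := 1 + M2 * Cg + 2 * (gv2 * (lam1 * Cg)).

Lemma Ex_rhou_sq : Ex (fun w => rhou w ^+ 2) <= cst_rho.
Proof.
have v3 := mom_dotW hF (@hWu s) (svec ba).
apply: (@le_trans _ _ (Ex (fun w => (1 + M2 * Cg) + 2 * dot (a_ (Uu s w)) (Wu s w) ^+ 2))).
  apply: Ex_le => //; [by apply: momX; exact: mom_rhou|by momt].
rewrite ExD; [|exact: mom_cst|by momt].
rewrite Ex_cst ExZ; last by momt.
by rewrite lerD2l ler_wpM2l.
Qed.

Lemma nsq_xu_le w : nsq (xu w) <= 2^-1 * M2 + 2 * lam1 * nsq (Wu s w).
Proof.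
rewrite /xu; apply: le_trans (nsqD_le _ _) _; rewrite nsqZ zt2.
have h1 := hdl (Uu s w); have h2 := hA1 (Uu s w) (Wu s w); lra.
Qed.

Let mW2 : mom P (fun w => nsq (Wu s w)). Proof. by apply: mom_nsq => k; exact: (mom_Wv hF (@hWu s)). Qed.

Lemma Ex_nsq_xu : Ex (fun w => nsq (xu w)) <= 2^-1 * M2 + 2 * lam1 * (gv2 * p%:R).
Proof.
apply: (@le_trans _ _ (Ex (fun w => 2^-1 * M2 + 2 * lam1 * nsq (Wu s w)))).
  apply: Ex_le; [by apply: mom_nsq => k; exact: mom_xu|by momt|exact: nsq_xu_le].
rewrite ExD; [|exact: mom_cst|by momt].
by rewrite Ex_cst ExZ // (Ex_nsqW hF (@hWu s)).
Qed.

Definition cst_x := 2^-1 * M2 * cst_rho + (2 + 2 * (M2 * Cg)) * lam1 * gv2 + 4 * lam1 * (gw4 R * (lam1 * Cg)).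

Lemma Ex_rho_x_sq : (0 < p)%N -> Ex (fun w => rhou w ^+ 2 * nsq (xu w)) <= cst_x * p%:R.
Proof.
move=> p0; have v3 := mom_dotW hF (@hWu s) (svec ba).
have mr := mom_rhou.
have mx : mom P (fun w => nsq (xu w)) by apply: mom_nsq => k; exact: mom_xu.
pose k1 := 1 + M2 * Cg.
apply: (@le_trans _ _ (Ex (fun w => 2^-1 * M2 * rhou w ^+ 2 + (2 * k1 * lam1 * nsq (Wu s w)
    + 4 * lam1 * (dot (a_ (Uu s w)) (Wu s w) ^+ 2 * nsq (Wu s w)))))).
  apply: Ex_le; [by momt|by momt|move=> w].
  have h1 := nsq_xu_le w; have h2 := hrho w; have h3 := sqr_ge0 (rhou w).
  have h4 := nsq_ge0 (Wu s w).
  apply: (@le_trans _ _ (rhou w ^+ 2 * (2^-1 * M2 + 2 * lam1 * nsq (Wu s w)))); first by rewrite ler_wpM2l.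
  rewrite mulrDr [rhou w ^+ 2 * (2^-1 * M2)]mulrC lerD2l.
  apply: (@le_trans _ _ ((k1 + 2 * dot (a_ (Uu s w)) (Wu s w) ^+ 2) * (2 * lam1 * nsq (Wu s w)))).
    by rewrite ler_wpM2r // mulr_ge0 // mulr_ge0 // ltW.
  by rewrite le_eqVlt; apply/orP; left; apply/eqP; ring.
rewrite ExD; [|by momt|by momt].
rewrite ExD; [|by momt|by momt].
rewrite !ExZ; [|by momt..].
rewrite (Ex_nsqW hF (@hWu s)).
have h1 := Ex_rhou_sq.
have h2 := Ex_dotW4 hF (@wsu_inj s) (@wsu_S s) (@hWu s) (svec ba).
have h3 : Ex (fun w => nsq (a_ (Uu s w))) <= lam1 * Cg.
  rewrite -(Ex_cst P (lam1 * Cg)); apply: Ex_le; [|exact: mom_cst|by move=> w].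
  by apply: (@momU s (fun u => nsq (a_ u))); apply: bm_nsq => k; exact: ba.
have w40 : 0 <= gw4 R by rewrite addr_ge0 ?gv4_ge0 // sqr_ge0.
have p1 : 1 <= p%:R :> R by rewrite ler1n.
have cr0 : 0 <= cst_rho by apply: le_trans h1; apply: Ex_ge0 => w; exact: sqr_ge0.
have -> : cst_x * p%:R = 2^-1 * M2 * cst_rho * p%:R + ((2 + 2 * (M2 * Cg)) * lam1 * gv2 * p%:R
    + 4 * lam1 * (gw4 R * (lam1 * Cg)) * p%:R) by rewrite /cst_x; ring.
apply: lerD; last apply: lerD.
- apply: (@le_trans _ _ (2^-1 * M2 * cst_rho)); first by rewrite ler_wpM2l // mulr_ge0.
  by rewrite ler_peMr // !mulr_ge0.
- by rewrite le_eqVlt; apply/orP; left; apply/eqP; rewrite /k1; ring.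
- rewrite -[leRHS]mulrA ler_wpM2l ?mulr_ge0 ?(ltW l10) //; apply: le_trans h2 _.
  by rewrite [leRHS]mulrAC ler_wpM2l // mulr_ge0.
Qed.

End WithDirection.
End OneUnit.

Lemma outerE k (v : 'cV[R]_k) i j : (v *m v^T) i j = v i 0 * v j 0.
Proof. by rewrite mxE big_ord1 mxE. Qed.

Lemma nsq_colE a b (G : 'M[R]_(a, b)) j : nsq (col j G) = \sum_i G i j ^+ 2.
Proof. by apply: eq_bigr => i _; rewrite mxE. Qed.

Lemma dot_row_mulmx (G : 'M[R]_(p, L)) b j : (G *m b) j 0 = dot (row j G)^T b.
Proof. by rewrite !mxE; apply: eq_bigr => a _; rewrite !mxE. Qed.

Lemma bm_GB (G : 'M[R]_(p, L)) j : bm (fun u => (G *m Bf u) j 0).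
Proof. by under eq_fun do rewrite mxE; bmt. Qed.

Lemma EU_nsq_GB (G : 'M[R]_(p, L)) :
  g0 * fsq G <= EU (fun u => nsq (G *m Bf u)) <= g1 * fsq G.
Proof.
have mm j : mom P (fun w => dot (row j G)^T (Bf (U0 w)) ^+ 2).
  by apply: (@mom_bm _ _ _ P U0 (fun u => dot (row j G)^T (Bf u) ^+ 2)) => //; bmt.
have -> : EU (fun u => nsq (G *m Bf u)) = \sum_j EU (fun u => dot (row j G)^T (Bf u) ^+ 2).
  by rewrite -Ex_sum //; congr Eexp; apply/funext => w; apply: eq_bigr => j _; rewrite dot_row_mulmx.
have -> : fsq G = \sum_j nsq (row j G)^T.
  by apply: eq_bigr => j _; apply: eq_bigr => a _; rewrite !mxE.
by rewrite !mulr_sumr; apply/andP; split; apply: ler_sum => j _.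
Qed.

Definition zt0 (w : T) : R := Zlab (Y0 w == 1).
Definition Kp (w : T) : 'cV[R]_(p * L) := kron (xu (inr tt) zt0 w) (Bf (U0 w)).
Definition Dp : 'M[R]_(p * L) := mxExp P (fun w => Kp w *m (Kp w)^T).
Definition gamp : 'cV[R]_(p * L) := invmx Dp *m mxExp P (fun w => zt0 w *: Kp w).
Definition Gam : 'M[R]_(p, L) := vec_mx gamp^T.
Definition gt (u : R) : 'cV[R]_p := Gam *m Bf u.

Lemma Zlab_sq b : Zlab b ^+ 2 = 4^-1 :> R.
Proof. by rewrite /Zlab; case: b; rewrite /=; field. Qed.

Lemma zt0_sq w : zt0 w ^+ 2 = 4^-1. Proof. exact: Zlab_sq. Qed.

Lemma msig_zt0 : msig F [set None]%SET zt0.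
Proof.
have m1 : measurable_fun setT (fun y : R => Zlab (y == 1) : R).
  apply: measurable_funB => //; rewrite (_ : (fun y => _) = \1_[set 1]); first exact: measurable_indic.
  apply/funext => y; rewrite indicE; congr (nat_of_bool _)%:R.
  by apply/eqP/idP => [->|]; [rewrite inE|rewrite inE].
apply: (measurableT_comp m1); apply: (@msig_coord _ _ _ _ F _ None); exact: finset.set11.
Qed.

Let mom_K k : mom P (fun w => Kp w k 0).
Proof.
case/mxvec_indexP: k => j a; under eq_fun do rewrite /Kp kronE.
by apply: momM; [exact: (mom_xu (inr tt) msig_zt0 zt0_sq)|exact: (mom_bm P mU0 (bB a))].
Qed.

Lemma Dp_mul v : Dp *m v = \col_k Ex (fun w => Kp w k 0 * dot (Kp w) v).
Proof.
apply/colP => k; rewrite !mxE.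
have e l : Dp k l = Ex (fun w => Kp w k 0 * Kp w l 0).
  by rewrite /Dp mxE; congr Eexp; apply/funext => w; rewrite outerE.
rewrite (eq_bigr (fun l => Ex (fun w => Kp w k 0 * Kp w l 0 * v l 0))); last first.
  by move=> l _; rewrite e ExZr //; exact: momM.
rewrite -Ex_sum; last by move=> l; apply: momM => //; [exact: momM|exact: mom_cst].
by congr Eexp; apply/funext => w; rewrite mulr_sumr; apply: eq_bigr => l _; rewrite mulrA.
Qed.

Let momKv v : mom P (fun w => dot (Kp w) v).
Proof. by apply: mom_dot => k; [exact: mom_K|exact: mom_cst]. Qed.

Lemma Dp_form v : dot v (Dp *m v) = Ex (fun w => dot (Kp w) v ^+ 2).
Proof.
rewrite Dp_mul {1}/dot.
rewrite (eq_bigr (fun k => Ex (fun w => v k 0 * (Kp w k 0 * dot (Kp w) v)))); last first.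
  by move=> k _; rewrite mxE ExZ //; exact: momM.
rewrite -Ex_sum; last by move=> k; apply: momM; [exact: mom_cst|exact: momM].
congr Eexp; apply/funext => w; rewrite expr2 {2}/dot mulr_suml; apply: eq_bigr => k _; ring.
Qed.

Definition kapP := gv2 * lam0 * g0.
Let kapP0 : 0 < kapP. Proof. by rewrite !mulr_gt0 ?gv2_gt0. Qed.

Lemma Dp_posdef v : kapP * nsq v <= dot v (Dp *m v).
Proof.
rewrite Dp_form; set G := vec_mx v^T.
have bG : forall k, bm (fun u => (G *m Bf u) k 0) by move=> k; exact: bm_GB.
under eq_fun do rewrite /Kp dot_kron -/G.
have := Ex_dot_xu_sq (inr tt) msig_zt0 zt0_sq bG => /= ->.
have /andP[h1 _] := EU_nsq_GB G; rewrite nsq_vec -/G /kapP -mulrA.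
have mG : mom P (fun w => nsq (G *m Bf (U0 w))) by apply: (@mom_bm _ _ _ P U0 (fun u => nsq (G *m Bf u))) => //; bmt.
apply: (@le_trans _ _ (EU (fun u => gv2 * lam0 * nsq (G *m Bf u)))).
  by rewrite ExZ // ler_wpM2l // mulr_ge0 // ltW // gv2_gt0.
apply: Ex_le; [by momt| |].
  apply: (@mom_bm _ _ _ P U0 (fun u => 4^-1 * dot (dl u) (G *m Bf u) ^+ 2 + gv2 * nsq ((Ac u)^T *m (G *m Bf u)))) => //.
  have bt := bm_trA; bmt.
move=> w; rewrite -[leLHS]add0r; apply: lerD; first by rewrite mulr_ge0 ?sqr_ge0 ?invr_ge0.
by rewrite -mulrA ler_wpM2l ?(ltW gv2_gt0).
Qed.

Lemma gamp_normal : Dp *m gamp = mxExp P (fun w => zt0 w *: Kp w).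
Proof. by rewrite mulKVmx //; exact: (posdef_unit kapP0 Dp_posdef). Qed.

Let bgt k : bm (fun u => gt u k 0). Proof. exact: bm_GB. Qed.

Lemma gt_orthogonal j a :
  EU (fun u => (4^-1 * (1 - dot (dl u) (gt u)) * dl u j 0 - gv2 * (Ac u *m ((Ac u)^T *m gt u)) j 0) * Bf u a 0) = 0.
Proof.
rewrite -(score_mean (inr tt) msig_zt0 zt0_sq bgt j (bB a)).
have h : Ex (fun w => Kp w (mxvec_index j a) 0 * dot (Kp w) gamp) = Ex (fun w => zt0 w * Kp w (mxvec_index j a) 0).
  have /colP/(_ (mxvec_index j a)) := gamp_normal; rewrite Dp_mul !mxE => ->.
  by congr Eexp; apply/funext => w; rewrite mxE.
have mz : mom P zt0.
  apply: (@mom_bounded _ _ _ P _ 1); first exact: (msig_meas hF.1 msig_zt0).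
  move=> w; rewrite /zt0 /Zlab; case: (_ == _) => /=; rewrite ler_norml; lra.
have -> : (fun w => rhou (inr tt) zt0 gt w * xu (inr tt) zt0 w j 0 * Bf (Uu (inr tt) w) a 0)
   = (fun w => zt0 w * Kp w (mxvec_index j a) 0 - Kp w (mxvec_index j a) 0 * dot (Kp w) gamp).
  by apply/funext => w; rewrite /rhou /Kp kronE dot_kron -/Gam -/(gt _) /=; ring.
by rewrite ExB ?h ?subrr //; apply: momM.
Qed.

Definition Vf u (v v' : 'cV[R]_p) := 4^-1 * dot (dl u) v * dot (dl u) v' + gv2 * dot ((Ac u)^T *m v) ((Ac u)^T *m v').
Definition LamV := 4^-1 * M2 + gv2 * lam1.

Lemma VfC u v v' : Vf u v v' = Vf u v' v.
Proof. by rewrite /Vf (dotC ((Ac u)^T *m v)); ring. Qed.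

Lemma Vf_sumr u v (I' : finType) (y : I' -> R) (G : I' -> 'cV[R]_p) :
  Vf u v (\sum_b y b *: G b) = \sum_b y b * Vf u v (G b).
Proof.
rewrite /Vf mulmx_sumr !dot_sumr !mulr_sumr -big_split; apply: eq_bigr => b _ /=.
by rewrite -scalemxAr !dotZr; ring.
Qed.

Lemma Vf_le u v v' : `|Vf u v v'| <= LamV * (Num.sqrt (nsq v) * Num.sqrt (nsq v')).
Proof.
have cs k (x z : 'cV[R]_k) : `|dot x z| <= Num.sqrt (nsq x) * Num.sqrt (nsq z).
  rewrite -sqrtrM ?nsq_ge0 // -(@ler_pXn2r _ 2) ?nnegrE // real_normK ?num_real //.
  by rewrite sqr_sqrtr ?mulr_ge0 ?nsq_ge0 //; exact: cauchy_schwarz.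
have s1 (v1 : 'cV[R]_p) : `|dot (dl u) v1| <= Num.sqrt M2 * Num.sqrt (nsq v1).
  by apply: le_trans (cs _ _ _) _; rewrite ler_wpM2r // ler_sqrt // hdl.
have s2 (v1 : 'cV[R]_p) : Num.sqrt (nsq ((Ac u)^T *m v1)) <= Num.sqrt lam1 * Num.sqrt (nsq v1).
  by rewrite -sqrtrM ?(ltW l10) // ler_sqrt ?hA2 // mulr_ge0 ?nsq_ge0 // ltW.
apply: le_trans (ler_normD _ _) _; rewrite /LamV mulrDl; apply: lerD.
  rewrite !normrM ger0_norm ?invr_ge0 // -!mulrA ler_wpM2l ?invr_ge0 //.
  rewrite -[X in _ <= X * _](sqr_sqrtr M20) expr2 mulrACA; exact: ler_pM.
rewrite normrM ger0_norm ?(ltW gv2_gt0) // -mulrA ler_wpM2l ?(ltW gv2_gt0) //.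
apply: le_trans (cs _ _ _) _; rewrite -[X in _ <= X * _](sqr_sqrtr (ltW l10)) expr2 mulrACA; exact: ler_pM.
Qed.

Lemma gt_orthogonalV v a : EU (fun u => Vf u v (gt u) * Bf u a 0) = EU (fun u => 4^-1 * dot (dl u) v * Bf u a 0).
Proof.
have bt := bm_trA.
have m1 : mom P (fun w => Vf (U0 w) v (gt (U0 w)) * Bf (U0 w) a 0).
  apply: (@mom_bm _ _ _ P U0 (fun u => Vf u v (gt u) * Bf u a 0)) => //; rewrite /Vf; bmt.
have m2 : mom P (fun w => 4^-1 * dot (dl (U0 w)) v * Bf (U0 w) a 0).
  apply: (@mom_bm _ _ _ P U0 (fun u => 4^-1 * dot (dl u) v * Bf u a 0)) => //; bmt.
apply/eqP; rewrite eq_sym -subr_eq0 -ExB //; apply/eqP.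
transitivity (\sum_j v j 0 * EU (fun u => (4^-1 * (1 - dot (dl u) (gt u)) * dl u j 0
   - gv2 * (Ac u *m ((Ac u)^T *m gt u)) j 0) * Bf u a 0)); last first.
  by rewrite big1 // => j _; rewrite gt_orthogonal mulr0.
have mj j : mom P (fun w => (4^-1 * (1 - dot (dl (U0 w)) (gt (U0 w))) * dl (U0 w) j 0
   - gv2 * (Ac (U0 w) *m ((Ac (U0 w))^T *m gt (U0 w))) j 0) * Bf (U0 w) a 0).
  apply: (@mom_bm _ _ _ P U0 (fun u => (4^-1 * (1 - dot (dl u) (gt u)) * dl u j 0
   - gv2 * (Ac u *m ((Ac u)^T *m gt u)) j 0) * Bf u a 0)) => //; bmt.
under eq_bigr do rewrite -ExZ //.
rewrite -Ex_sum; last by move=> j; apply: momM => //; exact: mom_cst.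
congr Eexp; apply/funext => w; set u := U0 w.
have -> : \sum_j v j 0 * ((4^-1 * (1 - dot (dl u) (gt u)) * dl u j 0 - gv2 * (Ac u *m ((Ac u)^T *m gt u)) j 0) * Bf u a 0)
   = (4^-1 * (1 - dot (dl u) (gt u)) * dot (dl u) v - gv2 * dot v (Ac u *m ((Ac u)^T *m gt u))) * Bf u a 0.
  by rewrite /dot !mulr_sumr -sumrB mulr_suml; apply: eq_bigr => j _; ring.
by rewrite dot_mulmxr /Vf; ring.
Qed.

Section Agmon.
Variable k : 'I_L.
Definition epsA := kapP / (LamV * g1 + 1).
Definition rA := agmon_ratio m epsA.
Let LamV0 : 0 <= LamV. Proof. by rewrite addr_ge0 // mulr_ge0 ?invr_ge0 // ltW // gv2_gt0. Qed.
Let den0 : 0 < LamV * g1 + 1. Proof. by rewrite ltr_wpDl // mulr_ge0 // ltW. Qed.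
Let eps0 : 0 < epsA. Proof. exact: divr_gt0. Qed.
Let rA01 : 0 < rA < 1. Proof. by case: (agmon_ratioP m0 eps0). Qed.
Let sa (a : 'I_L) : R := rA ^+ ndist a k.
Let sa0 a : 0 < sa a. Proof. by apply: exprn_gt0; case/andP: rA01. Qed.
Let Ga a : 'cV[R]_p := col a Gam.
Let ta a : R := sa a * Num.sqrt (nsq (Ga a)).
Let Gs : 'M[R]_(p, L) := \matrix_(j, a) (sa a * Gam j a).
Let tv : 'cV[R]_L := \col_a ta a.

Let ta0 a : 0 <= ta a. Proof. by rewrite mulr_ge0 // ltW. Qed.

Let sa_close (a b : 'I_L) : (ndist a b <= m)%N -> (sa a - sa b) ^+ 2 <= epsA * (sa a * sa b).
Proof.
wlog ba : a b / (ndist b k <= ndist a k)%N.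
  move=> wl ab; case: (leqP (ndist b k) (ndist a k)) => h; first exact: wl.
  by rewrite -sqrrN opprB [sa a * _]mulrC; apply: wl; [exact: ltnW|move: ab; rewrite /ndist addnC].
move=> ab; have [_ hs] := agmon_ratioP m0 eps0.
have ds : (ndist a k - ndist b k <= m)%N by move: ab; rewrite /ndist; clear; lia.
have -> : sa a = rA ^+ (ndist a k - ndist b k) * sa b by rewrite /sa -exprD subnK.
have := hs _ ds; rewrite -/rA; move: (rA ^+ _) => y hy.
have -> : (y * sa b - sa b) ^+ 2 = (1 - y) ^+ 2 * sa b ^+ 2 by ring.
have -> : epsA * (y * sa b * sa b) = epsA * y * sa b ^+ 2 by ring.
by rewrite ler_wpM2r ?sqr_ge0.
Qed.

Let gtE u : gt u = \sum_b Bf u b 0 *: Ga b.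
Proof.
apply/colP => j; rewrite /gt mxE summxE; apply: eq_bigr => b _; by rewrite !mxE mulrC.
Qed.

Let GsE u : Gs *m Bf u = \sum_b (sa b * Bf u b 0) *: Ga b.
Proof.
apply/colP => j; rewrite mxE summxE; apply: eq_bigr => b _; rewrite !mxE; ring.
Qed.

Let fsq_Gs : fsq Gs = nsq tv.
Proof.
rewrite fsq_col; apply: eq_bigr => a _; rewrite mxE exprMn sqr_sqrtr ?nsq_ge0 // -nsqZ.
by apply: eq_bigr => j _; rewrite !mxE.
Qed.

(* [(s_a^2 + s_b^2) / 2 = s_a s_b + (s_a - s_b)^2 / 2], and the last term is at most [epsA s_a s_b]
   for overlapping basis functions: conjugating by the weights costs little. *)
Let pointwise u : gv2 * lam0 * nsq (Gs *m Bf u) - 2^-1 * epsA * LamV * dot tv (Bf u) ^+ 2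
  <= \sum_a sa a ^+ 2 * (Vf u (Ga a) (gt u) * Bf u a 0).
Proof.
pose v a b := Bf u a 0 * Bf u b 0 * Vf u (Ga a) (Ga b).
have vC a b : v a b = v b a by rewrite /v VfC; ring.
have e1 : \sum_a sa a ^+ 2 * (Vf u (Ga a) (gt u) * Bf u a 0) = \sum_a \sum_b sa a ^+ 2 * v a b.
  apply: eq_bigr => a _; rewrite gtE Vf_sumr mulr_suml mulr_sumr; apply: eq_bigr => b _; rewrite /v; ring.
have e2 : Vf u (Gs *m Bf u) (Gs *m Bf u) = \sum_a \sum_b sa a * sa b * v a b.
  rewrite GsE Vf_sumr; apply: eq_bigr => a _; rewrite VfC Vf_sumr mulr_sumr; apply: eq_bigr => b _.
  rewrite /v; ring.
have e3 : \sum_a \sum_b sa a ^+ 2 * v a b = \sum_a \sum_b sa a * sa b * v a b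
    + 2^-1 * \sum_a \sum_b (sa a - sa b) ^+ 2 * v a b.
  have ex : \sum_a \sum_b sa a ^+ 2 * v a b = \sum_a \sum_b sa b ^+ 2 * v a b.
    by rewrite exchange_big; apply: eq_bigr => a _; apply: eq_bigr => b _; rewrite vC.
  have : \sum_a \sum_b (sa a - sa b) ^+ 2 * v a b = \sum_a \sum_b sa a ^+ 2 * v a b
     + \sum_a \sum_b sa b ^+ 2 * v a b - 2 * \sum_a \sum_b sa a * sa b * v a b.
    rewrite mulr_sumr -!big_split -sumrB; apply: eq_bigr => a _ /=.
    rewrite mulr_sumr -!big_split -sumrB; apply: eq_bigr => b _ /=; ring.
  move: ex => <-; move: (\sum_a _) (\sum_a _) (\sum_a _) => x y z ->; lra.
have e4 : gv2 * lam0 * nsq (Gs *m Bf u) <= Vf u (Gs *m Bf u) (Gs *m Bf u).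
  rewrite /Vf dotvv -[leLHS]add0r; apply: lerD; first by rewrite -mulrA -expr2 mulr_ge0 ?sqr_ge0 ?invr_ge0.
  by rewrite -mulrA ler_wpM2l ?(ltW gv2_gt0).
have e5 : dot tv (Bf u) ^+ 2 = \sum_a \sum_b ta a * ta b * (Bf u a 0 * Bf u b 0).
  rewrite expr2 /dot mulr_suml; apply: eq_bigr => a _; rewrite mulr_sumr; apply: eq_bigr => b _.
  by rewrite !mxE; ring.
have e6 : - (epsA * LamV * dot tv (Bf u) ^+ 2) <= \sum_a \sum_b (sa a - sa b) ^+ 2 * v a b.
  rewrite e5 mulr_sumr -sumrN; apply: ler_sum => a _; rewrite mulr_sumr -sumrN; apply: ler_sum => b _.
  have BB : 0 <= Bf u a 0 * Bf u b 0 by exact: mulr_ge0.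
  have [z|nz] := eqVneq (Bf u a 0 * Bf u b 0) 0; first by rewrite /v z mul0r !mulr0 oppr0.
  have close : (ndist a b <= m)%N.
    rewrite /ndist; case: (leqP (a + m) b) => h1; first by move: nz; rewrite B_ov ?eqxx.
    case: (leqP (b + m) a) => h2; first by move: nz; rewrite mulrC B_ov ?eqxx.
    by move: h1 h2; clear; lia.
  have h1 := sa_close close; have /ler_normlP[h2 _] := Vf_le u (Ga a) (Ga b).
  have q0 : 0 <= LamV * (Num.sqrt (nsq (Ga a)) * Num.sqrt (nsq (Ga b))) by rewrite !mulr_ge0.
  have -> : epsA * LamV * (ta a * ta b * (Bf u a 0 * Bf u b 0))
     = epsA * (sa a * sa b) * (Bf u a 0 * Bf u b 0 * (LamV * (Num.sqrt (nsq (Ga a)) * Num.sqrt (nsq (Ga b))))).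
    by rewrite /ta; ring.
  rewrite /v; move: (Bf u a 0 * Bf u b 0) (LamV * _) (Vf _ _ _) (epsA * _) ((sa a - sa b) ^+ 2) (sqr_ge0 (sa a - sa b)) BB q0 h1 h2.
  move=> B V1 V2 E S S0 BB V10 SE VV.
  have h3 : S * (B * - V2) <= E * (B * V1).
    apply: (@le_trans _ _ (S * (B * V1))); first by rewrite ler_wpM2l // ler_wpM2l.
    by rewrite ler_wpM2r // mulr_ge0.
  by move: h3; rewrite !mulrN; lra.
rewrite e1 e3 -e2; move: e4 e6; move: (\sum_a _) (Vf _ _ _) (nsq _) (dot _ _ ^+ 2) => x y z t; lra.
Qed.

Definition c2A := 4^-1 * Num.sqrt M2 * g1.
Definition sumA := 2 / (1 - rA ^+ 2).

(* The weight equals one at [k] and has bounded sum, so the weighted energy bounds column [k]. *)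
Lemma col_Gam_le : nsq (col k Gam) <= 4 * c2A ^+ 2 / kapP ^+ 2 * sumA / L%:R.
Proof.
have bt := bm_trA.
have LR : 0 < L%:R :> R by rewrite ltr0n.
have mV a : mom P (fun w => Vf (U0 w) (Ga a) (gt (U0 w)) * Bf (U0 w) a 0).
  apply: (@mom_bm _ _ _ P U0 (fun u => Vf u (Ga a) (gt u) * Bf u a 0)) => //; rewrite /Vf; bmt.
have mG : mom P (fun w => nsq (Gs *m Bf (U0 w))).
  by have bG := bm_GB Gs; apply: (@mom_bm _ _ _ P U0 (fun u => nsq (Gs *m Bf u))) => //; bmt.
have mt : mom P (fun w => dot tv (Bf (U0 w)) ^+ 2).
  by apply: (@mom_bm _ _ _ P U0 (fun u => dot tv (Bf u) ^+ 2)) => //; bmt.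
have E1 : gv2 * lam0 * EU (fun u => nsq (Gs *m Bf u)) - 2^-1 * epsA * LamV * EU (fun u => dot tv (Bf u) ^+ 2)
   <= \sum_a sa a ^+ 2 * EU (fun u => 4^-1 * dot (dl u) (Ga a) * Bf u a 0).
  under eq_bigr do rewrite -gt_orthogonalV -ExZ //.
  rewrite -Ex_sum; last by move=> a; apply: momM => //; exact: mom_cst.
  have -> : gv2 * lam0 * EU (fun u => nsq (Gs *m Bf u)) - 2^-1 * epsA * LamV * EU (fun u => dot tv (Bf u) ^+ 2)
     = EU (fun u => gv2 * lam0 * nsq (Gs *m Bf u) - 2^-1 * epsA * LamV * dot tv (Bf u) ^+ 2).
    by rewrite ExB; [rewrite !ExZ //|apply: momM => //; exact: mom_cst..].
  apply: Ex_le; [by apply: momB; apply: momM => //; exact: mom_cst| |by move=> w; exact: pointwise].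
  by apply: mom_sum => a; apply: momM => //; exact: mom_cst.
have /andP[E2 _] := EU_nsq_GB Gs; have E3 := hgu tv; rewrite fsq_Gs in E2.
set X := nsq tv in E2 E3.
have X0 : 0 <= X by exact: nsq_ge0.
have E4 : 2^-1 * kapP * X <= gv2 * lam0 * EU (fun u => nsq (Gs *m Bf u)) - 2^-1 * epsA * LamV * EU (fun u => dot tv (Bf u) ^+ 2).
  have h1 : kapP * X <= gv2 * lam0 * EU (fun u => nsq (Gs *m Bf u)).
    by rewrite /kapP -mulrA ler_wpM2l // mulr_ge0 // ltW // gv2_gt0.
  have h2 : epsA * LamV * EU (fun u => dot tv (Bf u) ^+ 2) <= kapP * X.
    apply: (@le_trans _ _ (epsA * LamV * (g1 * X))); first by rewrite ler_wpM2l // mulr_ge0 // ltW.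
    rewrite mulrA ler_wpM2r // /epsA -mulrA mulrAC ler_pdivrMr // ler_wpM2l ?(ltW kapP0) //.
    by rewrite lerDl.
  by move: h1 h2; lra.
have E5 a : sa a ^+ 2 * EU (fun u => 4^-1 * dot (dl u) (Ga a) * Bf u a 0)
   <= 4^-1 * kapP * ta a ^+ 2 + c2A ^+ 2 / kapP * (sa a ^+ 2) / L%:R.
  have q1 : EU (fun u => 4^-1 * dot (dl u) (Ga a) * Bf u a 0)
      <= c2A / Num.sqrt L%:R * Num.sqrt (nsq (Ga a)).
    apply: (@le_trans _ _ (EU (fun u => 4^-1 * (Num.sqrt M2 * Num.sqrt (nsq (Ga a))) * Bf u a 0))).
      apply: Ex_le.
      - apply: (@mom_bm _ _ _ P U0 (fun u => 4^-1 * dot (dl u) (Ga a) * Bf u a 0)) => //; bmt.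
      - by apply: momM; [exact: mom_cst|exact: (mom_bm P mU0 (bB a))].
      - move=> w; rewrite ler_wpM2r // ler_wpM2l ?invr_ge0 //; apply: le_trans (ler_norm _) _.
        rewrite -sqrtrM // -(@ler_pXn2r _ 2) ?nnegrE // real_normK ?num_real // sqr_sqrtr ?mulr_ge0 ?nsq_ge0 //.
        by apply: le_trans (cauchy_schwarz _ _) _; rewrite ler_wpM2r ?nsq_ge0.
    rewrite ExZ; last exact: (mom_bm P mU0 (bB a)).
    have -> : c2A / Num.sqrt L%:R * Num.sqrt (nsq (Ga a)) = 4^-1 * (Num.sqrt M2 * Num.sqrt (nsq (Ga a))) * (g1 / Num.sqrt L%:R).
      by rewrite /c2A; ring.
    by rewrite ler_wpM2l // ?mulr_ge0 ?invr_ge0 // hgb.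
  apply: (@le_trans _ _ (sa a ^+ 2 * (c2A / Num.sqrt L%:R * Num.sqrt (nsq (Ga a))))).
    by rewrite ler_wpM2l ?sqr_ge0.
  have -> : sa a ^+ 2 * (c2A / Num.sqrt L%:R * Num.sqrt (nsq (Ga a))) = ta a * (c2A * sa a / Num.sqrt L%:R).
    by rewrite /ta; ring.
  have -> : c2A ^+ 2 / kapP * sa a ^+ 2 / L%:R = kapP^-1 * (c2A * sa a / Num.sqrt L%:R) ^+ 2.
    by move: (sa a) c2A => s' c'; rewrite !exprMn exprVn sqr_sqrtr ?(ltW LR) //; ring.
  move: (ta a) (c2A * sa a / Num.sqrt L%:R) => x z.
  have : 0 <= kapP^-1 * (2^-1 * kapP * x - z) ^+ 2 by rewrite mulr_ge0 ?sqr_ge0 // invr_ge0 ltW.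
  have -> : kapP^-1 * (2^-1 * kapP * x - z) ^+ 2 = 4^-1 * kapP * x ^+ 2 - x * z + kapP^-1 * z ^+ 2.
    by field; rewrite gt_eqF.
  by lra.
have E6 : \sum_a sa a ^+ 2 <= sumA.
  have rr : 0 <= rA ^+ 2 < 1.
    case/andP: rA01 => r0 r1; rewrite sqr_ge0 /= expr2; nra.
  case/andP: rr => rr0 rr1; apply: le_trans (sum_ndist_le L k rr0 rr1).
  by apply: ler_sum => a _; rewrite /sa -!exprM mulnC.
have E7 : 2^-1 * kapP * X <= 4^-1 * kapP * X + c2A ^+ 2 / kapP * sumA / L%:R.
  apply: (le_trans E4); apply: (le_trans E1).
  apply: (le_trans (ler_sum _ (fun a _ => E5 a))).
  rewrite big_split /= -mulr_sumr; apply: lerD.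
    by rewrite le_eqVlt; apply/orP; left; apply/eqP; congr (_ * _); apply: eq_bigr => a _; rewrite mxE.
  rewrite -!mulr_suml -mulr_sumr ler_pM2r ?invr_gt0 // ler_wpM2l //.
  by rewrite divr_ge0 ?sqr_ge0 // ltW.
have E8 : nsq (col k Gam) <= X.
  rewrite /X /nsq (bigD1 k) //= mxE /ta {1}/sa /ndist subnn expr0 mul1r sqr_sqrtr ?nsq_ge0 //.
  by rewrite lerDl; apply: sumr_ge0 => a _; exact: sqr_ge0.
apply: (le_trans E8).
rewrite -(ler_pM2l kapP0) -(@ler_pM2l _ 4^-1) ?invr_gt0 //.
have -> : 4^-1 * (kapP * (4 * c2A ^+ 2 / kapP ^+ 2 * sumA / L%:R)) = c2A ^+ 2 / kapP * sumA / L%:R.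
  by field; rewrite !gt_eqF.
by move: E7; lra.
Qed.

End Agmon.

Definition Cgt := 4 * c2A ^+ 2 / kapP ^+ 2 * sumA.

Lemma gt_sup u : nsq (gt u) <= Cgt.
Proof.
have LR : 0 < L%:R :> R by rewrite ltr0n.
have h a : nsq (col a Gam) <= Cgt / L%:R by exact: col_Gam_le.
have C0 : 0 <= Cgt / L%:R by apply: le_trans (h (Ordinal L0)); exact: nsq_ge0.
have -> : nsq (gt u) = \sum_j (\sum_a Gam j a * Bf u a 0) ^+ 2 by apply: eq_bigr => j _; rewrite mxE.
apply: (@le_trans _ _ (\sum_j (\sum_a Gam j a ^+ 2 * Bf u a 0) * Num.sqrt L%:R)).
  apply: ler_sum => j _.
  have := cauchy_schwarz_sum xpredT (fun a => Gam j a * Num.sqrt (Bf u a 0)) (fun a => Num.sqrt (Bf u a 0)).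
  under eq_bigr do rewrite -mulrA -expr2 sqr_sqrtr //.
  move/le_trans; apply.
  under eq_bigr do rewrite exprMn sqr_sqrtr //.
  under [X in _ * X <= _]eq_bigr do rewrite sqr_sqrtr //.
  by rewrite ler_wpM2l //; apply: sumr_ge0 => a _; rewrite mulr_ge0 // sqr_ge0.
rewrite -mulr_suml exchange_big /=.
apply: (@le_trans _ _ ((\sum_a Cgt / L%:R * Bf u a 0) * Num.sqrt L%:R)).
  rewrite ler_wpM2r //; apply: ler_sum => a _; rewrite -mulr_suml ler_wpM2r //.
  by rewrite -nsq_colE.
rewrite -mulr_sumr -mulrA; apply: (@le_trans _ _ (Cgt / L%:R * (Num.sqrt L%:R * Num.sqrt L%:R))).
  by rewrite ler_wpM2l // ler_wpM2r.
by rewrite -expr2 sqr_sqrtr ?(ltW LR) // divfK // gt_eqF.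
Qed.

Lemma Cgt_ge0 : 0 <= Cgt. Proof. by apply: le_trans (gt_sup 0); exact: nsq_ge0. Qed.

Definition SU (i : 'I_N) : {set I} := [set Some (inl i, o) | o : option 'I_p]%SET.

Lemma SU_disj (i i' : 'I_N) j : i != i' -> j \in SU i -> j \notin SU i'.
Proof.
move=> ii' /finset.imsetP [q _ ->]; apply/finset.imsetP => -[q' _ [e _]].
by move: ii'; rewrite e eqxx.
Qed.

Lemma msig_U i f : bm f -> msig F (SU i) (fun w => f (U i w)).
Proof.
move=> bf; apply: (@msig_bm _ _ _ _ F _ (U i)) => //.
by apply: (@msig_coord _ _ _ _ F _ (Some (inl i, None))); apply/finset.imsetP; exists None.
Qed.

Lemma msig_W i k : msig F (SU i) (W i k).
Proof.
by apply: (@msig_coord _ _ _ _ F _ (Some (inl i, Some k))); apply/finset.imsetP; exists (Some k).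
Qed.

Section Variance.
Variables (J : finType) (Q : pred 'I_N) (xi : 'I_N -> J -> T -> R) (v : R).
Hypothesis mxi : forall i c, mom P (xi i c).
Hypothesis sxi : forall i c, msig F (SU i) (xi i c).
Hypothesis cxi : forall c, \sum_(i | Q i) Ex (xi i c) = 0.
Hypothesis vxi : forall i, Ex (fun w => \sum_c xi i c w ^+ 2) <= v.

Lemma var_sum : Ex (fun w => \sum_c (\sum_(i | Q i) xi i c w) ^+ 2) <= N%:R * v.
Proof.
rewrite Ex_sum; last by move=> c; momt.
have v0 i : 0 <= Ex (fun w => \sum_c xi i c w ^+ 2).
  by apply: Ex_ge0 => w; apply: sumr_ge0 => c _; exact: sqr_ge0.
apply: (@le_trans _ _ (\sum_c \sum_(i | Q i) Ex (fun w => xi i c w ^+ 2))); last first.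
  rewrite exchange_big /=; apply: (@le_trans _ _ (\sum_(i < N) v)).
    rewrite big_mkcond; apply: ler_sum => i _; case: ifP => _; last exact: le_trans (v0 i) (vxi i).
    by rewrite -Ex_sum // => c; exact: momX.
  by rewrite sumr_const card_ord mulr_natl.
apply: ler_sum => c _.
have -> : (fun w => (\sum_(i | Q i) xi i c w) ^+ 2) = (fun w => \sum_(i | Q i) \sum_(j | Q j) xi i c w * xi j c w).
  by apply/funext => w; rewrite expr2 mulr_suml; apply: eq_bigr => i _; rewrite mulr_sumr.
rewrite Ex_sum; last by move=> i; apply: mom_sum => j; exact: momM.
apply: (@le_trans _ _ (\sum_(i | Q i) (Ex (fun w => xi i c w ^+ 2) + Ex (xi i c) * \sum_(j | Q j) Ex (xi j c)))); last first.
  by rewrite cxi; under eq_bigr do rewrite mulr0 addr0.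
apply: ler_sum => i Qi; rewrite Ex_sum; last by move=> j; exact: momM.
rewrite mulr_sumr (bigD1 i) //= [X in _ <= _ + X](bigD1 i) //= addrA; apply: lerD.
  by under eq_fun do rewrite -expr2; rewrite lerDl -expr2 sqr_ge0.
apply: ler_sum => j /andP[_ ji]; rewrite (Ex_mul_indep hF (S := SU i) (S' := SU j)) // => l.
by apply: SU_disj; rewrite eq_sym.
Qed.

End Variance.

Lemma var_fsq a b (Q : pred 'I_N) (X : 'I_N -> T -> 'M[R]_(a, b)) (v : R) :
  (forall i j k, mom P (fun w => X i w j k)) -> (forall i j k, msig F (SU i) (fun w => X i w j k)) ->
  (forall j k, \sum_(i | Q i) Ex (fun w => X i w j k) = 0) ->
  (forall i, Ex (fun w => fsq (X i w)) <= v) ->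
  mom P (fun w => fsq (\sum_(i | Q i) X i w)) /\ Ex (fun w => fsq (\sum_(i | Q i) X i w)) <= N%:R * v.
Proof.
move=> mX sX cX vX.
have -> : (fun w => fsq (\sum_(i | Q i) X i w)) = (fun w => \sum_(c : 'I_a * 'I_b) (\sum_(i | Q i) X i w c.1 c.2) ^+ 2).
  apply/funext => w; rewrite /fsq pair_bigA /=; apply: eq_bigr => c _; by rewrite summxE.
split; first by apply: mom_sum => c; apply: momX; apply: mom_sum => i; exact: mX.
apply: (@var_sum _ Q (fun i (c : 'I_a * 'I_b) w => X i w c.1 c.2)) => //.
by move=> i; apply: le_trans (vX i); rewrite le_eqVlt; apply/orP; left; apply/eqP; congr Eexp; apply/funext => w; rewrite /fsq pair_bigA.
Qed.

Lemma markov_fsq a b (Q : pred 'I_N) (X : 'I_N -> T -> 'M[R]_(a, b)) (v t : R) :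
  (forall i j k, mom P (fun w => X i w j k)) -> (forall i j k, msig F (SU i) (fun w => X i w j k)) ->
  (forall j k, \sum_(i | Q i) Ex (fun w => X i w j k) = 0) ->
  (forall i, Ex (fun w => fsq (X i w)) <= v) -> 0 < t ->
  measurable [set w | t <= fsq (\sum_(i | Q i) X i w)] /\
  prob P [set w | t <= fsq (\sum_(i | Q i) X i w)] <= N%:R * v / t.
Proof.
move=> h1 h2 h3 h4 t0; have [m1 m2] := var_fsq h1 h2 h3 h4.
split; first exact: (measurable_ge t (mom_meas m1)).
apply: (le_trans (markov_ineq m1 _ t0)); first by move=> w; exact: fsq_ge0.
by rewrite ler_pM2r ?invr_gt0.
Qed.

Variable y : 'I_N -> bool.
Definition zi i : T -> R := fun=> Zlab (y i).
Definition xi_ i w : 'cV[R]_p := xu (inl i) (zi i) w.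
Definition rho_ i w : R := rhou (inl i) (zi i) gt w.
Definition Wc i w : 'cV[R]_p := \col_k W i k w.

Let szi i : msig F [set None]%SET (zi i). Proof. exact: measurable_cst. Qed.
Let zi2 i w : zi i w ^+ 2 = 4^-1. Proof. exact: Zlab_sq. Qed.

Lemma xiE i w : xi_ i w = Zlab (y i) *: dl (U i w) + Ac (U i w) *m Wc i w.
Proof. by []. Qed.

Lemma rhoE i w : rho_ i w = Zlab (y i) - dot (gt (U i w)) (xi_ i w).
Proof. by rewrite /rho_ /rhou dotC. Qed.

Let mU_ i : measurable_fun setT (U i). Proof. exact: (mUu (inl i)). Qed.
Let momUi i f : bm f -> mom P (fun w => f (U i w)). Proof. exact: (@momU (inl i)). Qed.
Let EUi i f : bm f -> Ex (fun w => f (U i w)) = EU f. Proof. exact: (@EUs (inl i)). Qed.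

Lemma mom_xi i j : mom P (fun w => xi_ i w j 0). Proof. exact: (mom_xu (inl i) (szi i) (zi2 i)). Qed.
Lemma mom_rho i : mom P (rho_ i). Proof. exact: (mom_rhou (inl i) (szi i) (zi2 i) bgt). Qed.

Lemma msig_AW i j : msig F (SU i) (fun w => (Ac (U i w) *m Wc i w) j 0).
Proof.
have -> : (fun w => (Ac (U i w) *m Wc i w) j 0) = (fun w => \sum_k Ac (U i w) j k * W i k w).
  by apply/funext => w; rewrite mxE; apply: eq_bigr => k _; rewrite mxE.
have -> : (fun w => \sum_k Ac (U i w) j k * W i k w) = (fun w => \sum_(k <- enum 'I_p) Ac (U i w) j k * W i k w).
  by apply/funext => w; rewrite big_enum.
by apply: measurable_sum => k; apply: measurable_funM; [exact: (msig_U (bA j k))|exact: msig_W].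
Qed.

Lemma mom_AW i j : mom P (fun w => (Ac (U i w) *m Wc i w) j 0).
Proof.
have -> : (fun w => (Ac (U i w) *m Wc i w) j 0) = (fun w => \sum_k Ac (U i w) j k * W i k w).
  by apply/funext => w; rewrite mxE; apply: eq_bigr => k _; rewrite mxE.
apply: mom_sum => k; apply: momM; [exact: (momUi i (bA j k))|exact: (mom_W hF (@hWu (inl i)) k)].
Qed.

Lemma msig_xi i j : msig F (SU i) (fun w => xi_ i w j 0).
Proof.
have -> : (fun w => xi_ i w j 0) = (fun w => Zlab (y i) * dl (U i w) j 0 + (Ac (U i w) *m Wc i w) j 0).
  by apply/funext => w; rewrite xiE !mxE.
by apply: measurable_funD; [apply: measurable_funM => //; exact: (msig_U (bdl j))|exact: msig_AW].
Qed.

Lemma msig_rho i : msig F (SU i) (rho_ i).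
Proof.
have -> : rho_ i = (fun w => Zlab (y i) - \sum_(k <- enum 'I_p) gt (U i w) k 0 * xi_ i w k 0).
  by apply/funext => w; rewrite rhoE /dot big_enum.
apply: measurable_funB => //; apply: measurable_sum => k; apply: measurable_funM.
  exact: (msig_U (bgt k)).
exact: msig_xi.
Qed.

Let msM (S : {set I}) f g : msig F S f -> msig F S g -> msig F S (fun w => f w * g w).
Proof. exact: measurable_funM. Qed.

Lemma fsq_outer a b (v : 'cV[R]_a) (v' : 'cV[R]_b) : fsq (v *m v'^T) = nsq v * nsq v'.
Proof.
rewrite /fsq /nsq mulr_suml; apply: eq_bigr => i _; rewrite mulr_sumr; apply: eq_bigr => j _.
by rewrite mxE big_ord1 mxE exprMn.
Qed.

Lemma outer2E a b (v : 'cV[R]_a) (v' : 'cV[R]_b) i j : (v *m v'^T) i j = v i 0 * v' j 0.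
Proof. by rewrite mxE big_ord1 mxE. Qed.

Let hB2 u : nsq (Bf u) ^+ 2 <= L%:R ^+ 2.
Proof. by rewrite lerXn2r ?nnegrE ?nsq_ge0. Qed.

Definition T1m w : 'M[R]_(p, L) := \sum_(i < N) rho_ i w *: (xi_ i w *m (Bf (U i w))^T).
Definition Rm w : 'M[R]_L := \sum_(i < N) rho_ i w *: (Bf (U i w) *m (Bf (U i w))^T).
Definition Gbar : 'M[R]_L := \matrix_(a, b) EU (fun u => Bf u a 0 * Bf u b 0).
Definition Gm cls w : 'M[R]_L := \sum_(i < N | y i == cls) (Bf (U i w) *m (Bf (U i w))^T - Gbar).
Definition Em cls w : 'M[R]_(L, p) := \sum_(i < N | y i == cls) Bf (U i w) *m (Ac (U i w) *m Wc i w)^T.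

Let crho := cst_rho Cgt.
Let cx := cst_x Cgt.

Let Erho i : Ex (fun w => rho_ i w ^+ 2) <= crho.
Proof. exact: (Ex_rhou_sq (inl i) (szi i) (zi2 i) bgt gt_sup). Qed.

Lemma T1_tail t : (0 < p)%N -> 0 < t ->
  measurable [set w | t <= fsq (T1m w)] /\
  prob P [set w | t <= fsq (T1m w)] <= N%:R * (L%:R * (cx * p%:R)) / t.
Proof.
move=> p0 t0; have e i j a : (fun w => (rho_ i w *: (xi_ i w *m (Bf (U i w))^T)) j a)
     = (fun w => rho_ i w * xi_ i w j 0 * Bf (U i w) a 0).
  by apply/funext => w; rewrite mxE outer2E mulrA.
have mr := mom_rho; have mx := mom_xi; have mb i a := momUi i (bB a).
apply: markov_fsq => //.
- by move=> i j a; rewrite e; momt.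
- by move=> i j a; rewrite e; apply: msM; [apply: msM; [exact: msig_rho|exact: msig_xi]|exact: (msig_U (bB a))].
- move=> j a; rewrite big1 // => i _; rewrite e.
  by have := score_mean (inl i) (szi i) (zi2 i) bgt j (bB a) => /= ->; exact: gt_orthogonal.
- move=> i; have := Ex_rho_x_sq (inl i) (szi i) (zi2 i) bgt gt_sup p0 => h.
  have mx2 : mom P (fun w => nsq (xi_ i w)) by apply: mom_nsq => k; exact: mx.
  apply: (@le_trans _ _ (L%:R * Ex (fun w => rho_ i w ^+ 2 * nsq (xi_ i w)))); last by rewrite ler_wpM2l ?ler0n.
  rewrite -ExZ; last by momt.
  apply: Ex_le.
  + apply: mom_sum => j; apply: mom_sum => a; apply: momX; rewrite e; by momt.
  + by momt.
  + move=> w; rewrite fsqZ fsq_outer mulrA [leRHS]mulrC ler_wpM2l // mulr_ge0 ?sqr_ge0 ?nsq_ge0 //.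
Qed.

Lemma Ex_rho_f i f : bm f -> Ex (fun w => rho_ i w * f (U i w)) = Zlab (y i) * EU (fun u => (1 - dot (dl u) (gt u)) * f u).
Proof.
move=> bf; pose a_ u := f u *: ((Ac u)^T *m gt u); have bt := bm_trA.
have ba k : bm (fun u => a_ u k 0) by under eq_fun do rewrite mxE; bmt.
have v1 : msigv P F (S0u (inl i)) (fun w => a_ (U i w)).
  move=> k; split; last exact: (momUi i (ba k)).
  by apply: (@msig_bm _ _ _ _ F _ (U i) (fun u => a_ u k 0)) => //; apply: (@msig_coord _ _ _ _ F _ (Some (inl i, None))); rewrite finset.in_setU1 finset.in_set1 eqxx.
have bc : bm (fun u => (1 - dot (dl u) (gt u)) * f u) by bmt.
have -> : (fun w => rho_ i w * f (U i w)) = (fun w => Zlab (y i) * ((1 - dot (dl (U i w)) (gt (U i w))) * f (U i w))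
     - dot (a_ (U i w)) (Wu (inl i) w)).
  by apply/funext => w; rewrite /rho_ rhouE /a_ dotZl /zi /=; ring.
have m1 := momUi i bc; have m2 := mom_dotW hF (@hWu (inl i)) v1.
rewrite ExB //; last by apply: momM => //; exact: mom_cst.
rewrite (Ex_dotW hF (@wsu_S (inl i)) (@hWu (inl i)) v1) subr0 ExZ // (EUi i bc) //.
Qed.

Hypothesis hbal : \sum_i Zlab (y i) = 0 :> R.

Lemma R_tail t : 0 < t ->
  measurable [set w | t <= fsq (Rm w)] /\ prob P [set w | t <= fsq (Rm w)] <= N%:R * (L%:R ^+ 2 * crho) / t.
Proof.
move=> t0; have e i a b : (fun w => (rho_ i w *: (Bf (U i w) *m (Bf (U i w))^T)) a b)
     = (fun w => rho_ i w * (Bf (U i w) a 0 * Bf (U i w) b 0)).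
  by apply/funext => w; rewrite mxE outer2E.
have mr := mom_rho; have mb i a := momUi i (bB a).
apply: markov_fsq => //.
- by move=> i a b; rewrite e; momt.
- by move=> i a b; rewrite e; apply: msM; [exact: msig_rho|apply: msM; [exact: (msig_U (bB a))|exact: (msig_U (bB b))]].
- move=> a b; under eq_bigr do rewrite e.
  have bb : bm (fun u => Bf u a 0 * Bf u b 0) by bmt.
  by under eq_bigr do rewrite (Ex_rho_f _ bb); rewrite -mulr_suml hbal mul0r.
- move=> i; apply: (@le_trans _ _ (L%:R ^+ 2 * Ex (fun w => rho_ i w ^+ 2))); last by rewrite ler_wpM2l ?sqr_ge0.
  rewrite -ExZ; last by momt.
  apply: Ex_le; [|by momt|].
  + apply: mom_sum => j; apply: mom_sum => a; apply: momX; rewrite e; by momt.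
  + by move=> w; rewrite fsqZ fsq_outer mulrC -expr2 ler_wpM2r ?sqr_ge0.
Qed.

Lemma rho_tail t : 0 < t ->
  measurable [set w | t <= \sum_i rho_ i w ^+ 2] /\ prob P [set w | t <= \sum_i rho_ i w ^+ 2] <= N%:R * crho / t.
Proof.
move=> t0; have mr := mom_rho; have m1 : mom P (fun w => \sum_i rho_ i w ^+ 2) by momt.
split; first exact: (measurable_ge t (mom_meas m1)).
apply: (le_trans (markov_ineq m1 _ t0)); first by move=> w; apply: sumr_ge0 => i _; exact: sqr_ge0.
rewrite ler_pM2r ?invr_gt0 // Ex_sum; last by move=> i; momt.
by rewrite mulr_natl -[X in _ *+ X](card_ord N) -sumr_const; apply: ler_sum => i _.
Qed.

Lemma x_tail t : 0 < t ->
  measurable [set w | t <= \sum_i nsq (xi_ i w)] /\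
  prob P [set w | t <= \sum_i nsq (xi_ i w)] <= N%:R * (2^-1 * M2 + 2 * lam1 * (gv2 * p%:R)) / t.
Proof.
move=> t0; have mx i : mom P (fun w => nsq (xi_ i w)) by apply: mom_nsq => k; exact: mom_xi.
have m1 : mom P (fun w => \sum_i nsq (xi_ i w)) by momt.
split; first exact: (measurable_ge t (mom_meas m1)).
apply: (le_trans (markov_ineq m1 _ t0)); first by move=> w; apply: sumr_ge0 => i _; exact: nsq_ge0.
rewrite ler_pM2r ?invr_gt0 // Ex_sum //.
rewrite mulr_natl -[X in _ *+ X](card_ord N) -sumr_const; apply: ler_sum => i _.
exact: (Ex_nsq_xu (inl i) (szi i) (zi2 i)).
Qed.

Lemma G_tail cls t : 0 < t ->
  measurable [set w | t <= fsq (Gm cls w)] /\ prob P [set w | t <= fsq (Gm cls w)] <= N%:R * L%:R ^+ 2 / t.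
Proof.
move=> t0; have e i a b : (fun w => (Bf (U i w) *m (Bf (U i w))^T - Gbar) a b)
     = (fun w => Bf (U i w) a 0 * Bf (U i w) b 0 - Gbar a b).
  by apply/funext => w; rewrite mxE outer2E [(- Gbar) a b]mxE.
have mb i a := momUi i (bB a); have bb a b : bm (fun u => Bf u a 0 * Bf u b 0) by bmt.
have m1 i a b : mom P (fun w => Bf (U i w) a 0 * Bf (U i w) b 0) by momt.
have E1 i a b : Ex (fun w => Bf (U i w) a 0 * Bf (U i w) b 0) = Gbar a b by rewrite mxE (EUi i (bb a b)).
apply: markov_fsq => //.
- by move=> i a b; rewrite e; apply: momB => //; exact: mom_cst.
- by move=> i a b; rewrite e; apply: measurable_funB => //; apply: msM; [exact: (msig_U (bB a))|exact: (msig_U (bB b))].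
- move=> a b; rewrite big1 // => i _; rewrite e ExB //; last exact: mom_cst.
  by rewrite Ex_cst E1 subrr.
- move=> i; have m2 : forall a b, mom P (fun w => (Bf (U i w) *m (Bf (U i w))^T - Gbar) a b).
    by move=> a b; rewrite e; apply: momB => //; exact: mom_cst.
  rewrite /fsq Ex_sum; last by move=> a; apply: mom_sum => b; exact: momX.
  apply: (@le_trans _ _ (\sum_a \sum_b Ex (fun w => (Bf (U i w) a 0 * Bf (U i w) b 0) ^+ 2))).
    apply: ler_sum => a _; rewrite Ex_sum; last by move=> b; exact: momX.
    apply: ler_sum => b _; under eq_fun do rewrite (congr1 (fun g => g _ ^+ 2) (e i a b)) /=.
    have -> : (fun w => (Bf (U i w) a 0 * Bf (U i w) b 0 - Gbar a b) ^+ 2)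
       = (fun w => (Bf (U i w) a 0 * Bf (U i w) b 0) ^+ 2 + (- 2 * Gbar a b * (Bf (U i w) a 0 * Bf (U i w) b 0) + Gbar a b ^+ 2)).
      by apply/funext => w; ring.
    have mm : mom P (fun w => - 2 * Gbar a b * (Bf (U i w) a 0 * Bf (U i w) b 0)) by apply: momM => //; exact: mom_cst.
    rewrite ExD; [|by apply: momX|by apply: momD => //; exact: mom_cst].
    rewrite gerDl ExD //; last exact: mom_cst.
    by rewrite ExZ // E1 Ex_cst; have := sqr_ge0 (Gbar a b); rewrite !expr2; lra.
  apply: (@le_trans _ _ (Ex (fun w => nsq (Bf (U i w)) ^+ 2))).
    have m3 a b : mom P (fun w => (Bf (U i w) a 0 * Bf (U i w) b 0) ^+ 2) by apply: momX.
    under eq_bigr do rewrite -Ex_sum //.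
    rewrite -Ex_sum; last by move=> a; apply: mom_sum.
    rewrite le_eqVlt; apply/orP; left; apply/eqP; congr Eexp; apply/funext => w.
    rewrite expr2 {1}/nsq mulr_suml; apply: eq_bigr => a _; rewrite /nsq mulr_sumr; apply: eq_bigr => b _.
    by rewrite exprMn.
  rewrite -(Ex_cst P (L%:R ^+ 2)); apply: Ex_le; [|exact: mom_cst|by move=> w; exact: hB2].
  by apply: (momUi i (f := fun u => nsq (Bf u) ^+ 2)); bmt.
Qed.

Lemma E_tail cls t : 0 < t ->
  measurable [set w | t <= fsq (Em cls w)] /\
  prob P [set w | t <= fsq (Em cls w)] <= N%:R * (L%:R * (lam1 * (gv2 * p%:R))) / t.
Proof.
move=> t0; have e i a j : (fun w => (Bf (U i w) *m (Ac (U i w) *m Wc i w)^T) a j)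
     = (fun w => Bf (U i w) a 0 * (Ac (U i w) *m Wc i w) j 0).
  by apply/funext => w; rewrite outer2E.
have mb i a := momUi i (bB a); have ma := mom_AW.
apply: markov_fsq => //.
- by move=> i a j; rewrite e; exact: momM.
- by move=> i a j; rewrite e; apply: msM; [exact: (msig_U (bB a))|exact: msig_AW].
- move=> a j; rewrite big1 // => i _; rewrite e.
  pose a_ u : 'cV[R]_p := \col_k (Bf u a 0 * Ac u j k).
  have ba k : bm (fun u => a_ u k 0) by under eq_fun do rewrite mxE; bmt.
  have v1 : msigv P F (S0u (inl i)) (fun w => a_ (U i w)).
    move=> k; split; last exact: (momUi i (ba k)).
    by apply: (@msig_bm _ _ _ _ F _ (U i) (fun u => a_ u k 0)) => //; apply: (@msig_coord _ _ _ _ F _ (Some (inl i, None))); rewrite finset.in_setU1 finset.in_set1 eqxx.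
  rewrite -(Ex_dotW hF (@wsu_S (inl i)) (@hWu (inl i)) v1); congr Eexp; apply/funext => w.
  by rewrite mxE /dot mulr_sumr; apply: eq_bigr => k _; rewrite !mxE mulrA.
- move=> i; have mw : mom P (fun w => nsq (Wc i w)) by apply: mom_nsq => k; exact: (mom_Wv hF (@hWu (inl i))).
  have <- : Ex (fun w => nsq (Wc i w)) = gv2 * p%:R by exact: (Ex_nsqW hF (@hWu (inl i))).
  rewrite -!ExZ //; last by momt.
  apply: Ex_le; [|by momt|].
    by apply: mom_sum => a; apply: mom_sum => j; apply: momX; rewrite e; exact: momM.
  by move=> w; rewrite fsq_outer; apply: ler_pM; rewrite ?nsq_ge0.
Qed.

Variable phb : R -> 'cV[R]_p.
Hypothesis bphb : forall k, bm (fun u => phb u k 0).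

Definition fi (G M : 'M[R]_(p, L)) i w : R :=
  dot (xi_ i w + phb (U i w) - M *m Bf (U i w)) (G *m Bf (U i w)).

Definition sC : R := (8 * lam1 * L%:R)^-1.
Definition kC : R := lam0 * g0 / 8.
Definition tauC : R := kC / 2.
Definition cC : R := lam0 * g0 / (128 * lam1).

Let LR : 0 < L%:R :> R. Proof. by rewrite ltr0n. Qed.
Let sC0 : 0 < sC. Proof. by rewrite invr_gt0 !mulr_gt0. Qed.
Let kC0 : 0 < kC. Proof. by rewrite !mulr_gt0 // invr_gt0. Qed.

Lemma inv_sqrt_le (x : R) : 0 <= x -> x <= 1 -> (Num.sqrt (1 + x))^-1 <= 1 - x / 4.
Proof.
move=> x0 x1; have s0 : 0 < Num.sqrt (1 + x) by rewrite sqrtr_gt0; lra.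
rewrite -[_^-1]mul1r ler_pdivrMr //.
have a0 : 0 <= 1 - x / 4 by lra.
rewrite -[1 - x / 4]ger0_norm // -sqrtr_sqr -sqrtrM ?sqr_ge0 // -[leLHS]sqrtr1 ler_sqrt ?mulr_ge0 ?sqr_ge0 //; [|lra..].
by rewrite expr2; nra.
Qed.

Section Point.
Variables G M : 'M[R]_(p, L).
Hypothesis hG : 4^-1 <= fsq G <= 4.

Let a_ u : 'cV[R]_p := (Ac u)^T *m (G *m Bf u).
Let ba k : bm (fun u => a_ u k 0).
Proof. by have bt := bm_trA; have bG := bm_GB G; rewrite /a_; bmt. Qed.
Let c_ i u : R := Zlab (y i) * dot (dl u) (G *m Bf u) + dot (phb u - M *m Bf u) (G *m Bf u).
Let bc i : bm (c_ i).
Proof.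
have bG := bm_GB G; have bM := bm_GB M.
have bv k : bm (fun u => (phb u - M *m Bf u) k 0).
  have -> : (fun u => (phb u - M *m Bf u) k 0) = (fun u => phb u k 0 - (M *m Bf u) k 0).
    by apply/funext => u; rewrite !mxE.
  by bmt.
by rewrite /c_; bmt.
Qed.

Let fiE i w : fi G M i w = \sum_k a_ (U i w) k 0 * W i k w + c_ i (U i w).
Proof.
have -> : \sum_k a_ (U i w) k 0 * W i k w = dot (a_ (U i w)) (Wu (inl i) w).
  by apply: eq_bigr => k _; rewrite [Wv _ _ _ _ _]mxE.
have e := dot_xu (inl i) (zi i) w (G *m Bf (U i w)).
rewrite /fi -(addrA (xi_ i w)) dotDl /c_ [dot (xi_ i w) _]e -/(a_ _) /zi /Uu /=.
by move: (dot _ _) (dot _ _) (dot _ _) => *; ring.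
Qed.

Lemma mom_fi i : mom P (fi G M i).
Proof.
have -> : fi G M i = (fun w => \sum_k a_ (U i w) k 0 * W i k w + c_ i (U i w)) by apply/funext => w; exact: fiE.
have m1 k := momUi i (ba k); have m2 k : mom P (W i k) := mom_W hF (@hWu (inl i)) k; have m3 := momUi i (bc i).
by apply: momD => //; apply: mom_sum => k; exact: momM.
Qed.

Lemma msig_fi i : msig F (SU i) (fi G M i).
Proof.
have -> : fi G M i = (fun w => \sum_(k <- enum 'I_p) a_ (U i w) k 0 * W i k w + c_ i (U i w)).
  by apply/funext => w; rewrite fiE big_enum.
apply: measurable_funD; last exact: (msig_U (bc i)).
by apply: measurable_sum => k; apply: measurable_funM; [exact: (msig_U (ba k))|exact: msig_W].
Qed.

Let ei i w : R := expR (- (sC * fi G M i w ^+ 2)).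
Let ei1 i w : `|ei i w| <= 1.
Proof. by rewrite ger0_norm ?expR_ge0 // -[leRHS]expR0 ler_expR oppr_le0 mulr_ge0 ?sqr_ge0 // ltW. Qed.
Let sei i : msig F (SU i) (ei i).
Proof.
apply: measurableT_comp => //; apply: measurableT_comp => //; apply: measurable_funM => //.
by apply: measurable_funX; exact: msig_fi.
Qed.
Let mei i : mom P (ei i).
Proof. by apply: (@mom_bounded _ _ _ P _ 1); [exact: (msig_meas hF.1 (@sei i))|exact: ei1]. Qed.

Lemma unit_mgf i : Ex (ei i) <= expR (- (sC * kC)).
Proof.
pose S1 : {set I} := [set Some (inl i, None)]%SET.
pose ks : seq I := [seq wsu (inl i) k | k <- enum 'I_p].
pose aa (j : I) : T -> R := if j is Some (_, Some k) then (fun w => a_ (U i w) k 0) else (fun=> 0).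
have sU1 f : bm f -> msig F S1 (fun w => f (U i w)).
  move=> bf; apply: (@msig_bm _ _ _ _ F _ (U i)) => //.
  by apply: (@msig_coord _ _ _ _ F _ (Some (inl i, None))); rewrite finset.in_set1.
have := @gauss_unit _ _ _ P _ F hF S1 ks aa (fun w => c_ i (U i w)) (fun=> 1) (fun=> sC).
have e1 w : \sum_(k <- ks) aa k w * F k w = \sum_k a_ (U i w) k 0 * W i k w by rewrite big_map big_enum.
have e2 w : \sum_(k <- ks) aa k w ^+ 2 = nsq (a_ (U i w)) by rewrite big_map big_enum.
move=> /(_ _ _ _ _ _ _ _ _ _); move=> h.
have {h}h : (\int[P]_w (1 * expR (- (sC * (\sum_(k <- ks) aa k w * F k w + c_ i (U i w)) ^+ 2)))%:E <=
   \int[P]_w (1 * (Num.sqrt (1 + 2 * (sC * \sum_(k <- ks) aa k w ^+ 2)))^-1)%:E)%E.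
  apply: h => //.
  - by rewrite map_inj_uniq ?enum_uniq //; exact: wsu_inj.
  - by move=> k /mapP[l _ ->]; rewrite finset.in_set1; apply/eqP => -[].
  - by move=> k /mapP[l _ ->]; exact: hWu.
  - move=> [[s [k|]]|] /=; try exact: measurable_cst; exact: (sU1 _ (ba k)).
  - exact: (sU1 _ (bc i)).
  - exact: measurable_cst.
  - exact: measurable_cst.
  - by move=> w; exact: ltW.
have ball : bm (fun u => nsq (a_ u)) by apply: bm_nsq => k; exact: ba.
have x0 u : 0 <= 2 * (sC * nsq (a_ u)) by rewrite mulr_ge0 // mulr_ge0 ?nsq_ge0 // ltW.
have x1 u : 2 * (sC * nsq (a_ u)) <= 1.
  have q1 : nsq (a_ u) <= 4 * lam1 * L%:R.
    apply: (le_trans (hA2 _ _)); rewrite [4 * _]mulrC -mulrA ler_wpM2l ?(ltW l10) //.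
    apply: (le_trans (nsq_mulmx _ _)); apply: ler_pM; rewrite ?fsq_ge0 ?nsq_ge0 //.
    by case/andP: hG.
  rewrite mulrCA /sC mulrC ler_pdivrMr ?mul1r; last by rewrite !mulr_gt0.
  by move: q1; lra.
have mq : mom P (fun w => (Num.sqrt (1 + 2 * (sC * nsq (a_ (U i w)))))^-1).
  apply: (@mom_bounded _ _ _ P _ 1).
    apply: (msig_meas hF.1 (S := S1)); apply: msig_inv_sqrt.
    by apply: measurable_funD => //; apply: measurable_funM => //; apply: measurable_funM => //; exact: (sU1 _ ball).
  move=> w; rewrite ger0_norm ?invr_ge0 // invf_le1 ?sqrtr_gt0; last by have := x0 (U i w); lra.
  by rewrite -[leLHS]sqrtr1 ler_sqrt; have := x0 (U i w); lra.
have h2 : Ex (ei i) <= Ex (fun w => (Num.sqrt (1 + 2 * (sC * nsq (a_ (U i w)))))^-1).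
  rewrite -lee_fin !ExE //.
  under eq_integral do rewrite /ei fiE -e1 -[expR _]mul1r.
  by apply: (le_trans h); under eq_integral do rewrite mul1r e2.
have m3 := momUi i ball.
have h3 : Ex (fun w => (Num.sqrt (1 + 2 * (sC * nsq (a_ (U i w)))))^-1) <= Ex (fun w => 1 - 2^-1 * sC * nsq (a_ (U i w))).
  apply: Ex_le => //; first by apply: momB; [exact: mom_cst|apply: momM => //; exact: mom_cst].
  move=> w; apply: (le_trans (inv_sqrt_le (x0 _) (x1 _))); lra.
apply: (le_trans h2); apply: (le_trans h3).
rewrite ExB; [|exact: mom_cst|by apply: momM => //; exact: mom_cst].
rewrite Ex_cst ExZ // (EUi i ball).
have h4 : 4^-1 * (lam0 * g0) <= EU (fun u => nsq (a_ u)).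
  have /andP[q1 _] := EU_nsq_GB G.
  have mG : mom P (fun w => nsq (G *m Bf (U0 w))).
    by apply: (@mom_bm _ _ _ P U0 (fun u => nsq (G *m Bf u))) => //; have bG := bm_GB G; bmt.
  apply: (@le_trans _ _ (lam0 * EU (fun u => nsq (G *m Bf u)))).
    rewrite mulrCA ler_wpM2l ?(ltW l00) //; apply: le_trans q1; rewrite mulrC ler_wpM2l ?(ltW g00) //.
    by case/andP: hG.
  rewrite -ExZ //; apply: Ex_le; [by apply: momM => //; exact: mom_cst|exact: (mom_bm P mU0 ball)|by move=> w].
apply: (@le_trans _ _ (1 + - (sC * kC))); last exact: expR_ge1Dx.
rewrite lerD2l lerN2 /kC; have -> : sC * (lam0 * g0 / 8) = 2^-1 * sC * (4^-1 * (lam0 * g0)) by field.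
by apply: ler_wpM2l => //; apply: mulr_ge0; [rewrite invr_ge0|exact: ltW].
Qed.

Lemma point_tail : measurable [set w | \sum_i fi G M i w ^+ 2 <= tauC * N%:R] /\
  prob P [set w | \sum_i fi G M i w ^+ 2 <= tauC * N%:R] <= expR (- (cC * N%:R / L%:R)).
Proof.
pose pe w := \prod_(i <- index_enum 'I_N) ei i w.
have peE w : pe w = expR (- (sC * \sum_i fi G M i w ^+ 2)).
  by rewrite /pe mulr_sumr -sumrN expR_sum.
have mpe : mom P pe.
  apply: (@mom_bounded _ _ _ P _ 1).
    have -> : pe = (fun w => expR (- (sC * \sum_i fi G M i w ^+ 2))) by apply/funext => w; exact: peE.
    apply: measurableT_comp => //; apply: measurableT_comp => //; apply: measurable_funM => //.
    by apply: mom_meas; apply: mom_sum => i; apply: momX; exact: mom_fi.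
  move=> w; rewrite peE ger0_norm ?expR_ge0 // -[leRHS]expR0 ler_expR oppr_le0 mulr_ge0 ?(ltW sC0) //.
  by apply: sumr_ge0 => i _; exact: sqr_ge0.
have -> : [set w | \sum_i fi G M i w ^+ 2 <= tauC * N%:R] = [set w | expR (- (sC * (tauC * N%:R))) <= pe w].
  by apply/seteqP; split=> w /=; rewrite peE ler_expR lerN2 ler_pM2l.
split; first exact: (measurable_ge _ (mom_meas mpe)).
apply: (le_trans (markov_ineq mpe _ (expR_gt0 _))); first by move=> w; rewrite peE expR_ge0.
rewrite (@Ex_prod_indep _ _ _ P _ F _ (index_enum 'I_N) SU ei) //; try exact: index_enum_uniq; try by move=> a b l ab; apply: SU_disj.
apply: (@le_trans _ _ ((\prod_(i <- index_enum 'I_N) expR (- (sC * kC))) / expR (- (sC * (tauC * N%:R))))).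
  rewrite ler_pM2r ?invr_gt0 ?expR_gt0 //; apply: ler_prod => i _; rewrite unit_mgf andbT.
  by apply: Ex_ge0 => w; exact: expR_ge0.
rewrite prodr_const card_ord -expRM_natl -expRN opprK -expRD ler_expR.
rewrite le_eqVlt; apply/orP; left; apply/eqP; rewrite /tauC /kC /cC /sC.
by field; rewrite !gt_eqF.
Qed.

End Point.

Definition gval (q k : nat) : R := k%:R / q%:R ^+ 4 - q%:R.

Lemma grid_near (q : nat) (x : R) : (0 < q)%N -> `|x| <= q%:R ->
  exists k : 'I_(2 * q ^ 5).+1, `|x - gval q k| <= (q%:R ^+ 4)^-1.
Proof.
move=> q0 /ler_normlP[x1 x2]; have qR : 0 < q%:R :> R by rewrite ltr0n.
have q4 : 0 < q%:R ^+ 4 :> R by exact: exprn_gt0.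
have z0 : 0 <= (x + q%:R) * q%:R ^+ 4 by rewrite mulr_ge0 ?(ltW q4) //; lra.
have /andP[t1 t2] := truncn_itv z0; set k := Num.truncn _ in t1 t2.
have kb : (k < (2 * q ^ 5).+1)%N.
  rewrite ltnS -(ler_nat R); apply: (le_trans t1); rewrite natrM natrX [q%:R ^+ 5]exprS mulrA.
  by rewrite ler_pM2r //; lra.
exists (Ordinal kb); rewrite /gval /=.
have -> : x - (k%:R / q%:R ^+ 4 - q%:R) = ((x + q%:R) * q%:R ^+ 4 - k%:R) / q%:R ^+ 4.
  by field; rewrite gt_eqF.
rewrite normrM [`|_^-1|]gtr0_norm ?invr_gt0 // ler_piMl ?invr_ge0 ?(ltW q4) //.
by rewrite ger0_norm ?subr_ge0 // lerBlDl natr1 ltW.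
Qed.

Section Net.
Variable q : nat.
Let Jn : finType := (bool * 'I_p * 'I_L)%type.
Let Gn := {ffun Jn -> 'I_(2 * q ^ 5).+1}.
Definition Gg (b : bool) (g : Gn) : 'M[R]_(p, L) := \matrix_(j, a) gval q (g (b, j, a)).

Definition bad_net : set T :=
  [set w | exists g : Gn, (if 4^-1 <= fsq (Gg true g) <= 4
     then [set w | \sum_i fi (Gg true g) (Gg false g) i w ^+ 2 <= tauC * N%:R] else set0) w].

Lemma bad_net_tail : measurable bad_net /\
  prob P bad_net <= ((2 * q ^ 5).+1 ^ (2 * p * L))%:R * expR (- (cC * N%:R / L%:R)).
Proof.
have mA g : measurable (if 4^-1 <= fsq (Gg true g) <= 4
     then [set w | \sum_i fi (Gg true g) (Gg false g) i w ^+ 2 <= tauC * N%:R] else set0).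
  by case: ifP => // h; case: (point_tail (Gg false g) h).
split.
  rewrite /bad_net [X in measurable X](_ : _ = \bigcup_(g in [set` predT]) (if 4^-1 <= fsq (Gg true g) <= 4
     then [set w | \sum_i fi (Gg true g) (Gg false g) i w ^+ 2 <= tauC * N%:R] else set0)).
    by apply: fin_bigcup_measurable => //; exact: finite_finset.
  by apply/seteqP; split=> w /= [g]; [exists g|move=> ?; exists g].
apply: (le_trans (prob_bigU_le P mA)).
apply: (@le_trans _ _ (\sum_(g : Gn) expR (- (cC * N%:R / L%:R)))).
  apply: ler_sum => g _; case: ifP => h; first by case: (point_tail (Gg false g) h).
  by rewrite /prob measure0 expR_ge0.
by rewrite sumr_const card_ffun card_ord !card_prod card_bool !card_ord mulr_natl.
Qed.

Definition kapN : R := tauC / 4.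
Hypothesis q2 : (1 < q)%N.
Hypothesis N0 : (0 < N)%N.
Hypothesis pq : (p <= q)%N.
Hypothesis Lq : (L <= q)%N.
Hypothesis hph : forall u, nsq (phb u) <= q%:R ^+ 2.
Hypothesis hq : 28 / q%:R ^+ 2 <= kapN.

Lemma fsq_close (A B : 'M[R]_(p, L)) : (forall j a, `|A j a - B j a| <= (q%:R ^+ 4)^-1) ->
  fsq (A - B) <= (q%:R ^+ 6)^-1.
Proof.
move=> h; have qR : 0 < q%:R :> R by rewrite ltr0n ltnW.
apply: (@le_trans _ _ (\sum_(j < p) \sum_(a < L) ((q%:R ^+ 4)^-1) ^+ 2)).
  apply: ler_sum => j _; apply: ler_sum => a _; rewrite mxE [(- B) j a]mxE.
  by rewrite -[leLHS]real_normK ?num_real // lerXn2r ?nnegrE ?invr_ge0 ?exprn_ge0 // ltW.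
rewrite !sumr_const !card_ord -mulrnA -[leLHS]mulr_natl.
apply: (@le_trans _ _ (q%:R ^+ 2 * ((q%:R ^+ 4)^-1) ^+ 2)).
  by rewrite ler_wpM2r ?sqr_ge0 // -natrX ler_nat expnS expn1 leq_mul.
by rewrite le_eqVlt; apply/orP; left; apply/eqP; field; rewrite gt_eqF.
Qed.

Lemma net_lower_unit w : ~ bad_net w -> \sum_i nsq (xi_ i w) <= N%:R * q%:R ^+ 2 ->
  forall G M, fsq G = 1 -> fsq M <= q%:R ^+ 2 -> kapN <= N%:R^-1 * \sum_i fi G M i w ^+ 2.
Proof.
move=> nb hx G M G1 hM.
have q1 : 2 <= q%:R :> R by rewrite ler_nat.
have qR : 0 < q%:R :> R by lra.
have NR : 0 < N%:R :> R by rewrite ltr0n.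
have ent (A : 'M[R]_(p, L)) j a : A j a ^+ 2 <= fsq A.
  rewrite /fsq (bigD1 j) //= (bigD1 a) //= -addrA lerDl addr_ge0 //; last first.
    by apply: sumr_ge0 => i _; apply: sumr_ge0 => b _; exact: sqr_ge0.
  by apply: sumr_ge0 => b _; exact: sqr_ge0.
have entq (A : 'M[R]_(p, L)) j a : fsq A <= q%:R ^+ 2 -> `|A j a| <= q%:R.
  move=> hA; rewrite -(@ler_pXn2r _ 2) ?nnegrE ?(ltW qR) // real_normK ?num_real //.
  exact: le_trans (ent A j a) hA.
have hG' : fsq G <= q%:R ^+ 2 by rewrite G1 expr2; nra.
pose X (c : Jn) : R := if c.1.1 then G c.1.2 c.2 else M c.1.2 c.2.
have hX c : exists k : 'I_(2 * q ^ 5).+1, `|X c - gval q k| <= (q%:R ^+ 4)^-1.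
  by apply: grid_near; [exact: ltnW|rewrite /X; case: c.1.1; exact: entq].
have [g hg] := choice hX.
pose g' : Gn := [ffun c => g c].
set G' := Gg true g'; set M' := Gg false g'.
have dG : fsq (G - G') <= (q%:R ^+ 6)^-1.
  by apply: fsq_close => j a; rewrite mxE ffunE; exact: (hg (true, j, a)).
have dM : fsq (M - M') <= (q%:R ^+ 6)^-1.
  by apply: fsq_close => j a; rewrite mxE ffunE; exact: (hg (false, j, a)).
have q6 : (q%:R ^+ 6)^-1 <= 8^-1 :> R.
  rewrite lef_pV2 ?posrE ?exprn_gt0 //; apply: (@le_trans _ _ (2 ^+ 6)); first by rewrite !exprS expr0; lra.
  by rewrite lerXn2r ?nnegrE // ltW.
have GG : 4^-1 <= fsq G' <= 4.
  have h1 : fsq G <= 2 * fsq (G - G') + 2 * fsq G' by rewrite -{1}(subrK G' G); exact: fsqD_le.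
  have h2 : fsq G' <= 2 * fsq (G' - G) + 2 * fsq G by rewrite -{1}(subrK G G'); exact: fsqD_le.
  have e : fsq (G' - G) = fsq (G - G').
    by rewrite -opprB; apply: eq_bigr => j _; apply: eq_bigr => a _; rewrite mxE sqrrN.
  by apply/andP; split; move: h1 h2 dG q6; rewrite e G1; lra.
have big : tauC * N%:R <= \sum_i fi G' M' i w ^+ 2.
  rewrite leNgt; apply/negP => lt; apply: nb; exists g'; rewrite -/G' -/M' GG.
  exact: ltW.
have LL : L%:R <= q%:R :> R by rewrite ler_nat.
have L00 : 0 <= L%:R :> R by exact: ler0n.
have df i : (fi G M i w - fi G' M' i w) ^+ 2 <= 2 * (q%:R ^+ 6)^-1 * L%:R * (4 * nsq (xi_ i w) + 4 * q%:R ^+ 2 + 2 * (q%:R ^+ 2 * L%:R) + 4 * L%:R).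
  set v := xi_ i w + phb (U i w) - M *m Bf (U i w); set b := Bf (U i w).
  have e : fi G M i w - fi G' M' i w = dot v ((G - G') *m b) - dot ((M - M') *m b) (G' *m b).
    rewrite /fi -/b -/v.
    have -> : xi_ i w + phb (U i w) - M' *m b = v + (M - M') *m b by rewrite /v mulmxBl -/b; apply/colP => k; rewrite !mxE; ring.
    by rewrite dotDl [(G - G') *m b]mulmxBl dotBr; ring.
  have bL : nsq b <= L%:R by exact: B_nsq.
  have h1 : dot v ((G - G') *m b) ^+ 2 <= nsq v * ((q%:R ^+ 6)^-1 * L%:R).
    apply: (le_trans (cauchy_schwarz _ _)); rewrite ler_wpM2l ?nsq_ge0 //.
    by apply: (le_trans (nsq_mulmx _ _)); apply: ler_pM; rewrite ?fsq_ge0 ?nsq_ge0.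
  have h2 : dot ((M - M') *m b) (G' *m b) ^+ 2 <= ((q%:R ^+ 6)^-1 * L%:R) * (4 * L%:R).
    apply: (le_trans (cauchy_schwarz _ _)); apply: ler_pM; rewrite ?nsq_ge0 //.
      by apply: (le_trans (nsq_mulmx _ _)); apply: ler_pM; rewrite ?fsq_ge0 ?nsq_ge0.
    by apply: (le_trans (nsq_mulmx _ _)); apply: ler_pM; rewrite ?fsq_ge0 ?nsq_ge0 //; case/andP: GG.
  have h3 : nsq v <= 4 * nsq (xi_ i w) + 4 * q%:R ^+ 2 + 2 * (q%:R ^+ 2 * L%:R).
    have a1 := nsqB_le (xi_ i w + phb (U i w)) (M *m b).
    have a2 := nsqD_le (xi_ i w) (phb (U i w)); have a3 := hph (U i w).
    have a4 : nsq (M *m b) <= q%:R ^+ 2 * L%:R by apply: (le_trans (nsq_mulmx _ _)); apply: ler_pM; rewrite ?fsq_ge0 ?nsq_ge0.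
    by rewrite /v; move: a1 a2 a3 a4; lra.
  have c0 : 0 <= (q%:R ^+ 6)^-1 * L%:R :> R by rewrite mulr_ge0 // invr_ge0 exprn_ge0 // ltW.
  rewrite e; move: (dot v _) (dot _ (G' *m b)) h1 h2 => s t h1 h2.
  have : (s - t) ^+ 2 <= 2 * s ^+ 2 + 2 * t ^+ 2 by have := sqr_ge0 (s + t); rewrite !expr2; nra.
  set c := (q%:R ^+ 6)^-1 * L%:R in c0 h1 h2 * => h4.
  have h5 : nsq v * c <= (4 * nsq (xi_ i w) + 4 * q%:R ^+ 2 + 2 * (q%:R ^+ 2 * L%:R)) * c by rewrite ler_wpM2r.
  have -> : 2 * (q%:R ^+ 6)^-1 * L%:R * (4 * nsq (xi_ i w) + 4 * q%:R ^+ 2 + 2 * (q%:R ^+ 2 * L%:R) + 4 * L%:R)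
    = 2 * ((4 * nsq (xi_ i w) + 4 * q%:R ^+ 2 + 2 * (q%:R ^+ 2 * L%:R)) * c) + 2 * (c * (4 * L%:R)) by rewrite /c; ring.
  move: (_ * c) (c * _) (nsq v * c) (s ^+ 2) (t ^+ 2) h1 h2 h4 h5 => a1 a2 a3 a4 a5; lra.
have sdf : N%:R^-1 * \sum_i (fi G M i w - fi G' M' i w) ^+ 2 <= 28 / q%:R ^+ 2.
  apply: (@le_trans _ _ (N%:R^-1 * \sum_i (2 * (q%:R ^+ 6)^-1 * L%:R * (4 * nsq (xi_ i w) + 4 * q%:R ^+ 2 + 2 * (q%:R ^+ 2 * L%:R) + 4 * L%:R)))).
    by rewrite ler_wpM2l ?invr_ge0 ?(ltW NR) //; apply: ler_sum => i _; exact: df.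
  have -> : N%:R^-1 * \sum_i (2 * (q%:R ^+ 6)^-1 * L%:R * (4 * nsq (xi_ i w) + 4 * q%:R ^+ 2 + 2 * (q%:R ^+ 2 * L%:R) + 4 * L%:R))
     = 2 * (q%:R ^+ 6)^-1 * L%:R * (4 * (N%:R^-1 * \sum_i nsq (xi_ i w)) + (4 * q%:R ^+ 2 + 2 * (q%:R ^+ 2 * L%:R) + 4 * L%:R)).
    rewrite -mulr_sumr.
    have -> : \sum_i (4 * nsq (xi_ i w) + 4 * q%:R ^+ 2 + 2 * (q%:R ^+ 2 * L%:R) + 4 * L%:R)
       = 4 * \sum_i nsq (xi_ i w) + N%:R * (4 * q%:R ^+ 2 + 2 * (q%:R ^+ 2 * L%:R) + 4 * L%:R).
      under eq_bigr do rewrite -!addrA.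
      by rewrite big_split /= -mulr_sumr sumr_const card_ord -[_ *+ N]mulr_natl !addrA.
    by field; rewrite !gt_eqF.
  have hx' : N%:R^-1 * \sum_i nsq (xi_ i w) <= q%:R ^+ 2 by rewrite mulrC ler_pdivrMr // mulrC.
  apply: (@le_trans _ _ (2 * (q%:R ^+ 6)^-1 * q%:R * (8 * q%:R ^+ 2 + 2 * q%:R ^+ 3 + 4 * q%:R))).
    apply: ler_pM => //.
    - rewrite addr_ge0 //.
        by rewrite mulr_ge0 // mulr_ge0 ?invr_ge0 ?(ltW NR) //; apply: sumr_ge0 => i _; exact: nsq_ge0.
    - by rewrite ler_wpM2l // mulr_ge0 // invr_ge0 exprn_ge0 // ltW.
    - have : q%:R ^+ 2 * L%:R <= q%:R ^+ 3 :> R by rewrite [q%:R ^+ 3]exprSr ler_wpM2l ?sqr_ge0.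
      by move: hx' LL; lra.
  rewrite -(@ler_pM2r _ (q%:R ^+ 6)) ?exprn_gt0 //.
  have -> : 2 * (q%:R ^+ 6)^-1 * q%:R * (8 * q%:R ^+ 2 + 2 * q%:R ^+ 3 + 4 * q%:R) * q%:R ^+ 6
     = 16 * q%:R ^+ 3 + 4 * q%:R ^+ 4 + 8 * q%:R ^+ 2 :> R by field; rewrite gt_eqF.
  have -> : 28 / q%:R ^+ 2 * q%:R ^+ 6 = 28 * q%:R ^+ 4 :> R by field; rewrite gt_eqF.
  have a1 : 2 * q%:R ^+ 2 <= q%:R ^+ 3 :> R by rewrite [q%:R ^+ 3]exprS ler_wpM2r ?sqr_ge0.
  have a2 : 2 * q%:R ^+ 3 <= q%:R ^+ 4 :> R by rewrite [q%:R ^+ 4]exprS ler_wpM2r ?exprn_ge0 // ltW.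
  by move: a1 a2 (exprn_ge0 4 (ltW qR)); lra.
have : N%:R^-1 * \sum_i fi G' M' i w ^+ 2 <= 2 * (N%:R^-1 * \sum_i fi G M i w ^+ 2)
    + 2 * (N%:R^-1 * \sum_i (fi G M i w - fi G' M' i w) ^+ 2).
  rewrite !mulr_sumr -big_split /=; apply: ler_sum => i _.
  have : fi G' M' i w ^+ 2 <= 2 * fi G M i w ^+ 2 + 2 * (fi G M i w - fi G' M' i w) ^+ 2.
    by have := sqr_ge0 (2 * fi G M i w - fi G' M' i w); rewrite !expr2; nra.
  have : 0 <= N%:R^-1 :> R by rewrite invr_ge0 ltW.
  move: (fi G' M' i w ^+ 2) (fi G M i w ^+ 2) ((fi G M i w - _) ^+ 2) (N%:R^-1) => a b c e e0 h.
  have : e * a <= e * (2 * b + 2 * c) by rewrite ler_wpM2l.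
  by lra.
have : tauC <= N%:R^-1 * \sum_i fi G' M' i w ^+ 2 by rewrite mulrC ler_pdivlMr.
have kE : tauC = 4 * kapN by rewrite /kapN; field.
by rewrite kE; move: sdf hq; lra.
Qed.

Lemma net_lower w : ~ bad_net w -> \sum_i nsq (xi_ i w) <= N%:R * q%:R ^+ 2 ->
  forall G M, fsq M <= q%:R ^+ 2 -> kapN * fsq G <= N%:R^-1 * \sum_i fi G M i w ^+ 2.
Proof.
move=> nb hx G M hM.
have [G0|Gn0] := eqVneq (fsq G) 0.
  rewrite G0 mulr0 mulr_ge0 ?invr_ge0 ?ler0n //; apply: sumr_ge0 => i _; exact: sqr_ge0.
have Gp : 0 < fsq G by rewrite lt_neqAle eq_sym Gn0 fsq_ge0.
pose c := (Num.sqrt (fsq G))^-1.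
have c2 : c ^+ 2 = (fsq G)^-1 by rewrite /c exprVn sqr_sqrtr ?fsq_ge0.
have := net_lower_unit nb hx (G := c *: G) (M := M); rewrite fsqZ c2 mulVf // => /(_ erefl hM).
have -> : \sum_i fi (c *: G) M i w ^+ 2 = (fsq G)^-1 * \sum_i fi G M i w ^+ 2.
  rewrite mulr_sumr; apply: eq_bigr => i _; by rewrite /fi -scalemxAl dotZr exprMn c2.
by rewrite mulrCA mulrC -ler_pdivrMr ?invr_gt0 // invrK.
Qed.

End Net.

Section Deterministic.
Variables (n q : nat) (Sm : bool -> 'M[R]_(p, L)) (phf : bool -> R -> 'cV[R]_p) (be2 : R).
Hypothesis n0 : (0 < n)%N.
Hypothesis NE : N = (2 * n)%N.
Hypothesis hcard : forall cls, #|[pred i | y i == cls]| = n.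
Hypothesis phbE : forall u, phb u = 2^-1 *: (phf true u + phf false u).
Hypothesis dlE : forall u, dl u = (Sm true *m Bf u + phf true u) - (Sm false *m Bf u + phf false u).
Hypothesis hbe : forall cls u, nsq (phf cls u) <= be2.

Variable w : T.
Local Notation Us := (fun i => U i w).
Local Notation B_ i := (Bf (U i w)).
Definition Xs_ i : 'cV[R]_p := Sm (y i) *m B_ i + phf (y i) (U i w) + Ac (U i w) *m Wc i w.

Variables (vE vT vR tr : R).
Hypothesis hGm : forall cls, fsq (Gm cls w) <= (n%:R * (g0 / 2)) ^+ 2.
Hypothesis hEm : forall cls, fsq (Em cls w) <= n%:R ^+ 2 * vE.
Hypothesis hT1 : fsq (T1m w) <= N%:R ^+ 2 * vT.
Hypothesis hRm : fsq (Rm w) <= N%:R ^+ 2 * vR.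
Hypothesis hrho2 : \sum_i rho_ i w ^+ 2 <= N%:R * tr.

Definition LamG : R := g1 + g0.
Definition mM : R := 4 / g0 ^+ 2 * (2 * LamG * be2 + 2 * vE).
Hypothesis q2 : (1 < q)%N.
Hypothesis pq : (p <= q)%N.
Hypothesis Lq : (L <= q)%N.
Hypothesis hph : forall u, nsq (phb u) <= q%:R ^+ 2.
Hypothesis hq : 28 / q%:R ^+ 2 <= kapN.
Hypothesis hmM : mM <= q%:R ^+ 2.
Hypothesis hbad : ~ bad_net q w.
Hypothesis hxx : \sum_i nsq (xi_ i w) <= N%:R * q%:R ^+ 2.

Let nR : 0 < n%:R :> R. Proof. by rewrite ltr0n. Qed.
Let NR : 0 < N%:R :> R. Proof. by rewrite NE natrM mulr_gt0. Qed.
Let LamG0 : 0 < LamG. Proof. exact: addr_gt0. Qed.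
Let be20 : 0 <= be2. Proof. by apply: le_trans (hbe true 0); exact: nsq_ge0. Qed.
Let Gc := Gcls n Bf y Us.

Let GcE cls : Gc cls = Gbar + n%:R^-1 *: Gm cls w.
Proof.
have -> : Gm cls w = \sum_(i < N | y i == cls) B_ i *m (B_ i)^T - n%:R *: Gbar.
  by rewrite /Gm sumrB sumr_const hcard scaler_nat.
by rewrite scalerBr scalerA mulVf ?gt_eqF // scale1r addrC subrK.
Qed.

Let Gbar_form v : dot v (Gbar *m v) = EU (fun u => dot v (Bf u) ^+ 2).
Proof.
have mb a : mom P (fun w => Bf (U0 w) a 0) by exact: (mom_bm P mU0 (bB a)).
have -> : (fun w0 => dot v (Bf (U0 w0)) ^+ 2) = (fun w0 => \sum_a \sum_b v a 0 * v b 0 * (Bf (U0 w0) a 0 * Bf (U0 w0) b 0)).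
  apply/funext => w0; rewrite expr2 {1}/dot mulr_suml; apply: eq_bigr => a _; rewrite /dot mulr_sumr.
  by apply: eq_bigr => b _; ring.
rewrite Ex_sum; last by move=> a; momt.
apply: eq_bigr => a _; rewrite Ex_sum; last by move=> b; momt.
rewrite mxE mulr_sumr; apply: eq_bigr => b _; rewrite mxE ExZ; last by momt.
by ring.
Qed.

Let Gm_form cls v : `|dot v (Gm cls w *m v)| <= n%:R * (g0 / 2) * nsq v.
Proof.
have g2 : 0 <= n%:R * (g0 / 2) by rewrite mulr_ge0 ?(ltW nR) // divr_ge0 // ltW.
have r0 : 0 <= n%:R * (g0 / 2) * nsq v by apply: mulr_ge0 => //; exact: nsq_ge0.
rewrite -(@ler_pXn2r _ 2) ?nnegrE // real_normK ?num_real //.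
apply: (le_trans (cauchy_schwarz _ _)).
have -> : (n%:R * (g0 / 2) * nsq v) ^+ 2 = nsq v * ((n%:R * (g0 / 2)) ^+ 2 * nsq v) by ring.
rewrite ler_wpM2l ?nsq_ge0 //; apply: (le_trans (nsq_mulmx _ _)); rewrite ler_wpM2r ?nsq_ge0 //.
Qed.

Let hG cls v : g0 / 2 * nsq v <= dot v (Gc cls *m v) <= LamG * nsq v.
Proof.
rewrite GcE mulmxDl dotDr Gbar_form -scalemxAl dotZr.
have h1 := hgl v; have h2 := hgu v; have /ler_normlP[h3 h4] := Gm_form cls v.
have v0 := nsq_ge0 v.
have h5 : n%:R^-1 * dot v (Gm cls w *m v) <= g0 / 2 * nsq v.
  by rewrite ler_pdivrMl // mulrA.
have h6 : - (g0 / 2 * nsq v) <= n%:R^-1 * dot v (Gm cls w *m v).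
  by rewrite ler_pdivlMl // mulrN lerNl mulrA.
have h7 : 0 <= g0 * nsq v by rewrite mulr_ge0 // ltW.
by apply/andP; split; rewrite /LamG; move: h1 h2 h5 h6 h7; move: (Eexp P _) (n%:R^-1 * _) => X Y; lra.
Qed.

Let g20 : 0 < g0 / 2. Proof. by rewrite divr_gt0. Qed.
Let phi_ cls i := phf cls (U i w).
Let e_ i := Ac (U i w) *m Wc i w.
Let Mb := Mbar n Bf y Us phi_ e_.

Let sumB_cls cls v : n%:R^-1 * \sum_(i | y i == cls) dot v (B_ i) ^+ 2 <= LamG * nsq v.
Proof.
have /andP[_] := hG cls v; apply: le_trans; rewrite /Gc /Gcls -scalemxAl dotZr mulmx_suml dot_sumr.
rewrite le_eqVlt; apply/orP; left; apply/eqP; congr (_ * _); apply: eq_bigr => i _.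
rewrite -mulmxA [(B_ i)^T *m v]mx11_scalar -dotE mul_mx_scalar dotZr (dotC (B_ i)) expr2 //.
Qed.

Let sum_cls (f : 'I_N -> R) : \sum_i f i = \sum_(i | y i == true) f i + \sum_(i | y i == false) f i.
Proof.
rewrite (bigID (fun i => y i == true)) /=; congr (_ + _); apply: eq_bigl => i; by case: (y i).
Qed.

Let Ninv : N%:R^-1 = 2^-1 * n%:R^-1 :> R. Proof. by rewrite NE natrM invfM. Qed.

Let sumB v : N%:R^-1 * \sum_i dot v (B_ i) ^+ 2 <= LamG * nsq v.
Proof.
rewrite sum_cls Ninv -mulrA mulrDr; have := sumB_cls true v; have := sumB_cls false v.
move: (n%:R^-1 * _) (n%:R^-1 * _) => x z; lra.
Qed.

Let fsq_Mb : fsq Mb <= mM.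
Proof.
have hM cls : fsq (Mcls n Bf y Us phi_ e_ cls) <= mM.
  rewrite /Mcls fsq_tr; apply: (le_trans (fsq_inv_mul (kap := g0 / 2) _ g20 _)).
    by move=> v; have /andP[] := hG cls v.
  have -> : Fcls n Bf y Us phi_ e_ cls = n%:R^-1 *: (\sum_(i | y i == cls) B_ i *m (phi_ cls i)^T) + n%:R^-1 *: Em cls w.
    rewrite /Fcls /Em -scalerDr -big_split /=; congr (_ *: _); apply: eq_bigr => i _.
    by rewrite linearD /= mulmxDr.
  have h1 : fsq (n%:R^-1 *: (\sum_(i | y i == cls) B_ i *m (phi_ cls i)^T)) <= LamG * be2.
    apply: fsq_outer_mean; [by rewrite invr_ge0 ltW|exact: ltW|exact: sumB_cls|].
    rewrite mulrC ler_pdivrMr //; apply: (@le_trans _ _ (\sum_(i | y i == cls) be2)).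
      by apply: ler_sum => i _; exact: hbe.
    by rewrite sumr_const hcard mulr_natr.
  have h2 : fsq (n%:R^-1 *: Em cls w) <= vE.
    by rewrite fsqZ exprVn mulrC ler_pdivrMr ?exprn_gt0 // mulrC.
  rewrite ler_pdivrMr ?exprn_gt0 //; apply: (le_trans (fsqD_le _ _)).
  have -> : mM * (g0 / 2) ^+ 2 = 2 * LamG * be2 + 2 * vE by rewrite /mM; field; rewrite gt_eqF.
  by move: h1 h2; lra.
rewrite /Mb /Mbar fsqZ; have := fsqD_le (Mcls n Bf y Us phi_ e_ true) (Mcls n Bf y Us phi_ e_ false).
have := hM true; have := hM false; rewrite expr2; lra.
Qed.

Let XsE i : Xs_ i = Sm (y i) *m B_ i + phi_ (y i) i + e_ i. Proof. by []. Qed.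

Let resid i : Xs_ i - mu_hat Bf y Us Xs_ (U i w) = xi_ i w + phb (U i w) - Mb *m B_ i.
Proof.
rewrite (Xs_sub_mu_hat (n := n) (S := Sm) (ph := phi_) (e := e_) (LamG := LamG) n0 XsE g20 hG i).
by rewrite xiE dlE -/Mb /phbar phbE.
Qed.

Let BtE i : Btilde_hat Bf y Us Xs_ i = kron (xi_ i w + phb (U i w) - Mb *m B_ i) (B_ i).
Proof. by rewrite /Btilde_hat resid. Qed.

Let sumMB : N%:R^-1 * \sum_i nsq (Mb *m B_ i) <= LamG * mM.
Proof.
have -> : N%:R^-1 * \sum_i nsq (Mb *m B_ i) = \sum_j N%:R^-1 * \sum_i dot (row j Mb)^T (B_ i) ^+ 2.
  rewrite -mulr_sumr exchange_big /=; congr (_ * _); apply: eq_bigr => i _; apply: eq_bigr => j _.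
  by rewrite dot_row_mulmx.
apply: (@le_trans _ _ (\sum_j LamG * nsq (row j Mb)^T)); first by apply: ler_sum => j _; exact: sumB.
rewrite -mulr_sumr ler_wpM2l ?(ltW LamG0) //; apply: le_trans fsq_Mb.
by rewrite le_eqVlt; apply/orP; left; apply/eqP; apply: eq_bigr => j _; apply: eq_bigr => a _; rewrite !mxE.
Qed.

Definition final_bound : R :=
  6 / kapN ^+ 2 * (4 * vT + 4 * (LamG * (be2 * tr)) + 2 * (mM * vR))
  + 2 / kapN * (Cgt * (2 * be2 + 2 * (LamG * mM))).

Let nsq_phb u : nsq (phb u) <= be2.
Proof.
by rewrite phbE; apply: nsq_mean_le.
Qed.

Lemma gamma_hat_bound : nsq (gamma_hat Bf y Us Xs_ - gamp) <= final_bound.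
Proof.
have kap0 : 0 < kapN by apply: divr_gt0 => //; apply: divr_gt0.
have N0 : (0 < N)%N by rewrite NE muln_gt0.
pose eta i := dot (phb (U i w) - Mb *m B_ i) (gt (U i w)).
have := @ls_bound R N (p * L) (Btilde_hat Bf y Us Xs_) (fun i => Zlab (y i)) (fun i => rho_ i w) eta gamp kapN kap0 N0.
move=> /(_ _ _); rewrite -/(D_n Bf y Us Xs_) -/(b_n Bf y Us Xs_) -/(gamma_hat Bf y Us Xs_) => h.
apply: (le_trans (h _ _)) => {h}.
- move=> v; rewrite nsq_vec; apply: (le_trans (net_lower q2 N0 pq Lq hph hq hbad hxx (vec_mx v^T) (le_trans fsq_Mb hmM))).
  rewrite le_eqVlt; apply/orP; left; apply/eqP; congr (_ * _); apply: eq_bigr => i _.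
  by rewrite BtE dot_kron.
- move=> i; rewrite BtE dot_kron -/Gam -/(gt (U i w)) rhoE /eta.
  have -> : dot (xi_ i w + phb (U i w) - Mb *m B_ i) (gt (U i w))
     = dot (gt (U i w)) (xi_ i w) + dot (phb (U i w) - Mb *m B_ i) (gt (U i w)) by rewrite (dotC (gt _)) -dotDl addrA.
  by ring.
apply: lerD.
- rewrite ler_wpM2l ?divr_ge0 ?exprn_ge0 ?(ltW kap0) // nsq_vec.
  have -> : vec_mx (N%:R^-1 *: \sum_i rho_ i w *: Btilde_hat Bf y Us Xs_ i)^T
     = (N%:R^-1 *: T1m w + (N%:R^-1 *: \sum_i B_ i *m (rho_ i w *: phb (U i w))^T)^T) - N%:R^-1 *: (Mb *m Rm w).
    have eL : vec_mx (N%:R^-1 *: \sum_i rho_ i w *: Btilde_hat Bf y Us Xs_ i)^T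
       = N%:R^-1 *: \sum_i rho_ i w *: ((xi_ i w + phb (U i w) - Mb *m B_ i) *m (B_ i)^T).
      rewrite linearZ /= linearZ /=; congr (_ *: _); rewrite linear_sum /= linear_sum /=.
      by apply: eq_bigr => i _; rewrite BtE linearZ /= linearZ /= vec_mx_kron.
    have eM : Mb *m Rm w = \sum_i rho_ i w *: (Mb *m B_ i *m (B_ i)^T).
      by rewrite /Rm mulmx_sumr; apply: eq_bigr => i _; rewrite -scalemxAr mulmxA.
    have eP : (\sum_i B_ i *m (rho_ i w *: phb (U i w))^T)^T = \sum_i rho_ i w *: (phb (U i w) *m (B_ i)^T).
      by rewrite linear_sum /=; apply: eq_bigr => i _; rewrite trmx_mul trmxK -scalemxAl.
    rewrite eL linearZ /= eP eM -scalerDr -scalerBr; congr (_ *: _); rewrite -big_split -sumrB.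
    by apply: eq_bigr => i _ /=; rewrite -scalerDr -scalerBr mulmxBl mulmxDl.
  apply: (le_trans (fsqD_le _ _)).
  have -> : fsq (- (N%:R^-1 *: (Mb *m Rm w))) = fsq (N%:R^-1 *: (Mb *m Rm w)) by rewrite -scaleNr !fsqZ sqrrN.
  have h1 := fsqD_le (N%:R^-1 *: T1m w) (N%:R^-1 *: \sum_i B_ i *m (rho_ i w *: phb (U i w))^T)^T.
  have h2 : fsq (N%:R^-1 *: T1m w) <= vT.
    by rewrite fsqZ exprVn mulrC ler_pdivrMr ?exprn_gt0 // mulrC.
  have h3 : fsq (N%:R^-1 *: \sum_i B_ i *m (rho_ i w *: phb (U i w))^T)^T <= LamG * (be2 * tr).
    rewrite fsq_tr; apply: fsq_outer_mean; [by rewrite invr_ge0 ltW|exact: ltW|exact: sumB|].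
    rewrite mulrC ler_pdivrMr //; apply: (@le_trans _ _ (be2 * \sum_i rho_ i w ^+ 2)).
      rewrite mulr_sumr; apply: ler_sum => i _; rewrite nsqZ mulrC ler_wpM2r ?sqr_ge0 //.
    by rewrite -mulrA ler_wpM2l // mulrC.
  have h4 : fsq (N%:R^-1 *: (Mb *m Rm w)) <= mM * vR.
    rewrite fsqZ exprVn mulrC ler_pdivrMr ?exprn_gt0 //; apply: (le_trans (fsq_mulmx _ _)).
    by rewrite -mulrA; apply: ler_pM; rewrite ?fsq_ge0 // mulrC.
  by move: h1 h2 h3 h4; lra.
- apply: ler_wpM2l; first by apply: divr_ge0 => //; exact: ltW.
  apply: (@le_trans _ _ (N%:R^-1 * \sum_i Cgt * (2 * be2 + 2 * nsq (Mb *m B_ i)))).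
    rewrite ler_wpM2l ?invr_ge0 ?(ltW NR) //; apply: ler_sum => i _.
    apply: (le_trans (cauchy_schwarz _ _)); rewrite mulrC; apply: ler_pM; rewrite ?nsq_ge0 ?gt_sup //.
    apply: (le_trans (nsqB_le _ _)); have := nsq_phb (U i w); lra.
  have -> : N%:R^-1 * \sum_i Cgt * (2 * be2 + 2 * nsq (Mb *m B_ i)) = Cgt * (2 * be2 + 2 * (N%:R^-1 * \sum_i nsq (Mb *m B_ i))).
    rewrite -mulr_sumr big_split /= sumr_const card_ord -[_ *+ N]mulr_natl -mulr_sumr.
    by field; rewrite gt_eqF.
  by rewrite ler_wpM2l ?Cgt_ge0 // lerD2l ler_wpM2l // sumMB.
Qed.

End Deterministic.

Section Assembly.
Variables (n q : nat) (Sm : bool -> 'M[R]_(p, L)) (phf : bool -> R -> 'cV[R]_p) (be2 t : R).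
Hypothesis p0 : (0 < p)%N.
Hypothesis n0 : (0 < n)%N.
Hypothesis NE : N = (2 * n)%N.
Hypothesis hcard : forall cls, #|[pred i | y i == cls]| = n.
Hypothesis phbE : forall u, phb u = 2^-1 *: (phf true u + phf false u).
Hypothesis dlE : forall u, dl u = (Sm true *m Bf u + phf true u) - (Sm false *m Bf u + phf false u).
Hypothesis hbe : forall cls u, nsq (phf cls u) <= be2.
Hypothesis t0 : 0 < t.
Hypothesis q2 : (1 < q)%N.
Hypothesis pq : (p <= q)%N.
Hypothesis Lq : (L <= q)%N.
Hypothesis hbq : be2 <= q%:R ^+ 2.
Hypothesis hq : 28 / q%:R ^+ 2 <= kapN.
Definition xN : R := p%:R * L%:R / n%:R.
Hypothesis hmM : mM be2 (t * xN) <= q%:R ^+ 2.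
Hypothesis hL2 : L%:R ^+ 2 <= n%:R :> R.

Let nR : 0 < n%:R :> R. Proof. by rewrite ltr0n. Qed.
Let NR : N%:R = 2 * n%:R :> R. Proof. by rewrite NE natrM. Qed.
Let pR : 0 < p%:R :> R. Proof. by rewrite ltr0n. Qed.
Let xN0 : 0 < xN. Proof. by rewrite divr_gt0 // mulr_gt0. Qed.

Definition cst_tail : R := cst_x Cgt + 2 * cst_rho Cgt + 4 * (lam1 * gv2).
Definition cst_final : R :=
  6 / kapN ^+ 2 * (4 * t + 4 * (LamG * t) + 2 * (8 / g0 ^+ 2 * (LamG + t) * t))
  + 2 / kapN * (Cgt * (2 + 2 * (LamG * (8 / g0 ^+ 2 * (LamG + t))))).

Lemma model_bound : exists Bad : set T, [/\ measurable Bad,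
  prob P Bad <= cst_tail / t + 16 / g0 ^+ 2 * (L%:R ^+ 2 / n%:R)
     + (2^-1 * M2 + 2 * lam1 * (gv2 * p%:R)) / q%:R ^+ 2
     + ((2 * q ^ 5).+1 ^ (2 * p * L))%:R * expR (- (cC * N%:R / L%:R)) &
  forall w, ~ Bad w -> nsq (gamma_hat Bf y (fun i => U i w) (Xs_ Sm phf w) - gamp) <= cst_final * (be2 + xN)].
Proof.
have l1 := ltW l10; have gv := @gv2_gt0 R.
have NR0 : 0 < N%:R :> R by rewrite NR mulr_gt0.
pose vT := t * xN / 2; pose vR := t * (L%:R ^+ 2 / N%:R).
have vT0 : 0 < vT by rewrite /vT divr_gt0 // mulr_gt0.
have vR0 : 0 < vR by rewrite /vR mulr_gt0 // divr_gt0 // exprn_gt0.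
have vE0 : 0 < t * xN by rewrite mulr_gt0.
have N20 : 0 < N%:R ^+ 2 :> R by exact: exprn_gt0.
have n20 : 0 < n%:R ^+ 2 :> R by exact: exprn_gt0.
have nn : n%:R != 0 :> R by rewrite gt_eqF.
have ng : g0 != 0 by rewrite gt_eqF.
have nt : t != 0 by rewrite gt_eqF.
have nL : L%:R != 0 :> R by rewrite gt_eqF.
have np : p%:R != 0 :> R by rewrite gt_eqF.
have qR0 : 0 < q%:R :> R by rewrite ltr0n ltnW.
have [m1 P1] := T1_tail p0 (mulr_gt0 N20 vT0).
have [m2 P2] := R_tail (mulr_gt0 N20 vR0).
have [m3 P3] := rho_tail (mulr_gt0 NR0 t0).
have [m4 P4] := E_tail true (mulr_gt0 n20 vE0).
have [m5 P5] := E_tail false (mulr_gt0 n20 vE0).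
have gg : 0 < (n%:R * (g0 / 2)) ^+ 2 by rewrite exprn_gt0 // mulr_gt0 // divr_gt0.
have [m6 P6] := G_tail true gg.
have [m7 P7] := G_tail false gg.
have [m8 P8] := x_tail (mulr_gt0 NR0 (exprn_gt0 2 qR0)).
have [m9 P9] := bad_net_tail q.
have U2 (A B : set T) (a b : R) : measurable A -> prob P A <= a -> measurable B -> prob P B <= b ->
    measurable (A `|` B) /\ prob P (A `|` B) <= a + b.
  move=> mA hA mB hB; split; first exact: measurableU.
  apply: (le_trans _ (lerD hA hB)); rewrite /prob -lee_fin EFinD !fineK ?fin_num_measure //; last exact: measurableU.
  exact: measureU2.
have [n2 Q2] := U2 _ _ _ _ m1 P1 m2 P2.
have [n3 Q3] := U2 _ _ _ _ n2 Q2 m3 P3.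
have [n4 Q4] := U2 _ _ _ _ n3 Q3 m4 P4.
have [n5 Q5] := U2 _ _ _ _ n4 Q4 m5 P5.
have [n6 Q6] := U2 _ _ _ _ n5 Q5 m6 P6.
have [n7 Q7] := U2 _ _ _ _ n6 Q6 m7 P7.
have [n8 Q8] := U2 _ _ _ _ n7 Q7 m8 P8.
have [n9 Q9] := U2 _ _ _ _ n8 Q8 m9 P9.
eexists; split; [exact: n9| |].
- apply: (le_trans Q9); rewrite lerD2r; rewrite le_eqVlt; apply/orP; left; apply/eqP.
  rewrite /vT /vR /xN /cst_tail NR /cx /crho; move: (cst_x _) (cst_rho _) => a b.
  by field; rewrite ?nn ?ng ?nt ?nL ?np ?gt_eqF.
- move=> w nB.
  have c1 : fsq (T1m w) <= N%:R ^+ 2 * vT.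
    by rewrite leNgt; apply/negP => /ltW h; apply: nB; do 8 left.
  have c2 : fsq (Rm w) <= N%:R ^+ 2 * vR.
    by rewrite leNgt; apply/negP => /ltW h; apply: nB; do 7 left; right.
  have c3 : \sum_i rho_ i w ^+ 2 <= N%:R * t.
    by rewrite leNgt; apply/negP => /ltW h; apply: nB; do 6 left; right.
  have c4 cls : fsq (Em cls w) <= n%:R ^+ 2 * (t * xN).
    by rewrite leNgt; apply/negP => /ltW h; apply: nB; case: cls h => h; [do 5 left; right|do 4 left; right].
  have c6 cls : fsq (Gm cls w) <= (n%:R * (g0 / 2)) ^+ 2.
    by rewrite leNgt; apply/negP => /ltW h; apply: nB; case: cls h => h; [do 3 left; right|do 2 left; right].
  have c8 : \sum_i nsq (xi_ i w) <= N%:R * q%:R ^+ 2.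
    by rewrite leNgt; apply/negP => /ltW h; apply: nB; left; right.
  have c9 : ~ bad_net q w by move=> h; apply: nB; right.
  have be20 : 0 <= be2 by apply: le_trans (hbe true 0); exact: nsq_ge0.
  have hph u : nsq (phb u) <= q%:R ^+ 2.
    by apply: le_trans hbq; rewrite phbE; apply: nsq_mean_le.
  apply: (le_trans (gamma_hat_bound n0 NE hcard phbE dlE hbe c6 c4 c1 c2 c3 q2 pq Lq hph hq hmM c9 c8)).
  have kap0 : 0 < kapN by apply: divr_gt0 => //; apply: divr_gt0.
  have LG0 : 0 < LamG by exact: addr_gt0.
  set X := be2 + xN; have X0 : 0 <= X by rewrite addr_ge0 // ltW.
  have bX : be2 <= X by rewrite lerDl ltW.
  have xX : xN <= X by rewrite lerDr.
  pose mc := 8 / g0 ^+ 2 * (LamG + t).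
  have mc0 : 0 <= mc by rewrite mulr_ge0 // ?divr_ge0 ?sqr_ge0 // addr_ge0 // ltW.
  have hM : mM be2 (t * xN) <= mc * X.
    rewrite /mM /mc.
    have -> : 4 / g0 ^+ 2 * (2 * LamG * be2 + 2 * (t * xN)) = 8 / g0 ^+ 2 * (LamG * be2 + t * xN) by field; rewrite ng.
    rewrite -[leRHS]mulrA; apply: ler_wpM2l; first by apply: divr_ge0 => //; exact: sqr_ge0.
    by rewrite [leRHS]mulrDl; apply: lerD; apply: ler_wpM2l => //; exact: ltW.
  have vR1 : vR <= t.
    rewrite /vR ler_piMr ?(ltW t0) // ler_pdivrMr // mul1r; apply: (le_trans hL2).
    by rewrite NR ler_peMl ?(ltW nR) // ler1n.
  have hMR : mM be2 (t * xN) * vR <= mc * t * X.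
    apply: (@le_trans _ _ (mc * X * vR)); first by rewrite ler_wpM2r // ltW.
    by rewrite mulrAC ler_wpM2r // ler_wpM2l.
  have hvT : vT <= t * X.
    rewrite /vT; have : t * xN <= t * X by rewrite ler_wpM2l // ltW.
    by move: vE0; lra.
  have hbt : LamG * (be2 * t) <= LamG * t * X.
    by rewrite -mulrA ler_wpM2l ?(ltW LG0) // mulrC ler_wpM2l // ltW.
  have hLM : LamG * mM be2 (t * xN) <= LamG * mc * X by rewrite -mulrA ler_wpM2l // ltW.
  rewrite /final_bound /cst_final -/mc [leRHS]mulrDl; apply: lerD.
    rewrite -[leRHS]mulrA ler_wpM2l ?divr_ge0 ?exprn_ge0 ?(ltW kap0) //.
    have -> : (4 * t + 4 * (LamG * t) + 2 * (mc * t)) * X = 4 * (t * X) + 4 * (LamG * t * X) + 2 * (mc * t * X) by ring.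
    by apply: lerD; [apply: lerD|]; apply: ler_wpM2l.
  have -> : 2 / kapN * (Cgt * (2 + 2 * (LamG * mc))) * X = 2 / kapN * (Cgt * ((2 + 2 * (LamG * mc)) * X)) by ring.
  apply: ler_wpM2l; first by apply: divr_ge0 => //; exact: ltW.
  apply: ler_wpM2l; first exact: Cgt_ge0.
  have -> : (2 + 2 * (LamG * mc)) * X = 2 * X + 2 * (LamG * mc * X) by ring.
  by apply: lerD; apply: ler_wpM2l.
Qed.

End Assembly.
End Model.

Section MatrixMeasurability.
Context d (T : measurableType d) (R : realType).

Definition mxmeas a b (F : T -> 'M[R]_(a, b)) := forall i j, measurable_fun setT (fun w => F w i j).

Lemma measurable_bigsum (I : finType) (Q : pred I) (f : I -> T -> R) :
  (forall i, measurable_fun setT (f i)) -> measurable_fun setT (fun w => \sum_(i | Q i) f i w).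
Proof.
move=> mf; rewrite (_ : (fun w => _) = (fun w => \sum_(i <- enum Q) f i w)); last first.
  by apply/funext => w; rewrite big_enum.
exact: measurable_sum.
Qed.

Lemma measurable_bigprod (I : Type) (s : seq I) (f : I -> T -> R) :
  (forall i, measurable_fun setT (f i)) -> measurable_fun setT (fun w => \prod_(i <- s) f i w).
Proof.
move=> mf; elim: s => [|i s IH]; first by under eq_fun do rewrite big_nil; exact: measurable_cst.
by under eq_fun do rewrite big_cons; exact: measurable_funM.
Qed.

Lemma mxmeas_cst a b (A : 'M[R]_(a, b)) : mxmeas (fun=> A).
Proof. by move=> i j; exact: measurable_cst. Qed.

Lemma mxmeas_mul a b c (F : T -> 'M[R]_(a, b)) (G : T -> 'M[R]_(b, c)) :
  mxmeas F -> mxmeas G -> mxmeas (fun w => F w *m G w).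
Proof.
move=> mF mG i j; under eq_fun do rewrite mxE.
by apply: measurable_bigsum => k; exact: measurable_funM.
Qed.

Lemma mxmeas_add a b (F G : T -> 'M[R]_(a, b)) : mxmeas F -> mxmeas G -> mxmeas (fun w => F w + G w).
Proof. by move=> mF mG i j; under eq_fun do rewrite mxE; exact: measurable_funD. Qed.

Lemma mxmeas_opp a b (F : T -> 'M[R]_(a, b)) : mxmeas F -> mxmeas (fun w => - F w).
Proof. by move=> mF i j; under eq_fun do rewrite mxE; apply: measurableT_comp. Qed.

Lemma mxmeas_scale a b c (F : T -> 'M[R]_(a, b)) : mxmeas F -> mxmeas (fun w => c *: F w).
Proof. by move=> mF i j; under eq_fun do rewrite mxE; exact: measurable_funM. Qed.

Lemma mxmeas_tr a b (F : T -> 'M[R]_(a, b)) : mxmeas F -> mxmeas (fun w => (F w)^T).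
Proof. by move=> mF i j; under eq_fun do rewrite mxE; exact: mF. Qed.

Lemma mxmeas_sum (I : finType) (Q : pred I) a b (F : I -> T -> 'M[R]_(a, b)) :
  (forall i, mxmeas (F i)) -> mxmeas (fun w => \sum_(i | Q i) F i w).
Proof.
move=> mF i j; under eq_fun do rewrite summxE.
by apply: measurable_bigsum => k; exact: mF.
Qed.

Lemma mxmeas_vec_mx a b (F : T -> 'rV[R]_(a * b)) : mxmeas F -> mxmeas (fun w => vec_mx (F w)).
Proof. by move=> mF i j; under eq_fun do rewrite mxE; exact: mF. Qed.

Lemma mxmeas_kron a b (F : T -> 'cV[R]_a) (G : T -> 'cV[R]_b) :
  mxmeas F -> mxmeas G -> mxmeas (fun w => kron (F w) (G w)).
Proof.
move=> mF mG i j; rewrite ord1; case/mxvec_indexP: i => k l; under eq_fun do rewrite kronE.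
exact: measurable_funM.
Qed.

Lemma measurable_det a (F : T -> 'M[R]_a) : mxmeas F -> measurable_fun setT (fun w => \det (F w)).
Proof.
move=> mF; rewrite /determinant; apply: measurable_bigsum => s.
by apply: measurable_funM => //; apply: measurable_bigprod.
Qed.

Lemma mxmeas_inv a (F : T -> 'M[R]_a) : mxmeas F -> mxmeas (fun w => invmx (F w)).
Proof.
move=> mF i j.
have -> : (fun w => invmx (F w) i j) = (fun w => (\det (F w))^-1 * \adj (F w) i j + \1_[set 0] (\det (F w)) * F w i j).
  apply/funext => w; rewrite /invmx unitmxE unitfE indicE.
  case: (eqVneq (\det (F w)) 0) => h /=.
    by rewrite h invr0 mul0r add0r mem_set // mul1r.
  by rewrite mxE memNset ?mul0r ?addr0 // => /eqP; rewrite (negPf h).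
have mdet := measurable_det mF.
apply: measurable_funD; apply: measurable_funM.
- exact: (measurableT_comp measurable_inv mdet).
- under eq_fun do rewrite mxE /cofactor; apply: measurable_funM => //.
  apply: measurable_det => k l; under eq_fun do rewrite !mxE; exact: mF.
- by apply: (measurableT_comp _ mdet); exact: measurable_indic.
- exact: mF.
Qed.

Lemma mxmeas_gamma_hat p L N (Bf : R -> 'cV[R]_L) (y : 'I_N -> bool) (Us : 'I_N -> T -> R) (Xs : 'I_N -> T -> 'cV[R]_p) :
  (forall i, mxmeas (fun w => Bf (Us i w))) -> (forall i, mxmeas (Xs i)) ->
  mxmeas (fun w => gamma_hat Bf y (fun i => Us i w) (fun i => Xs i w)).
Proof.
move=> mB mX.
have ma cls : mxmeas (fun w => alpha_hat Bf y (fun i => Us i w) (fun i => Xs i w) cls).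
  apply: mxmeas_mul; first apply: mxmeas_inv; apply: mxmeas_sum => i; apply: mxmeas_mul => //; exact: mxmeas_tr.
have mm i : mxmeas (fun w => mu_hat Bf y (fun i => Us i w) (fun i => Xs i w) (Us i w)).
  apply: mxmeas_scale; apply: mxmeas_add; apply: mxmeas_mul => //; exact: mxmeas_tr.
have mBt i : mxmeas (fun w => Btilde_hat Bf y (fun i => Us i w) (fun i => Xs i w) i).
  by apply: mxmeas_kron => //; apply: mxmeas_add => //; exact: mxmeas_opp.
apply: mxmeas_mul; first apply: mxmeas_inv.
  by apply: mxmeas_scale; apply: mxmeas_sum => i; apply: mxmeas_mul => //; exact: mxmeas_tr.
by apply: mxmeas_scale; apply: mxmeas_sum => i; apply: mxmeas_scale.
Qed.

End MatrixMeasurability.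

(** * The theorem *)

Section ThetaDistance.
Context {R : realType}.

Lemma L2dist_thetaOf p L (v v' : 'cV[R]_(p * L)) (Bf : R -> 'cV[R]_L) : (forall k, bm (fun u => Bf u k 0)) ->
  L2dist (thetaOf v Bf) (thetaOf v' Bf) = Num.sqrt (Eexp unif01 (fun u => nsq (vec_mx (v - v')^T *m Bf u))).
Proof.
move=> bB; rewrite /L2dist; congr Num.sqrt; apply: EFin_inj.
have bG : bm (fun u => nsq (vec_mx (v - v')^T *m Bf u)) by bmt.
have mG : mom unif01 (fun u => nsq (vec_mx (v - v')^T *m Bf u)).
  by apply: (@mom_bm _ _ _ unif01 id (fun u => nsq (vec_mx (v - v')^T *m Bf u))).
have -> : ([set u : R | 0 <= u <= 1] : set R) = `[0%R, 1%R]%classic.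
  by apply/seteqP; split=> x /=; rewrite in_itv.
have e : (\int[lebesgue_measure]_(u in `[0%R, 1%R]) (vnorm2 (thetaOf v Bf u - thetaOf v' Bf u) ^+ 2)%:E
   = (Eexp unif01 (fun u => nsq (vec_mx (v - v')^T *m Bf u)))%:E)%E.
  rewrite ExE // unif01_integral; last 2 first.
  - by apply/measurable_EFinP; case: bG.
  - by move=> x; rewrite lee_fin nsq_ge0.
  by apply: eq_integral => x _; rewrite vnorm2_sq thetaOfB.
by rewrite e.
Qed.

Lemma measurable_L2_thetaOf d (T : measurableType d) p L (v : T -> 'cV[R]_(p * L)) (v' : 'cV[R]_(p * L))
  (Bf : R -> 'cV[R]_L) : (forall k, bm (fun u => Bf u k 0)) -> mxmeas v ->
  measurable_fun setT (fun w => L2dist (thetaOf (v w) Bf) (thetaOf v' Bf)).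
Proof.
move=> bB mv; under eq_fun do rewrite L2dist_thetaOf //.
apply: (measurableT_comp measurable_sqrt).
have mb a : mom unif01 (fun u => Bf u a 0) by exact: (@mom_bm _ _ _ unif01 id _ _ (bB a)).
pose G w := vec_mx (v w - v')^T.
have mG : mxmeas G.
  apply: mxmeas_vec_mx; apply: mxmeas_tr; apply: mxmeas_add => //; exact: mxmeas_cst.
have -> : (fun w => Eexp unif01 (fun u => nsq (vec_mx (v w - v')^T *m Bf u)))
   = (fun w => \sum_(j < p) \sum_(a < L) \sum_(b < L) G w j a * G w j b * Eexp unif01 (fun u => Bf u a 0 * Bf u b 0)).
  apply/funext => w; rewrite -/(G w).
  have -> : (fun u => nsq (G w *m Bf u)) = (fun u => \sum_(j < p) \sum_(a < L) \sum_(b < L) G w j a * G w j b * (Bf u a 0 * Bf u b 0)).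
    apply/funext => u; apply: eq_bigr => j _; rewrite mxE expr2 mulr_suml; apply: eq_bigr => a _.
    by rewrite mulr_sumr; apply: eq_bigr => b _; ring.
  rewrite Ex_sum; last by move=> j; momt.
  apply: eq_bigr => j _; rewrite Ex_sum; last by move=> a; momt.
  apply: eq_bigr => a _; rewrite Ex_sum; last by move=> b; momt.
  by apply: eq_bigr => b _; rewrite ExZ //; momt.
do 3 (apply: measurable_bigsum => ?).
apply: measurable_funM => //; apply: measurable_funM; exact: mG.
Qed.

End ThetaDistance.

Section Transpose.
Context {R : realType}.

Lemma nsq_mulmx_transp k (A : 'M[R]_k) c : 0 <= c -> (forall v, nsq (A^T *m v) <= c * nsq v) ->
  forall v, nsq (A *m v) <= c * nsq v.
Proof.
move=> c0 h v; have h1 : nsq (A *m v) = dot v (A^T *m (A *m v)) by rewrite -dotvv dotC dot_mulmxr dotC.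
have h2 := cauchy_schwarz v (A^T *m (A *m v)); rewrite -h1 in h2.
have h3 : nsq (A *m v) ^+ 2 <= nsq v * (c * nsq (A *m v)).
  by apply: (le_trans h2); rewrite ler_wpM2l ?nsq_ge0.
have [->|nz] := eqVneq (nsq (A *m v)) 0; first by rewrite mulr_ge0 ?nsq_ge0.
have np : 0 < nsq (A *m v) by rewrite lt_neqAle eq_sym nz nsq_ge0.
by rewrite -(ler_pM2r np) -expr2; apply: (le_trans h3); rewrite mulrCA mulrA.
Qed.

End Transpose.

Section Concrete.
Context {R : realType}.
Variables (m t : nat) (r Dc Lc lam0 lam1 D1 D2 M Cq : R).
Hypothesis hm : (t < m)%N.
Hypothesis hlam : 0 < lam0 <= lam1.
Hypothesis hD : 0 < D1 <= D2.
Variables (K : nat) (xi : nat -> R).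
Hypothesis hxi : interior_knots K xi.
Hypothesis hqu : quasi_uniform Cq K xi.
Local Notation L := (nbasis m K).
Local Notation B := (Bvec m K xi).
Variable c0 : R.
Hypothesis c00 : 0 < c0.
Hypothesis hstab : forall c, c0 * nsq c <= Eexp unif01 (fun u => dot c (B u) ^+ 2).
Variable Ca : R.
Hypothesis happ : forall f, holder_class t r Dc Lc f -> exists c : 'cV[R]_L, forall u, 0 <= u <= 1 ->
  `|f u - dot c (B u)| <= Ca * (L%:R `^ (- (r + t%:R))).
Context d (T : measurableType d) (P : probability T R).
Variables (p n : nat) (h : R -> R) (mu1 mu2 : R -> 'cV[R]_p) (Sig A : R -> 'M[R]_p).
Variables (y : 'I_(2 * n) -> bool) (U : 'I_(2 * n) -> T -> R) (W : 'I_(2 * n) -> 'I_p -> T -> R)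
  (U0 : T -> R) (W0 : 'I_p -> T -> R) (Y0 : T -> R).
Hypothesis hlab : #|[pred i | y i]| = n.
Hypothesis hind : mutually_independent P (sample_family U W U0 W0 Y0).
Hypothesis hU : forall i, has_density_01 P (U i) h.
Hypothesis hU0 : has_density_01 P U0 h.
Hypothesis hW : forall i k, std_normal P (W i k).
Hypothesis hW0 : forall k, std_normal P (W0 k).
Hypothesis mh : measurable_fun setT h.
Hypothesis mmu1 : forall j, measurable_fun setT (fun u => mu1 u j 0).
Hypothesis mmu2 : forall j, measurable_fun setT (fun u => mu2 u j 0).
Hypothesis mA : forall i j, measurable_fun setT (fun u => A u i j).
Hypothesis hSigA : forall u, 0 <= u <= 1 -> Sig u = A u *m (A u)^T.
Hypothesis hC1 : forall u a, 0 <= u <= 1 -> eigenvalue (Sig u) a -> lam0 <= a <= lam1.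
Hypothesis hC2 : forall u, 0 <= u <= 1 -> D1 <= h u <= D2.
Hypothesis hC3mu1 : forall j, holder_class t r Dc Lc (fun u => mu1 u j 0).
Hypothesis hC3mu2 : forall j, holder_class t r Dc Lc (fun u => mu2 u j 0).
Hypothesis hC4 : forall u, 0 <= u <= 1 -> vnorm2 (mu1 u - mu2 u) <= M.

Let m0 : (0 < m)%N. Proof. exact: leq_ltn_trans hm. Qed.
Let l00 : 0 < lam0. Proof. by case/andP: hlam. Qed.
Let l10 : 0 < lam1. Proof. by case/andP: hlam => a b; exact: lt_le_trans b. Qed.
Let D10 : 0 < D1. Proof. by case/andP: hD. Qed.
Let D20 : 0 < D2. Proof. by case/andP: hD => a b; exact: lt_le_trans b. Qed.

Definition g0c := D1 * c0.
Definition g1c := D2 * (m%:R ^+ 2 * Cq).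

Let g00 : 0 < g0c. Proof. exact: mulr_gt0. Qed.
Let g10 : 0 < g1c.
Proof.
rewrite mulr_gt0 // mulr_gt0 ?exprn_gt0 ?ltr0n //.
by apply: lt_le_trans (quasi_uniform_ge1 hxi hqu).
Qed.

(* The splines vanish outside [0, 1], so the model functions may be cut off there without changing
   either estimator; this makes them bounded. *)
Definition clip k l (f : R -> 'M[R]_(k, l)) (u : R) : 'M[R]_(k, l) := if 0 <= u <= 1 then f u else 0.
Let dl := clip (fun u => mu1 u - mu2 u).
Let Ac := clip A.
Let muc (cls : bool) : R -> 'cV[R]_p := clip (if cls then mu1 else mu2).

Lemma bm_clip k l (f : R -> 'M[R]_(k, l)) i j C : measurable_fun setT (fun u => f u i j) ->
  (forall u, 0 <= u <= 1 -> `|f u i j| <= C) -> bm (fun u => clip f u i j).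
Proof.
move=> mf hC; have mI : measurable (`[0%R, 1%R]%classic : set R) by exact: measurable_itv.
have e : (fun u => clip f u i j) = (fun u => f u i j * \1_(`[0%R, 1%R]%classic) u).
  apply/funext => u; rewrite /clip indicE; case: ifP => hu.
    by rewrite mem_set ?mulr1 //= in_itv.
  by rewrite memNset ?mulr0 ?mxE //= in_itv /= hu.
split; first by rewrite e; apply: measurable_funM => //; exact: measurable_indic.
exists `|C| => u; rewrite /clip; case: ifP => hu; last by rewrite mxE normr0.
exact: le_trans (hC u hu) (ler_norm C).
Qed.

Let holder_sup f u : holder_class t r Dc Lc f -> 0 <= u <= 1 -> `|f u| <= Dc.
Proof. by move=> [_ [hb _]] hu; exact: (hb 0%N u). Qed.

Let bmuc cls k : bm (fun u => muc cls u k 0).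
Proof.
rewrite /muc; case: cls.
  by apply: (bm_clip (mmu1 k)) => u hu; exact: (holder_sup (hC3mu1 k) hu).
by apply: (bm_clip (mmu2 k)) => u hu; exact: (holder_sup (hC3mu2 k) hu).
Qed.

Let dlE' u : dl u = muc true u - muc false u.
Proof. by rewrite /dl /muc /clip; case: ifP => //; rewrite subr0. Qed.

Let bdl k : bm (fun u => dl u k 0).
Proof.
have -> : (fun u => dl u k 0) = (fun u => muc true u k 0 - muc false u k 0).
  by apply/funext => u; rewrite dlE' !mxE.
by have := bmuc; move=> hb; bmt.
Qed.

Let hdl u : nsq (dl u) <= M ^+ 2.
Proof.
rewrite /dl /clip; case: ifP => hu.
  by rewrite -vnorm2_sq lerXn2r ?nnegrE ?sqrtr_ge0 ?hC4 // (le_trans _ (hC4 hu)) // sqrtr_ge0.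
rewrite /nsq big1 ?sqr_ge0 // => i _; by rewrite mxE expr0n.
Qed.

Let hAt u v : 0 <= u <= 1 -> lam0 * nsq v <= nsq ((A u)^T *m v) <= lam1 * nsq v.
Proof.
move=> hu; have sS : (Sig u)^T = Sig u by rewrite hSigA // trmx_mul trmxK.
have := sym_form_bounds sS (fun a => @hC1 u a hu) v.
by rewrite hSigA // -mulmxA dot_mulmxr dotvv.
Qed.

Let nsq0 k : nsq (0 : 'cV[R]_k) = 0.
Proof. by rewrite /nsq big1 // => i _; rewrite mxE expr0n. Qed.

Let hA2 u v : nsq ((Ac u)^T *m v) <= lam1 * nsq v.
Proof.
rewrite /Ac /clip; case: ifP => hu; first by case/andP: (hAt v hu).
by rewrite trmx0 mul0mx nsq0 mulr_ge0 ?nsq_ge0 // ltW.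
Qed.

Let hA1 u v : nsq (Ac u *m v) <= lam1 * nsq v.
Proof. by apply: nsq_mulmx_transp; [exact: ltW|move=> v'; exact: hA2]. Qed.

Let hA0 u (G : 'M[R]_(p, L)) : lam0 * nsq (G *m B u) <= nsq ((Ac u)^T *m (G *m B u)).
Proof.
case: (boolP (0 <= u <= 1)) => hu; first by rewrite /Ac /clip hu; case/andP: (hAt (G *m B u) hu).
by rewrite (Bvec_out m hxi) // !mulmx0 !nsq0 mulr0.
Qed.

Let bA i j : bm (fun u => Ac u i j).
Proof.
apply: (@bm_clip _ _ A i j (Num.sqrt lam1)) => // u hu.
have h1 : nsq (A u *m (delta_mx j 0 : 'cV[R]_p)) <= lam1.
  apply: (le_trans (nsq_mulmx_transp (ltW l10) (fun v => proj2 (andP (hAt v hu))) _)).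
  rewrite /nsq (bigD1 j) //= mxE !eqxx expr1n big1 ?addr0 ?mulr1 // => k /negPf kj.
  by rewrite mxE kj expr0n.
rewrite -(@ler_pXn2r _ 2) ?nnegrE ?sqrtr_ge0 // real_normK ?num_real // sqr_sqrtr ?(ltW l10) //.
apply: le_trans h1; rewrite /nsq (bigD1 i) //= -colE mxE lerDl.
by apply: sumr_ge0 => k _; exact: sqr_ge0.
Qed.

Let bL : R := L%:R `^ (- (r + t%:R)).
Definition be2c : R := p%:R * (Ca * bL) ^+ 2.

Let Ssp : {Sm : bool -> 'M[R]_(p, L) | forall cls j u, 0 <= u <= 1 ->
  `|(if cls then mu1 else mu2) u j 0 - (Sm cls *m B u) j 0| <= Ca * bL}.
Proof.
have ex cls j : exists c : 'cV[R]_L, forall u, 0 <= u <= 1 ->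
    `|(if cls then mu1 else mu2) u j 0 - dot c (B u)| <= Ca * bL.
  by case: cls; [exact: happ (hC3mu1 j)|exact: happ (hC3mu2 j)].
pose Sm cls := \matrix_(j, a) (projT1 (cid (ex cls j))) a 0.
exists Sm => cls j u hu; have := projT2 (cid (ex cls j)) u hu.
suff -> : (Sm cls *m B u) j 0 = dot (projT1 (cid (ex cls j))) (B u) by [].
by rewrite mxE; apply: eq_bigr => a _; rewrite !mxE.
Qed.

Let Sm := projT1 Ssp.
Let phf cls u : 'cV[R]_p := muc cls u - Sm cls *m B u.
Let phb u : 'cV[R]_p := 2^-1 *: (phf true u + phf false u).

Let bphf cls k : bm (fun u => phf cls u k 0).
Proof.
have -> : (fun u => phf cls u k 0) = (fun u => muc cls u k 0 - (Sm cls *m B u) k 0) by apply/funext => u; rewrite !mxE.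
by have hb := bmuc; have hB := bm_Bvec m0 hxi; bmt.
Qed.

Let bphb k : bm (fun u => phb u k 0).
Proof.
have -> : (fun u => phb u k 0) = (fun u => 2^-1 * (phf true u k 0 + phf false u k 0)) by apply/funext => u; rewrite !mxE.
by have hb := bphf; bmt.
Qed.

Let hbe cls u : nsq (phf cls u) <= be2c.
Proof.
rewrite /phf /muc /clip; case: (boolP (0 <= u <= 1)) => hu; last first.
  by rewrite (Bvec_out m hxi) // mulmx0 subr0 nsq0 mulr_ge0 ?ler0n ?sqr_ge0.
rewrite /be2c mulr_natl -[X in _ *+ X](card_ord p) -sumr_const; apply: ler_sum => j _.
have := projT2 Ssp cls j u hu; rewrite -/Sm => hj.
have C0 : 0 <= Ca * bL by apply: le_trans hj.
rewrite -[leLHS]real_normK ?num_real // lerXn2r ?nnegrE //.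
by move: hj; rewrite !mxE; case: cls.
Qed.

Let dlE u : dl u = (Sm true *m B u + phf true u) - (Sm false *m B u + phf false u).
Proof. by rewrite /phf !(addrC (Sm _ *m B u)) !subrK dlE'. Qed.

Let mF i : measurable_fun setT (sample_family U W U0 W0 Y0 i) := hind.1 i.
Let mU0 : measurable_fun setT U0. Proof. exact: (mF (Some (inr tt, None))). Qed.
Let mU i : measurable_fun setT (U i). Proof. exact: (mF (Some (inl i, None))). Qed.
Let mW i k : measurable_fun setT (W i k). Proof. exact: (mF (Some (inl i, Some k))). Qed.

Let bB k : bm (fun u => B u k 0). Proof. exact: bm_Bvec. Qed.

Let hgl c : g0c * nsq c <= Eexp P (fun w => dot c (B (U0 w)) ^+ 2).
Proof.
have bf : bm (fun u => dot c (B u) ^+ 2) by bmt.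
have /andP[h1 _] := Ex_density_bounds mU0 hU0 mh D10 hC2 bf (fun u => sqr_ge0 _).
by apply: le_trans h1; rewrite /g0c -mulrA ler_wpM2l ?(ltW D10).
Qed.

Let L0 : (0 < L)%N. Proof. exact: (nbasis_gt0 m hxi). Qed.

Let hcard cls : #|[pred i | y i == cls]| = n.
Proof.
have e1 : #|[pred i | y i == true]| = n by transitivity #|[pred i | y i]| => //; apply: eq_card => i; rewrite !inE; case: (y i).
case: cls => //.
have h1 : (n + #|[predC [pred i | y i == true]]| = n + n)%N.
  by have := cardC [pred i | y i == true]; rewrite e1 addnn -mul2n => ->; exact: card_ord.
transitivity #|[predC [pred i | y i == true]]|; last exact: addnI h1.
by apply: eq_card => i; rewrite !inE; case: (y i).
Qed.

Let hbal : \sum_i Zlab (y i) = 0 :> R.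
Proof.
rewrite (bigID (fun i => y i == true)) /=.
rewrite (eq_bigr (fun=> 2^-1 : R)); last by move=> i /eqP ->; rewrite /Zlab /=; lra.
rewrite [X in _ + X](eq_bigr (fun=> - 2^-1 : R)); last by move=> i; case: (y i) => //= _; rewrite /Zlab /=; lra.
rewrite !sumr_const hcard.
have -> : #|[pred i | y i != true]| = n by transitivity #|[pred i | y i == false]| => //; apply: eq_card => i; rewrite !inE; case: (y i).
by rewrite mulNrn subrr.
Qed.

Let gpE : gamma_tilde P B mu1 mu2 A U0 W0 Y0 = gamp P U W U0 W0 Y0 B dl Ac.
Proof.
have e : Btilde_pop B mu1 mu2 A U0 W0 Y0 = Kp U W U0 W0 Y0 B dl Ac.
  apply/funext => w; rewrite /Btilde_pop /Kp; case: (boolP (0 <= U0 w <= 1)) => hu; last first.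
    by rewrite (Bvec_out m hxi) // /kron trmx0 !mulmx0.
  congr kron; rewrite /X0 /xu /gauss_obs /mu_mid /zt0 /Zlab /Uu /= /dl /Ac /clip hu.
  have -> : colv W0 w = Wv (sample_family U W U0 W0 Y0) (@wsu _ p (inr tt)) w by apply/colP => k; rewrite !mxE.
  by rewrite addrAC; congr (_ + _); apply/colP => k; case: (_ == _); rewrite !mxE /=; field.
by rewrite /gamma_tilde /gamp /D_pop /b_pop /Dp e.
Qed.

Let ghE w : theta_hat B y (fun i => U i w) (fun i => gauss_obs mu1 mu2 A (y i) (U i w) (colv (W i) w))
  = thetaOf (gamma_hat B y (fun i => U i w) (Xs_ U W B Ac y Sm phf w)) B.
Proof.
apply: theta_hat_ext => i; case: (boolP (0 <= U i w <= 1)) => hu; last by left; rewrite (Bvec_out m hxi).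
right; rewrite /Xs_ /phf addrC [_ + (muc _ _ - _)]addrC subrK addrC /gauss_obs /muc /Ac /clip hu.
by case: (y i).
Qed.

Let mgh : mxmeas (fun w => gamma_hat B y (fun i => U i w) (Xs_ U W B Ac y Sm phf w)).
Proof.
have mb i (f : R -> R) : bm f -> measurable_fun setT (fun w => f (U i w)).
  by move=> [mf _]; exact: (measurableT_comp mf (mU i)).
have mBU i : mxmeas (fun w => B (U i w)) by move=> k l; rewrite ord1; exact: (mb i (fun u => B u k 0)).
apply: (@mxmeas_gamma_hat _ _ _ _ _ _ B y U (fun i w => Xs_ U W B Ac y Sm phf w i)) => // i.
apply: mxmeas_add; first apply: mxmeas_add.
- by apply: mxmeas_mul => //; exact: mxmeas_cst.
- by move=> k l; rewrite ord1; exact: (mb i (fun u => phf (y i) u k 0)).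
- apply: mxmeas_mul => k l; first exact: (mb i (fun u => Ac u k l)).
  by under eq_fun do rewrite mxE; exact: mW.
Qed.

Variables (tt_ : R).
Hypothesis p0 : (0 < p)%N.
Hypothesis n1 : (1 < n)%N.
Hypothesis tt0 : 0 < tt_.
Hypothesis pn : (p <= n)%N.
Hypothesis Ln : (L <= n)%N.
Hypothesis hbq : be2c <= n%:R ^+ 2.
Hypothesis hq : 28 / n%:R ^+ 2 <= kapN g0c lam0.
Hypothesis hmM : mM g0c g1c be2c (tt_ * xN R p L n) <= n%:R ^+ 2.
Hypothesis hL2 : L%:R ^+ 2 <= n%:R :> R.

Lemma L2_tail c : Num.sqrt (g1c / D1 * (`|cst_final m g0c g1c (M ^+ 2) lam0 lam1 tt_| * (be2c + xN R p L n))) <= c ->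
  prob P [set w | c < L2dist
       (theta_hat B y (fun i => U i w) (fun i => gauss_obs mu1 mu2 A (y i) (U i w) (colv (W i) w)))
       (theta_tilde P B mu1 mu2 A U0 W0 Y0)]
  <= cst_tail m g0c g1c (M ^+ 2) lam0 lam1 / tt_ + 16 / g0c ^+ 2 * (L%:R ^+ 2 / n%:R)
     + (2^-1 * M ^+ 2 + 2 * lam1 * (gv2 * p%:R)) / n%:R ^+ 2
     + ((2 * n ^ 5).+1 ^ (2 * p * L))%:R * expR (- (cC g0c lam0 lam1 * (2 * n)%:R / L%:R)).
Proof.
move=> hc.
have hUlaw i (S : set R) : measurable S -> P (U0 @^-1` S) = P (U i @^-1` S) by move=> mS; rewrite hU0 // hU.
have hgu v := Ex_dot_Bvec_le m0 hxi hqu mU0 hU0 mh D10 hC2 v.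
have hgb k := Ex_Bvec_le m0 hxi hqu mU0 hU0 mh D10 hC2 k.
have [Bad [mBad PBad hBad]] := @model_bound _ T R P (2 * n)%N p L m U W U0 W0 Y0 hind hUlaw hW hW0 B dl Ac
  g0c g1c (M ^+ 2) lam0 lam1 m0 L0 bB (Bvec_ge0 m0 hxi) (Bvec_sum_le m0 hxi) (nsq_Bvec_le m0 hxi)
  (Bvec_overlap m0 hxi) g00 g10 hgl hgu hgb bdl (sqr_ge0 M) hdl bA l00 l10 hA1 hA2 hA0 y hbal phb bphb
  n n Sm phf be2c tt_ p0 (ltnW n1) erefl hcard (fun u => erefl) dlE hbe tt0 n1 pn Ln hbq hq hmM hL2.
apply: le_trans PBad; apply: prob_le => //.
  apply: measurable_gt.
  rewrite (_ : (fun w => _) = (fun w => L2dist (thetaOf (gamma_hat B y (fun i => U i w) (Xs_ U W B Ac y Sm phf w)) B)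
      (thetaOf (gamp P U W U0 W0 Y0 B dl Ac) B))); last first.
    by apply/funext => w; rewrite ghE /theta_tilde gpE.
  exact: measurable_L2_thetaOf.
move=> w /=; rewrite ghE /theta_tilde gpE => hw; apply: contrapT => nb; move: hw; apply/negP; rewrite -leNgt.
apply: le_trans hc; rewrite L2dist_thetaOf //.
set De := gamma_hat _ _ _ _ - _; have hDe := hBad w nb; rewrite -/De in hDe.
have X0 : 0 <= be2c + xN R p L n by apply: addr_ge0; [exact: le_trans (nsq_ge0 _) (hbe true 0)|rewrite /xN divr_ge0 // mulr_ge0].
have hD' : nsq De <= `|cst_final m g0c g1c (M ^+ 2) lam0 lam1 tt_| * (be2c + xN R p L n).
  by apply: (le_trans hDe); rewrite ler_wpM2r // ler_norm.
have q0 : 0 <= g1c / D1 by rewrite divr_ge0 // ltW.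
rewrite ler_sqrt; last by rewrite mulr_ge0 // mulr_ge0.
apply: (@le_trans _ _ (g1c / D1 * nsq De)); last by rewrite ler_wpM2l.
rewrite mulrAC ler_pdivlMr // mulrC nsq_vec.
have bf : bm (fun u => nsq (vec_mx De^T *m B u)) by bmt.
have /andP[h1 _] := Ex_density_bounds mU0 hU0 mh D10 hC2 bf (fun u => nsq_ge0 _).
apply: (le_trans h1).
have := EU_nsq_GB hind (U := U) (W := W) (W0 := W0) (Y0 := Y0) bB hgl hgu (vec_mx De^T).
by case/andP.
Qed.

End Concrete.

Section Asymptotics.
Context {R : realType}.

Lemma net_cardinality_bound (n p L : nat) (s c : R) : (2 < n)%N -> (0 < p)%N -> (0 < L)%N -> 0 < c -> 1 <= ln (n%:R : R) ->
  L%:R ^+ 2 * (p%:R * ln n%:R / n%:R) <= s -> 12 * s <= c ->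
  ((2 * n ^ 5).+1 ^ (2 * p * L))%:R * expR (- (c * (2 * n)%:R / L%:R)) <= s / c.
Proof.
move=> n3 p0 L0 c0 ln1 hs sc.
have nR : 0 < n%:R :> R by rewrite ltr0n (leq_trans _ n3).
have LR : 0 < L%:R :> R by rewrite ltr0n.
have pR : 1 <= p%:R :> R by rewrite ler1n.
have LR1 : 1 <= L%:R :> R by rewrite ler1n.
have h1 : ((2 * n ^ 5).+1 ^ (2 * p * L))%:R <= expR ((12 * (p * L))%:R * ln n%:R) :> R.
  rewrite expRM_natl lnK ?posrE // -natrX ler_nat.
  have -> : (12 * (p * L) = 6 * (2 * p * L))%N by ring.
  rewrite [X in (_ <= X)%N]expnM leq_exp2r ?muln_gt0 ?p0 ?L0 //.
  rewrite (expnS n 5); apply: (@leq_trans (3 * n ^ 5)); last by rewrite leq_mul2r n3 orbT.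
  by rewrite -[(3 * _)%N]/((2 + 1) * _)%N mulnDl mul1n -addn1 leq_add2l expn_gt0 (leq_trans _ n3).
have h2 : L%:R ^+ 2 * (p%:R * ln n%:R) <= s * n%:R by rewrite -ler_pdivrMr // -mulrA.
have h3 : (12 * (p * L))%:R * ln n%:R <= c * n%:R / L%:R :> R.
  rewrite ler_pdivlMr // !natrM; apply: (@le_trans _ _ (12 * (s * n%:R))).
    have -> : 12 * (p%:R * L%:R) * ln n%:R * L%:R = 12 * (L%:R ^+ 2 * (p%:R * ln n%:R)) :> R by ring.
    by rewrite ler_wpM2l.
  by rewrite mulrA ler_wpM2r // ltW.
have x0 : 0 < c * n%:R / L%:R by rewrite divr_gt0 // mulr_gt0.
apply: (@le_trans _ _ (expR ((12 * (p * L))%:R * ln n%:R) * expR (- (c * (2 * n)%:R / L%:R)))).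
  by rewrite ler_wpM2r ?expR_ge0.
rewrite -expRD; apply: (@le_trans _ _ (expR (- (c * n%:R / L%:R)))).
  rewrite ler_expR [(2 * n)%:R]natrM.
  have -> : c * (2 * n%:R) / L%:R = 2 * (c * n%:R / L%:R) by ring.
  by move: h3; move: (_ * ln _) (c * n%:R / L%:R) => a b; lra.
rewrite expRN; apply: (@le_trans _ _ (c * n%:R / L%:R)^-1).
  rewrite lef_pV2 ?posrE ?expR_gt0 //; apply: le_trans (expR_ge1Dx _); lra.
have -> : (c * n%:R / L%:R)^-1 = L%:R / n%:R / c by field; rewrite !gt_eqF.
rewrite ler_pM2r ?invr_gt0 // ler_pdivrMr //; apply: le_trans h2.
apply: (@le_trans _ _ (L%:R ^+ 2)); first by rewrite expr2 ler_peMl // ltW.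
by rewrite ler_peMr ?sqr_ge0 //; nra.
Qed.

Lemma rate_ge0 (d : R) p L n : (0 < n)%N -> 0 <= rate d p L n.
Proof.
by move=> n0; rewrite /rate /a_rate !addr_ge0 ?sqrtr_ge0.
Qed.

Lemma rate_lower (d Ca : R) p L n : (0 < n)%N -> 1 <= ln (n%:R : R) ->
  p%:R * (Ca * L%:R `^ (- d)) ^+ 2 + p%:R * L%:R / n%:R <= (Ca ^+ 2 + 1) * rate d p L n ^+ 2.
Proof.
move=> n0 ln1; have nR : 0 < n%:R :> R by rewrite ltr0n.
have r0 := rate_ge0 d p L n0.
set a := Num.sqrt p%:R * L%:R `^ (- d); set b := Num.sqrt (p%:R * L%:R * ln n%:R / n%:R : R).
have a0 : 0 <= a by rewrite mulr_ge0 ?sqrtr_ge0 ?powR_ge0.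
have b0 : 0 <= b by exact: sqrtr_ge0.
have m0 : 0 <= a_rate d L n * (p%:R * L%:R) * Num.sqrt (ln n%:R / n%:R : R).
  by rewrite /a_rate !mulr_ge0 ?ler0n ?sqrtr_ge0 // addr_ge0 ?sqrtr_ge0 ?powR_ge0.
have rE : rate d p L n = b + a_rate d L n * (p%:R * L%:R) * Num.sqrt (ln n%:R / n%:R : R) + a by [].
have ha : a ^+ 2 <= rate d p L n ^+ 2 by rewrite lerXn2r ?nnegrE // rE; lra.
have hb : b ^+ 2 <= rate d p L n ^+ 2 by rewrite lerXn2r ?nnegrE // rE; lra.
have pL0 : 0 <= p%:R * L%:R :> R by rewrite mulr_ge0.
have hb' : p%:R * L%:R / n%:R <= b ^+ 2.
  rewrite /b sqr_sqrtr; last by rewrite divr_ge0 ?mulr_ge0 // ?(ltW nR) // (le_trans _ ln1).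
  by rewrite ler_pM2r ?invr_gt0 // ler_peMr.
have ha' : p%:R * (Ca * L%:R `^ (- d)) ^+ 2 = Ca ^+ 2 * a ^+ 2.
  by rewrite /a !exprMn sqr_sqrtr ?ler0n //; ring.
rewrite ha' mulrDl mul1r; apply: lerD; first by rewrite ler_wpM2l ?sqr_ge0.
exact: le_trans hb' hb.
Qed.

Lemma L2dist_dim0 (f g : R -> 'cV[R]_0) : L2dist f g = 0.
Proof.
rewrite /L2dist (eq_integral (cst 0%E)); last first.
  by move=> u _; rewrite vnorm2_sq /nsq big_ord0.
by rewrite integral0 /= sqrtr0.
Qed.

Lemma near_ge (x : R) : exists N : nat, forall n, (N <= n)%N -> x <= n%:R.
Proof.
exists (Num.truncn `|x|).+1 => n hn; apply: (le_trans (ler_norm x)).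
apply: (@le_trans _ _ (Num.truncn `|x|).+1%:R); last by rewrite ler_nat.
by have /andP[_ /ltW] := truncn_itv (normr_ge0 x).
Qed.

End Asymptotics.

Theorem theorem2
  (R : realType)
  (* fixed constants: spline order m, smoothness d = r + t, (C1)-(C4) constants *)
  (m t : nat) (r Dc Lc lam0 lam1 D1 D2 M Cq : R)
  (hm : (t < m)%N) (hr : 0 < r <= 1) (hd : 1 <= r + t%:R)
  (hlam : 0 < lam0 <= lam1) (hD : 0 < D1 <= D2)
  (* dimensions p = p_n, knots (K_n + 1 interior knots, L_n = K_n + m - 1) *)
  (pn K : nat -> nat) (xi : nat -> nat -> R)
  (hknots : forall n, interior_knots (K n) (xi n))
  (hquasi : forall n, quasi_uniform Cq (K n) (xi n))
  (* for each n, a probability space carrying the sample and a population copy *)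
  (dsp : measure_display) (T : nat -> measurableType dsp)
  (P : forall n, probability (T n) R)
  (h : nat -> R -> R)
  (mu1 mu2 : forall n, R -> 'cV[R]_(pn n))
  (Sig A : forall n, R -> 'M[R]_(pn n))
  (thstar : forall n, R -> 'cV[R]_(pn n))
  (y : forall n, 'I_(2 * n) -> bool)
  (U : forall n, 'I_(2 * n) -> T n -> R)
  (W : forall n, 'I_(2 * n) -> 'I_(pn n) -> T n -> R)
  (U0 : forall n, T n -> R) (W0 : forall n, 'I_(pn n) -> T n -> R)
  (Y0 : forall n, T n -> R)
  (* |I_1| = |I_2| = n *)
  (hlab : forall n, #|[pred i | y n i]| = n)
  (* independence and marginal laws *)
  (hind : forall n, mutually_independent (P n)
            (sample_family (U n) (W n) (U0 n) (W0 n) (Y0 n)))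
  (hU : forall n i, has_density_01 (P n) (U n i) (h n))
  (hU0 : forall n, has_density_01 (P n) (U0 n) (h n))
  (hW : forall n i k, std_normal (P n) (W n i k))
  (hW0 : forall n k, std_normal (P n) (W0 n k))
  (hY0 : forall n, fair_label (P n) (Y0 n))
  (* model functions *)
  (hmeas_h : forall n, measurable_fun setT (h n))
  (hmeas_mu1 : forall n j, measurable_fun setT (fun u => mu1 n u j 0))
  (hmeas_mu2 : forall n j, measurable_fun setT (fun u => mu2 n u j 0))
  (hmeas_A : forall n i j, measurable_fun setT (fun u => A n u i j))
  (hSigA : forall n u, 0 <= u <= 1 -> Sig n u = A n u *m (A n u)^T)
  (* (C1) *)
  (hC1 : forall n u a, 0 <= u <= 1 -> eigenvalue (Sig n u) a -> lam0 <= a <= lam1)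
  (* (C2) *)
  (hC2 : forall n u, 0 <= u <= 1 -> D1 <= h n u <= D2)
  (* (C3) *)
  (hC3mu1 : forall n j, holder_class t r Dc Lc (fun u => mu1 n u j 0))
  (hC3mu2 : forall n j, holder_class t r Dc Lc (fun u => mu2 n u j 0))
  (hC3beta : forall n j, holder_class t r Dc Lc
      (fun u => (invmx (Sig n u) *m (mu1 n u - mu2 n u)) j 0))
  (* theta^*(u) minimizes E[(Z - theta^T (X - mu(U)))^2 | U = u] *)
  (hthstar : forall n u (th : 'cV[R]_(pn n)), 0 <= u <= 1 ->
      cond_risk (P n) (mu1 n) (mu2 n) (A n) (W0 n) (Y0 n) u (thstar n u)
      <= cond_risk (P n) (mu1 n) (mu2 n) (A n) (W0 n) (Y0 n) u th)
  (* (C4) *)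
  (hC4 : forall n u, 0 <= u <= 1 ->
      vnorm2 (mu1 n u - mu2 n u) <= M /\ vnorm2 (thstar n u) <= M)
  (hp : ((pn n)%:R / (n%:R `^ ((2 * (r + t%:R) - 1) / (2 * (r + t%:R) + 1)))
           : R) @[n --> \oo] --> 0)
  (* asymptotic regime for L_n *)
  (hLinf : ((nbasis m (K n))%:R : R) @[n --> \oo] --> +oo)
  (hLrate : ((nbasis m (K n))%:R
               * Num.sqrt ((pn n)%:R * ln (n%:R) / n%:R) : R) @[n --> \oo] --> 0) :
  (* || hat theta - tilde theta ||_{L_2} = O_P(rate) *)
  forall eps : R, 0 < eps ->
  exists C : R, 0 < C /\ exists N : nat, forall n : nat, (N <= n)%N ->
    prob (P n) [set w | C * rate (r + t%:R) (pn n) (nbasis m (K n)) n <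
       L2dist
         (theta_hat (Bvec m (K n) (xi n)) (y n) (fun i => U n i w)
            (fun i => gauss_obs (mu1 n) (mu2 n) (A n) (y n i) (U n i w)
                        (colv (W n i) w)))
         (theta_tilde (P n) (Bvec m (K n) (xi n)) (mu1 n) (mu2 n) (A n)
            (U0 n) (W0 n) (Y0 n))]
    <= eps.
Proof.
move=> eps eps0; have [r0 _] := andP hr; have m0 : (0 < m)%N by exact: leq_ltn_trans hm.
have [D10 _] := andP hD; have [l00 l01] := andP hlam; have l10 := lt_le_trans l00 l01.
have [c0 c00 hstab] := @spline_stability R m Cq m0.
have [Ca Ca0 happ] := @spline_approx R m t r Dc Lc Cq hm r0.
pose g0 : R := g0c D1 c0; pose g1 : R := g1c m D2 Cq.
have Cq1 := quasi_uniform_ge1 (hknots 0%N) (hquasi 0%N).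
have g00 : 0 < g0 by exact: mulr_gt0.
have g10 : 0 < g1.
  have [_ D12] := andP hD; apply: mulr_gt0; first exact: lt_le_trans D12.
  by apply: mulr_gt0; [rewrite exprn_gt0 // ltr0n|exact: lt_le_trans Cq1].
pose ct := cst_tail m g0 g1 (M ^+ 2) lam0 lam1.
pose tt := 4 * `|ct| / eps + 1.
have tt0 : 0 < tt by rewrite ltr_wpDl // divr_ge0 ?(ltW eps0) // mulr_ge0.
pose cf := `|cst_final m g0 g1 (M ^+ 2) lam0 lam1 tt|.
pose kap := kapN g0 lam0; pose cc := cC g0 lam0 lam1.
have kap0 : 0 < kap by rewrite /kap /kapN /tauC /kC !divr_gt0 // mulr_gt0.
have cc0 : 0 < cc by rewrite /cc /cC divr_gt0 ?mulr_gt0.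
pose Q := g1 / D1 * cf * (Ca ^+ 2 + 1).
have q0 : 0 <= g1 / D1 by apply: divr_ge0; exact: ltW.
have Q0 : 0 <= Q by apply: mulr_ge0; [apply: mulr_ge0 => //; exact: normr_ge0|rewrite addr_ge0 ?sqr_ge0].
exists (Num.sqrt Q + 1); split; first by rewrite ltr_wpDl ?sqrtr_ge0.
pose s := Num.min (Num.min 1 (eps * g0 ^+ 2 / 64)) (Num.min (cc / 12) (eps * cc / 4)).
have s0 : 0 < s.
  have a1 : 0 < eps * g0 ^+ 2 / 64 by apply: divr_gt0 => //; apply: mulr_gt0 => //; exact: exprn_gt0.
  have a2 : 0 < cc / 12 by exact: divr_gt0.
  have a3 : 0 < eps * cc / 4 by apply: divr_gt0 => //; exact: mulr_gt0.
  by rewrite /s !lt_min ltr01 a1 a2 a3.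
have [s1 s2 s3 s4] : [/\ s <= 1, s <= eps * g0 ^+ 2 / 64, s <= cc / 12 & s <= eps * cc / 4].
  by rewrite /s; split; rewrite !ge_min lexx ?orbT.
have [N1 hN1] : exists N1 : nat, forall n, (N1 <= n)%N ->
    (nbasis m (K n))%:R * Num.sqrt ((pn n)%:R * ln (n%:R) / n%:R) <= Num.sqrt s.
  have /cvgrPdist_lt/(_ (Num.sqrt s)) := hLrate; rewrite sqrtr_gt0 => /(_ s0) [N1 _ hN1].
  exists N1 => n nN; have := hN1 n nN; rewrite /= sub0r normrN => /ltW; apply: le_trans; exact: ler_norm.
have [N2 hN2] := near_ge (expR 1 : R).
have [N3 hN3] := near_ge (28 / kap).
have [N4 hN4] := near_ge (4 / g0 ^+ 2 * (2 * LamG g0 g1 * Ca ^+ 2 + 2 * tt)).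
have [N5 hN5] := near_ge (Ca ^+ 2).
have [N6 hN6] := near_ge (4 * (2^-1 * M ^+ 2 + 2 * lam1 * gv2) / eps).
exists (maxn 3 (maxn (maxn N1 N2) (maxn (maxn N3 N4) (maxn N5 N6)))) => n.
rewrite !geq_max => /andP[n3 /andP[/andP[/hN1 hs /hN2 he] /andP[/andP[/hN3 hk /hN4 hM4] /andP[/hN5 hc5 /hN6 hm6]]]].
have n0 : (0 < n)%N by exact: leq_trans n3.
have nR : 0 < n%:R :> R by rewrite ltr0n.
have nR1 : 1 <= n%:R :> R by rewrite ler1n.
have ln1 : 1 <= ln (n%:R : R) by rewrite -[leLHS](expRK 1) ler_ln ?posrE ?expR_gt0.
set p := pn n; set L := nbasis m (K n).
have [p00|p0] := posnP p.
  rewrite [X in prob _ X](_ : _ = set0); first by rewrite /prob measure0 ltW.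
  apply/seteqP; split=> // w /=; apply/negP; rewrite -leNgt.
  have -> : forall (k : nat) (f g : R -> 'cV[R]_k), k = 0%N -> L2dist f g = 0.
    by move=> k f g k0; move: f g; rewrite k0 => f g; exact: L2dist_dim0.
  - by apply: mulr_ge0; [rewrite addr_ge0 ?sqrtr_ge0|exact: rate_ge0].
  - exact: p00.
have L0 : (0 < L)%N by exact: (nbasis_gt0 m (hknots n)).
have LR1 : 1 <= L%:R :> R by rewrite ler1n.
have pR1 : 1 <= p%:R :> R by rewrite ler1n.
have hs2 : L%:R ^+ 2 * (p%:R * ln n%:R / n%:R) <= s.
  have z0 : 0 <= p%:R * ln n%:R / n%:R :> R by rewrite divr_ge0 ?mulr_ge0 // ?(ltW nR) // (le_trans _ ln1).
  rewrite -[X in _ * X](sqr_sqrtr z0) -exprMn -[leRHS](sqr_sqrtr (ltW s0)) lerXn2r ?nnegrE ?sqrtr_ge0 //.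
have hs3 : L%:R ^+ 2 * p%:R <= s * n%:R.
  rewrite -ler_pdivrMr //; apply: le_trans hs2; rewrite -[leLHS]mulrA; apply: ler_wpM2l; first exact: sqr_ge0.
  by rewrite ler_wpM2r ?invr_ge0 ?(ltW nR) // ler_peMr // (le_trans _ pR1).
have L21 : L%:R <= L%:R ^+ 2 :> R by rewrite expr2 ler_peMr // (le_trans _ LR1).
have L20 : 1 <= L%:R ^+ 2 :> R by apply: le_trans L21.
have sn : s * n%:R <= n%:R by rewrite ler_piMl // ltW.
have hL2 : L%:R ^+ 2 <= s * n%:R.
  by apply: le_trans hs3; rewrite ler_peMr // (le_trans _ L20).
have hpn : p%:R <= n%:R :> R.
  by apply: le_trans sn; apply: le_trans hs3; rewrite ler_peMl // (le_trans _ pR1).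
have hLn : L%:R <= n%:R :> R by apply: le_trans sn; apply: le_trans hL2.
have xN1 : xN R p L n <= 1.
  rewrite /xN ler_pdivrMr // mul1r; apply: le_trans sn; apply: le_trans hs3.
  by rewrite mulrC ler_wpM2r // (le_trans _ pR1).
have bL1 : L%:R `^ (- (r + t%:R)) <= 1 :> R.
  have : L%:R `^ (- (r + t%:R)) <= L%:R `^ 0 :> R by rewrite ler_powR // oppr_le0 (le_trans _ hd).
  by rewrite powRr0.
have bL0 : 0 <= L%:R `^ (- (r + t%:R)) :> R by exact: powR_ge0.
have be_le : be2c m t r (K n) Ca p <= Ca ^+ 2 * n%:R.
  rewrite /be2c exprMn mulrCA ler_wpM2l ?sqr_ge0 //; apply: le_trans hpn; rewrite ler_piMr //.
  by rewrite exprn_ile1.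
have hbq : be2c m t r (K n) Ca p <= n%:R ^+ 2.
  by apply: (le_trans be_le); rewrite expr2 ler_wpM2r // ltW.
have hq : 28 / n%:R ^+ 2 <= kapN (g0c D1 c0) lam0.
  rewrite ler_pdivrMr ?exprn_gt0 // mulrC -ler_pdivrMr //; apply: (le_trans hk).
  by rewrite expr2 ler_peMr // ltW.
have LG0 : 0 <= LamG g0 g1 by rewrite /LamG addr_ge0 ?(ltW g00) ?(ltW g10).
have hmM : mM (g0c D1 c0) (g1c m D2 Cq) (be2c m t r (K n) Ca p) (tt * xN R p L n) <= n%:R ^+ 2.
  rewrite /mM -/g0 -/g1; apply: (@le_trans _ _ (4 / g0 ^+ 2 * (2 * LamG g0 g1 * Ca ^+ 2 + 2 * tt) * n%:R)); last first.
    by rewrite expr2 ler_wpM2r // ltW.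
  rewrite -[leRHS]mulrA; apply: ler_wpM2l; first by rewrite divr_ge0 ?sqr_ge0.
  rewrite [leRHS]mulrDl; apply: lerD.
    by rewrite -[leRHS]mulrA; apply: ler_wpM2l => //; exact: mulr_ge0.
  rewrite -[leRHS]mulrA; apply: ler_wpM2l => //; apply: ler_wpM2l; first exact: ltW.
  exact: le_trans xN1 nR1.
have [pn' Ln'] : (p <= n)%N /\ (L <= n)%N by rewrite -(ler_nat R) -(ler_nat R L).
have hL2' : L%:R ^+ 2 <= n%:R :> R by exact: le_trans hL2 sn.
have hcst : Num.sqrt (g1c m D2 Cq / D1 * (`|cst_final m (g0c D1 c0) (g1c m D2 Cq) (M ^+ 2) lam0 lam1 tt|
    * (be2c m t r (K n) Ca p + xN R p L n))) <= (Num.sqrt Q + 1) * rate (r + t%:R) p L n.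
  have ra0 := rate_ge0 (r + t%:R) p L n0.
  apply: (@le_trans _ _ (Num.sqrt Q * rate (r + t%:R) p L n)); last by rewrite ler_wpM2r // lerDl.
  have -> : Num.sqrt Q * rate (r + t%:R) p L n = Num.sqrt (Q * rate (r + t%:R) p L n ^+ 2).
    by rewrite [RHS]sqrtrM // sqrtr_sqr ger0_norm.
  rewrite ler_sqrt; last by apply: mulr_ge0 => //; exact: sqr_ge0.
  rewrite -/g0 -/g1 -/cf /Q mulrA -[leRHS]mulrA; apply: ler_wpM2l.
    by rewrite mulr_ge0 ?divr_ge0 ?(ltW g10) ?(ltW D10) // normr_ge0.
  exact: rate_lower.
have n1 : (1 < n)%N by exact: ltnW.
have tail := L2_tail hm hlam hD (hknots n) (hquasi n) c00 (hstab _ _ (hknots n) (hquasi n))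
  (happ _ _ (hknots n) (hquasi n)) (hlab n) (hind n) (hU n) (hU0 n) (hW n) (hW0 n) (hmeas_h n)
  (hmeas_mu1 n) (hmeas_mu2 n) (hmeas_A n) (hSigA n) (hC1 n) (hC2 n) (hC3mu1 n) (hC3mu2 n)
  (fun u hu => proj1 (hC4 n u hu)) p0 n1 tt0 pn' Ln' hbq hq hmM hL2' hcst.
apply: (le_trans tail).
have b1 : ct / tt <= eps / 4.
  apply: (@le_trans _ _ (`|ct| / tt)); first by rewrite ler_wpM2r ?invr_ge0 ?(ltW tt0) // ler_norm.
  rewrite ler_pdivrMr // /tt mulrDr mulr1.
  have -> : eps / 4 * (4 * `|ct| / eps) = `|ct| by field; rewrite gt_eqF.
  by rewrite lerDl divr_ge0 // ltW.
have b2 : 16 / g0 ^+ 2 * (L%:R ^+ 2 / n%:R) <= eps / 4.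
  apply: (@le_trans _ _ (16 / g0 ^+ 2 * (eps * g0 ^+ 2 / 64))).
    apply: ler_wpM2l; first by rewrite divr_ge0 ?sqr_ge0.
    by apply: le_trans s2; rewrite ler_pdivrMr.
  by rewrite le_eqVlt; apply/orP; left; apply/eqP; field; rewrite gt_eqF.
have b3 : (2^-1 * M ^+ 2 + 2 * lam1 * (gv2 * p%:R)) / n%:R ^+ 2 <= eps / 4.
  have v0 : 0 <= 2 * lam1 * gv2 by rewrite !mulr_ge0 ?(ltW l10) ?(ltW gv2_gt0).
  have M0 : 0 <= 2^-1 * M ^+ 2 by rewrite mulr_ge0 ?sqr_ge0 ?invr_ge0.
  rewrite ler_pdivrMr ?exprn_gt0 //.
  apply: (@le_trans _ _ ((2^-1 * M ^+ 2 + 2 * lam1 * gv2) * n%:R)).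
    rewrite [leRHS]mulrDl; apply: lerD; first by rewrite ler_peMr.
    by rewrite mulrA ler_wpM2l.
  have -> : eps / 4 * n%:R ^+ 2 = eps / 4 * n%:R * n%:R by ring.
  apply: ler_wpM2r; first exact: ltW.
  by move: hm6; rewrite ler_pdivrMr //; lra.
have b4 := @net_cardinality_bound R n p L s cc n3 p0 L0 cc0 ln1 hs2.
have b5 : s / cc <= eps / 4 by rewrite ler_pdivrMr // mulrAC.
have b6 : 12 * s <= cc by move: s3; lra.
apply: (@le_trans _ _ (eps / 4 + eps / 4 + eps / 4 + eps / 4)); last by lra.
by apply: lerD; [apply: lerD; [apply: lerD|]|apply: (le_trans (b4 b6))].
Qed.
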